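(* Let $n\ge2$ and let $x:M^n\to\mathbb H^{n+1}$ be an embedding of a connected, oriented manifold such that $x(M)$ is a complete radial graph over a geodesic sphere (with center $o\in\mathbb H^{n+1}$) minus $k\geq0$ points. Let $r$ be the distance function from $o$ in $\mathbb H^{n+1}$ and $\xi=\sinh(r)\,\tilde\nabla r$. Let $A$ and $H$ be the second fundamental form and mean curvature of $M$ with respect to a unit normal field. If $|A|$ is bounded, $H$ is constant and $p\mapsto|\xi(x(p))^\top|$ is integrable on $M$, then $k=0$ and $x(M)$ is a geodesic sphere.
   Context: $\mathbb H^{n+1}$ is hyperbolic space of constant sectional curvature $-1$ and $\tilde\nabla r$ is the gradient of $r$. A radial graph over an open set $\Omega$ of a geodesic sphere centered at $o$ (here $\Omega$ is the geodesic sphere minus finitely many, $k$, points) is a hypersurface of the form $\{\exp_o(u(v)v)\}$, where $v$ ranges over the unit vectors of $T_o\mathbb H^{n+1}$ pointing to points of $\Omega$ and $u$ is a smooth positive function; in particular it is transversal to $\xi$ at every point. Complete refers to the induced metric. $(\cdot)^\top$ is orthogonal projection onto the tangent spaces of $M$; integrable means in $\mathcal L^1(M)$ for the induced Riemannian volume measure. $nH$ is the trace of $A$. *)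

(* Defs.v *)
From HB Require Import structures.
From mathcomp Require Import all_boot all_order all_algebra.
From mathcomp Require Import all_classical all_reals all_analysis.
Set Implicit Arguments.
Unset Strict Implicit.
Unset Printing Implicit Defensive.
Import Order.TTheory GRing.Theory Num.Theory.
Import numFieldNormedType.Exports.
Local Open Scope classical_set_scope.
Local Open Scope ring_scope.

Section Smooth.
Variables (R : realType) (V W : normedModType R).

Fixpoint iter_derive (vs : seq V) (f : V -> W) : V -> W :=
  if vs is v :: vs' then fun x => 'D_v (iter_derive vs' f) x else f.

(* C^oo on the open set U (V finite-dimensional): the iterated directional
   derivatives of all orders exist and are continuous on U. *)
Definition smooth_on (U : set V) (f : V -> W) : Prop :=
  forall (vs : seq V) (x : V), U x ->
    (forall v, derivable (iter_derive vs f) x v) /\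
    {for x, continuous (iter_derive vs f)}.

(* Smoothness on an arbitrary subset: local smooth extensions. *)
Definition smooth_on_subset (A : set V) (f : V -> W) : Prop :=
  forall a, A a -> exists U : set V, exists g : V -> W,
    [/\ open U, U a, smooth_on U g & forall b, U b -> A b -> g b = f b].

End Smooth.

Section Manifold.
Variables (R : realType) (n : nat) (M : topologicalType).

(* [cinv] is only meaningful on the image of [cdom] by [cmap]. *)
Record chart := Chart {
  cdom : set M ;
  cmap : M -> 'rV[R]_n ;
  cinv : 'rV[R]_n -> M }.

Definition chart_image (c : chart) : set 'rV[R]_n := cmap c @` cdom c.

Definition is_chart (c : chart) : Prop :=
  [/\ open (cdom c), open (chart_image c),
      {in cdom c, cancel (cmap c) (cinv c)},
      {within cdom c, continuous (cmap c)} &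
      {within chart_image c, continuous (cinv c)}].

Definition transition (c c' : chart) : 'rV[R]_n -> 'rV[R]_n :=
  cmap c' \o cinv c.

(* An oriented smooth atlas, indexed by the points of M: [C p] is a chart
   around p.  Every atlas contains a compatible one of this form. *)
Definition oriented_atlas (C : M -> chart) : Prop :=
  (forall p, is_chart (C p) /\ cdom (C p) p) /\
  (forall p q, let U := cmap (C p) @` (cdom (C p) `&` cdom (C q)) in
     smooth_on U (transition (C p) (C q)) /\
     forall y, U y -> 0 < \det (jacobian (transition (C p) (C q)) y)).

Definition oriented_manifold (C : M -> chart) : Prop :=
  [/\ hausdorff_space M, @second_countable M & oriented_atlas C].

Definition smooth_map (W : normedModType R) (C : M -> chart) (f : M -> W) :=
  forall p, smooth_on (chart_image (C p)) (f \o cinv (C p)).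

Definition C1_curve (C : M -> chart) (c : R -> M) : Prop :=
  continuous c /\
  forall p t, cdom (C p) (c t) ->
    derivable (cmap (C p) \o c) t 1 /\
    {for t, continuous (derive1 (cmap (C p) \o c))}.

End Manifold.

(* The hyperboloid model: for m = n + 1, H^m is the upper sheet of
   {<p, p> = -1} in Minkowski space R^{m+1}, with the induced metric. *)
Section Hyperbolic.
Variables (R : realType) (m : nat).
Local Notation E := 'rV[R]_m.+1.

Definition cosh (t : R) : R := (expR t + expR (- t)) / 2.
Definition sinh (t : R) : R := (expR t - expR (- t)) / 2.
Definition arcosh (y : R) : R := ln (y + Num.sqrt (y ^+ 2 - 1)).

Definition lsign (i : 'I_m.+1) : R := if i == ord0 then -1 else 1.
Definition lor (u v : E) : R := \sum_i lsign i * u 0 i * v 0 i.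

(* The Riemannian norm of vectors tangent to the hyperboloid. *)
Definition lnorm (w : E) : R := Num.sqrt (lor w w).

Definition hyperboloid : set E := [set p | lor p p = -1 /\ 0 < p 0 0].

Definition hdist (p q : E) : R := arcosh (- lor p q).

(* For w tangent at p; it is p when w = 0. *)
Definition hexp (p w : E) : E :=
  cosh (lnorm w) *: p + (sinh (lnorm w) / lnorm w) *: w.

(* Riemannian gradient on the hyperboloid of (the restriction of) f, which has
   to be defined near p in the ambient space: the Lorentzian gradient of f,
   projected orthogonally onto T_p = {w | <w, p> = 0}. *)
Definition lgrad (f : E -> R) (p : E) : E :=
  \row_i (lsign i * 'D_(delta_mx 0 i) f p).
Definition hgrad (f : E -> R) (p : E) : E :=
  lgrad f p + lor (lgrad f p) p *: p.

Definition xi (o p : E) : E := sinh (hdist o p) *: hgrad (hdist o) p.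

Definition geodesic_sphere (o : E) (rho : R) : set E :=
  [set p | hyperboloid p /\ hdist o p = rho].

(* Unit vectors of T_o pointing to the points of a subset Omega of the geodesic
   sphere of center o and radius rho. *)
Definition directions (o : E) (rho : R) (Omega : set E) : set E :=
  [set v | [/\ lor v o = 0, lor v v = 1 & Omega (hexp o (rho *: v))]].

Definition radial_graph (o : E) (rho : R) (Omega S : set E) : Prop :=
  exists u : E -> R,
    [/\ forall v, directions o rho Omega v -> 0 < u v,
        smooth_on_subset (directions o rho Omega) (u : E -> R^o) &
        S = [set hexp o (u v *: v) | v in directions o rho Omega]].

End Hyperbolic.

(* Lebesgue integral over R^n of a nonnegative Borel function, as an iterated
   integral. *)
Fixpoint integral_rV (R : realType) (n : nat) :
    ('rV[R]_n -> \bar R) -> \bar R :=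
  match n return ('rV[R]_n -> \bar R) -> \bar R with
  | 0 => fun F => F 0
  | n'.+1 => fun F =>
      (\int[@lebesgue_measure R]_(t in [set: R])
         integral_rV (fun w : 'rV[R]_n' => F (row_mx (t%:M : 'rV[R]_1) w)))%E
  end.

Section Hypersurface.
Variables (R : realType) (n : nat) (M : ptopologicalType).
Variable C : M -> chart R n M.
Local Notation E := 'rV[R]_n.+2.
Variables x N : M -> E.

Definition partial (i : 'I_n) (f : 'rV[R]_n -> E) (y : 'rV[R]_n) : E :=
  'D_(delta_mx 0 i) f y.

Definition hyperbolic_embedding : Prop :=
  [/\ forall p, hyperboloid (x p),
      smooth_map C x,
      forall p (v : 'rV[R]_n), v != 0 ->
        'D_v (x \o cinv (C p)) (cmap (C p) p) != 0,
      injective x &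
      continuous x /\
      forall U : set M, open U ->
        exists2 V : set E, open V & U = x @^-1` V].

Definition unit_normal_field : Prop :=
  smooth_map C N /\
  forall p, [/\ lor (N p) (x p) = 0, lor (N p) (N p) = 1 &
    forall v : 'rV[R]_n,
      lor (N p) ('D_v (x \o cinv (C p)) (cmap (C p) p)) = 0].

Definition gram (c : chart R n M) (y : 'rV[R]_n) : 'M[R]_n :=
  let X := x \o cinv c in
  \matrix_(i, j) lor (partial i X y) (partial j X y).

(* The Levi-Civita connection of the hyperboloid is the tangential part of the
   flat one and N is tangent to the hyperboloid, so that the second fundamental
   form has coefficients <d_i d_j X, N>. *)
Definition second_form (p : M) : 'M[R]_n :=
  let X := x \o cinv (C p) in
  \matrix_(i, j) lor (partial i (partial j X) (cmap (C p) p)) (N p).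

Definition shape (p : M) : 'M[R]_n :=
  invmx (gram (C p) (cmap (C p) p)) *m second_form p.

(* [shape p] represents a self-adjoint operator: |A|^2 = tr A^2. *)
Definition normA (p : M) : R := Num.sqrt (\tr (shape p *m shape p)).

Definition mean_curvature (p : M) : R := \tr (shape p) / n%:R.

(* Orthogonal projection of a vector of T_{x p} H onto T_p M. *)
Definition tangential (p : M) (w : E) : E := w - lor w (N p) *: N p.

(* A C^1 curve may stop, so these curves have the same infimum of lengths as
   the piecewise C^1 curves defined on [0, 1]. *)
Definition riemannian_dist (p q : M) : \bar R :=
  ereal_inf
    [set (\int[@lebesgue_measure R]_(t in `[0%R, 1%R])
            (lnorm (derive1 (x \o c) t))%:E)%E
    | c in [set c : R -> M | [/\ C1_curve C c, c 0 = p & c 1 = q]]].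

Definition complete_hypersurface : Prop :=
  forall s : nat -> M,
    (forall e : R, 0 < e -> exists K, forall i j, (K <= i)%N -> (K <= j)%N ->
       (riemannian_dist (s i) (s j) < e%:E)%E) ->
    exists p, forall e : R, 0 < e -> exists K, forall i, (K <= i)%N ->
      (riemannian_dist (s i) p < e%:E)%E.

(* This characterizes the Riemannian volume measure among Borel measures, since
   M is covered by countably many of the chart domains. *)
Definition riemannian_volume
    (vol : {measure set (g_sigma_algebraType (@open M)) -> \bar R}) : Prop :=
  forall (p : M) (B : set M), <<s @open M >> B -> B `<=` cdom (C p) ->
    vol B = integral_rV
      ((fun y => (Num.sqrt (\det (gram (C p) y)))%:E) \_ (cmap (C p) @` B)).

End Hypersurface.

(* Main.v *)
(**
  Write c = cosh r = -<x, o> and theta = -<N, o>; then |xi^T|^2 = c^2 - 1 - theta^2, and theta never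
  vanishes because a radial graph is transversal to xi.

  Suppose there is a puncture.  Since |A| is bounded, every intrinsic ball of small radius projects
  onto a ball of the tangent plane at its centre, which bounds volumes of balls from below; moreover
  1/c and theta/c are Lipschitz.  If |xi^T| > c/2 at a point q then |xi^T| stays comparable with c(q)
  on a ball of fixed radius around q, so integrability gives |xi^T| <= c/2 wherever c is large.  In
  coordinates y on the sphere of directions centred at the puncture this flatness makes 1/c
  Lipschitz with value 0 at y = 0, so c >= 1/|y|, and the derivative of c is at most a multiple of
  |xi^T| c.  On a segment of length of order 1 ending at distance eta from the puncture, c^n varies
  by at least a multiple of eta^-n; the mean value theorem on the cells of a grid, together with
  disjoint balls of radius proportional to c, turns this into a lower bound of order 1/eta for
  the integral of |xi^T|: a contradiction.

  Without punctures M is compact.  With sg the sign of theta, the function f = -sg <N + H x, o>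
  satisfies Delta f = -(|A|^2 - n H^2) |theta| <= 0, so it is constant by the strong minimum
  principle and M is umbilic.  Then N + H x is a constant vector a with <x, a> = -H.  Comparing the
  points of the graph in two opposite directions shows that a is timelike, and x(M) is the sphere
  centred at a normalized, each ray from o meeting that sphere exactly once.
*)
Require Import Defs.
From HB Require Import structures.
From mathcomp Require Import all_boot all_order all_algebra.
From mathcomp Require Import all_classical all_reals all_analysis.
From mathcomp Require Import ring lra zify.
Set Implicit Arguments.
Unset Strict Implicit.
Unset Printing Implicit Defensive.
Import Order.TTheory GRing.Theory Num.Theory.
Import numFieldNormedType.Exports.
Local Open Scope classical_set_scope.
Local Open Scope ring_scope.

(** * Calculus in several variables *)

(** The argument at a puncture presupposes that the graph escapes to infinity there, although a
    priori the radial function could stay bounded or even tend to 0. A sideways step excludes this: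
    from a point of bounded height whose direction is close to the puncture, one moves inside M over
    a bounded length, perpendicularly to the radial direction, and reaches a direction at a definite
    distance from the puncture. Such a tangent direction exists because n >= 2. Hence sets of
    bounded height have bounded intrinsic diameter, and completeness puts them into compact balls.

    The second obstacle is that volumes are bounded below only for radii under a threshold that
    depends on a compact set. Fixed radii are reached by packing tiny balls whose centres project to
    a grid in a tangent plane. The power c^n is the one to differentiate because a ball of radius
    proportional to c has volume of order c^n, so an increment of c^n over a cell is bounded by
    |xi^T| times the volume of a ball.

    Distances are expressed by C^1 curves together with a primitive of their speed, which turns
    every Lipschitz estimate into a mean value theorem. *)

Section Differentiability.
Variable R : realType.

Lemma differentiable_of_approx (V W : normedModType R) (f : V -> W)
    (df : {linear V -> W}) (x : V) : continuous df ->
  (forall e : R, 0 < e -> \forall h \near 0, `|f (h + x) - f x - df h| <= e * `|h|) ->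
  differentiable f x.
Proof.
move=> dfc H; apply/diffP.
(* The differential is a chosen value, so it suffices to exhibit one continuous linear map with a
   little-o error. *)
apply: (@getPex _ (fun (df : {linear V -> W}) => continuous df /\
  forall y, f y = f (lim (nbhs x)) + df (y - lim (nbhs x))
                  +o_(y \near x) (y - lim (nbhs x)))).
exists df; split=> //; apply: eqaddoEx => z; rewrite lim_id //.
rewrite -[LHS](subrK (f x + df (z - x))) [LHS]addrC; congr (_ + _).
pose k h := f (h + x) - f x - df h.
have -> : f z - (f x + df (z - x)) = k (z - x) by rewrite /k subrK opprD addrA.
rewrite littleo_center0 /= (_ : (fun y => y - x) \o shift x = id); last first.
  by apply/funext => u /=; rewrite addrK.
instantiate (1 := fun u => f u - f x - df (u - x)).
have -> : (fun u => f u - f x - df (u - x)) \o shift x = k.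
  by apply/funext => u /=; rewrite addrK.
by rewrite littleoE.
Qed.

Lemma is_derive_line (V W : normedModType R) (f : V -> W) (a v : V) (s : R) :
  derivable f (a + s *: v) v ->
  is_derive s 1 (fun s => f (a + s *: v)) ('D_v f (a + s *: v)).
Proof.
rewrite /derivable /derive => df.
have E : (fun h : R => h^-1 *: (((fun s => f (a + s *: v)) \o shift s) (h *: 1) - f (a + s *: v)))
   = (fun h => h^-1 *: ((f \o shift (a + s *: v)) (h *: v) - f (a + s *: v))).
  apply/funext => h /=; congr (_ *: (f _ - _)).
  by rewrite [h *: 1]mulr1 scalerDl addrCA.
by split; rewrite /derivable /derive E.
Qed.

Lemma MVT01 (g g' : R -> R) : (forall s : R, 0 <= s <= 1 -> is_derive s 1 g (g' s)) ->
  exists2 s, 0 <= s <= 1 & g 1 - g 0 = g' s.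
Proof.
move=> H.
have [||c] := @MVT _ g g' 0 1 ltr01.
- by move=> s /itvP hs; apply: H; rewrite !hs.
- apply: derivable_within_continuous => s /itvP hs.
  by have [] := H s _; rewrite ?hs.
by move=> /itvP hc; rewrite subr0 mulr1 => E; exists c; rewrite ?hc.
Qed.

(** The vectors [trunc h k] are the corners of a path from 0 to [h] whose edges are parallel to the
    axes, so that only partial derivatives occur along it. *)
Definition trunc n (h : 'rV[R]_n) (k : nat) : 'rV[R]_n :=
  \row_j (if (j < k)%N then h 0 j else 0).

Lemma norm_rowP n (h : 'rV[R]_n) (e : R) : 0 <= e ->
  `|h| <= e <-> forall j, `|h 0 j| <= e.
Proof.
move=> e0; rewrite [`|h|]mx_normrE; split.
  by move=> H j; apply: le_trans H; rewrite (le_bigmax _ _ (0, j)).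
by move=> H; apply: bigmax_le => // -[i j] _ /=; rewrite ord1.
Qed.

Lemma norm_rowE n (h : 'rV[R]_n) j : `|h 0 j| <= `|h|.
Proof. by move: j; apply/norm_rowP. Qed.

(** Restricted to the line through [x], the claim is the chain rule for the scaling by [k]; this
    form also covers [k = 0]. *)
Lemma derivableZv (V W : normedModType R) (f : V -> W) (x v : V) (k : R) :
  derivable f x v -> is_derive x (k *: v) f (k *: 'D_v f x).
Proof.
move=> df.
have H0 : is_derive (k * 0 : R) 1 (fun s => f (x + s *: v)) ('D_v f (x + (k * 0) *: v)).
  by apply: is_derive_line; rewrite mulr0 scale0r addr0.
have H : differentiable (fun s : R => f (x + s *: v)) (k * 0).
  by apply/derivable1_diffP; case: H0.
have Hk : is_diff (0 : R) ( *%R k : R -> R) ( *%R k).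
  exact: (@is_diff_scaler _ _ k 0).
have Hc : differentiable ((fun s : R => f (x + s *: v)) \o ( *%R k)) 0.
  by apply: differentiable_comp => //; case: Hk.
have /derivable1_diffP Dc := Hc.
have E : (fun h : R => h^-1 *: ((f \o shift x) (h *: (k *: v)) - f x)) =
   (fun h : R => h^-1 *: (((((fun s : R => f (x + s *: v)) \o ( *%R k))) \o shift 0) (h *: 1) -
    ((fun s : R => f (x + s *: v)) \o ( *%R k)) 0)).
  apply/funext => h /=.
  by rewrite [h *: 1]mulr1 addr0 scalerA mulrC mulr0 scale0r addr0 [x + _]addrC.
split; first by rewrite /derivable E.
have -> : 'D_(k *: v) f x = 'D_1 ((fun s : R => f (x + s *: v)) \o ( *%R k)) 0.
  by rewrite /derive E.
rewrite deriveE // diff_comp //.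
rewrite /= [X in 'd _ _ X](_ : _ = k *: 1); last first.
  by rewrite (@diff_val _ _ _ _ _ _ _ Hk).
rewrite linearZ /=; congr (_ *: _).
by rewrite -deriveE // (@derive_val _ _ _ _ _ _ _ H0) mulr0 scale0r addr0.
Qed.

Section Scalar.
Variables (n : nat) (f : 'rV[R]_n -> R) (y : 'rV[R]_n).
Definition dlin (h : 'rV[R]_n) : R := \sum_(i < n) h 0 i * 'D_(delta_mx 0 i) f y.

Lemma dlin_linear : linear dlin.
Proof.
move=> a u v; rewrite /dlin scaler_sumr -big_split /=; apply: eq_bigr => i _.
by rewrite !mxE mulrDl -mulrA.
Qed.
HB.instance Definition _ := GRing.isLinear.Build R _ _ _ dlin dlin_linear.

Lemma differentiable_of_partials (U : set 'rV[R]_n) : open U -> U y ->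
  (forall z (i : 'I_n), U z -> derivable f z (delta_mx 0 i)) ->
  (forall i : 'I_n, {for y, continuous ('D_(delta_mx 0 i) f)}) ->
  differentiable f y.
Proof.
move=> oU Uy dU cD.
apply: (@differentiable_of_approx _ _ _ [the {linear 'rV[R]_n -> R} of dlin]) => [z|e e0].
  apply: differentiable_continuous; rewrite /= /dlin.
  have -> : (fun h : 'rV[R]_n => \sum_(i < n) h 0 i * 'D_(delta_mx 0 i) f y) =
     \sum_(i < n) (fun h : 'rV[R]_n => h 0 i * 'D_(delta_mx 0 i) f y).
    by apply/funext => h; rewrite fct_sumE.
  apply: differentiable_sum => i; apply: differentiableM => //.
  exact: differentiable_coord.
(* The error [e] is distributed over the n edges of the coordinate path; the denominator n + 1 stays
   positive for n = 0. *)
have e1 : 0 < e / (n%:R + 1) by rewrite divr_gt0 // ltr_wpDl.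
have [d d0 Hd] : exists2 d : R, 0 < d & forall z, `|z - y| < d -> U z /\
   forall i : 'I_n, `|'D_(delta_mx 0 i) f z - 'D_(delta_mx 0 i) f y| <= e / (n%:R + 1).
  have : \forall z \near y, U z /\
     forall i : 'I_n, `|'D_(delta_mx 0 i) f z - 'D_(delta_mx 0 i) f y| <= e / (n%:R + 1).
    apply: filterI; first exact: open_nbhs_nbhs.
    apply: (@filter_forall _ _ _ _ (nbhs_filter y)) => i.
    have /cvgrPdist_le /(_ _ e1) := cD i.
    by apply: filterS => z; rewrite distrC.
  move=> /nbhs_ballP [d d0 Hd]; exists d => // z zy; apply: Hd.
  by rewrite -ball_normE /= distrC.
near=> h.
have hd : `|h| < d.
  near: h; apply/nbhs_ballP; exists d => // h; rewrite -ball_normE /= sub0r normrN //.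
have tn k : `|trunc h k| <= `|h|.
  apply/norm_rowP => // j; rewrite mxE; case: ifP => _; rewrite ?normr0 //.
  exact: norm_rowE.
have tS (k : 'I_n) : trunc h k.+1 = trunc h k + h 0 k *: delta_mx 0 k.
  apply/rowP => j; rewrite !mxE eqxx /= ltnS leq_eqVlt.
  have [->|jk] := eqVneq j k; first by rewrite eqxx ltnn add0r mulr1.
  by rewrite (_ : (_ == _ :> nat) = false) ?mulr0 ?addr0 //; apply/negbTE.
have Et : f (h + y) - f y = \sum_(k < n) (f (y + trunc h k.+1) - f (y + trunc h k)).
  rewrite -(big_mkord xpredT (fun k => f (y + trunc h k.+1) - f (y + trunc h k))) telescope_sumr //.
  congr (f _ - f _); last by apply/rowP => j; rewrite !mxE ltn0 addr0.
  by apply/rowP => j; rewrite !mxE ltn_ord addrC.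
rewrite Et /= /dlin -sumrB.
apply: (le_trans (ler_norm_sum _ _ _)).
have Hk (k : 'I_n) : `|f (y + trunc h k.+1) - f (y + trunc h k) - h 0 k * 'D_(delta_mx 0 k) f y|
   <= `|h| * (e / (n%:R + 1)).
  have Hz s : 0 <= s <= 1 -> `|y + trunc h k + s *: (h 0 k *: delta_mx 0 k) - y| < d.
    move=> /andP[s0 s1]; rewrite addrAC [y + _]addrC addrK addrC.
    apply: le_lt_trans hd; apply/norm_rowP => // j.
    rewrite !mxE eqxx /=; have [jk|jk] := eqVneq j k.
      rewrite jk ltnn addr0 mulr1 normrM ger0_norm //.
      by apply: le_trans (norm_rowE h k); rewrite ler_piMl.
    rewrite mulr0 mulr0 add0r; case: ifP => _; rewrite ?normr0 //; exact: norm_rowE.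
  pose a := y + trunc h k.
  have [s s01 Es] : exists2 s, 0 <= s <= 1 &
     f (a + 1 *: (h 0 k *: delta_mx 0 k)) - f (a + 0 *: (h 0 k *: delta_mx 0 k)) =
      h 0 k * 'D_(delta_mx 0 k) f (a + s *: (h 0 k *: delta_mx 0 k)).
    apply: (@MVT01 (fun s => f (a + s *: (h 0 k *: delta_mx 0 k)))
       (fun s => h 0 k * 'D_(delta_mx 0 k) f (a + s *: (h 0 k *: delta_mx 0 k)))) => s s01.
    have [Uz _] := Hd _ (Hz s s01).
    have [D1 D2] := derivableZv (h 0 k) (dU _ k Uz).
    by rewrite -[_ * _]D2; apply: is_derive_line.
  move: Es; rewrite scale1r scale0r addr0 /a -addrA -tS => ->.
  rewrite -mulrBr normrM; apply: ler_pM => //; first exact: norm_rowE.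
  by have [_] := Hd _ (Hz s s01).
apply: (le_trans (ler_sum _ (fun k _ => Hk k))).
rewrite sumr_const card_ord -[_ *+ n]mulr_natr -mulrA [leRHS]mulrC ler_wpM2l //.
by rewrite mulrAC ler_pdivrMr ?ltr_wpDl // mulrDr mulr1 lerDl ltW.
Unshelve. all: by end_near. Qed.

End Scalar.
End Differentiability.

Section SmoothOn.
Variable R : realType.

Lemma derivable_coord (V : normedModType R) m (f : V -> 'rV[R]_m) (x v : V) j :
  derivable f x v -> is_derive x v (fun y => f y 0 j) ('D_v f x 0 j).
Proof.
move=> df; split; first by have /derivable_mxP := df; apply.
by rewrite derive_mx // mxE.
Qed.

Lemma differentiable_rV (V : normedModType R) m (f : V -> 'rV[R]_m) (x : V) :
  differentiable f x <-> forall j, differentiable (fun y => f y 0 j) x.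
Proof.
split=> [df j|df].
  have -> : (fun y => f y 0 j) = (fun M : 'rV[R]_m => M 0 j) \o f by [].
  by apply: differentiable_comp => //; exact: differentiable_coord.
have -> : f = \sum_(j < m) (fun y => f y 0 j *: delta_mx 0 j).
  by apply/funext => y; rewrite fct_sumE -row_sum_delta.
by apply: differentiable_sum => j; exact: differentiableZl.
Qed.

Lemma is_derive_chain (V W : normedModType R) n (g : V -> 'rV[R]_n)
    (f : 'rV[R]_n -> W) (x v : V) :
  derivable g x v -> differentiable f (g x) ->
  is_derive x v (f \o g) ('D_('D_v g x) f (g x)).
Proof.
move=> dg df.
have H0 : is_derive (0 : R) 1 (fun s => g (x + s *: v)) ('D_v g x).
  rewrite -{2}[x]addr0 -(scale0r v).
  by apply: is_derive_line; rewrite scale0r addr0.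
have dg0 : differentiable (fun s : R => g (x + s *: v)) (0 : R).
  by apply/derivable1_diffP; case: H0.
have df0 : differentiable f ((fun s : R => g (x + s *: v)) 0).
  by rewrite scale0r addr0.
have dfg := differentiable_comp dg0 df0.
have E : (fun h : R => h^-1 *: (((f \o g) \o shift x) (h *: v) - (f \o g) x)) =
   (fun h : R => h^-1 *: (((f \o (fun s : R => g (x + s *: v))) \o shift 0) (h *: 1) -
    (f \o (fun s : R => g (x + s *: v))) 0)).
  apply/funext => h /=.
  by rewrite [h *: 1]mulr1 addr0 scale0r addr0 [x + _]addrC.
split; first by rewrite /derivable E; have /derivable1_diffP := dfg.
have -> : 'D_v (f \o g) x = 'D_1 (f \o (fun s : R => g (x + s *: v))) 0.
  by rewrite /derive E.
have E1 : 'd (fun s : R => g (x + s *: v)) (0 : R) (1 : R) = 'D_v g x.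
  by have := @derive_val _ _ _ _ _ _ _ H0; rewrite deriveE.
rewrite deriveE // diff_comp //= E1 -deriveE //.
by rewrite scale0r addr0.
Qed.

Lemma derive_sumv (V W : normedModType R) (f : V -> W) (x : V) n (F : 'I_n -> V) :
  differentiable f x -> 'D_(\sum_i F i) f x = \sum_i 'D_(F i) f x.
Proof. by move=> df; rewrite deriveE // raddf_sum; apply: eq_bigr => i _; rewrite deriveE. Qed.

Lemma derive_scale (V W : normedModType R) (f : V -> W) (x : V) (a : R) (u : V) :
  differentiable f x -> 'D_(a *: u) f x = a *: 'D_u f x.
Proof. by move=> df; rewrite !deriveE // linearZ. Qed.

Lemma iter_derive_cat (V W : normedModType R) (f : V -> W) s1 s2 :
  iter_derive (s1 ++ s2) f = iter_derive s1 (iter_derive s2 f).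
Proof. by elim: s1 => //= v s1 ->. Qed.

Lemma smooth_onD (V W : normedModType R) (U : set V) (f : V -> W) v :
  smooth_on U f -> smooth_on U ('D_v f).
Proof.
move=> sf vs x Ux; have := sf (vs ++ [:: v]) x Ux.
by rewrite iter_derive_cat.
Qed.

Lemma smooth_on_coord (V : normedModType R) m (U : set V) (f : V -> 'rV[R]_m) j :
  open U -> smooth_on U f -> smooth_on U (fun y => f y 0 j).
Proof.
move=> oU sf vs.
have E x : U x -> iter_derive vs (fun y => f y 0 j) x = iter_derive vs f x 0 j.
  elim: vs x => //= v vs IH x Ux.
  have [/(_ v) d _] := sf vs x Ux.
  have [_ <-] := derivable_coord j d.
  apply: near_eq_derive; apply: filterS IH _.
  exact: open_nbhs_nbhs.
move=> x Ux; have [d c] := sf vs x Ux.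
have nE : {near x, iter_derive vs (fun y => f y 0 j) =1 (fun y => iter_derive vs f y 0 j)}.
  by apply: filterS E _; exact: open_nbhs_nbhs.
have nE' : {near x, (fun y => iter_derive vs f y 0 j) =1 iter_derive vs (fun y => f y 0 j)}.
  by apply: filterS nE.
split => [v|].
  by apply: (near_eq_derivable nE'); case: (derivable_coord j (d v)).
rewrite /prop_for /continuous_at (E _ Ux).
apply: (@cvg_trans _ ((fun y => iter_derive vs f y 0 j) @ x)).
  exact: near_eq_cvg.
apply: (@continuous_comp _ _ _ (iter_derive vs f) (fun M : 'rV[R]_m => M 0 j) x c).
exact: coord_continuous.
Qed.

Lemma smooth_on_differentiable_scalar n (U : set 'rV[R]_n) (f : 'rV[R]_n -> R) x :
  open U -> smooth_on U f -> U x -> differentiable f x.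
Proof.
move=> oU sf Ux; apply: (differentiable_of_partials oU Ux) => [z i Uz|i].
  by have [+ _] := sf [::] z Uz; apply.
by have [_ +] := sf [:: delta_mx 0 i] x Ux.
Qed.

Lemma smooth_on_differentiable n m (U : set 'rV[R]_n) (f : 'rV[R]_n -> 'rV[R]_m) x :
  open U -> smooth_on U f -> U x -> differentiable f x.
Proof.
move=> oU sf Ux; apply/differentiable_rV => j.
by apply: (smooth_on_differentiable_scalar oU) => //; exact: smooth_on_coord.
Qed.

Lemma smooth_on_continuous (V W : normedModType R) (U : set V) (f : V -> W) x :
  smooth_on U f -> U x -> {for x, continuous f}.
Proof. by move=> sf Ux; have [_ +] := sf [::] x Ux. Qed.

(** Two mean value theorems: along [v] for the difference of [f] across [w], then along [w] for
    ['D_v f]. The left side is symmetric in [v] and [w], and letting [s] tend to 0 makes the mixed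
    derivatives equal. *)
Lemma second_difference n (f : 'rV[R]_n -> R) (U : set 'rV[R]_n) (y v w : 'rV[R]_n) (s : R) :
  (forall a b : R, 0 <= a <= 1 -> 0 <= b <= 1 -> U (y + (a * s) *: v + (b * s) *: w)) ->
  smooth_on U f ->
  exists2 ab : R * R, (0 <= ab.1 <= 1) && (0 <= ab.2 <= 1) &
    f (y + s *: v + s *: w) - f (y + s *: v) - f (y + s *: w) + f y =
     s ^+ 2 * 'D_w ('D_v f) (y + (ab.1 * s) *: v + (ab.2 * s) *: w).
Proof.
move=> HU sf.
pose g (a : R) := f ((y + s *: w) + a *: (s *: v)) - f (y + a *: (s *: v)).
have zz x : x + 0 *: w = x :> 'rV_n by rewrite scale0r addr0.
have dv a b : 0 <= a <= 1 -> 0 <= b <= 1 -> derivable f (y + (a * s) *: v + (b * s) *: w) (s *: v).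
  move=> ha hb; have [+ _] := sf [::] _ (HU a b ha hb).
  by move=> /(_ v) d; case: (derivableZv s d).
have h0 : 0 <= (0:R) <= 1 by rewrite lexx ler01.
have h1 : 0 <= (1:R) <= 1 by rewrite lexx ler01.
have [|a ha Ea] := @MVT01 _ g (fun a => 'D_(s *: v) f (y + s *: w + a *: (s *: v)) - 'D_(s *: v) f (y + a *: (s *: v))).
  move=> a ha; apply: is_deriveB; apply: is_derive_line.
    by have := dv a 1 ha h1; rewrite mul1r scalerA addrAC.
  by have := dv a 0 ha h0; rewrite mul0r scalerA zz.
pose k (b : R) := s * 'D_v f ((y + (a * s) *: v) + b *: (s *: w)).
have [|b hb Eb] := @MVT01 _ k (fun b => s * 'D_(s *: w) ('D_v f) ((y + (a * s) *: v) + b *: (s *: w))).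
  move=> b hb; apply: is_deriveZ; apply: is_derive_line.
  have [+ _] := sf [:: v] _ (HU a b ha hb).
  by move=> /(_ w) d /=; rewrite scalerA; case: (derivableZv s d).
exists (a, b) => /=; first by rewrite ha hb.
have Dsv z : U z -> 'D_(s *: v) f z = s * 'D_v f z.
  by move=> Uz; have [+ _] := sf [::] _ Uz => /(_ v) d; case: (derivableZv s d).
have Dsw z : U z -> 'D_(s *: w) ('D_v f) z = s * 'D_w ('D_v f) z.
  by move=> Uz; have [+ _] := sf [:: v] _ Uz => /(_ w) d; case: (derivableZv s d).
move: Ea; rewrite /g !scale1r !scale0r !addr0.
rewrite !Dsv; last 2 first.
- by have := HU a 0 ha h0; rewrite mul0r scalerA zz.
- by have := HU a 1 ha h1; rewrite mul1r scalerA addrAC.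
move=> Ea; move: Eb; rewrite /k scale1r scale0r addr0.
rewrite Dsw; last by rewrite scalerA; exact: HU.
rewrite scalerA mulrA -expr2 => <-.
by move: Ea; rewrite !scalerA ![y + s *: w + _]addrAC => <-; ring.
Qed.

Lemma second_limits_eq n (F1 F2 : 'rV[R]_n -> R) (U : set 'rV[R]_n) (y v w : 'rV[R]_n)
    (D : R -> R) : open U -> U y -> {for y, continuous F1} -> {for y, continuous F2} ->
  (forall s, (forall a b : R, 0 <= a <= 1 -> 0 <= b <= 1 -> U (y + (a * s) *: v + (b * s) *: w)) ->
    exists2 ab : R * R, (0 <= ab.1 <= 1) && (0 <= ab.2 <= 1) &
    D s = s ^+ 2 * F1 (y + (ab.1 * s) *: v + (ab.2 * s) *: w)) ->
  (forall s, (forall a b : R, 0 <= a <= 1 -> 0 <= b <= 1 -> U (y + (a * s) *: w + (b * s) *: v)) ->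
    exists2 ab : R * R, (0 <= ab.1 <= 1) && (0 <= ab.2 <= 1) &
    D s = s ^+ 2 * F2 (y + (ab.1 * s) *: w + (ab.2 * s) *: v)) ->
  F1 y = F2 y.
Proof.
move=> oU Uy c1 c2 S1 S2; apply/eqP; rewrite -subr_eq0 -normr_le0; apply/ler_addgt0Pr => e e0.
rewrite add0r.
have e2 : 0 < e / 2 by rewrite divr_gt0.
have : \forall z \near y, [/\ U z, `|F1 y - F1 z| <= e / 2 & `|F2 y - F2 z| <= e / 2].
  have /cvgrPdist_le /(_ _ e2) H1 := c1; have /cvgrPdist_le /(_ _ e2) H2 := c2.
  have oy : nbhs y U by exact: open_nbhs_nbhs.
  by apply: filterS3 oy H1 H2 => z; split.
move=> /nbhs_ballP [d /= d0 Hd].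
pose s := d / 2 / (`|v| + `|w| + 1).
have D0 : 0 < `|v| + `|w| + 1 by rewrite ltr_wpDl // addr_ge0.
have s0 : 0 < s by rewrite !divr_gt0.
have Es : s * (`|v| + `|w| + 1) = d / 2 by rewrite /s divfK ?gt_eqF.
clearbody s.
have Hz a b : 0 <= a <= 1 -> 0 <= b <= 1 -> ball y d (y + (a * s) *: v + (b * s) *: w).
  move=> /andP[a0 a1] /andP[b0 b1]; rewrite -ball_normE /= -addrA opprD addrA subrr sub0r normrN.
  have s0' := ltW s0; apply: (le_lt_trans (ler_normD _ _)).
  rewrite !normrZ !ger0_norm ?mulr_ge0 //.
  apply: (@le_lt_trans _ _ (s * (`|v| + `|w| + 1))).
    have H1 : a * s * `|v| <= s * `|v| by rewrite -mulrA ler_piMl // mulr_ge0.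
    have H2 : b * s * `|w| <= s * `|w| by rewrite -mulrA ler_piMl // mulr_ge0.
    by rewrite !mulrDr mulr1; lra.
  by rewrite Es ltr_pdivrMr // ltr_pMr // ltr1n.
have [|[a b] /andP[/= ha hb] E1] := S1 s.
  by move=> a b ha hb; have [] := Hd _ (Hz a b ha hb).
have HU' a1 b1 : 0 <= a1 <= 1 -> 0 <= b1 <= 1 -> ball y d (y + (a1 * s) *: w + (b1 * s) *: v).
  by move=> ha1 hb1; rewrite addrAC; exact: Hz.
have [|[a' b'] /andP[/= ha' hb'] E2] := S2 s.
  by move=> a1 b1 h1 h2; have [] := Hd _ (HU' a1 b1 h1 h2).
have E : F1 (y + (a * s) *: v + (b * s) *: w) = F2 (y + (a' * s) *: w + (b' * s) *: v).
  apply: (@mulfI _ (s ^+ 2)); first by rewrite expf_neq0 // gt_eqF.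
  by rewrite -E1 -E2.
have [_ H1 _] := Hd _ (Hz a b ha hb).
have [_ _ H2] := Hd _ (HU' a' b' ha' hb').
rewrite -E in H2; rewrite (splitr e) -(subrKA (F1 (y + (a * s) *: v + (b * s) *: w))).
by apply: (le_trans (ler_normD _ _)); rewrite lerD // distrC.
Qed.

Lemma schwarz_scalar n (f : 'rV[R]_n -> R) (U : set 'rV[R]_n) (y v w : 'rV[R]_n) :
  open U -> smooth_on U f -> U y -> 'D_w ('D_v f) y = 'D_v ('D_w f) y.
Proof.
move=> oU sf Uy.
have [_ /= c1] := sf [:: w; v] y Uy; have [_ /= c2] := sf [:: v; w] y Uy.
apply: (second_limits_eq (D := fun s => f (y + s *: v + s *: w) - f (y + s *: v) - f (y + s *: w) + f y)
  oU Uy c1 c2) => s HU; first exact: second_difference HU sf.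
have [ab hab E] := second_difference HU sf; exists ab; first exact: hab.
by rewrite -E [y + s *: w + s *: v]addrAC; ring.
Qed.

Lemma schwarz n m (f : 'rV[R]_n -> 'rV[R]_m) (U : set 'rV[R]_n) (y v w : 'rV[R]_n) :
  open U -> smooth_on U f -> U y -> 'D_w ('D_v f) y = 'D_v ('D_w f) y.
Proof.
move=> oU sf Uy; apply/rowP => j.
have Dc a : smooth_on U ('D_a f) by exact: smooth_onD.
have E a b : 'D_b ('D_a f) y 0 j = 'D_b ('D_a (fun y => f y 0 j)) y.
  have [/(_ b) d _] := sf [:: a] y Uy.
  have [_ <-] := derivable_coord j d.
  apply: near_eq_derive; apply: (filterS _ (open_nbhs_nbhs (conj oU Uy))) => z Uz.
  have [/(_ a) dz _] := sf [::] z Uz.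
  by have [_ <-] := derivable_coord j dz.
have S := schwarz_scalar v w oU (smooth_on_coord j oU sf) Uy.
exact: (etrans (E v w) (etrans S (esym (E w v)))).
Qed.
End SmoothOn.

(** * Minkowski space *)

Section Lorentz.
Variables (R : realType) (m : nat).
Local Notation E := 'rV[R]_m.+1.
Implicit Types u v w x y : E.

Lemma lorC u v : lor u v = lor v u.
Proof. by apply: eq_bigr => i _; rewrite mulrAC. Qed.

Lemma lorDl u v w : lor (u + v) w = lor u w + lor v w.
Proof. by rewrite /lor -big_split; apply: eq_bigr => i _; rewrite mxE /=; ring. Qed.

Lemma lorZl (a : R) u w : lor (a *: u) w = a * lor u w.
Proof. by rewrite /lor mulr_sumr; apply: eq_bigr => i _; rewrite mxE /=; ring. Qed.

Lemma lorDr u v w : lor w (u + v) = lor w u + lor w v.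
Proof. by rewrite !(lorC w) lorDl. Qed.

Lemma lorZr (a : R) u w : lor w (a *: u) = a * lor w u.
Proof. by rewrite !(lorC w) lorZl. Qed.

Lemma lorNl u w : lor (- u) w = - lor u w.
Proof. by rewrite -scaleN1r lorZl mulN1r. Qed.

Lemma lorNr u w : lor w (- u) = - lor w u.
Proof. by rewrite !(lorC w) lorNl. Qed.

Lemma lor0l w : lor 0 w = 0.
Proof. by rewrite -(scale0r 0) lorZl mul0r. Qed.

Lemma lor0r w : lor w 0 = 0.
Proof. by rewrite lorC lor0l. Qed.

Lemma lor_suml (I : Type) (r : seq I) (P : pred I) (F : I -> E) w :
  lor (\sum_(i <- r | P i) F i) w = \sum_(i <- r | P i) lor (F i) w.
Proof. by apply: (big_morph (fun u => lor u w)) => [u v|]; rewrite ?lorDl ?lor0l. Qed.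

Lemma lor_sumr (I : Type) (r : seq I) (P : pred I) (F : I -> E) w :
  lor w (\sum_(i <- r | P i) F i) = \sum_(i <- r | P i) lor w (F i).
Proof. by rewrite lorC lor_suml; apply: eq_bigr => i _; rewrite lorC. Qed.

Definition lorE := (lorDl, lorDr, lorZl, lorZr, lorNl, lorNr).

Lemma sum_cauchy_schwarz (I : finType) (a b : I -> R) :
  (\sum_i a i * b i) ^+ 2 <= (\sum_i a i ^+ 2) * (\sum_i b i ^+ 2).
Proof.
set A := \sum_i a i ^+ 2; set B := \sum_i b i ^+ 2; set D := \sum_i a i * b i.
have B0 : 0 <= B by apply: sumr_ge0 => i _; exact: sqr_ge0.
have H : 0 <= B * (A * B - D ^+ 2).
  have -> : B * (A * B - D ^+ 2) = \sum_i (B * a i - D * b i) ^+ 2.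
    have -> : \sum_i (B * a i - D * b i) ^+ 2 =
       \sum_i (B ^+ 2 * a i ^+ 2 - (B * D *+ 2) * (a i * b i) + D ^+ 2 * b i ^+ 2).
      by apply: eq_bigr => i _; ring.
    by rewrite big_split sumrB /= -!mulr_sumr -/A -/B -/D; ring.
  by apply: sumr_ge0 => i _; exact: sqr_ge0.
have [B1|] := ltP 0 B; first by move: H; rewrite pmulr_rge0 // subr_ge0.
move=> B1; have BE : B = 0 by apply/eqP; rewrite eq_le B0 B1.
have b0 i : b i = 0.
  have /eqP := BE; rewrite psumr_eq0; last by move=> j _; exact: sqr_ge0.
  by move=> /allP /(_ i (mem_index_enum i)) /=; rewrite sqrf_eq0 => /eqP.
rewrite BE mulr0 /D big1 ?expr0n //= => i _; by rewrite b0 mulr0.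
Qed.

Definition spat u v : R := \sum_(i < m) u 0 (lift ord0 i) * v 0 (lift ord0 i).

Lemma lor_spat u v : lor u v = spat u v - u 0 0 * v 0 0.
Proof.
rewrite /lor big_ord_recl /lsign eqxx mulN1r mulNr addrC; congr (_ - _).
by apply: eq_bigr => i _; rewrite -(inj_eq val_inj) /= mul1r.
Qed.

Lemma spat_cs u v : spat u v ^+ 2 <= spat u u * spat v v.
Proof. by rewrite /spat; apply: sum_cauchy_schwarz. Qed.

Lemma spat_ge0 u : 0 <= spat u u.
Proof. by apply: sumr_ge0 => i _; rewrite -expr2 sqr_ge0. Qed.

(** Orthogonality expresses the product of the time components as the Euclidean product of the
    spatial parts, and Cauchy-Schwarz applies. This is positivity on the complement of a timelike
    vector in quantitative form: it also bounds the Euclidean size of [w] by its Lorentzian length,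
    which yields compactness of unit spheres and the comparison of topologies. *)
Lemma lor_perp_bound x w : lor x x = -1 -> lor w x = 0 ->
  spat w w <= lor w w * (x 0 0) ^+ 2.
Proof.
rewrite !lor_spat => xx wx; have := spat_cs w x.
have -> : spat w x = w 0 0 * x 0 0 by move: wx; lra.
have -> : spat x x = (x 0 0) ^+ 2 - 1 by move: xx; rewrite expr2; lra.
by rewrite exprMn => H; rewrite mulrBl -expr2; nra.
Qed.

Lemma lor_perp_ge0 x w : lor x x = -1 -> lor w x = 0 -> 0 <= lor w w.
Proof.
move=> xx wx; have := le_trans (spat_ge0 w) (lor_perp_bound xx wx).
have x0 : 0 < x 0 0 ^+ 2 by have := spat_ge0 x; move: xx; rewrite lor_spat expr2; lra.
by rewrite pmulr_lge0.
Qed.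

Lemma lor_perp_eq0 x w : lor x x = -1 -> lor w x = 0 -> lor w w = 0 -> w = 0.
Proof.
move=> xx wx ww; have := lor_perp_bound xx wx; rewrite ww mul0r => s0.
have sE : spat w w = 0 by apply/eqP; rewrite eq_le s0 spat_ge0.
apply/rowP => i; rewrite mxE; case: (unliftP ord0 i) => [j|] ->.
  have /eqP := sE; rewrite psumr_eq0; last by move=> k _; rewrite -expr2 sqr_ge0.
  by move=> /allP /(_ j (mem_index_enum j)) /=; rewrite mulf_eq0 orbb => /eqP.
by move: ww; rewrite lor_spat sE sub0r => /eqP; rewrite oppr_eq0 mulf_eq0 orbb => /eqP.
Qed.

Lemma lor_perp_gt0 x w : lor x x = -1 -> lor w x = 0 -> w != 0 -> 0 < lor w w.
Proof.
move=> xx wx w0; rewrite lt_neqAle (lor_perp_ge0 xx) // andbT eq_sym.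
by apply: contra w0 => /eqP ww; apply/eqP; exact: lor_perp_eq0 wx ww.
Qed.

Lemma lor_perp_cs x u v : lor x x = -1 -> lor u x = 0 -> lor v x = 0 ->
  lor u v ^+ 2 <= lor u u * lor v v.
Proof.
move=> xx ux vx; have [v0|v0] := eqVneq (lor v v) 0.
  by rewrite (lor_perp_eq0 xx vx v0) !lor0r mulr0 expr0n.
have vp : 0 < lor v v by rewrite lt_neqAle eq_sym v0 (lor_perp_ge0 xx).
have := @lor_perp_ge0 x (lor v v *: u - lor u v *: v) xx.
rewrite !lorE ux vx !mulr0 subr0 => /(_ erefl); rewrite (lorC v u).
rewrite (_ : _ + _ = lor v v * (lor u u * lor v v - lor u v ^+ 2)); last by ring.
by rewrite pmulr_rge0 // subr_ge0.
Qed.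

(** Reversed Cauchy-Schwarz: [y + lor x y *: x] is orthogonal to [x], so its square <x,y>^2 - 1 is
    nonnegative, and the common sheet fixes the sign. *)
Lemma hyperboloid_lor x y : hyperboloid x -> hyperboloid y -> 1 <= - lor x y.
Proof.
move=> [xx x0] [yy y0].
have sx : spat x x = (x 0 0) ^+ 2 - 1 by move: xx; rewrite lor_spat expr2; lra.
have sy : spat y y = (y 0 0) ^+ 2 - 1 by move: yy; rewrite lor_spat expr2; lra.
have xy0 : 0 < x 0 0 * y 0 0 by rewrite mulr_gt0.
have x1 : 0 <= (x 0 0) ^+ 2 - 1 by rewrite -sx spat_ge0.
have y1 : 0 <= (y 0 0) ^+ 2 - 1 by rewrite -sy spat_ge0.
have P : 0 < - lor x y.
  rewrite lor_spat opprB subr_gt0.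
  have [s0|s0] := leP (spat x y) 0; first by apply: le_lt_trans xy0.
  rewrite -(@ltr_pXn2r _ 2) // ?nnegrE ?ltW //.
  apply: (le_lt_trans (spat_cs x y)); rewrite sx sy exprMn; nra.
have := @lor_perp_ge0 x (y + lor x y *: x) xx.
rewrite !lorE xx (lorC y x) => H.
have {}H : 0 <= lor x y ^+ 2 - 1 by move: H; rewrite yy; nra.
by nra.
Qed.

Lemma is_derive_lor (V : normedModType R) (f g : V -> E) (p d : V) (df dg : E) :
  is_derive p d f df -> is_derive p d g dg ->
  is_derive p d (fun q => lor (f q) (g q)) (lor df (g p) + lor (f p) dg).
Proof.
move=> [Df <-] [Dg <-].
have -> : (fun q => lor (f q) (g q)) =
   \sum_(i < m.+1) (fun q => lsign R i * ((fun q => f q 0 i) q * (fun q => g q 0 i) q)).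
  by apply/funext => q; rewrite fct_sumE; apply: eq_bigr => i _; rewrite mulrA.
have Hi i : is_derive p d (fun q => lsign R i * (f q 0 i * g q 0 i))
   (lsign R i * (f p 0 i * ('D_d g p 0 i) + g p 0 i * ('D_d f p 0 i))).
  apply: is_deriveZ; apply: is_deriveM; exact: derivable_coord.
apply: is_derive_eq.
by rewrite /lor -big_split; apply: eq_bigr => i _ /=; ring.
Qed.

Lemma continuous_lor (T : topologicalType) (f g : T -> E) (t : T) :
  {for t, continuous f} -> {for t, continuous g} ->
  {for t, continuous (fun q => lor (f q) (g q))}.
Proof.
move=> cf cg; rewrite /lor.
have -> : (fun q => \sum_i lsign R i * f q 0 i * g q 0 i) =
   \sum_(i < m.+1) (fun q => lsign R i * f q 0 i * g q 0 i).
  by apply/funext => q; rewrite fct_sumE.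
elim/big_ind: _ => [|h1 h2 c1 c2|i _]; first exact: cst_continuous.
  by apply: continuousD.
have cc (h : T -> E) : {for t, continuous h} -> {for t, continuous (fun q => h q 0 i)}.
  move=> ch; apply: (@continuous_comp _ _ _ h (fun M : E => M 0 i) t ch).
  exact: coord_continuous.
apply: continuousM; last exact: cc.
by apply: continuousM; [exact: cst_continuous|exact: cc].
Qed.
End Lorentz.

Section Frame.
Variables (R : realType) (n : nat).
Local Notation E := 'rV[R]_n.+2.

Lemma lsign0 m : lsign R (ord0 : 'I_m.+1) = -1.
Proof. by rewrite /lsign eqxx. Qed.

Lemma lsign_lift m (i : 'I_m) : lsign R (lift ord0 i) = 1.
Proof. by rewrite /lsign eq_sym (negbTE (neq_lift _ _)). Qed.

Definition lorentz_frame (x N : E) (V : 'I_n -> E) :=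
  [/\ lor x x = -1, lor N N = 1, lor N x = 0 &
  [/\ forall a, lor (V a) x = 0, forall a, lor (V a) N = 0 &
      forall a b, lor (V a) (V b) = (a == b)%:R]].

(** The Gram relations say that the matrix of the n + 2 frame vectors has a right inverse, built
    from its transpose and the signature. For a square matrix this is also a left inverse, and that
    identity is the expansion in the frame. *)
Lemma frame_decomposition (x N : E) (V : 'I_n -> E) (w : E) :
  lorentz_frame x N V ->
  w = - lor w x *: x + lor w N *: N + \sum_a lor w (V a) *: V a.
Proof.
move=> [xx NN Nx [Vx VN VV]].
pose q (i : 'I_n.+2) : E := if unlift ord0 i is Some k then
  (if unlift ord0 k is Some a then V a else N) else x.
have q0 : q ord0 = x by rewrite /q unlift_none.
have q1 : q (lift ord0 ord0) = N by rewrite /q liftK unlift_none.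
have q2 a : q (lift ord0 (lift ord0 a)) = V a by rewrite /q !liftK.
have qq i j : lor (q i) (q j) = (i == j)%:R * lsign R i.
  case: (unliftP ord0 i) => [i1|] ->; last first.
    rewrite q0 lsign0.
    case: (unliftP ord0 j) => [j1|] ->; last by rewrite q0 eqxx xx mul1r.
    rewrite (negbTE (neq_lift _ _)) mul0r.
    by case: (unliftP ord0 j1) => [a|] ->; rewrite ?q1 ?q2 lorC.
  rewrite lsign_lift mulr1.
  case: (unliftP ord0 j) => [j1|] ->; last first.
    rewrite [lift _ _ == _]eq_sym (negbTE (neq_lift _ _)) q0.
    by case: (unliftP ord0 i1) => [a|] ->; rewrite ?q1 ?q2.
  rewrite (inj_eq (@lift_inj _ _)).
  case: (unliftP ord0 i1) => [a|] ->; case: (unliftP ord0 j1) => [b|] ->; rewrite ?q1 ?q2.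
  - by rewrite (inj_eq (@lift_inj _ _)) VV.
  - by rewrite [lift _ _ == _]eq_sym (negbTE (neq_lift _ _)) VN.
  - by rewrite (negbTE (neq_lift _ _)) lorC VN.
  - by rewrite eqxx.
pose Q : 'M[R]_n.+2 := \matrix_(i, j) q i 0 j.
pose J : 'M[R]_n.+2 := diag_mx (\row_i lsign R i).
have lJ : J *m J = 1%:M.
  rewrite mulmx_diag; apply/matrixP => i j; rewrite !mxE /lsign.
  by case: (i == j); rewrite ?mulr0n //; case: ifP => _; rewrite ?mulrNN !mulr1.
have JQ i j : (J *m Q^T *m J) i j = lsign R i * q j 0 i * lsign R j.
  by rewrite /J mul_mx_diag mul_diag_mx !mxE.
have QJ : Q *m (J *m Q^T *m J) = 1%:M.
  apply/matrixP => i j; rewrite !mxE.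
  have -> : \sum_k Q i k * (J *m Q^T *m J) k j = lor (q i) (q j) * lsign R j.
    by rewrite /lor mulr_suml; apply: eq_bigr => k _; rewrite JQ mxE; ring.
  rewrite qq /lsign; have [->|_] := eqVneq i j; rewrite ?mul0r //.
  by case: ifP => _; rewrite ?mul1r ?mulrNN ?mulr1.
have QI := mulmx1C QJ.
have Ew : w = \sum_i (lor w (q i) * lsign R i) *: q i.
  rewrite -[LHS]mulmx1 -QI mulmxA; apply/rowP => j; rewrite mxE summxE.
  apply: eq_bigr => i _; rewrite !mxE; congr (_ * _).
  by rewrite /lor mulr_suml; apply: eq_bigr => k _; rewrite JQ; ring.
rewrite [LHS]Ew 2!big_ord_recl q0 q1 addrA; congr (_ + _ + _).
- by rewrite lsign0 mulrN1.
- by rewrite lsign_lift mulr1.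
- by apply: eq_bigr => a _; rewrite q2 /lsign eq_sym (negbTE (neq_lift _ _)) mulr1.
Qed.

Lemma frame_parseval (x N : E) (V : 'I_n -> E) (w z : E) :
  lorentz_frame x N V ->
  lor w z = - lor w x * lor z x + lor w N * lor z N + \sum_a lor w (V a) * lor z (V a).
Proof.
move=> F; rewrite {1}(frame_decomposition w F) !lorE lor_suml.
rewrite (lorC x z) (lorC N z); congr (_ + _).
by apply: eq_bigr => a _; rewrite lorZl (lorC (V a) z).
Qed.
End Frame.

Section Cholesky.
Variable R : realType.

(** Gram-Schmidt from the last coordinate upwards: the first row is made orthogonal to the remaining
    ones, which are handled by induction on the lower right block. The triangular shape serves the
    volume estimate, where an iterated integral over a parallelepiped is evaluated one coordinate at
    a time. *)
Lemma upper_orthonormalization n (G : 'M[R]_n) : G^T = G ->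
  (forall v : 'rV_n, v != 0 -> 0 < (v *m G *m v^T) 0 0) ->
  exists T : 'M[R]_n, [/\ forall i j : 'I_n, (j < i)%N -> T i j = 0,
    forall i, 0 < T i i & T *m G *m T^T = 1%:M].
Proof.
elim: n G => [|n IH] G GT pos.
  by exists 0; split => [[]|[]|] //; apply/matrixP => -[].
rewrite -[n.+1]/(1 + n)%N in G GT pos *.
pose al : 'M[R]_1 := ulsubmx G; pose be : 'rV[R]_n := ursubmx G; pose ga : 'M[R]_n := drsubmx G.
have GE : G = block_mx al be be^T ga.
  by rewrite -[LHS]submxK; congr block_mx; rewrite /be -[G in LHS]GT trmx_ursub.
have gT : ga^T = ga by rewrite /ga trmx_drsub GT.
have [v v0|T [Tup Tpos TG]] := IH ga gT.
  have := pos (row_mx 0 v); rewrite GE tr_row_mx mul_row_block !mul0mx !add0r mul_row_col.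
  rewrite trmx0 mulmx0 add0r; apply.
  by apply: contra v0 => /eqP /(congr1 rsubmx); rewrite row_mxKr linear0 => ->.
have be1 : be *m T^T *m T *m ga = be.
  have TU : T^T *m (T *m ga) = 1%:M by exact: mulmx1C.
  by rewrite -!mulmxA TU mulmx1.
pose z : 'rV[R]_(1 + n) := row_mx 1%:M (- (be *m T^T *m T)).
have zG : z *m G = row_mx (al - be *m T^T *m T *m be^T) 0.
  by rewrite /z GE mul_row_block !mul1mx !mulNmx be1 subrr.
pose c : R := (z *m G *m z^T) 0 0.
have c0 : 0 < c.
  apply: pos; apply/eqP => /(congr1 (fun M : 'rV_(1 + n) => lsubmx M 0 0)).
  by rewrite row_mxKl !mxE eqxx => /eqP; rewrite oner_eq0.
pose s := (Num.sqrt c)^-1.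
have s0 : 0 < s by rewrite invr_gt0 sqrtr_gt0.
exists (block_mx (s *: 1%:M) (- s *: (be *m T^T *m T)) 0 T); split.
- move=> i j; case: (split_ordP i) => i' ->; case: (split_ordP j) => j' ->.
  + by rewrite !ord1.
  + by rewrite [i']ord1 /= ltn0.
  + by rewrite block_mxEdl mxE.
  + by rewrite block_mxEdr /= ltn_add2l; exact: Tup.
- move=> i; case: (split_ordP i) => i' ->; last by rewrite block_mxEdr.
  by rewrite block_mxEul ord1 !mxE eqxx mulr1.
have -> : block_mx (s *: 1%:M) (- s *: (be *m T^T *m T)) 0 T = col_mx (s *: z) (row_mx 0 T).
  by rewrite /z scale_row_mx scalerN scaleNr.
rewrite mul_col_mx tr_col_mx mul_col_row.
have -> : row_mx 0 T *m G *m (row_mx 0 T)^T = 1%:M.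
  by rewrite GE tr_row_mx mul_row_block !mul0mx !add0r mul_row_col trmx0 mulmx0 add0r.
have zw : z *m G *m (row_mx (0 : 'cV[R]_n) T)^T = 0.
  by rewrite zG tr_row_mx mul_row_col trmx0 mulmx0 mul0mx addr0.
have wz : row_mx 0 T *m G *m z^T = 0.
  by apply: trmx_inj; rewrite !trmx_mul trmxK GT mulmxA zw trmx0.
have -> : s *: z *m G *m (row_mx 0 T)^T = 0 by rewrite -!scalemxAl zw scaler0.
have -> : row_mx 0 T *m G *m (s *: z)^T = 0 by rewrite linearZ /= -scalemxAr wz scaler0.
have -> : s *: z *m G *m (s *: z)^T = 1%:M.
  rewrite linearZ /= -scalemxAr -!scalemxAl scalerA.
  apply/matrixP => i j; rewrite !ord1 mxE [in RHS]mxE eqxx -/c.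
  by rewrite /s -invfM -expr2 sqr_sqrtr ?ltW // mulVf ?gt_eqF.
by rewrite -scalar_mx_block.
Qed.
End Cholesky.

(** * Hyperbolic functions and the position field xi *)

Section HyperbolicFunctions.
Variable R : realType.

Lemma is_derive_line0 (V W : normedModType R) (h : V -> W) (x v : V) (d : W) :
  is_derive (0 : R) 1 (fun s : R => h (x + s *: v)) d <-> is_derive x v h d.
Proof.
have E : (fun k : R => k^-1 *: (((fun s : R => h (x + s *: v)) \o shift 0) (k *: 1)
     - h (x + 0 *: v))) = (fun k : R => k^-1 *: ((h \o shift x) (k *: v) - h x)).
  apply/funext => k /=; rewrite scale0r !addr0; congr (_ *: (h _ - _)).
  by rewrite [k *: 1]mulr1 addrC.
by split => -[H1 H2]; split; rewrite -?H2 /derivable /derive ?E // -?E.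
Qed.

Lemma is_derive_scalar_comp (V : normedModType R) (f : R -> R) (g : V -> R) (x v : V) (a b : R) :
  is_derive (g x) 1 f a -> is_derive x v g b -> is_derive x v (f \o g) (a * b).
Proof.
move=> Hf /is_derive_line0 Hg; apply/is_derive_line0.
apply: (@is_derive1_comp _ f (fun s : R => g (x + s *: v))) => //.
by rewrite scale0r addr0.
Qed.

Lemma cosh_sinh (t : R) : cosh t ^+ 2 - sinh t ^+ 2 = 1.
Proof.
have := expRxMexpNx_1 t; rewrite /cosh /sinh.
by move: (expR t) (expR (- t)) => a b ab; field: ab.
Qed.

Lemma cosh_ge1 (t : R) : 1 <= cosh t.
Proof.
have := expRxMexpNx_1 t; rewrite /cosh; have := expR_gt0 t; have := expR_gt0 (- t).
move: (expR t) (expR (- t)) => a b b0 a0 ab; rewrite ler_pdivlMr // mul1r.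
have H : 0 <= b * (a - 1) ^+ 2 by rewrite mulr_ge0 ?sqr_ge0 // ltW.
have E : b * (a - 1) ^+ 2 = a * (a * b) - 2 * (a * b) + b by ring.
by move: H; rewrite E ab; lra.
Qed.

Lemma sinh_gt0 (t : R) : 0 < t -> 0 < sinh t.
Proof. by move=> t0; rewrite /sinh divr_gt0 // subr_gt0 ltr_expR; lra. Qed.

Lemma sinh_cosh (t : R) : 0 <= t -> sinh t = Num.sqrt (cosh t ^+ 2 - 1).
Proof.
move=> t0; have -> : cosh t ^+ 2 - 1 = sinh t ^+ 2 by have := cosh_sinh t; lra.
rewrite sqrtr_sqr ger0_norm //; move: t0; rewrite le_eqVlt => /predU1P[<-|/sinh_gt0/ltW//].
by rewrite /sinh oppr0 subrr mul0r.
Qed.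

Lemma arcosh_cosh (t : R) : 0 <= t -> arcosh (cosh t) = t.
Proof.
move=> t0; rewrite /arcosh -sinh_cosh // -[RHS]expRK; congr ln.
by rewrite /cosh /sinh; field.
Qed.

Lemma expR_arcosh (y : R) : 1 <= y -> expR (arcosh y) = y + Num.sqrt (y ^+ 2 - 1).
Proof. by move=> y1; rewrite /arcosh lnK // posrE ltr_pwDl ?sqrtr_ge0 // (lt_le_trans _ y1). Qed.

Lemma sqrt_sq_sub1 (y : R) : 1 <= y -> Num.sqrt (y ^+ 2 - 1) ^+ 2 = y ^+ 2 - 1.
Proof. by move=> y1; rewrite sqr_sqrtr // subr_ge0 expr_ge1 // (le_trans _ y1). Qed.

Lemma expRN_arcosh (y : R) : 1 <= y -> expR (- arcosh y) = y - Num.sqrt (y ^+ 2 - 1).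
Proof.
move=> y1; rewrite expRN expR_arcosh //.
have s2 := sqrt_sq_sub1 y1; have s0 := sqrtr_ge0 (y ^+ 2 - 1).
have y0 : 0 < y + Num.sqrt (y ^+ 2 - 1) by rewrite ltr_pwDl // (lt_le_trans _ y1).
apply: (mulfI (lt0r_neq0 y0)); rewrite mulfV ?gt_eqF //.
move: s2; set s := Num.sqrt _ => s2.
by rewrite (_ : _ * _ = y ^+ 2 - s ^+ 2); [rewrite s2; ring | ring].
Qed.

Lemma cosh_arcosh (y : R) : 1 <= y -> cosh (arcosh y) = y.
Proof. by move=> y1; rewrite /cosh expR_arcosh // expRN_arcosh //; field. Qed.

Lemma sinh_arcosh (y : R) : 1 <= y -> sinh (arcosh y) = Num.sqrt (y ^+ 2 - 1).
Proof. by move=> y1; rewrite /sinh expR_arcosh // expRN_arcosh //; field. Qed.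

Lemma arcosh_gt0 (y : R) : 1 < y -> 0 < arcosh y.
Proof.
by move=> y1; rewrite ln_gt0 // ltr_pwDr ?ltW // sqrtr_gt0 subr_gt0 expr_gt1 // ltW // (lt_trans _ y1).
Qed.

Lemma is_derive_cosh (t : R) : is_derive t 1 (@cosh R) (sinh t).
Proof.
have H : is_derive t 1 (fun t : R => 2^-1 *: (expR t + (expR \o -%R) t)) (2^-1 *: (expR t + expR (- t) * (- 1))).
  by apply: is_deriveZ; apply: is_deriveD.
have -> : @cosh R = (fun t : R => 2^-1 *: (expR t + (expR \o -%R) t)).
  by apply/funext => s; rewrite /cosh mulrC.
by apply: is_derive_eq; rewrite /sinh mulrN1 mulrC.
Qed.

Lemma is_derive_sinh (t : R) : is_derive t 1 (@sinh R) (cosh t).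
Proof.
have H : is_derive t 1 (fun t : R => 2^-1 *: (expR t - (expR \o -%R) t)) (2^-1 *: (expR t - expR (- t) * (- 1))).
  by apply: is_deriveZ; apply: is_deriveB.
have -> : @sinh R = (fun t : R => 2^-1 *: (expR t - (expR \o -%R) t)).
  by apply/funext => s; rewrite /sinh mulrC.
by apply: is_derive_eq; rewrite /cosh mulrN1 opprK mulrC.
Qed.

Lemma is_derive_arcosh (y : R) : 1 < y -> is_derive y 1 (@arcosh R) (Num.sqrt (y ^+ 2 - 1))^-1.
Proof.
move=> y1; have y0 : 0 < y ^+ 2 - 1 by rewrite subr_gt0 expr_gt1 // ltW // (lt_trans _ y1).
have s0 : 0 < Num.sqrt (y ^+ 2 - 1) by rewrite sqrtr_gt0.
have H1 : is_derive y 1 (fun y : R => y ^+ 2 - 1) (2 * y).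
  have H : is_derive y 1 ((id : R -> R) * (id : R -> R) - cst 1) (y *: 1 + y *: 1 - 0).
    by apply: is_deriveB.
  have -> : (fun y : R => y ^+ 2 - 1) = ((id : R -> R) * (id : R -> R) - cst 1).
    by apply/funext => z; rewrite expr2.
  by apply: is_derive_eq; rewrite subr0 [y *: 1]mulr1 mulr_natl.
have H2 := @is_derive1_comp _ Num.sqrt (fun y : R => y ^+ 2 - 1) y _ _ (is_derive1_sqrt y0) H1.
have H3 : is_derive y 1 (fun y : R => y + (Num.sqrt \o (fun y : R => y ^+ 2 - 1)) y)
   (1 + (2 * Num.sqrt (y ^+ 2 - 1))^-1 * (2 * y)) by apply: is_deriveD.
have p0 : 0 < y + Num.sqrt (y ^+ 2 - 1) by rewrite addr_gt0 // (lt_trans _ y1).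
have H4 := @is_derive1_comp _ (@ln R) (fun y : R => y + (Num.sqrt \o (fun y : R => y ^+ 2 - 1)) y) y _ _ (is_derive1_ln p0) H3.
rewrite (_ : @arcosh R = @ln R \o (fun y : R => y + (Num.sqrt \o (fun y : R => y ^+ 2 - 1)) y)) //.
apply: is_derive_eq; move: s0 p0; set s := Num.sqrt _ => s0 p0.
by field; rewrite !gt_eqF.
Qed.

Lemma arcosh_inj (y z : R) : 1 <= y -> 1 <= z -> arcosh y = arcosh z -> y = z.
Proof. by move=> y1 z1 E; rewrite -(cosh_arcosh y1) E cosh_arcosh. Qed.

Section Space.
Variable m : nat.
Local Notation E := 'rV[R]_m.+1.
Implicit Types o p v : E.

Lemma lnorm_scale (t : R) v : lor v v = 1 -> 0 <= t -> lnorm (t *: v) = t.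
Proof. by move=> v1 t0; rewrite /lnorm !lorE v1 mulr1 -expr2 sqrtr_sqr ger0_norm. Qed.

Lemma hexp_unit o v (t : R) : lor v v = 1 -> 0 < t ->
  hexp o (t *: v) = cosh t *: o + sinh t *: v.
Proof.
move=> v1 t0; rewrite /hexp lnorm_scale ?ltW // scalerA divfK ?gt_eqF //.
Qed.

(** sinh(r) grad r is the gradient of cosh r = -<o,p>, which is the projection of -o to the tangent
    space at [p]. The strict inequality keeps [p] away from [o], where [arcosh] is not
    differentiable. *)
Lemma xi_linear o p : hyperboloid o -> hyperboloid p -> 1 < - lor o p ->
  xi o p = - (o + lor o p *: p).
Proof.
move=> ho hp op; rewrite /xi /hgrad /hdist.
have D i : is_derive p (delta_mx 0 i) (fun q => - lor o q) (- (lsign R i * o 0 i)).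
  have H : is_derive p (delta_mx 0 i) (fun q : E => lor (cst o q) (id q)) (lor (0 : E) p + lor o (delta_mx 0 i)).
    by apply: is_derive_lor.
  have -> : lsign R i * o 0 i = lor (0 : E) p + lor o (delta_mx 0 i).
    rewrite lor0l add0r /lor (bigD1 i) //= !mxE !eqxx mulr1 big1 ?addr0 // => j ji.
    by rewrite !mxE (negbTE ji) andbF mulr0.
  exact: is_deriveN.
set s := Num.sqrt ((- lor o p) ^+ 2 - 1).
have s0 : 0 < s.
  by rewrite sqrtr_gt0 subr_gt0 expr_gt1 // ltW // (lt_trans _ op).
have G : lgrad (fun q => arcosh (- lor o q)) p = - s^-1 *: o.
  apply/rowP => i; rewrite !mxE.
  have [_] := @is_derive_scalar_comp _ (@arcosh R) (fun q => - lor o q) _ _ _ _ (is_derive_arcosh op) (D i).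
  rewrite /comp => ->.
  rewrite -/s /lsign; case: ifP => _; ring.
rewrite G lorZl sinh_arcosh ?ltW // -/s scalerDr !scalerA mulrN mulfV ?gt_eqF //.
by rewrite mulrA mulrN mulfV ?gt_eqF // mulN1r scaleN1r scaleNr opprD.
Qed.
End Space.
End HyperbolicFunctions.

(** * Charts and tangent frames *)

Section Charts.
Variables (R : realType) (n : nat) (M : ptopologicalType) (C : M -> chart R n M).
Hypothesis hM : oriented_manifold C.

(** A tangent vector at [p] is encoded by its coordinates in the chart [C p] attached to [p]
    itself. *)
Definition dM (W : normedModType R) (f : M -> W) (p : M) (v : 'rV[R]_n) : W :=
  'D_v (f \o cinv (C p)) (cmap (C p) p).

Let hC : oriented_atlas C. Proof. by case: hM. Qed.

Lemma atlas_chart p : is_chart (C p). Proof. by have [H _] := hC; have [] := H p. Qed.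

Lemma cdom_center p : cdom (C p) p. Proof. by have [H _] := hC; have [] := H p. Qed.

Lemma cdom_open p : open (cdom (C p)). Proof. by have [] := atlas_chart p. Qed.

Lemma chart_image_open p : open (chart_image (C p)).
Proof. by have [] := atlas_chart p. Qed.

Lemma cmapK p m : cdom (C p) m -> cinv (C p) (cmap (C p) m) = m.
Proof. by move=> pm; have [_ _ H _ _] := atlas_chart p; rewrite H // inE. Qed.

Lemma chart_image_cmap p m : cdom (C p) m -> chart_image (C p) (cmap (C p) m).
Proof. by move=> pm; exists m. Qed.

Lemma chart_image_center p : chart_image (C p) (cmap (C p) p).
Proof. exact: chart_image_cmap (cdom_center p). Qed.

Lemma cinvK p y : chart_image (C p) y -> cmap (C p) (cinv (C p) y) = y.
Proof. by move=> [m pm <-]; rewrite cmapK. Qed.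

Lemma cdom_cinv p y : chart_image (C p) y -> cdom (C p) (cinv (C p) y).
Proof. by move=> [m pm <-]; rewrite cmapK. Qed.

Lemma cmap_continuous p m : cdom (C p) m -> {for m, continuous (cmap (C p))}.
Proof.
move=> pm; have [oD _ _ H _] := atlas_chart p.
by move: H; rewrite continuous_open_subspace // => H; apply: H; rewrite inE.
Qed.

Lemma cinv_continuous p y : chart_image (C p) y -> {for y, continuous (cinv (C p))}.
Proof.
move=> py; have [_ oI _ _ H] := atlas_chart p.
by move: H; rewrite continuous_open_subspace // => H; apply: H; rewrite inE.
Qed.

Lemma near_cdom p m : cdom (C p) m -> nbhs m (cdom (C p)).
Proof. by move=> pm; apply: open_nbhs_nbhs; split => //; exact: cdom_open. Qed.

Lemma near_chart_image p y : chart_image (C p) y -> nbhs y (chart_image (C p)).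
Proof. by move=> pm; apply: open_nbhs_nbhs; split => //; exact: chart_image_open. Qed.

Definition overlap p q := cmap (C p) @` (cdom (C p) `&` cdom (C q)).

Lemma overlap_open p q : open (overlap p q).
Proof.
have -> : overlap p q = chart_image (C p) `&` cinv (C p) @^-1` (cdom (C q)).
  apply/seteqP; split => [y [m [pm qm] <-]|y [[m pm <-]]] /=.
    by split; [exists m|rewrite /= cmapK].
  by rewrite /= cmapK // => qm; exists m.
rewrite openE => y [py qy]; apply: filterI; first exact: near_chart_image.
exact: cinv_continuous py _ (near_cdom qy).
Qed.

Lemma transition_differentiable p q m : cdom (C p) m -> cdom (C q) m ->
  differentiable (transition (C p) (C q)) (cmap (C p) m).
Proof.
move=> pm qm; have [_ H] := hC; have [/= sT _] := H p q.
by apply: (@smooth_on_differentiable _ _ _ _ _ (cmap (C p) m) (@overlap_open p q) sT); exists m.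
Qed.

Lemma transition_derive_continuous p q m v : cdom (C p) m -> cdom (C q) m ->
  {for cmap (C p) m, continuous ('D_v (transition (C p) (C q)))}.
Proof.
move=> pm qm; have [_ H] := hC; have [/= sT _] := H p q.
have [|_ //] := sT [:: v] (cmap (C p) m); by exists m.
Qed.

Lemma near_transition p q m : cdom (C p) m -> cdom (C q) m ->
  \forall z \near cmap (C p) m,
    cinv (C p) z = cinv (C q) (transition (C p) (C q) z).
Proof.
move=> pm qm; have : nbhs (cmap (C p) m) (overlap p q).
  by apply: open_nbhs_nbhs; split; [exact: overlap_open|exists m].
by apply: filterS => z [m' [pm' qm'] <-]; rewrite /transition /= cmapK // cmapK.
Qed.

Lemma smooth_map_differentiable m (f : M -> 'rV[R]_m) p y :
  smooth_map C f -> chart_image (C p) y -> differentiable (f \o cinv (C p)) y.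
Proof. by move=> sf py; apply: (@smooth_on_differentiable _ _ _ _ _ y (@chart_image_open p) (sf p)). Qed.

Lemma smooth_map_continuous m (f : M -> 'rV[R]_m) : smooth_map C f -> continuous f.
Proof.
move=> sf p.
have H : {for p, continuous ((f \o cinv (C p)) \o cmap (C p))}.
  apply: continuous_comp; first exact: cmap_continuous (cdom_center p).
  by apply: differentiable_continuous; apply: smooth_map_differentiable => //; exact: chart_image_center.
rewrite /prop_for /continuous_at -[f p]/(f p).
have E : f p = ((f \o cinv (C p)) \o cmap (C p)) p by rewrite /= cmapK //; exact: cdom_center.
rewrite E; apply: cvg_trans H; apply: near_eq_cvg.
by apply: filterS (near_cdom (cdom_center p)) => m' pm'; rewrite /= cmapK.
Qed.

(** Vectors at [q] are read in [C q], so derivatives computed in another chart are transported by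
    the Jacobian of the transition. One matrix [J] serves all smooth maps simultaneously, which
    allows [x] and [N] to be compared. *)
Lemma chart_change p y : chart_image (C p) y ->
  let q := cinv (C p) y in
  exists2 J : 'M[R]_n, J \in unitmx &
  forall m (f : M -> 'rV[R]_m), smooth_map C f ->
    forall v, 'D_v (f \o cinv (C p)) y = dM f q (v *m J).
Proof.
move=> py q; have pq : cdom (C p) q := cdom_cinv py; have qq := cdom_center q.
have yE : y = cmap (C p) q by rewrite /q cinvK.
exists (jacobian (transition (C p) (C q)) y).
  have [_ H] := hC; have [/= _ Hd] := H p q.
  by rewrite unitmxE unitfE gt_eqF // Hd //; rewrite yE; exists q.
move=> m f sf v.
have dT : differentiable (transition (C p) (C q)) y.
  by rewrite yE; exact: transition_differentiable.
rewrite -(deriveEjacobian _ dT).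
have tE : transition (C p) (C q) y = cmap (C q) q by [].
have dF : differentiable (f \o cinv (C q)) (transition (C p) (C q) y).
  by rewrite tE; apply: smooth_map_differentiable => //; exact: chart_image_center.
have dTv : derivable (transition (C p) (C q)) y v by exact: diff_derivable.
have [_] := is_derive_chain dTv dF; rewrite tE /dM => <-.
apply: near_eq_derive; have := near_transition pq qq; rewrite -yE.
by apply: filterS => z /= ->.
Qed.

Lemma dMZ m (f : M -> 'rV[R]_m) p (a : R) u : smooth_map C f ->
  dM f p (a *: u) = a *: dM f p u.
Proof.
by move=> sf; apply: derive_scale; apply: smooth_map_differentiable => //; exact: chart_image_center.
Qed.

Lemma dM_sum m (f : M -> 'rV[R]_m) p (k : nat) (c : 'I_k -> R) (F : 'I_k -> 'rV_n) :
  smooth_map C f -> dM f p (\sum_i c i *: F i) = \sum_i c i *: dM f p (F i).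
Proof.
move=> sf; rewrite /dM derive_sumv.
  by apply: eq_bigr => i _; exact: dMZ.
by apply: smooth_map_differentiable => //; exact: chart_image_center.
Qed.

Lemma dM_mul m (f : M -> 'rV[R]_m) p v : smooth_map C f ->
  dM f p v = \sum_i v 0 i *: dM f p (delta_mx 0 i).
Proof. by move=> sf; rewrite {1}(row_sum_delta v) dM_sum. Qed.

Lemma is_derive_curve (c : R -> M) (t : R) : C1_curve C c ->
  exists v, forall m (f : M -> 'rV[R]_m), smooth_map C f ->
    is_derive t 1 (f \o c) (dM f (c t) v).
Proof.
move=> [cc Hc]; have ct := cdom_center (c t).
have [dc _] := Hc (c t) t ct.
exists ('D_1 (cmap (C (c t)) \o c) t) => m f sf.
have dF : differentiable (f \o cinv (C (c t))) ((cmap (C (c t)) \o c) t).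
  by apply: smooth_map_differentiable => //; exact: chart_image_center.
have H := is_derive_chain dc dF.
apply: near_eq_is_derive H.
have : nbhs t (c @^-1` cdom (C (c t))) by apply: cc; exact: near_cdom.
by apply: filterS => s /= cs; rewrite cmapK.
Qed.
End Charts.

Opaque derive.

Lemma lor_orthonormal_comb (R : realType) (m n : nat) (V : 'I_n -> 'rV[R]_m.+1) (c : 'I_n -> R) :
  (forall a b, lor (V a) (V b) = (a == b)%:R) ->
  lor (\sum_a c a *: V a) (\sum_a c a *: V a) = \sum_a c a ^+ 2.
Proof.
move=> VV; rewrite lor_suml; apply: eq_bigr => a _; rewrite lorZl lor_sumr (bigD1 a) //= lorZr.
rewrite VV eqxx mulr1 big1 ?addr0 ?expr2 // => b ba.
by rewrite lorZr VV eq_sym (negbTE ba) mulr0.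
Qed.

(** * First and second fundamental forms in orthonormal tangent frames *)

Section LocalGeometry.
Variables (R : realType) (n : nat) (M : ptopologicalType) (C : M -> chart R n M).
Local Notation E := 'rV[R]_n.+2.
Variables x N : M -> E.
Hypothesis hM : oriented_manifold C.
Hypothesis hx : hyperbolic_embedding C x.
Hypothesis hN : unit_normal_field C x N.

Lemma smooth_x : smooth_map C x. Proof. by case: hx. Qed.
Lemma smooth_N : smooth_map C N. Proof. by case: hN. Qed.
Lemma x_hyperboloid p : hyperboloid (x p). Proof. by case: hx. Qed.
Lemma lor_xx p : lor (x p) (x p) = -1. Proof. by case: (x_hyperboloid p). Qed.
Lemma lor_NN p : lor (N p) (N p) = 1. Proof. by have [_ /(_ p) []] := hN. Qed.
Lemma lor_Nx p : lor (N p) (x p) = 0. Proof. by have [_ /(_ p) []] := hN. Qed.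
Lemma lor_N_dx p v : lor (N p) (dM C x p v) = 0.
Proof. by have [_ /(_ p) [_ _ H]] := hN; exact: H. Qed.
Lemma dx_neq0 p v : v != 0 -> dM C x p v != 0.
Proof. by case: hx => _ _ H _ _; exact: H. Qed.
Lemma x_inj : injective x. Proof. by case: hx. Qed.
Lemma x_open_preimage (U : set M) : open U -> exists2 V : set E, open V & U = x @^-1` V.
Proof. by case: hx => _ _ _ _ [_]; apply. Qed.

Lemma lor_dM0 (f g : M -> E) (k : R) p v : smooth_map C f -> smooth_map C g ->
  (forall q, lor (f q) (g q) = k) ->
  lor (dM C f p v) (g p) + lor (f p) (dM C g p v) = 0.
Proof.
move=> sf sg fg.
have D (h : M -> E) : smooth_map C h -> is_derive (cmap (C p) p) v (h \o cinv (C p)) (dM C h p v).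
  move=> sh; split=> //; apply: diff_derivable; apply: smooth_map_differentiable => //.
  exact: chart_image_center.
have := is_derive_lor (D f sf) (D g sg).
have -> : (fun q => lor ((f \o cinv (C p)) q) ((g \o cinv (C p)) q)) = cst k.
  by apply/funext => y /=; rewrite fg.
move=> [_]; rewrite derive_cst /= (cmapK hM) //; exact: cdom_center.
Qed.

Lemma lor_dx_x p v : lor (dM C x p v) (x p) = 0.
Proof.
have := lor_dM0 p v smooth_x smooth_x lor_xx.
by rewrite (lorC (x p)); lra.
Qed.

Lemma lor_dN_N p v : lor (dM C N p v) (N p) = 0.
Proof.
have := lor_dM0 p v smooth_N smooth_N lor_NN.
by rewrite (lorC (N p)); lra.
Qed.

Lemma lor_dN_x p v : lor (dM C N p v) (x p) = 0.
Proof.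
have := lor_dM0 p v smooth_N smooth_x lor_Nx.
by rewrite lor_N_dx addr0.
Qed.

Lemma lor_N_dx_chart p y v : chart_image (C p) y ->
  lor (N (cinv (C p) y)) ('D_v (x \o cinv (C p)) y) = 0.
Proof.
move=> py; have [J _ H] := chart_change hM py.
by rewrite (H _ _ smooth_x) lor_N_dx.
Qed.

Lemma derivable_dx p v y : chart_image (C p) y -> forall w,
  derivable ('D_v (x \o cinv (C p))) y w.
Proof. by move=> py w; have [+ _] := smooth_x [:: v] py; apply. Qed.

(** Derivative of the identity <N, D_w X> = 0, valid on the whole chart. Combined with the symmetry
    of second derivatives it makes the shape operator self-adjoint. *)
Lemma lor_dN_dx p v w :
  lor (dM C N p v) (dM C x p w) = - lor ('D_v ('D_w (x \o cinv (C p))) (cmap (C p) p)) (N p).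
Proof.
have py := chart_image_center hM p.
have D1 : is_derive (cmap (C p) p) v (N \o cinv (C p)) (dM C N p v).
  split=> //; apply: diff_derivable; apply: smooth_map_differentiable => //.
  exact: smooth_N.
have D2 : is_derive (cmap (C p) p) v ('D_w (x \o cinv (C p))) ('D_v ('D_w (x \o cinv (C p))) (cmap (C p) p)).
  by split=> //; exact: derivable_dx.
have := is_derive_lor D1 D2.
have H : \forall y \near cmap (C p) p, (fun q => lor ((N \o cinv (C p)) q) ('D_w (x \o cinv (C p)) q)) y = cst 0 y.
  by apply: filterS (near_chart_image hM py) => y qy /=; rewrite lor_N_dx_chart.
move=> [_]; rewrite (near_eq_derive _ H) derive_cst /= (cmapK hM); last exact: cdom_center.
by rewrite (lorC (N p)) -/(dM C x p w); lra.
Qed.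

Lemma lor_dN_dx_sym p v w : lor (dM C N p v) (dM C x p w) = lor (dM C N p w) (dM C x p v).
Proof.
have S := schwarz w v (chart_image_open hM (p:=p)) (@smooth_x p) (chart_image_center hM p).
exact: (etrans (lor_dN_dx p v w) (etrans (congr1 (fun z => - lor z (N p)) S) (esym (lor_dN_dx p w v)))).
Qed.

(** The rows of [T] are the coordinates of an orthonormal basis of the tangent space. *)
Definition tangent_frame p (T : 'M[R]_n) : Prop :=
  [/\ forall i j : 'I_n, (j < i)%N -> T i j = 0, forall i, 0 < T i i &
      T *m gram x (C p) (cmap (C p) p) *m T^T = 1%:M].

Lemma gram_bilinear p (u v : 'rV[R]_n) :
  (u *m gram x (C p) (cmap (C p) p) *m v^T) 0 0 = lor (dM C x p u) (dM C x p v).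
Proof.
rewrite (dM_mul hM _ u smooth_x) (dM_mul hM _ v smooth_x) lor_suml mxE.
under [RHS]eq_bigr do rewrite lorZl lor_sumr mulr_sumr.
rewrite exchange_big /=; apply: eq_bigr => j _; rewrite !mxE mulr_suml.
by apply: eq_bigr => i _; rewrite !mxE lorZr; ring.
Qed.

Lemma lor_dx_gt0 p v : v != 0 -> 0 < lor (dM C x p v) (dM C x p v).
Proof. by move=> v0; apply: (lor_perp_gt0 (lor_xx p)); [exact: lor_dx_x|exact: dx_neq0]. Qed.

Lemma gram_sym p : (gram x (C p) (cmap (C p) p))^T = gram x (C p) (cmap (C p) p).
Proof. by apply/matrixP => i j; rewrite mxE [LHS]mxE [RHS]mxE; exact: lorC. Qed.

Lemma tangent_frame_exists p : exists T, tangent_frame p T.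
Proof.
have [v v0|T [T1 T2 T3]] := upper_orthonormalization (gram_sym p).
  by rewrite gram_bilinear lor_dx_gt0.
by exists T.
Qed.

Section AtFrame.
Variables (p : M) (T : 'M[R]_n).
Hypothesis hT : tangent_frame p T.

Definition fV (a : 'I_n) := dM C x p (row a T).
Definition fU (a : 'I_n) := dM C N p (row a T).
Definition fk a b := - lor (fU a) (fV b).

Lemma frame_gram a b : lor (fV a) (fV b) = (a == b)%:R.
Proof.
rewrite /fV -gram_bilinear; have [_ _ H] := hT.
have := congr1 (fun A : 'M[R]_n => A a b) H; rewrite mxE [in RHS]mxE => <-.
rewrite [LHS]mxE; apply: eq_bigr => j _; rewrite !mxE; congr (_ * _).
by apply: eq_bigr => i _; rewrite !mxE.
Qed.

Lemma frame_lorentz : lorentz_frame (x p) (N p) fV.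
Proof.
split; [exact: lor_xx|exact: lor_NN|exact: lor_Nx|split].
- by move=> a; exact: lor_dx_x.
- by move=> a; rewrite lorC lor_N_dx.
- exact: frame_gram.
Qed.

Lemma frame_unitmx : T \in unitmx.
Proof. by have [_ _ H] := hT; rewrite -mulmxA in H; case/mulmx1_unit: H. Qed.

Lemma frame_coord v : exists c : 'I_n -> R, v = \sum_a c a *: row a T.
Proof.
exists (fun a => (v *m invmx T) 0 a).
rewrite -[LHS]mulmx1 -(mulVmx frame_unitmx) mulmxA; apply/rowP => j.
by rewrite summxE mxE; apply: eq_bigr => a _; rewrite !mxE.
Qed.

Lemma fk_sym a b : fk a b = fk b a.
Proof. exact: (congr1 (fun z => - z) (lor_dN_dx_sym p (row a T) (row b T))). Qed.

Lemma fUE a : fU a = - \sum_b fk a b *: fV b.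
Proof.
rewrite (frame_decomposition (fU a) frame_lorentz) /fU lor_dN_x lor_dN_N oppr0 !scale0r !add0r.
by rewrite -sumrN; apply: eq_bigr => b _; rewrite -scaleNr opprK.
Qed.

Lemma lor_fV_comb (c : 'I_n -> R) :
  lor (\sum_a c a *: fV a) (\sum_a c a *: fV a) = \sum_a c a ^+ 2.
Proof. exact: lor_orthonormal_comb frame_gram. Qed.

(** Orthonormality gives [invmx G = T^T *m T], so [shape] is conjugate to the matrix [T *m h *m T^T]
    of the coefficients [fk], and traces are invariant under conjugation. *)
Lemma shape_frame :
  \tr (Defs.shape C x N p) = \sum_a fk a a /\
  \tr (Defs.shape C x N p *m Defs.shape C x N p) = \sum_a \sum_b fk a b ^+ 2.
Proof.
set G := gram x (C p) (cmap (C p) p); set h := second_form C x N p.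
have [_ _ H] := hT.
have TI : T^T *m (T *m G) = 1%:M by exact: mulmx1C.
have GI : invmx G = T^T *m T.
  have Gu : G \in unitmx.
    have [] := mulmx1_unit (A := T^T *m T) (B := G); first by rewrite -mulmxA.
    by [].
  by rewrite -[LHS]mul1mx -TI mulmxA mulmxK.
have kE : T *m h *m T^T = \matrix_(a, b) fk a b.
  apply/matrixP => a b; rewrite [RHS]mxE /fk /fU /fV.
  rewrite (dM_mul hM _ (row a T) smooth_N) (dM_mul hM _ (row b T) smooth_x) lor_suml mxE.
  under [in RHS]eq_bigr do rewrite lorZl lor_sumr mulr_sumr.
  rewrite exchange_big /= -sumrN; apply: eq_bigr => j _; rewrite !mxE mulr_suml -sumrN.
  apply: eq_bigr => i _; rewrite !mxE lorZr lor_dN_dx /partial; ring.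
have sE : Defs.shape C x N p = T^T *m (T *m h) by rewrite /Defs.shape -/G GI mulmxA.
split.
  by rewrite sE mxtrace_mulC kE; apply: eq_bigr => a _; rewrite mxE.
have -> : \tr (Defs.shape C x N p *m Defs.shape C x N p) =
    \tr ((T *m h *m T^T) *m (T *m h *m T^T)).
  by rewrite sE -mulmxA mxtrace_mulC !mulmxA.
rewrite kE; apply: eq_bigr => a _; rewrite mxE; apply: eq_bigr => b _.
by rewrite !mxE (fk_sym b) expr2.
Qed.

(** The operator norm is at most the Hilbert-Schmidt norm: Cauchy-Schwarz on each component in the
    frame. *)
Lemma dN_bound v :
  lor (dM C N p v) (dM C N p v) <= normA C x N p ^+ 2 * lor (dM C x p v) (dM C x p v).
Proof.
have [c ->] := frame_coord v.
have E2 := lor_fV_comb c; rewrite /fV in E2.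
rewrite (dM_sum hM _ _ _ smooth_N) (dM_sum hM _ _ _ smooth_x) [X in _ <= _ * X]E2.
rewrite /normA sqr_sqrtr; last first.
  have [_ ->] := shape_frame; apply: sumr_ge0 => a _; apply: sumr_ge0 => b _; exact: sqr_ge0.
have [_ ->] := shape_frame.
have -> : \sum_a c a *: dM C N p (row a T) = \sum_b (- \sum_a c a * fk a b) *: fV b.
  have -> : \sum_a c a *: dM C N p (row a T) = \sum_a \sum_b (- (c a * fk a b)) *: fV b.
    apply: eq_bigr => a _; rewrite -/(fU a) fUE scalerN scaler_sumr -sumrN.
    by apply: eq_bigr => b _; rewrite scalerA scaleNr.
  by rewrite exchange_big; apply: eq_bigr => b _; rewrite -scaler_suml sumrN.
rewrite lor_fV_comb exchange_big /= mulr_suml; apply: ler_sum => b _.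
by rewrite sqrrN mulrC; exact: sum_cauchy_schwarz.
Qed.

Lemma tangent_realize (W : E) : lor W (x p) = 0 -> lor W (N p) = 0 ->
  dM C x p (\sum_a lor W (fV a) *: row a T) = W.
Proof.
move=> Wx WN; rewrite (dM_sum hM _ _ _ smooth_x).
by rewrite {2}(frame_decomposition W frame_lorentz) Wx WN oppr0 !scale0r !add0r.
Qed.
End AtFrame.

Lemma tangent_vector p (W : E) : lor W (x p) = 0 -> lor W (N p) = 0 ->
  exists v, dM C x p v = W.
Proof. by have [T hT] := tangent_frame_exists p => Wx WN; exists (\sum_a lor W (fV p T a) *: row a T); exact: tangent_realize. Qed.

Lemma dN_norm_bound B p v : (forall q, normA C x N q <= B) ->
  lor (dM C N p v) (dM C N p v) <= B ^+ 2 * lor (dM C x p v) (dM C x p v).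
Proof.
move=> hB; have [T hT] := tangent_frame_exists p.
apply: (le_trans (dN_bound hT v)); apply: ler_wpM2r.
  by apply: (lor_perp_ge0 (lor_xx p)); exact: lor_dx_x.
by rewrite ler_pXn2r ?nnegrE // ?(le_trans (sqrtr_ge0 _) (hB p)) ?sqrtr_ge0.
Qed.
End LocalGeometry.

(** * Curves and the intrinsic metric *)

Section CurveCalculus.
Variable R : realType.

Lemma is_derive_comp1 (V : normedModType R) (g : R -> V) (tau : R -> R) (t b : R) (a : V) :
  is_derive (tau t) 1 g a -> is_derive t 1 tau b -> is_derive t 1 (g \o tau) (b *: a).
Proof.
move=> [dg ga] [dt tb].
have Dg : differentiable g (tau t) by apply/derivable1_diffP.
have Dt : differentiable tau t by apply/derivable1_diffP.
have Dc := differentiable_comp Dt Dg.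
split; first by apply/derivable1_diffP.
have Et : 'd tau t (1 : R) = b *: (1 : R) by rewrite -deriveE // tb [b *: 1]mulr1.
have Eg : 'd g (tau t) (1 : R) = a by rewrite -deriveE.
by rewrite deriveE // diff_comp //= Et linearZ /= Eg.
Qed.

Definition glue (T : Type) (t0 : R) (f g : R -> T) (t : R) : T := if t <= t0 then f t else g t.

Lemma glue_lt (T : Type) t0 (f g : R -> T) t : t < t0 -> \forall s \near t, f s = glue t0 f g s.
Proof.
move=> tt; have : \forall s \near t, s < t0 by exact: lt_nbhsl.
by apply: filterS => s st; rewrite /glue ltW.
Qed.

Lemma glue_gt (T : Type) t0 (f g : R -> T) t : t0 < t -> \forall s \near t, g s = glue t0 f g s.
Proof.
move=> tt; have : \forall s \near t, t0 < s by exact: lt_nbhsr.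
by apply: filterS => s st; rewrite /glue leNgt st.
Qed.

Lemma glue_derive (V : normedModType R) t0 (f g : R -> V) : f t0 = g t0 ->
  is_derive t0 1 f 0 -> is_derive t0 1 g 0 -> is_derive t0 1 (glue t0 f g) 0.
Proof.
move=> fg.
have crit (h : R -> V) : is_derive t0 1 h 0 <->
   (forall e : R, 0 < e -> \forall k \near (0 : R)^', `|k^-1 *: (h (k *: 1 + t0) - h t0)| <= e).
  split=> [[dh h0] e e0|H].
    have : (fun k : R => k^-1 *: ((h \o shift t0) (k *: 1) - h t0)) @ 0^' --> (0 : V).
      by have := cvgP _ dh; rewrite -h0.
    move=> /cvgrPdist_le /(_ e e0); apply: filterS => k /=.
    by rewrite sub0r normrN.
  have H0 : (fun k : R => k^-1 *: ((h \o shift t0) (k *: 1) - h t0)) @ 0^' --> (0 : V).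
    apply/cvgrPdist_le => e e0; apply: filterS (H e e0) => k /=.
    by rewrite sub0r normrN.
  by split; [apply/cvg_ex; exists 0|exact: cvg_lim H0].
move=> /crit Hf /crit Hg; apply/crit => e e0.
apply: filterS2 (Hf e e0) (Hg e e0) => k.
by rewrite /glue lexx; case: ifP => _ //; rewrite fg.
Qed.

Lemma derive1_germ (V : normedModType R) (f g : R -> V) (t : R) :
  (\forall s \near t, f s = g s) -> \forall s \near t, derive1 f s = derive1 g s.
Proof.
move=> /near_join; apply: filterS => s H.
by rewrite !derive1E; exact: near_eq_derive.
Qed.

Lemma is_derive1 (V : normedModType R) (f : R -> V) (t : R) d :
  is_derive t 1 f d -> derive1 f t = d.
Proof. by move=> [_ <-]; rewrite derive1E. Qed.

Lemma is_deriveI1 (V : normedModType R) (f : R -> V) (t : R) d :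
  derivable f t 1 -> derive1 f t = d -> is_derive t 1 f d.
Proof. by move=> df <-; rewrite derive1E; split. Qed.

Lemma derive1_continuous_germ (V : normedModType R) (f g : R -> V) (t : R) :
  (\forall s \near t, f s = g s) -> {for t, continuous (derive1 f)} ->
  {for t, continuous (derive1 g)}.
Proof.
move=> H; have H1 := derive1_germ H.
rewrite /prop_for /continuous_at (nbhs_singleton H1) => c.
apply: cvg_trans c; apply: near_eq_cvg.
by apply: filterS H1 => s ->.
Qed.
End CurveCalculus.

Section Curves.
Variables (R : realType) (n : nat) (M : ptopologicalType) (C : M -> chart R n M).
Hypothesis hM : oriented_manifold C.

Lemma C1_cst p : C1_curve C (fun=> p).
Proof.
split=> [t|q t _]; first exact: cst_continuous.
split; first exact: derivable_cst.
have -> : derive1 (cmap (C q) \o (fun=> p)) = cst 0 :> (R -> 'rV[R]_n).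
  by apply/funext => s; rewrite derive1_cst.
exact: cst_continuous.
Qed.

Lemma C1_reparam (c : R -> M) (tau dtau : R -> R) : C1_curve C c ->
  (forall t : R, is_derive t 1 tau (dtau t)) -> continuous dtau -> C1_curve C (c \o tau).
Proof.
move=> [cc Hc] Ht ct.
have ctau : continuous tau.
  by move=> t; apply: differentiable_continuous; apply/derivable1_diffP; case: (Ht t).
split=> [t|p t pt]; first by apply: continuous_comp; [exact: ctau|exact: cc].
have D (s : R) : cdom (C p) (c (tau s)) ->
    is_derive s 1 (cmap (C p) \o (c \o tau)) (dtau s *: derive1 (cmap (C p) \o c) (tau s)).
  move=> ps; have [d _] := Hc p (tau s) ps.
  exact: (@is_derive_comp1 R 'rV[R]_n (cmap (C p) \o c) tau _ _ _ (is_deriveI1 d erefl) (Ht s)).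
split; first by case: (D t pt).
have E : \forall s \near t, dtau s *: derive1 (cmap (C p) \o c) (tau s) =
    derive1 (cmap (C p) \o (c \o tau)) s.
  have : nbhs t ((c \o tau) @^-1` cdom (C p)).
    have H1 : {for t, continuous (c \o tau)} by apply: continuous_comp; [exact: ctau|exact: cc].
    by apply: H1; exact: near_cdom.
  by apply: filterS => s /= ps; rewrite (is_derive1 (D s ps)).
rewrite /prop_for /continuous_at -(nbhs_singleton E).
apply: (@cvg_trans _ ((fun s => dtau s *: derive1 (cmap (C p) \o c) (tau s)) @ t)).
  exact: near_eq_cvg.
have [_ cd] := Hc p (tau t) pt.
exact: (cvgZ (ct t) (@continuous_comp _ _ _ tau (derive1 (cmap (C p) \o c)) t (ctau t) cd)).
Qed.

(** Both velocities vanish at the junction, so the two germs match to first order in every chart.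
    Curves are slowed down beforehand to achieve this. *)
Lemma C1_glue (a b : R -> M) (t0 : R) : C1_curve C a -> C1_curve C b -> a t0 = b t0 ->
  (forall p, cdom (C p) (a t0) -> derive1 (cmap (C p) \o a) t0 = 0) ->
  (forall p, cdom (C p) (b t0) -> derive1 (cmap (C p) \o b) t0 = 0) ->
  C1_curve C (glue t0 a b).
Proof.
move=> Ca Cb ab da db.
have cg0 : {for t0, continuous (glue t0 a b)}.
  rewrite /prop_for /continuous_at {2}/glue lexx => U aU.
  have H1 : nbhs t0 (a @^-1` U) by apply: Ca.1.
  have H2 : nbhs t0 (b @^-1` U) by apply: Cb.1; rewrite -ab.
  by apply: filterS2 H1 H2 => s h1 h2; rewrite /preimage /= /glue; case: ifP.
have loc (t : R) : t != t0 -> exists2 g, C1_curve C g & \forall s \near t, g s = glue t0 a b s.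
  move=> /lt_total /orP[h|h]; first by exists a => //; exact: glue_lt.
  by exists b => //; exact: glue_gt.
split=> [t|p t].
  have [->//|/loc[g [cg _] E]] := eqVneq t t0.
  rewrite /continuous_at -(nbhs_singleton E).
  by apply: cvg_trans (cg t); apply: near_eq_cvg; apply: filterS E => s ->.
have [->|/loc[g [_ Hg] E]] := eqVneq t t0; last first.
  rewrite -(nbhs_singleton E) => gt; have [dg cdg] := Hg p t gt.
  have E' : \forall s \near t, (cmap (C p) \o g) s = (cmap (C p) \o glue t0 a b) s.
    by apply: filterS E => s /= ->.
  by split; [exact: near_eq_derivable E' dg|exact: derive1_continuous_germ E' cdg].
rewrite {1}/glue lexx => pa; have pb : cdom (C p) (b t0) by rewrite -ab.
have [d1 c1] := Ca.2 p t0 pa; have [d2 c2] := Cb.2 p t0 pb.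
have E0 : cmap (C p) \o glue t0 a b = glue t0 (cmap (C p) \o a) (cmap (C p) \o b).
  by apply/funext => s; rewrite /glue /=; case: ifP.
have Da : is_derive t0 1 (cmap (C p) \o a) 0 by apply: is_deriveI1 d1 (da p pa).
have Db : is_derive t0 1 (cmap (C p) \o b) 0 by apply: is_deriveI1 d2 (db p pb).
have Dg : is_derive t0 1 (glue t0 (cmap (C p) \o a) (cmap (C p) \o b)) 0.
  by apply: glue_derive => //=; rewrite ab.
rewrite E0; split; first by case: Dg.
have E1 s : derive1 (glue t0 (cmap (C p) \o a) (cmap (C p) \o b)) s =
   glue t0 (derive1 (cmap (C p) \o a)) (derive1 (cmap (C p) \o b)) s.
  have [st|st|->] := ltgtP s t0.
  - by rewrite -(nbhs_singleton (derive1_germ (glue_lt _ _ st))) /glue ltW.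
  - by rewrite -(nbhs_singleton (derive1_germ (glue_gt _ _ st))) /glue leNgt st.
  - by rewrite (is_derive1 Dg) /glue lexx da.
rewrite /prop_for /continuous_at E1 {2}/glue lexx (da p pa) => U U0.
have H1 : nbhs t0 (derive1 (cmap (C p) \o a) @^-1` U) by apply: c1; rewrite da.
have H2 : nbhs t0 (derive1 (cmap (C p) \o b) @^-1` U) by apply: c2; rewrite db.
by apply: filterS2 H1 H2 => s h1 h2; rewrite /preimage /= E1 /glue; case: ifP.
Qed.
End Curves.

Lemma derivable1_continuous (R : realType) (V : normedModType R) (f : R -> V) (t : R) :
  derivable f t 1 -> {for t, continuous f}.
Proof. by move=> df; apply: differentiable_continuous; apply/derivable1_diffP. Qed.

Lemma continuous_for_sum (R : realType) (T : topologicalType) (V : normedModType R) n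
    (F : 'I_n -> T -> V) (t : T) :
  (forall i, {for t, continuous (F i)}) -> {for t, continuous (fun s => \sum_i F i s)}.
Proof.
move=> cF; have -> : (fun s => \sum_i F i s) = \sum_(i < n) F i.
  by apply/funext => s; rewrite fct_sumE.
elim/big_ind: _ => [|h1 h2 c1 c2|i _ //]; first exact: cst_continuous.
exact: (continuousD c1 c2).
Qed.

Section Length.
Variables (R : realType) (n : nat) (M : ptopologicalType) (C : M -> chart R n M).
Local Notation E := 'rV[R]_n.+2.
Variables (x : M -> E).
Hypothesis hM : oriented_manifold C.
Hypothesis hx : hyperbolic_embedding C x.
Let sx : smooth_map C x := smooth_x hx.

Definition speed (c : R -> M) (t : R) : R := lnorm (derive1 (x \o c) t).

Lemma speed_ge0 c t : 0 <= speed c t. Proof. exact: sqrtr_ge0. Qed.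

Lemma lnormZ (a : R) (w : E) : lnorm (a *: w) = `|a| * lnorm w.
Proof. by rewrite /lnorm !lorE mulrA -expr2 sqrtrM ?sqr_ge0 // sqrtr_sqr. Qed.

Lemma C1_derive c (t : R) : C1_curve C c -> is_derive t 1 (x \o c) (derive1 (x \o c) t).
Proof. by move=> /(is_derive_curve hM t)[v /(_ _ _ sx) [d _]]; apply: is_deriveI1. Qed.

Lemma speed_continuous c : C1_curve C c -> continuous (speed c).
Proof.
move=> [cc Hc] t.
have ct := cdom_center hM (c t); set p := c t in ct *.
have nC : nbhs t (c @^-1` cdom (C p)) by apply: cc; exact: near_cdom.
have E : \forall s \near t, (\sum_i (derive1 (cmap (C p) \o c) s 0 i) *:
     'D_(delta_mx 0 i) (x \o cinv (C p)) ((cmap (C p) \o c) s)) = derive1 (x \o c) s.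
  apply: filterS nC => s /= ps.
  have [d _] := Hc p s ps.
  have dF : differentiable (x \o cinv (C p)) ((cmap (C p) \o c) s).
    by apply: smooth_map_differentiable => //; exact: chart_image_cmap.
  have H := is_derive_chain d dF.
  have H2 : is_derive s 1 (x \o c) ('D_('D_1 (cmap (C p) \o c) s) (x \o cinv (C p)) ((cmap (C p) \o c) s)).
    apply: near_eq_is_derive H.
    have : nbhs s (c @^-1` cdom (C p)) by apply: cc; exact: near_cdom.
    by apply: filterS => s' /= cs; rewrite (cmapK hM).
  rewrite (is_derive1 H2) -derive1E {2}(row_sum_delta (derive1 (cmap (C p) \o c) s)) derive_sumv //.
  by apply: eq_bigr => i _; rewrite derive_scale.
have cD : {for t, continuous (derive1 (x \o c))}.
  rewrite /prop_for /continuous_at -(nbhs_singleton E).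
  apply: (@cvg_trans _ ((fun s => \sum_i (derive1 (cmap (C p) \o c) s 0 i) *:
     'D_(delta_mx 0 i) (x \o cinv (C p)) ((cmap (C p) \o c) s)) @ t)).
    exact: near_eq_cvg.
  have [dc cdc] := Hc p t ct.
  have cg : {for t, continuous (cmap (C p) \o c)} by exact: derivable1_continuous dc.
  apply: (@continuous_for_sum _ _ _ _ (fun i s => (derive1 (cmap (C p) \o c) s 0 i) *:
     'D_(delta_mx 0 i) (x \o cinv (C p)) ((cmap (C p) \o c) s))) => i.
  have ca : {for t, continuous (fun s => derive1 (cmap (C p) \o c) s 0 i)}.
    apply: (@continuous_comp _ _ _ (derive1 (cmap (C p) \o c)) (fun A : 'rV[R]_n => A 0 i) t cdc).
    exact: coord_continuous.
  have [_ cX] := sx [:: delta_mx 0 i] (chart_image_cmap ct).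
  have cb := @continuous_comp _ _ _ (cmap (C p) \o c) ('D_(delta_mx 0 i) (x \o cinv (C p))) t cg cX.
  exact: (cvgZ ca cb).
apply: (@continuous_comp _ _ _ (fun s => lor (derive1 (x \o c) s) (derive1 (x \o c) s)) Num.sqrt t).
  exact: continuous_lor.
exact: sqrt_continuous.
Qed.

(** A primitive of the speed, with two-sided derivatives also at the ends, stands for arc length;
    lengths of pieces are differences of its values. *)
Definition is_length (c : R -> M) (l : R -> R) :=
  forall t : R, 0 <= t <= 1 -> is_derive t 1 l (speed c t).

Lemma length_primitive c : C1_curve C c -> exists l, is_length c l.
Proof.
move=> hc; have sc := speed_continuous hc.
exists (fun t => (\int[lebesgue_measure]_(s in `[(-1), t]) (speed c s))%R) => t /andP[t0 t1].
have t2 : t < 2 by lra.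
have tN : -1 < t by lra.
have i2 : lebesgue_measure.-integrable `[(-1), 2] (EFin \o speed c).
  apply: continuous_compact_integrable; first exact: segment_compact.
  exact: continuous_subspaceT.
have [d e] := continuous_FTC1_closed t2 i2 tN (sc t).
exact: is_deriveI1 d e.
Qed.

Lemma length_integral c l : C1_curve C c -> is_length c l ->
  (\int[@lebesgue_measure R]_(t in `[0%R, 1%R]) (speed c t)%:E)%E = (l 1 - l 0)%:E.
Proof.
move=> hc hl; have sc := speed_continuous hc.
have cl (t : R) : 0 <= t <= 1 -> {for t, continuous l}.
  by move=> /hl [d _]; exact: derivable1_continuous d.
rewrite (@continuous_FTC2 _ _ l 0 1) //.
- by apply: continuous_subspaceT.
- split.
  + by move=> t /itvP ht; have [] := hl t; rewrite ?ht.
  + by apply: cvg_at_right_filter; apply: cl; rewrite lexx ler01.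
  + by apply: cvg_at_left_filter; apply: cl; rewrite lexx ler01.
- by move=> t /itvP ht; apply: is_derive1; apply: hl; rewrite !ht.
Qed.

(** The length [L] belongs to one curve and is not minimized. All metric statements are phrased this
    way, and [riemannian_dist_lt] links them to the infimum of integrals. *)
Definition reach (p q : M) (L : R) : Prop := exists c l,
  [/\ C1_curve C c, c 0 = p, c 1 = q & is_length c l /\ l 1 - l 0 = L].

Lemma riemannian_dist_lt p q (e : R) :
  (riemannian_dist C x p q < e%:E)%E <-> exists2 L, L < e & reach p q L.
Proof.
split=> [/ereal_inf_lt [_ [c [hc c0 c1] <-]] H|[L Le [c [l [hc c0 c1 [hl lL]]]]]].
  have [l hl] := length_primitive hc.
  exists (l 1 - l 0); last by exists c, l.
  by rewrite -lte_fin -(length_integral hc hl).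
apply: (@le_lt_trans _ _ L%:E); last by rewrite lte_fin.
by apply: ereal_inf_lbound; exists c => //; rewrite -lL -(length_integral hc hl).
Qed.

Lemma speed_reparam c (tau dtau : R -> R) (t : R) : C1_curve C c ->
  (forall t : R, is_derive t 1 tau (dtau t)) ->
  speed (c \o tau) t = `|dtau t| * speed c (tau t).
Proof.
move=> hc ht; rewrite /speed -lnormZ; congr lnorm; apply: is_derive1.
exact: (@is_derive_comp1 R E (x \o c) tau _ _ _ (C1_derive _ hc) (ht t)).
Qed.

Lemma is_length_reparam c l (tau dtau : R -> R) (t : R) : C1_curve C c -> is_length c l ->
  (forall t : R, is_derive t 1 tau (dtau t)) -> 0 <= tau t <= 1 -> 0 <= dtau t ->
  is_derive t 1 (l \o tau) (speed (c \o tau) t).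
Proof.
move=> hc hl ht t01 d0; rewrite (speed_reparam _ hc ht) ger0_norm //.
exact: (@is_derive_comp1 R R l tau _ _ _ (hl _ t01) (ht t)).
Qed.

Lemma reach_ge0 p q L : reach p q L -> 0 <= L.
Proof.
move=> [c [l [_ _ _ [hl <-]]]].
by have [s _ ->] := MVT01 hl; exact: speed_ge0.
Qed.

Lemma reach_refl p : reach p p 0.
Proof.
exists (fun=> p), (cst 0); split=> //; first exact: C1_cst.
split; last by rewrite /= subrr.
move=> t _; have -> : speed (fun=> p) t = 0; last exact: is_derive_cst.
rewrite /speed (_ : x \o (fun=> p) = cst (x p)) // derive1_cst /lnorm lor0l sqrtr0 //.
Qed.

Lemma is_derive_affine (a b t : R) : is_derive t 1 (fun t : R => a + b * t) b.
Proof.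
have H : is_derive t 1 (fun t : R => cst a t + b *: id t) (0 + b *: (1 : R)).
  by apply: is_deriveD.
by apply: is_derive_eq; rewrite add0r [b *: 1]mulr1.
Qed.

Lemma reach_sub c l (a b : R) : C1_curve C c -> is_length c l -> 0 <= a -> a <= b -> b <= 1 ->
  reach (c a) (c b) (l b - l a).
Proof.
move=> hc hl a0 ab b1.
pose tau (t : R) := a + (b - a) * t.
have ht (t : R) : is_derive t 1 tau (cst (b - a) t) by exact: is_derive_affine.
exists (c \o tau), (l \o tau); split.
- by apply: (C1_reparam hM hc ht); exact: cst_continuous.
- by rewrite /= /tau mulr0 addr0.
- by rewrite /= /tau mulr1 addrC subrK.
split; last by rewrite /= /tau mulr0 addr0 mulr1 [a + _]addrC subrK.
move=> t /andP[t0 t1]; apply: is_length_reparam => //; last by rewrite /cst subr_ge0.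
by rewrite /tau; apply/andP; split; nra.
Qed.

Lemma length_mono c l (a b : R) : C1_curve C c -> is_length c l -> 0 <= a -> a <= b -> b <= 1 ->
  l a <= l b.
Proof. by move=> hc hl a0 ab b1; have := reach_ge0 (reach_sub hc hl a0 ab b1); rewrite subr_ge0. Qed.

Lemma reach_sym p q L : reach p q L -> reach q p L.
Proof.
move=> [c [l [hc <- <- [hl <-]]]].
pose tau (t : R) := 1 + (-1) * t.
have ht (t : R) : is_derive t 1 tau (cst (-1) t) by exact: is_derive_affine.
exists (c \o tau), (fun t => - (l \o tau) t); split.
- by apply: (C1_reparam hM hc ht); exact: cst_continuous.
- by rewrite /= /tau mulr0 addr0.
- by rewrite /= /tau mulr1 subrr.
split; last by rewrite /= /tau mulr0 addr0 mulr1 subrr; ring.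
move=> t /andP[t0 t1].
have -> : speed (c \o tau) t = - (- (speed c (tau t))).
  by rewrite (speed_reparam _ hc ht) /cst normrN normr1 mul1r opprK.
apply: is_deriveN.
have H : is_derive t 1 (l \o tau) ((-1) *: speed c (tau t)).
  apply: (@is_derive_comp1 R R l tau _ _ _ _ (ht t)); apply: hl.
  by rewrite /tau; apply/andP; split; lra.
by apply: is_derive_eq; rewrite scaleN1r.
Qed.

Lemma reach_trans p q r L1 L2 : reach p q L1 -> reach q r L2 -> reach p r (L1 + L2).
Proof.
move=> [c1 [l1 [h1 <- e1 [hl1 <-]]]] [c2 [l2 [h2 e2 <- [hl2 <-]]]].
(* t1 = 1 - (1 - 2t)^2 and t2 = (1 - 2t)^2 run from 0 to 1 on the two halves of [0,1] and have zero
   derivative at 1/2, so the concatenation is C^1 there. *)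
pose t1 (t : R) := 4 * t - 4 * (t * t).
pose t2 (t : R) := (1 - 4 * t) + 4 * (t * t).
have Q (t : R) : is_derive t 1 (fun t : R => t * t) (t + t).
  have H : is_derive t 1 ((id : R -> R) * (id : R -> R)) (t *: 1 + t *: 1) by apply: is_deriveM.
  by apply: is_derive_eq; rewrite [t *: 1]mulr1.
have D1 (t : R) : is_derive t 1 t1 (4 - 8 * t).
  have H : is_derive t 1 (fun t : R => 4 *: id t - 4 *: (t * t)) (4 *: (1 : R) - 4 *: (t + t)).
    by apply: is_deriveB.
  by apply: is_derive_eq; rewrite [4 *: 1]mulr1 [4 *: _](_ : _ = 8 * t) // -[_ *: _]/(_ * _); ring.
have D2 (t : R) : is_derive t 1 t2 (8 * t - 4).
  have H : is_derive t 1 (fun t : R => (1 + (-4) * t) + 4 *: (t * t)) (-4 + 4 *: (t + t)).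
    by apply: is_deriveD; exact: is_derive_affine.
  have -> : t2 = (fun t : R => (1 + (-4) * t) + 4 *: (t * t)).
    by apply/funext => s; rewrite /t2 mulNr.
  by apply: is_derive_eq; rewrite -[_ *: _]/(_ * _); ring.
have cD1 : continuous (fun t : R => 4 - 8 * t).
  move=> t; apply: derivable1_continuous.
  have -> : (fun t : R => 4 - 8 * t) = (fun t : R => 4 + (-8) * t) by apply/funext => s; rewrite mulNr.
  by have [] := is_derive_affine 4 (-8) t.
have cD2 : continuous (fun t : R => 8 * t - 4).
  move=> t; apply: derivable1_continuous.
  have -> : (fun t : R => 8 * t - 4) = (fun t : R => -4 + 8 * t) by apply/funext => s; rewrite addrC.
  by have [] := is_derive_affine (-4) 8 t.
have C1 := C1_reparam hM h1 D1 cD1; have C2 := C1_reparam hM h2 D2 cD2.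
pose h : R := 2^-1.
have t1h : t1 h = 1 by rewrite /t1 /h; field.
have t2h : t2 h = 0 by rewrite /t2 /h; field.
have d1h : 4 - 8 * h = 0 by rewrite /h; field.
have d2h : 8 * h - 4 = 0 by rewrite /h; field.
clearbody h.
have ch : (c1 \o t1) h = (c2 \o t2) h by rewrite /= t1h t2h e1 e2.
have cg : C1_curve C (glue h (c1 \o t1) (c2 \o t2)).
  apply: (C1_glue C1 C2 ch) => p' /= cp; apply: is_derive1.
    have [d _] := h1.2 p' (t1 h) cp; rewrite -(scale0r (derive1 (cmap (C p') \o c1) (t1 h))) -d1h.
    exact: (@is_derive_comp1 R 'rV[R]_n (cmap (C p') \o c1) t1 _ _ _ (is_deriveI1 d erefl) (D1 h)).
  have [d _] := h2.2 p' (t2 h) cp; rewrite -(scale0r (derive1 (cmap (C p') \o c2) (t2 h))) -d2h.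
  exact: (@is_derive_comp1 R 'rV[R]_n (cmap (C p') \o c2) t2 _ _ _ (is_deriveI1 d erefl) (D2 h)).
pose k := l1 1 - l2 0.
have h01 : 0 < h < 1 by apply/andP; split; lra.
exists (glue h (c1 \o t1) (c2 \o t2)), (glue h (l1 \o t1) (fun t => k + (l2 \o t2) t)); split; first exact: cg.
- by rewrite /glue ltW ?(andP h01).1 // /= /t1; congr c1; ring.
- by rewrite /glue leNgt (andP h01).2 /= /t2; congr c2; ring.
split; last first.
  rewrite /glue (ltW (andP h01).1) [1 <= h]leNgt (andP h01).2 /= /k.
  have -> : t1 0 = 0 by rewrite /t1; ring.
  have -> : t2 1 = 1 by rewrite /t2; ring.
  by ring.
have E0 : x \o glue h (c1 \o t1) (c2 \o t2) = glue h (x \o (c1 \o t1)) (x \o (c2 \o t2)).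
  by apply/funext => s; rewrite /glue /=; case: ifP.
have dl1 (t : R) : 0 <= t -> t <= h -> is_derive t 1 (l1 \o t1) (speed (c1 \o t1) t).
  move=> t0 th; apply: is_length_reparam => //; last by lra.
  by rewrite /t1; apply/andP; split; nra.
have dl2 (t : R) : t <= 1 -> h <= t -> is_derive t 1 (fun t => k + (l2 \o t2) t) (speed (c2 \o t2) t).
  move=> t0 th; rewrite -[speed _ _]add0r; apply: is_deriveD.
  apply: is_length_reparam => //; last by lra.
  by rewrite /t2; apply/andP; split; nra.
move=> t /andP[t0 t1'].
have [th|th|th] := ltgtP t h.
- have -> : speed (glue h (c1 \o t1) (c2 \o t2)) t = speed (c1 \o t1) t.
    by rewrite /speed E0 -(nbhs_singleton (derive1_germ (glue_lt _ _ th))).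
  by apply: (near_eq_is_derive (glue_lt _ _ th)); apply: dl1 => //; exact: ltW.
- have -> : speed (glue h (c1 \o t1) (c2 \o t2)) t = speed (c2 \o t2) t.
    by rewrite /speed E0 -(nbhs_singleton (derive1_germ (glue_gt _ _ th))).
  by apply: (near_eq_is_derive (glue_gt _ _ th)); apply: dl2 => //; exact: ltW.
rewrite {t t0 t1'}th.
have s1 : speed (c1 \o t1) h = 0 by rewrite (speed_reparam _ h1 D1) d1h normr0 mul0r.
have s2 : speed (c2 \o t2) h = 0 by rewrite (speed_reparam _ h2 D2) d2h normr0 mul0r.
have hh : 0 <= h by rewrite ltW // (andP h01).1.
have hh1 : h <= 1 by rewrite ltW // (andP h01).2.
have X1 : is_derive h 1 (x \o (c1 \o t1)) 0.
  rewrite -(scale0r (derive1 (x \o c1) (t1 h))) -d1h.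
  exact: (@is_derive_comp1 R E (x \o c1) t1 _ _ _ (C1_derive _ h1) (D1 h)).
have X2 : is_derive h 1 (x \o (c2 \o t2)) 0.
  rewrite -(scale0r (derive1 (x \o c2) (t2 h))) -d2h.
  exact: (@is_derive_comp1 R E (x \o c2) t2 _ _ _ (C1_derive _ h2) (D2 h)).
have -> : speed (glue h (c1 \o t1) (c2 \o t2)) h = 0.
  rewrite /speed E0 (is_derive1 (glue_derive _ X1 X2)) ?/lnorm ?lor0l ?sqrtr0 //=.
  by rewrite t1h t2h e1 e2.
apply: glue_derive; first by rewrite /= t1h t2h /k; ring.
  by rewrite -s1; exact: dl1.
by rewrite -s2; exact: dl2.
Qed.

(** Apply the mean value theorem to [f \o c + K l] and to [f \o c - K l]: their derivatives have a
    sign. *)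
Lemma curve_lipschitz (f : M -> R) (K : R) c l : is_length c l ->
  (forall t : R, 0 <= t <= 1 -> exists2 d, is_derive t 1 (f \o c) d & `|d| <= K * speed c t) ->
  `|f (c 1) - f (c 0)| <= K * (l 1 - l 0).
Proof.
move=> hl H.
pose d t := 'D_1 (f \o c) t.
have hd (t : R) : 0 <= t <= 1 -> is_derive t 1 (f \o c) (d t) /\ `|d t| <= K * speed c t.
  by move=> /H [e [De Ee] eK]; rewrite /d Ee.
rewrite ler_norml; apply/andP; split.
  have [|s hs] := @MVT01 R (fun t => (f \o c) t + K *: l t) (fun t => d t + K *: speed c t).
    by move=> s hs; apply: is_deriveD; [case: (hd s hs)|apply: is_deriveZ; exact: hl].
  have [_] := hd s hs; rewrite ler_norml => /andP[h1 h2] /=.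
  rewrite -![_ *: _]/(_ * _) => E; have : 0 <= d s + K * speed c s by lra.
  by rewrite -E; lra.
have [|s hs] := @MVT01 R (fun t => (f \o c) t - K *: l t) (fun t => d t - K *: speed c t).
  by move=> s hs; apply: is_deriveB; [case: (hd s hs)|apply: is_deriveZ; exact: hl].
have [_] := hd s hs; rewrite ler_norml => /andP[h1 h2] /=.
rewrite -![_ *: _]/(_ * _) => E; have : d s - K * speed c s <= 0 by lra.
by rewrite -E; lra.
Qed.

Lemma curve_vector c (t : R) : C1_curve C c -> exists2 v,
  speed c t = lnorm (dM C x (c t) v) &
  forall m (f : M -> 'rV[R]_m), smooth_map C f -> is_derive t 1 (f \o c) (dM C f (c t) v).
Proof.
move=> hc; have [v H] := is_derive_curve hM t hc; exists v; last exact: H.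
by rewrite /speed (is_derive1 (H _ _ sx)).
Qed.
End Length.

Lemma is_derive_lorr (R : realType) m (V : normedModType R) (g : V -> 'rV[R]_m.+1) (a : 'rV[R]_m.+1)
    (p d : V) dg : is_derive p d g dg -> is_derive p d (fun q => lor a (g q)) (lor a dg).
Proof.
move=> Dg; have H : is_derive p d (fun q => lor (cst a q) (g q)) (lor 0 (g p) + lor a dg).
  by apply: is_derive_lor.
by apply: is_derive_eq; rewrite lor0l add0r.
Qed.

Lemma is_derive_lorl (R : realType) m (V : normedModType R) (g : V -> 'rV[R]_m.+1) (a : 'rV[R]_m.+1)
    (p d : V) dg : is_derive p d g dg -> is_derive p d (fun q => lor (g q) a) (lor dg a).
Proof.
move=> /(is_derive_lorr a); rewrite lorC.
by have -> : (fun q => lor a (g q)) = (fun q => lor (g q) a) by apply/funext => q; rewrite lorC.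
Qed.

Section LocalMetric.
Variables (R : realType) (n : nat) (M : ptopologicalType) (C : M -> chart R n M).
Local Notation E := 'rV[R]_n.+2.
Variables (x : M -> E).
Hypothesis hM : oriented_manifold C.
Hypothesis hx : hyperbolic_embedding C x.
Let sx : smooth_map C x := smooth_x hx.

(** The second factor is the square of the projection of [a] to the tangent space of the hyperboloid
    at [z], and [T] pairs with that projection only. *)
Lemma tangent_cs (z T a : E) : lor z z = -1 -> lor T z = 0 ->
  lor T a ^+ 2 <= lor T T * (lor a a + lor a z ^+ 2).
Proof.
move=> zz Tz; have := @lor_perp_cs _ _ z T (a + lor a z *: z) zz Tz.
rewrite !lorE zz Tz mulr0 addr0 mulrN1 subrr => /(_ erefl).
by rewrite (lorC z a); congr (_ <= _ * _); ring.
Qed.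

Lemma sqrt_le_of_sq (a b c : R) : 0 <= c -> a ^+ 2 <= b * c ^+ 2 -> `|a| <= Num.sqrt b * c.
Proof.
move=> c0 H; rewrite -sqrtr_sqr -[X in _ * X](ger0_norm c0) -(sqrtr_sqr c).
have [b0|b0] := leP 0 b; first by rewrite -sqrtrM // ler_sqrt // mulr_ge0 // sqr_ge0.
have := le_trans (sqr_ge0 a) H; rewrite nmulr_rge0 // => c2.
rewrite (_ : a = 0) ?expr0n ?sqrtr0 ?mulr_ge0 ?sqrtr_ge0 //.
by apply/eqP; rewrite -sqrf_eq0 eq_le sqr_ge0 andbT (le_trans H) // nmulr_rle0 // sqr_ge0.
Qed.

(** The logarithm of cosh of the distance to a point is 1-Lipschitz, since the gradient of cosh r
    has norm sinh r <= cosh r. *)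
Lemma reach_lor_growth (o : E) p q L : hyperboloid o -> reach C x p q L ->
  - lor o (x q) <= expR L * - lor o (x p).
Proof.
move=> ho [c [l [hc <- <- [hl <-]]]].
pose f z := - lor o (x z).
have f1 z : 1 <= f z by exact: (hyperboloid_lor ho (x_hyperboloid hx _)).
have f0 z : 0 < f z by apply: lt_le_trans (f1 z).
have := @curve_lipschitz R n M x (fun z => ln (f z)) 1 c l hl.
rewrite mul1r => H.
have {H} : `|ln (f (c 1)) - ln (f (c 0))| <= l 1 - l 0.
  apply: H => t t01.
  have [v -> Hv] := curve_vector hM hx t hc.
  have D2 : is_derive t 1 (f \o c) (- lor o (dM C x (c t) v)).
    exact: (is_deriveN (is_derive_lorr o (Hv _ _ sx))).
  have D3 := @is_derive1_comp _ (@ln R) (f \o c) t _ _ (is_derive1_ln (f0 (c t))) D2.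
  exists ((f (c t))^-1 * - lor o (dM C x (c t) v)); first exact: D3.
  rewrite mul1r normrM normfV (gtr0_norm (f0 _)) ler_pdivrMl // normrN mulrC lorC.
  apply: sqrt_le_of_sq; first exact: ltW.
  apply: (le_trans (tangent_cs _ (lor_xx hx (c t)) (lor_dx_x hM hx _ _))).
  apply: ler_wpM2l.
    by apply: (lor_perp_ge0 (lor_xx hx (c t))); exact: lor_dx_x.
  by have [-> _] := ho; rewrite /f sqrrN; lra.
move=> H; rewrite -/(f (c 1)) -/(f (c 0)) -[leLHS](lnK (x := f (c 1))) ?posrE //.
rewrite -[f (c 0)](lnK (x := f (c 0))) ?posrE // -expRD ler_expR -lerBlDr.
by apply: le_trans H; rewrite ler_norm.
Qed.

Lemma reach_lor p q L : reach C x p q L -> - lor (x p) (x q) <= expR L.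
Proof.
by move=> /(reach_lor_growth (x_hyperboloid hx p)); rewrite (lor_xx hx) opprK mulr1.
Qed.

(** Split [w] into [psi *: z] and a tangent vector at [z] of square psi^2 - 1. The bound tends to 0
    as psi tends to 1, so small hyperbolic distance forces closeness of coordinates. *)
Lemma ambient_bound (z w : E) (psi : R) : hyperboloid z -> hyperboloid w ->
  psi = - lor z w ->
  `|w - z| <= z 0 0 * Num.sqrt (psi ^+ 2 - 1) + (psi - 1) * `|z|.
Proof.
move=> hz hw psiE; have [zz z0] := hz; have [ww _] := hw.
have p1 : 1 <= psi by rewrite psiE; exact: hyperboloid_lor.
pose u := w - psi *: z.
have uz : lor u z = 0 by rewrite /u !lorE zz psiE (lorC w z); ring.
have uu : lor u u = psi ^+ 2 - 1.
  by rewrite /u !lorE zz ww (lorC w z) psiE; ring.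
have S := lor_perp_bound zz uz; rewrite uu in S.
have s0 : 0 <= z 0 0 * Num.sqrt (psi ^+ 2 - 1) by rewrite mulr_ge0 ?sqrtr_ge0 // ltW.
have un : `|u| <= z 0 0 * Num.sqrt (psi ^+ 2 - 1).
  have uj j : u 0 j ^+ 2 <= spat u u.
    case: (unliftP ord0 j) => [k|] ->.
      rewrite /spat (bigD1 k) //= expr2 lerDl; apply: sumr_ge0 => i _.
      by rewrite -expr2 sqr_ge0.
    have := lor_perp_ge0 zz uz; rewrite lor_spat expr2; lra.
  apply/norm_rowP => // j.
  rewrite mulrC; apply: sqrt_le_of_sq; first exact: ltW.
  exact: le_trans (uj j) S.
have -> : w - z = u + (psi - 1) *: z by rewrite /u scalerBl scale1r addrA subrK.
apply: (le_trans (ler_normD _ _)); rewrite lerD // normrZ ger0_norm //.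
by rewrite subr_ge0.
Qed.

Definition mball p r : set M := [set q | exists2 L, L < r & reach C x p q L].

Lemma mball_center p r : 0 < r -> mball p r p.
Proof. by move=> r0; exists 0 => //; exact: reach_refl. Qed.

Lemma mball_sym p q r : mball p r q -> mball q r p.
Proof. by move=> [L Lr H]; exists L => //; exact: reach_sym. Qed.

Lemma mball_triangle p q z r s : mball p r q -> mball q s z -> mball p (r + s) z.
Proof.
move=> [L Lr H] [L' Ls H']; exists (L + L'); first exact: ltrD.
exact: reach_trans H H'.
Qed.

Lemma mballW p r s : r <= s -> mball p r `<=` mball p s.
Proof. by move=> rs q [L Lr H]; exists L => //; exact: lt_le_trans rs. Qed.

(** This uses that [x] is a topological embedding: a neighbourhood in M is cut out by an ambient
    one, and a short curve in M moves its image little in the ambient space. *)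
Lemma mball_sub_nbhs p (U : set M) : nbhs p U -> exists2 e : R, 0 < e & mball p e `<=` U.
Proof.
rewrite nbhsE => -[Ob [oO Op] OU].
have [V oV OV] := x_open_preimage hx oO.
have Vp : nbhs (x p) V by apply: open_nbhs_nbhs; split => //; move: Op; rewrite OV.
have [r /= r0 rV] := (nbhs_ballP _ _).1 Vp.
pose g (L : R) := (x p) 0 0 * Num.sqrt (expR L ^+ 2 - 1) + (expR L - 1) * `|x p|.
have cg : {for 0, continuous g}.
  have ce : {for (0 : R), continuous (@expR R)} by exact: continuous_expR.
  apply: continuousD.
    apply: continuousM; first exact: cst_continuous.
    apply: (@continuous_comp _ _ _ (fun L : R => expR L ^+ 2 - 1) Num.sqrt 0); last exact: sqrt_continuous.
    apply: continuousB; last exact: cst_continuous.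
    by rewrite /GRing.exp /=; exact: continuousM.
  apply: continuousM; last exact: cst_continuous.
  by apply: continuousB => //; exact: cst_continuous.
have g0 : g 0 = 0 by rewrite /g expR0 expr1n !subrr sqrtr0 mulr0 mul0r addr0.
have [e /= e0 He] : exists2 e : R, 0 < e & forall L, `|L| < e -> g L < r.
  have := cg; rewrite /prop_for /continuous_at g0 => /cvgrPdist_lt /(_ r r0) /nbhs_ballP [e /= e0 He].
  exists e => // L Le; have := He L; rewrite /ball /= !sub0r !normrN => /(_ Le).
  by apply: le_lt_trans; rewrite ler_norm.
exists e => // q [L Le H]; apply: OU; rewrite OV; apply: rV.
have L0 := reach_ge0 H.
rewrite -ball_normE /= distrC; apply: le_lt_trans (He L _); last by rewrite ger0_norm.
apply: (le_trans (ambient_bound (x_hyperboloid hx p) (x_hyperboloid hx q) erefl)).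
have p1 : 1 <= - lor (x p) (x q) by exact: (hyperboloid_lor (x_hyperboloid hx _) (x_hyperboloid hx _)).
have pe := reach_lor H.
rewrite /g lerD //; last by rewrite ler_wpM2r // lerD.
rewrite ler_wpM2l //; first by have [_ /ltW] := x_hyperboloid hx p.
rewrite ler_sqrt ?lerD // ?ler_pXn2r ?nnegrE ?(le_trans _ p1) ?expR_ge0 // subr_ge0.
by rewrite expr_ge1 ?expR_ge0 // (le_trans p1).
Qed.

Lemma segment_reach p (y w : 'rV[R]_n) (K : R) : 0 <= K ->
  (forall s : R, -1 <= s <= 1 -> chart_image (C p) (y + s *: w)) ->
  (forall s : R, -1 <= s <= 1 -> lnorm ('D_w (x \o cinv (C p)) (y + s *: w)) <= K) ->
  exists2 L, L <= K & reach C x (cinv (C p) y) (cinv (C p) (y + w)) L.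
Proof.
move=> K0 Hy HK.
(* A C^1 curve is defined on all of R, whereas the segment is known to lie in the chart for
   parameters in [-1,1] only. The sine confines the parameter to that interval, with values 0 and 1
   at the times 0 and 1. *)
pose rho (t : R) : R := sin (0 + (pi / 2) * t).
pose drho (t : R) : R := cos (0 + (pi / 2) * t) * (pi / 2).
have Dr (t : R) : is_derive t 1 rho (drho t).
  by apply: (@is_derive1_comp _ sin (fun t : R => 0 + (pi / 2) * t)); exact: is_derive_affine.
have cr : continuous rho by move=> t; apply: derivable1_continuous; case: (Dr t).
have ca : continuous (fun t : R => 0 + (pi / 2) * t).
  by move=> t; apply: derivable1_continuous; case: (is_derive_affine 0 (pi / 2 : R) t).
have cdr : continuous drho.
  move=> t; have c1 : {for t, continuous (cos \o (fun t : R => 0 + (pi / 2) * t))}.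
    by apply: (@continuous_comp _ _ _ (fun t : R => 0 + (pi / 2) * t) cos t (ca t)); exact: continuous_cos.
  exact: (cvgM c1 (cvg_cst _)).
have r1 t : -1 <= rho t <= 1 by rewrite sin_geN1 sin_le1.
pose g (t : R) := y + rho t *: w.
have Dg (t : R) : is_derive t 1 g (drho t *: w).
  rewrite -[drho t *: w]add0r; apply: is_deriveD.
  have Dd : differentiable rho t by apply/derivable1_diffP; case: (Dr t).
  have Ddw : differentiable (fun t => rho t *: w) t by apply: differentiableZl.
  split; first by apply/derivable1_diffP.
  by rewrite deriveE // diffZl //= -deriveE //; case: (Dr t) => _ ->.
have gI t : chart_image (C p) (g t) by exact: Hy.
pose c := cinv (C p) \o g.
have cgc : continuous g by move=> t; apply: derivable1_continuous; case: (Dg t).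
have cc : continuous c.
  by move=> t; apply: (@continuous_comp _ _ _ g (cinv (C p)) t (cgc t)); exact: cinv_continuous.
have pc t : cdom (C p) (c t) by exact: cdom_cinv.
have gE t : g t = cmap (C p) (c t) by rewrite /c /= (cinvK hM).
have hc : C1_curve C c.
  split=> // q t qt.
  have DT (s : R) : cdom (C q) (c s) -> is_derive s 1 (cmap (C q) \o c)
      (drho s *: 'D_w (transition (C p) (C q)) (g s)).
    move=> qs; have dT : differentiable (transition (C p) (C q)) (g s).
      by rewrite gE; exact: transition_differentiable.
    have [dg Eg] := Dg s.
    by have := is_derive_chain dg dT; rewrite Eg derive_scale.
  split; first by case: (DT t qt).
  have E1 : \forall s \near t, drho s *: 'D_w (transition (C p) (C q)) (g s) = derive1 (cmap (C q) \o c) s.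
    have : nbhs t (c @^-1` cdom (C q)) by apply: cc; exact: near_cdom.
    by apply: filterS => s qs; rewrite (is_derive1 (DT s qs)).
  rewrite /prop_for /continuous_at -(nbhs_singleton E1).
  apply: (@cvg_trans _ ((fun s => drho s *: 'D_w (transition (C p) (C q)) (g s)) @ t)).
    exact: near_eq_cvg.
  have cT := transition_derive_continuous (v := w) hM (pc t) qt; rewrite -gE in cT.
  exact: (cvgZ (cdr t) (@continuous_comp _ _ _ g ('D_w (transition (C p) (C q))) t (cgc t) cT)).
have [l hl] := length_primitive hM hx hc.
have rho0 : rho 0 = 0 by rewrite /rho mulr0 addr0 sin0.
have rho1 : rho 1 = 1 by rewrite /rho mulr1 add0r sin_pihalf.
exists (l 1 - l 0); last first.
  exists c, l; split=> //; first by rewrite /c /= /g rho0 scale0r addr0.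
  by rewrite /c /= /g rho1 scale1r.
have [|s hs] := @MVT01 R (fun t => l t - K *: rho t) (fun t => speed x c t - K *: drho t).
  by move=> s hs; apply: is_deriveB; exact: hl.
rewrite rho0 rho1 scaler0 [K *: 1]mulr1 subr0 => E1.
suff : speed x c s <= K * drho s by rewrite -subr_le0 -[K * _]/(K *: _) -E1; lra.
have d0 : 0 <= drho s.
  rewrite /drho mulr_ge0 ?divr_ge0 ?pi_ge0 //; apply: cos_ge0_pihalf.
  move: hs => /andP[s0 s1]; have p0 := pi_ge0 R.
  by rewrite add0r; apply/andP; split; nra.
have dX : differentiable (x \o cinv (C p)) (g s) by apply: smooth_map_differentiable.
have [dg Eg] := Dg s.
have := is_derive_chain dg dX; rewrite Eg derive_scale // => DX.
rewrite /speed (_ : x \o c = (x \o cinv (C p)) \o g) // (is_derive1 DX) lnormZ ger0_norm //.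
by rewrite mulrC; apply: ler_wpM2r => //; exact: HK.
Qed.
End LocalMetric.

(** * The Hopf-Rinow theorem *)

Lemma continuous_fst (R : realType) (V W : normedModType R) (f : V -> W) (a b : V) :
  {for a, continuous f} -> {for (a, b), continuous (fun u : V * V => f u.1)}.
Proof.
move=> cf A /cf hA; exists ([set u | A (f u)], setT); last by move=> [u v] [].
by split=> //; exact: filterT.
Qed.

Lemma continuous_snd (R : realType) (V W : normedModType R) (f : V -> W) (a b : V) :
  {for b, continuous f} -> {for (a, b), continuous (fun u : V * V => f u.2)}.
Proof.
move=> cf A /cf hA; exists (setT, [set u | A (f u)]); last by move=> [u v] [].
by split=> //; exact: filterT.
Qed.

Section HopfRinow.
Variables (R : realType) (n : nat) (M : ptopologicalType) (C : M -> chart R n M).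
Local Notation E := 'rV[R]_n.+2.
Variables (x : M -> E).
Hypothesis hM : oriented_manifold C.
Hypothesis hx : hyperbolic_embedding C x.
Let sx : smooth_map C x := smooth_x hx.

Lemma sum_abs_mul_le (k : nat) (c : 'I_k -> R) :
  \sum_a \sum_b `|c a| * `|c b| <= k%:R * \sum_a c a ^+ 2.
Proof.
have H (a b : 'I_k) : `|c a| * `|c b| <= 2^-1 * c a ^+ 2 + 2^-1 * c b ^+ 2.
  rewrite -(real_normK (num_real (c a))) -(real_normK (num_real (c b))).
  by have := sqr_ge0 (`|c a| - `|c b|); lra.
apply: (le_trans (ler_sum _ (fun a _ => ler_sum _ (fun b _ => H a b)))).
under eq_bigr do rewrite big_split /= sumr_const card_ord -mulr_sumr.
rewrite big_split /= sumr_const card_ord sumrMnl -mulr_sumr; set S := \sum_(i < k) _.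
by rewrite -[X in X + _]mulr_natl -[X in _ + X]mulr_natl; lra.
Qed.

(** The differential of [x] is compared at two different points of the chart: the diagonal case
    controls the metric, the general case will show that a short chord is not normal to M. The
    tolerance 1/(2(n+1)) per entry suffices because the sum of all |c_a||c_b| is at most n times the
    sum of squares. *)
Lemma gram_near_pair p (T : 'M[R]_n) : tangent_frame C x p T ->
  exists2 d : R, 0 < d & forall z z', `|z - cmap (C p) p| < d -> `|z' - cmap (C p) p| < d ->
    [/\ chart_image (C p) z, chart_image (C p) z' &
    forall (c : 'I_n -> R) w, w = \sum_a c a *: row a T ->
      `|lor ('D_w (x \o cinv (C p)) z) ('D_w (x \o cinv (C p)) z') - \sum_a c a ^+ 2| <=
      2^-1 * \sum_a c a ^+ 2].
Proof.
move=> hT; pose h a b (u : 'rV[R]_n * 'rV[R]_n) :=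
  lor ('D_(row a T) (x \o cinv (C p)) u.1) ('D_(row b T) (x \o cinv (C p)) u.2).
pose e : R := (2 * n.+1%:R)^-1.
have e0 : 0 < e by rewrite invr_gt0 mulr_gt0.
pose y0 := cmap (C p) p.
have Uy0 : chart_image (C p) y0 by exact: (chart_image_center hM).
have [d1 /= d10 Hd1] := (nbhs_ballP _ _).1 (near_chart_image hM Uy0).
have : \forall u \near (y0, y0), forall a b : 'I_n, `|h a b u - (a == b)%:R| <= e.
  apply: (@filter_forall _ _ _ _ (nbhs_filter (y0, y0))) => a.
  apply: (@filter_forall _ _ _ _ (nbhs_filter (y0, y0))) => b.
  have ch : {for (y0, y0), continuous (h a b)}.
    have [_ c1] := sx [:: row a T] Uy0.
    have [_ c2] := sx [:: row b T] Uy0.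
    have f1 : {for (y0, y0), continuous (fun u : 'rV[R]_n * 'rV[R]_n => 'D_(row a T) (x \o cinv (C p)) u.1)}.
      exact: (@continuous_fst R _ _ _ y0 y0 c1).
    have f2 : {for (y0, y0), continuous (fun u : 'rV[R]_n * 'rV[R]_n => 'D_(row b T) (x \o cinv (C p)) u.2)}.
      exact: (@continuous_snd R _ _ _ y0 y0 c2).
    exact: continuous_lor f1 f2.
  have h0 : h a b (y0, y0) = (a == b)%:R by exact: (frame_gram hM hx hT a b).
  have /cvgrPdist_le /(_ e e0) := ch.
  by apply: filterS => z; rewrite h0 distrC.
move=> /nbhs_ballP [d2 /= d20 Hd2]; exists (Num.min d1 d2); first by rewrite lt_min d10.
move=> z z'; rewrite !lt_min => /andP[z1 z2] /andP[z1' z2'].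
have Iz : chart_image (C p) z by apply: Hd1; rewrite -ball_normE /= distrC.
have Iz' : chart_image (C p) z' by apply: Hd1; rewrite -ball_normE /= distrC.
have Hz a b : `|h a b (z, z') - (a == b)%:R| <= e.
  by apply: Hd2; split; rewrite /= -ball_normE /= distrC.
split=> // c w wE.
have dX y : chart_image (C p) y -> differentiable (x \o cinv (C p)) y.
  by move=> Iy; apply: smooth_map_differentiable => //; exact: sx.
have -> : lor ('D_w (x \o cinv (C p)) z) ('D_w (x \o cinv (C p)) z') =
    \sum_a \sum_b c a * c b * h a b (z, z').
  rewrite wE !derive_sumv ?lor_suml; try exact: dX.
  apply: eq_bigr => a _; rewrite lor_sumr; apply: eq_bigr => b _.
  by rewrite !derive_scale ?lorZl ?lorZr /h /=; [ring|exact: dX|exact: dX].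
have -> : \sum_a \sum_b c a * c b * h a b (z, z') =
    \sum_a c a ^+ 2 + \sum_a \sum_b c a * c b * (h a b (z, z') - (a == b)%:R).
  rewrite -big_split; apply: eq_bigr => a _ /=.
  have -> : c a ^+ 2 = \sum_b c a * c b * (a == b)%:R.
    rewrite (bigD1 a) //= eqxx mulr1 big1 ?addr0 ?expr2 // => b ba.
    by rewrite eq_sym (negbTE ba) mulr0.
  by rewrite -big_split; apply: eq_bigr => b _ /=; ring.
set S := \sum_a c a ^+ 2; set D := \sum_a \sum_b _.
have S0 : 0 <= S by apply: sumr_ge0 => a _; exact: sqr_ge0.
rewrite addrC addKr.
have H1 : `|D| <= e * \sum_a \sum_b `|c a| * `|c b|.
  apply: (le_trans (ler_norm_sum _ _ _)); rewrite mulr_sumr; apply: ler_sum => a _.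
  apply: (le_trans (ler_norm_sum _ _ _)); rewrite mulr_sumr; apply: ler_sum => b _.
  by rewrite !normrM mulrC ler_wpM2r // mulr_ge0.
apply: (le_trans H1); have := sum_abs_mul_le c; rewrite -/S => H2.
apply: (le_trans (ler_wpM2l (ltW e0) H2)); rewrite mulrA ler_wpM2r //.
rewrite /e invfM -mulrA ler_piMr // mulrC ler_pdivrMr // mul1r ler_nat //.
Qed.

Lemma gram_near p (T : 'M[R]_n) : tangent_frame C x p T ->
  exists2 d : R, 0 < d & forall z, `|z - cmap (C p) p| < d -> chart_image (C p) z /\
    forall (c : 'I_n -> R) w, w = \sum_a c a *: row a T ->
      2^-1 * \sum_a c a ^+ 2 <= lor ('D_w (x \o cinv (C p)) z) ('D_w (x \o cinv (C p)) z) <=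
      2 * \sum_a c a ^+ 2.
Proof.
move=> hT; have [d d0 Hd] := gram_near_pair hT; exists d => // z zd.
have [Iz _ G] := Hd z z zd zd; split=> // c w wE.
by have := G c w wE; rewrite ler_norml => /andP[]; move: (\sum_a _) (lor _ _) => a b h1 h2; lra.
Qed.

Lemma frame_coord_bound p (T : 'M[R]_n) : tangent_frame C x p T ->
  exists2 K : R, 0 <= K & forall w : 'rV[R]_n, exists2 c : 'I_n -> R,
    w = \sum_a c a *: row a T & \sum_a c a ^+ 2 <= (K * `|w|) ^+ 2.
Proof.
move=> hT; have uT := frame_unitmx hT.
pose K1 : R := \sum_a \sum_j `|invmx T j a|.
have K10 : 0 <= K1 by apply: sumr_ge0 => a _; apply: sumr_ge0.
exists (n.+1%:R * K1) => [|w]; first by rewrite mulr_ge0.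
exists (fun a => (w *m invmx T) 0 a).
  rewrite -[LHS]mulmx1 -(mulVmx uT) mulmxA; apply/rowP => j.
  by rewrite summxE mxE; apply: eq_bigr => a _; rewrite !mxE.
have Hc a : `|(w *m invmx T) 0 a| <= K1 * `|w|.
  rewrite mxE; apply: (le_trans (ler_norm_sum _ _ _)).
  apply: (@le_trans _ _ (\sum_j `|invmx T j a| * `|w|)).
    by apply: ler_sum => j _; rewrite normrM mulrC ler_wpM2l // norm_rowE.
  rewrite -mulr_suml ler_wpM2r // /K1 [leRHS](bigD1 a) //= lerDl.
  by apply: sumr_ge0 => b _; apply: sumr_ge0.
apply: (@le_trans _ _ (\sum_(a < n) (K1 * `|w|) ^+ 2)).
  apply: ler_sum => a _; rewrite -(real_normK (num_real _)) ler_pXn2r ?nnegrE ?mulr_ge0 //.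
rewrite sumr_const card_ord -[_ *+ n]mulr_natl.
rewrite [leRHS](_ : _ = (n.+1%:R * n.+1%:R) * (K1 * `|w|) ^+ 2); last by ring.
rewrite ler_wpM2r ?sqr_ge0 // -natrM ler_nat; nia.
Qed.

Lemma nbhs_mball p (r : R) : 0 < r -> nbhs p (mball C x p r).
Proof.
move=> r0; have [T hT] := tangent_frame_exists hM hx p.
have [d d0 Hd] := gram_near hT; have [K K0 HK] := frame_coord_bound hT.
pose e := Num.min d (r / (2 * K + 1)).
have K1 : 0 < 2 * K + 1 by rewrite ltr_wpDl // mulr_ge0.
have e0 : 0 < e by rewrite lt_min d0 divr_gt0.
have Hn : \forall q \near p, cdom (C p) q /\ `|cmap (C p) q - cmap (C p) p| < e.
  apply: filterI; first exact: near_cdom (cdom_center hM p).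
  have := cmap_continuous hM (cdom_center hM p) => /cvgrPdist_lt /(_ e e0).
  by apply: filterS => q; rewrite distrC.
apply: filterS Hn => q [pq qe].
set w := cmap (C p) q - cmap (C p) p in qe.
have we : `|w| < d by rewrite (lt_le_trans qe) // ge_min lexx.
have Hs s : -1 <= s <= 1 -> `|cmap (C p) p + s *: w - cmap (C p) p| < d.
  move=> /andP[s0 s1]; rewrite addrAC subrr add0r normrZ; apply: le_lt_trans we.
  by rewrite ler_piMl // ler_norml s0 s1.
have [c wE cb] := HK w.
have [|||L Lle] := @segment_reach R n M C x hM hx p (cmap (C p) p) w (2 * (K * `|w|)).
- by rewrite mulr_ge0 // mulr_ge0.
- by move=> s hs; have [] := Hd _ (Hs s hs).
- move=> s hs; have [_ /(_ c w wE) /andP[_ H]] := Hd _ (Hs s hs).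
  rewrite /lnorm -[leRHS]ger0_norm ?mulr_ge0 // -sqrtr_sqr ler_sqrt ?sqr_ge0 //.
  by apply: (le_trans H); rewrite [leRHS]exprMn; have := sqr_ge0 (K * `|w|); lra.
rewrite (cmapK hM); last exact: cdom_center.
rewrite /w addrC subrK (cmapK hM) // => H.
exists L => //; apply: (le_lt_trans Lle).
have : `|w| < r / (2 * K + 1) by rewrite (lt_le_trans qe) // ge_min lexx orbT.
by rewrite ltr_pdivlMr //; have := normr_ge0 w; nra.
Qed.

Lemma mball_open p r : open (mball C x p r).
Proof.
rewrite openE => q [L Lr H]; apply: (@filterS _ (nbhs q) _ (mball C x q (r - L))).
  by move=> z [L' Lr' H']; exists (L + L'); [rewrite -ltrBrDl|exact: reach_trans H H'].
by apply: nbhs_mball; rewrite subr_gt0.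
Qed.

Definition totally_bounded (A : set M) := forall e : R, 0 < e ->
  exists s : seq M, forall q, A q -> exists2 z, z \in s & mball C x z e q.

(** The points at distance at most [r]; the infimum of lengths need not be attained, hence the
    margin [e]. *)
Definition cmball p r : set M := [set q | forall e : R, 0 < e -> mball C x p (r + e) q].

Lemma cmball_closed p r : closed (cmball p r).
Proof.
move=> q clq e e0; have e2 : 0 < e / 2 by rewrite divr_gt0.
have [z [Az zq]] := clq _ (nbhs_mball q e2).
have := mball_triangle hM hx (Az _ e2) (mball_sym hM hx zq).
by rewrite -addrA -splitr.
Qed.

Lemma mball_sub_cmball p r : mball C x p r `<=` cmball p r.
Proof. by move=> q pq e e0; apply: mballW pq; rewrite lerDl ltW. Qed.

Hypothesis hcomplete : complete_hypersurface C x.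

Lemma complete_mball (s : nat -> M) :
  (forall e : R, 0 < e -> exists K, forall i j, (K <= i)%N -> (K <= j)%N -> mball C x (s i) e (s j)) ->
  exists p, forall e : R, 0 < e -> exists K, forall i, (K <= i)%N -> mball C x (s i) e p.
Proof.
move=> H; have [e e0|p Hp] := hcomplete (s := s).
  have [K HK] := H e e0; exists K => i j Ki Kj.
  by apply/(riemannian_dist_lt hM hx); exact: HK.
exists p => e e0; have [K HK] := Hp e e0; exists K => i Ki.
by apply/(riemannian_dist_lt hM hx); exact: HK.
Qed.

Lemma ultra_cover (F : set_system M) (A : set M) (s : seq M) (B : M -> set M) :
  UltraFilter F -> F A -> (forall q, A q -> exists2 z, z \in s & B z q) -> exists z, F (B z).
Proof.
move=> UF; elim: s A => [|z s IH] A FA AB.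
  by have [q /AB []] := filter_ex FA.
have [FB|FB] := in_ultra_setVsetC (B z) UF; first by exists z.
apply: (IH (A `&` ~` B z)); first exact: filterI.
move=> q [Aq nB]; have [y] := AB q Aq; rewrite inE => /predU1P[-> //|ys yq].
by exists y.
Qed.

(** An ultrafilter on the set contains, for every k, some ball of radius 1/(k+1). Two such balls
    always meet, so their centres form a Cauchy sequence, and the ultrafilter converges to its
    limit. *)
Lemma closed_totally_bounded_compact (A : set M) : closed A -> totally_bounded A -> compact A.
Proof.
move=> cA tA; rewrite compact_ultra => F UF FA.
have inv0 k : 0 < (k.+1%:R : R)^-1 by rewrite invr_gt0.
have /choice [z Hz] : forall k : nat, exists z, F (mball C x z k.+1%:R^-1).
  move=> k; have [s Hs] := tA _ (inv0 k).
  exact: (@ultra_cover F A s (fun z => mball C x z k.+1%:R^-1) UF FA Hs).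
have archi (e : R) : 0 < e -> exists K : nat, forall i, (K <= i)%N -> (i.+1%:R : R)^-1 < e.
  move=> e0; have [K] := ltr_add_invr e0; rewrite add0r => HK.
  exists K => i Ki; apply: le_lt_trans HK.
  by rewrite lef_pV2 ?posrE // ler_nat ltnS.
have [e e0|p Hp] := complete_mball (s := z).
  have [K HK] := archi (e / 2) (divr_gt0 e0 (ltr0n _ 2)).
  exists K => i j Ki Kj.
  have [q [iq jq]] := filter_ex (filterI (Hz i) (Hz j)).
  apply: mballW (mball_triangle hM hx iq (mball_sym hM hx jq)).
  by rewrite (splitr e) lerD // ltW // HK.
have Fp : F --> p.
  move=> U /= /(mball_sub_nbhs hM hx) [e e0 eU].
  have e2 : 0 < e / 2 by rewrite divr_gt0.
  have [K1 HK1] := archi _ e2; have [K2 HK2] := Hp _ e2.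
  pose k := maxn K1 K2; apply: filterS (Hz k) => q zq; apply: eU.
  apply: mballW (mball_triangle hM hx (mball_sym hM hx (HK2 k (leq_maxr _ _))) zq).
  by rewrite [leRHS]splitr lerD // ltW // HK1 // leq_maxl.
exists p; split=> //; apply: cA => U Up.
by have [q Hq] := filter_ex (filterI FA (Fp U Up)); exists q.
Qed.

Lemma compact_finite_cover (A : set M) (r : M -> R) : compact A -> (forall z, 0 < r z) ->
  exists s : seq M, forall q, A q -> exists2 z, z \in s & mball C x z (r z) q.
Proof.
rewrite compact_cover => cA r0.
have [|q Aq|D _ HD] := cA M setT (fun z => mball C x z (r z)).
- by move=> z _; exact: mball_open.
- by exists q => //; exact: mball_center.
exists (finmap.enum_fset D) => q /HD [z /= zD zq]; exists z => //.
Qed.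

Lemma compact_totally_bounded (A : set M) : compact A -> totally_bounded A.
Proof. by move=> cA e e0; apply: (compact_finite_cover cA). Qed.

Lemma totally_boundedS (A B : set M) : A `<=` B -> totally_bounded B -> totally_bounded A.
Proof. by move=> AB tB e e0; have [s Hs] := tB e e0; exists s => q /AB /Hs. Qed.

Lemma totally_bounded_bigcup (s : seq M) (B : M -> set M) : (forall z, totally_bounded (B z)) ->
  totally_bounded [set q | exists2 z, z \in s & B z q].
Proof.
move=> tB e e0; elim: s => [|z s [s1 IH]]; first by exists [::] => q [].
have [s2 H2] := tB z e e0; exists (s1 ++ s2) => q [y].
rewrite inE => /predU1P[->|ys] yq.
  by have [u us uq] := H2 q yq; exists u => //; rewrite mem_cat us orbT.
by have [|u us uq] := IH q; [exists y|exists u => //; rewrite mem_cat us].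
Qed.

(** Cutting a nearly shortest curve at a prescribed length, found by the intermediate value theorem,
    plays the role of a minimizing geodesic. *)
Lemma mball_split p (r a : R) q : 0 < r -> 0 <= a -> mball C x p (r + a) q ->
  forall e : R, 0 < e -> exists2 z, mball C x p r z & mball C x z (a + e) q.
Proof.
move=> r0 a0 [L Lr [c [l [hc c0 c1 [hl lE]]]]] e e0.
have L0 : 0 <= l 1 - l 0 by rewrite subr_ge0; apply: (length_mono hM hx hc hl).
have lc (t : R) : 0 <= t <= 1 -> {for t, continuous l}.
  by move=> /hl [d _]; exact: derivable1_continuous d.
(* The first piece has length max(0, L - a - e/2) < r, and the remaining one at most a + e/2. *)
pose v := l 0 + Num.max 0 (L - a - e / 2).
have [t] : exists2 t, t \in `[0, 1]%R & l t = v.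
  apply: IVT => //.
    apply: continuous_in_subspaceT => t; rewrite inE /= in_itv /= => ht; exact: lc.
  rewrite /v; have [h|h] := leP 0 (L - a - e / 2).
    rewrite minEle maxEle; have -> : l 0 <= l 1 by lra.
    by apply/andP; split; lra.
  rewrite addr0 minEle maxEle; have -> : l 0 <= l 1 by lra.
  by rewrite lexx; lra.
rewrite in_itv /= => /andP[t0 t1] lt.
have R1 := reach_sub hM hx hc hl (lexx 0) t0 t1.
have R2 := reach_sub hM hx hc hl t0 t1 (lexx 1).
exists (c t).
  exists (l t - l 0); last by rewrite -c0.
  by rewrite lt /v; have [h|h] := leP 0 (L - a - e / 2); lra.
exists (l 1 - l t); last by rewrite -c1.
by rewrite lt /v; have [h|h] := leP 0 (L - a - e / 2); lra.
Qed.

Lemma mball_totally_bounded_local z : exists2 t : R, 0 < t & totally_bounded (mball C x z t).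
Proof.
have zI := near_chart_image hM (chart_image_center hM z).
have [d /= d0 dI] := (nbhs_ballP _ _).1 zI.
pose K := cinv (C z) @` closed_ball (cmap (C z) z) (d / 2).
have d2 : 0 < d / 2 by rewrite divr_gt0.
have sub : closed_ball (cmap (C z) z) (d / 2) `<=` chart_image (C z).
  move=> y; rewrite closed_ballE // /closed_ball_ /= => yd; apply: dI.
  by rewrite -ball_normE /= (le_lt_trans yd) // ltr_pdivrMr // ltr_pMr // ltr1n.
have cK : compact K.
  apply: continuous_compact; last first.
    apply: bounded_closed_compact; last exact: closed_ball_closed.
    exists (`|cmap (C z) z| + d / 2); split; first exact: num_real.
    move=> r rd y; rewrite closed_ballE // /closed_ball_ /= => yd.
    rewrite ltW // (le_lt_trans _ rd) // -(subrK (cmap (C z) z) y) addrC.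
    by rewrite (le_trans (ler_normD _ _)) // lerD // distrC.
  apply: continuous_in_subspaceT => y; rewrite inE => /sub yI; exact: cinv_continuous.
have [t t0 Ht] : exists2 t : R, 0 < t & mball C x z t `<=` K.
  apply: (mball_sub_nbhs hM hx).
  have : \forall q \near z, cdom (C z) q /\ `|cmap (C z) q - cmap (C z) z| < d / 2.
    apply: filterI; first exact: near_cdom (cdom_center hM z).
    have := cmap_continuous hM (cdom_center hM z) => /cvgrPdist_lt /(_ _ d2).
    by apply: filterS => q; rewrite distrC.
  apply: filterS => q [zq qd]; exists (cmap (C z) q); last by rewrite (cmapK hM).
  by rewrite closed_ballE // /closed_ball_ /= distrC ltW.
by exists t => //; apply: (totally_boundedS Ht); exact: compact_totally_bounded.
Qed.

Lemma totally_bounded_cmball p r : 0 < r -> totally_bounded (mball C x p r) ->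
  totally_bounded (cmball p r).
Proof.
move=> r0 tb e e0; have e2 : 0 < e / 2 by rewrite divr_gt0.
have e4 : 0 < e / 4 by rewrite divr_gt0.
have [s Hs] := tb _ e2; exists s => q /(_ _ e4) pq.
have [z pz zq] := mball_split r0 (ltW e4) pq e4.
have [u us uz] := Hs z pz; exists u => //.
by apply: mballW (mball_triangle hM hx uz zq); lra.
Qed.

(** Continuity argument on the radius. At a limit radius, a slightly smaller ball is e/4-dense up to
    a small error; beyond a good radius, the closed ball is compact and is covered by finitely many
    balls that are totally bounded with room to spare. *)
Theorem hopf_rinow p r : totally_bounded (mball C x p r).
Proof.
pose S : set R := [set r | 0 < r /\ totally_bounded (mball C x p r)].
have down a b : a <= b -> totally_bounded (mball C x p b) -> totally_bounded (mball C x p a).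
  by move=> ab; apply: totally_boundedS; exact: mballW.
have limit s : 0 < s -> (forall a, a < s -> totally_bounded (mball C x p a)) ->
    totally_bounded (mball C x p s).
  move=> s0 Hs e e0; have e3 : 0 < e / 4 by rewrite divr_gt0.
  have [se|se] := leP s (e / 4).
    exists [:: p] => q pq; exists p; first by rewrite inE.
    by apply: mballW pq; lra.
  have [s1 H1] := Hs (s - e / 4) ltac:(lra) _ e3; exists s1 => q pq.
  have pq' : mball C x p ((s - e / 4) + e / 4) q by rewrite subrK.
  have [|z pz zq] := mball_split _ (ltW e3) pq' e3; first by lra.
  have [u us uz] := H1 z pz; exists u => //.
  by apply: mballW (mball_triangle hM hx uz zq); lra.
have extend s : 0 < s -> totally_bounded (mball C x p s) ->
    exists2 t, 0 < t & totally_bounded (mball C x p (s + t)).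
  move=> s0 Hs.
  have cK := closed_totally_bounded_compact (@cmball_closed p s) (totally_bounded_cmball s0 Hs).
  have /choice [tau Ht] : forall z, exists t : R, 0 < t /\ totally_bounded (mball C x z t).
    by move=> z; have [t t0 Ht] := mball_totally_bounded_local z; exists t.
  have [|L HL] := compact_finite_cover (r := fun z => tau z / 2) cK.
    by move=> z; rewrite divr_gt0 //; case: (Ht z).
  have [t t0 tL] : exists2 t : R, 0 < t & forall z, z \in L -> t <= tau z / 4.
    elim: L {HL} => [|z L [t t0 IH]]; first by exists 1.
    exists (Num.min t (tau z / 4)).
      by rewrite lt_min t0 divr_gt0 //; case: (Ht z).
    by move=> y; rewrite inE ge_min => /predU1P[->|/IH ->]; rewrite ?lexx ?orbT.
  exists t => //; apply: (totally_boundedS _ (totally_bounded_bigcup L (fun z => (Ht z).2))) => q pq.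
  have [z pz zq] := mball_split s0 (ltW t0) pq t0.
  have [u us uz] := HL z (mball_sub_cmball pz); exists u => //.
  apply: mballW (mball_triangle hM hx uz zq); have := tL u us; lra.
have [t t0 Ht] := mball_totally_bounded_local p.
have S0 : S !=set0 by exists t.
have [[b ub]|nub] := pselect (has_ubound S).
  have hs : has_sup S by split => //; exists b.
  have tS : t <= sup S by apply: ub_le_sup => //; exists b.
  have s0 : 0 < sup S by apply: lt_le_trans tS.
  have Hs : totally_bounded (mball C x p (sup S)).
    apply: limit => // a asup.
    have [c [c0 Hc] ac] := sup_adherent (ltac:(by rewrite subr_gt0; exact: asup) : 0 < sup S - a) hs.
    by apply: down Hc; move: ac; rewrite opprB addrC subrK => /ltW.
  have [u u0 Hu] := extend _ s0 Hs.
  have : sup S + u <= sup S by apply: ub_le_sup; [exists b|split => //; rewrite addr_gt0].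
  by rewrite gerDl leNgt u0.
have [c Sc rc] : exists2 c, S c & r < c.
  apply: contrapT => H; apply: nub; exists r => c Sc; rewrite leNgt; apply/negP => rc.
  by apply: H; exists c.
by apply: down Sc.2; exact: ltW.
Qed.

Lemma cmball_compact p r : 0 < r -> compact (cmball p r).
Proof.
move=> r0; apply: closed_totally_bounded_compact; first exact: cmball_closed.
by apply: totally_bounded_cmball => //; exact: hopf_rinow.
Qed.
End HopfRinow.

(** * Volume of small intrinsic balls *)

Section IteratedIntegral.
Variable R : realType.

(** The integral of a nonnegative function is a supremum over simple functions below it, so it is
    monotone even for the inner iterated integrals, whose measurability is not established. *)
Lemma ge0_le_integral_nonmeas (f g : R -> \bar R) : (forall t, (0 <= f t)%E) -> (forall t, (f t <= g t)%E) ->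
  (\int[@lebesgue_measure R]_(t in [set: R]) f t <= \int[@lebesgue_measure R]_(t in [set: R]) g t)%E.
Proof.
move=> f0 fg; have g0 t : (0 <= g t)%E by exact: le_trans (f0 t) (fg t).
rewrite !ge0_integralTE //; apply: ereal_sup_le => _ [h /= hf <-].
exists h => // t; exact: le_trans (hf t) (fg t).
Qed.

Lemma integral_rV_ge0 n (F : 'rV[R]_n -> \bar R) : (forall y, (0 <= F y)%E) -> (0 <= integral_rV F)%E.
Proof. by elim: n F => [|n IH] F F0 //=; apply: integral_ge0 => t _; exact: IH. Qed.

(** For a triangular [T], fixing the first coordinate translates the remaining parallelepiped
    without deforming it. The induction therefore multiplies lengths of intervals, and the
    determinant of [T] appears as the product of its diagonal. *)
Lemma integral_rV_box n (F : 'rV[R]_n -> \bar R) (T : 'M[R]_n) (y0 : 'rV[R]_n) (s c : R) :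
  0 < s -> 0 <= c -> (forall y, (0 <= F y)%E) ->
  (forall i j : 'I_n, (j < i)%N -> T i j = 0) -> (forall i, 0 < T i i) ->
  (forall z : 'rV[R]_n, (forall i, `|z 0 i| < s) -> (c%:E <= F (y0 + z *m T)%R)%E) ->
  ((c * (2 * s) ^+ n * \prod_i T i i)%:E <= integral_rV F)%E.
Proof.
elim: n F T y0 c => [|n IH] F T y0 c s0 c0 F0 Tup Tpos H.
  rewrite big_ord0 expr0 !mulr1 /=; have := H 0; rewrite mul0mx addr0.
  by rewrite (_ : y0 = 0) => [|]; [apply=> -[]|apply/rowP => -[]].
rewrite -[n.+1]/(1 + n)%N in T y0 Tup Tpos H *.
pose a : R := T (lshift n 0) (lshift n 0).
pose b : 'rV[R]_n := ursubmx T.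
pose T' : 'M[R]_n := drsubmx T.
have a0 : 0 < a by exact: Tpos.
have TE : T = block_mx (a%:M) b 0 T'.
  rewrite -[LHS]submxK; congr block_mx.
    by apply/matrixP => i j; rewrite !ord1 !mxE eqxx mulr1n.
  by apply/matrixP => i j; rewrite !mxE Tup //= ord1 /=.
pose yl : R := lsubmx y0 0 0; pose yr : 'rV[R]_n := rsubmx y0.
have yE : y0 = row_mx (yl%:M) yr.
  rewrite -[LHS]hsubmxK; congr row_mx.
  by apply/matrixP => i j; rewrite !ord1 [RHS]mxE eqxx mulr1n.
have inner t : `|(t - yl) / a| < s ->
    ((c * (2 * s) ^+ n * \prod_i T' i i)%:E <= integral_rV (fun w : 'rV[R]_n => F (row_mx (t%:M : 'rV[R]_1) w)))%E.
  move=> ts; pose z0 := (t - yl) / a.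
  apply: (IH _ T' (yr + z0 *: b)) => //.
  - by move=> i j ij; rewrite !mxE Tup //= !ltn_add2l.
  - by move=> i; rewrite !mxE; exact: Tpos.
  move=> z zs; have := H (row_mx (z0%:M) z).
  have -> : (y0 + row_mx z0%:M z *m T = row_mx t%:M (yr + z0 *: b + z *m T')).
    rewrite yE TE mul_row_block mulmx0 addr0 mul_scalar_mx mul_scalar_mx add_row_mx addrA.
    congr row_mx; apply/matrixP => i j; rewrite !ord1 !mxE eqxx !mulr1n /z0 divfK ?gt_eqF //.
    by rewrite addrC subrK.
  apply=> i; case: (split_ordP i) => j ->; last by rewrite row_mxEr.
  by rewrite row_mxEl ord1 mxE eqxx mulr1n.
set K := (c * (2 * s) ^+ n * \prod_i T' i i) in inner.
have K0 : 0 <= K.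
  have PT : 0 <= \prod_i T' i i by apply: prodr_ge0 => i _; rewrite !mxE ltW.
  by rewrite !mulr_ge0 // exprn_ge0 // mulr_ge0 // ltW.
pose I : set R := `]yl - s * a, yl + s * a[%classic.
have -> : (c * (2 * s) ^+ n.+1 * \prod_i T i i)%:E =
  (\int[@lebesgue_measure R]_(t in [set: R]) ((cst K%:E) \_ I) t)%E.
  rewrite -integral_mkcond integral_cst /I //= lebesgue_measure_itv /= lte_fin.
  have -> : (yl - s * a < yl + s * a) by have := mulr_gt0 s0 a0; lra.
  rewrite -EFinB -EFinM; congr EFin; rewrite big_split_ord /= big_ord1 -/a /K.
  have -> : \prod_(i < n) T (rshift 1 i) (rshift 1 i) = \prod_(i < n) T' i i.
    by apply: eq_bigr => i _; rewrite !mxE.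
  by rewrite exprS; ring.
apply: ge0_le_integral_nonmeas => t; rewrite /patch; case: ifP => // tI.
- apply: inner; move: tI; rewrite inE /I /= in_itv /= => /andP[h1 h2].
  rewrite normrM normfV (gtr0_norm a0) ltr_pdivrMr // ltr_norml; apply/andP; split; lra.
- exact: integral_rV_ge0.
Qed.
End IteratedIntegral.

Lemma continuous_for_bigsum (R : realType) (T : topologicalType) (I : finType)
    (F : I -> T -> R) (t : T) :
  (forall i, {for t, continuous (F i)}) -> {for t, continuous (fun s => \sum_i F i s)}.
Proof.
move=> cF; elim: (index_enum I) => [|i r IH].
  have -> : (fun s => \sum_(i <- [::]) F i s) = cst 0 by apply/funext => s; rewrite big_nil.
  exact: cst_continuous.
have -> : (fun s => \sum_(j <- i :: r) F j s) = (fun s => F i s + \sum_(j <- r) F j s).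
  by apply/funext => s; rewrite big_cons.
exact: (continuousD (cF i) IH).
Qed.

Lemma continuous_for_bigprod (R : realType) (T : topologicalType) (I : finType)
    (F : I -> T -> R) (t : T) :
  (forall i, {for t, continuous (F i)}) -> {for t, continuous (fun s => \prod_i F i s)}.
Proof.
move=> cF; elim: (index_enum I) => [|i r IH].
  have -> : (fun s => \prod_(i <- [::]) F i s) = cst 1 by apply/funext => s; rewrite big_nil.
  exact: cst_continuous.
have -> : (fun s => \prod_(j <- i :: r) F j s) = (fun s => F i s * \prod_(j <- r) F j s).
  by apply/funext => s; rewrite big_cons.
exact: (cvgM (cF i) IH).
Qed.

Lemma continuous_for_det (R : realType) (T : topologicalType) n (A : T -> 'M[R]_n) (t : T) :
  (forall i j, {for t, continuous (fun s => A s i j)}) -> {for t, continuous (fun s => \det (A s))}.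
Proof.
move=> cA; rewrite /determinant; apply: continuous_for_bigsum => sg.
refine (cvgM (cvg_cst _) (@continuous_for_bigprod R T 'I_n
  (fun i s => A s i (perm.fun_of_perm sg i)) t _)) => i; exact: cA.
Qed.

Lemma lnorm_le (R : realType) m (w : 'rV[R]_m.+1) (c : R) :
  0 <= c -> lor w w <= c ^+ 2 -> lnorm w <= c.
Proof. by move=> c0 H; rewrite /lnorm -(ger0_norm c0) -sqrtr_sqr ler_sqrt ?sqr_ge0. Qed.

Section VolumeOfBalls.
Variables (R : realType) (n : nat) (M : ptopologicalType) (C : M -> chart R n M).
Local Notation E := 'rV[R]_n.+2.
Variables (x : M -> E).
Hypothesis hM : oriented_manifold C.
Hypothesis hx : hyperbolic_embedding C x.
Let sx : smooth_map C x := smooth_x hx.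
Variable vol : {measure set (g_sigma_algebraType (@open M)) -> \bar R}.
Hypothesis hvol : riemannian_volume C x vol.

(** A ball of small radius s contains the image of a cube of edge s/(n+1) in orthonormal
    coordinates, on which the volume density is at least half of its central value. *)
Definition ball_const : R := 2^-1 * n.+1%:R^-1 ^+ n.

Lemma ball_const_gt0 : 0 < ball_const.
Proof. by rewrite /ball_const mulr_gt0 ?invr_gt0 // exprn_gt0 // invr_gt0. Qed.

Lemma open_measurable_generated (U : set M) : open U -> <<s @open M >> U.
Proof. by move=> oU; exact: sub_gen_smallest. Qed.

Lemma mulmx_rows (z : 'rV[R]_n) (T : 'M[R]_n) : z *m T = \sum_a z 0 a *: row a T.
Proof. by apply/rowP => j; rewrite summxE mxE; apply: eq_bigr => a _; rewrite !mxE. Qed.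

Lemma mball_volume_near (p0 : M) :
  exists2 s0 : R, 0 < s0 & \forall p \near p0, forall s : R, 0 < s -> s < s0 ->
    ((ball_const * s ^+ n)%:E <= vol (mball C x p s))%E.
Proof.
have aux (u v : R) : 0 < u -> u - v < 4^-1 * u -> 4^-1 * u <= v by move=> *; lra.
have aux2 (u : R) : 2 * \sum_(a < n) u ^+ 2 <= (n.+1%:R * u) ^+ 2.
  rewrite sumr_const card_ord -[_ *+ n]mulr_natl exprMn mulrA ler_wpM2r ?sqr_ge0 //.
  by rewrite -natrX -natrM ler_nat; lia.
have [T hT] := tangent_frame_exists hM hx p0; have [Tup Tpos TG] := hT.
have [d1 d10 Hd1] := gram_near hM hx hT.
set G0 := gram x (C p0) (cmap (C p0) p0) in TG.
pose P := \prod_i T i i.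
have P0 : 0 < P by apply: prodr_gt0 => i _.
have dT : \det T = P.
  rewrite -det_tr det_trig; first by apply: eq_bigr => i _; rewrite mxE.
  by apply/is_trig_mxP => i j ij; rewrite mxE Tup.
(* The density at the centre is 1/P, which cancels the determinant of the frame. The bound below by
   a quarter of [\det G0] becomes a half after the square root. *)
have dG : P ^+ 2 * \det G0 = 1.
  have := congr1 determinant TG; rewrite !det_mulmx det_tr det1 dT => <-; ring.
have [d2 d20 Hd2] : exists2 d : R, 0 < d & forall z, `|z - cmap (C p0) p0| < d ->
    4^-1 * \det G0 <= \det (gram x (C p0) z).
  have cd : {for cmap (C p0) p0, continuous (fun z => \det (gram x (C p0) z))}.
    apply: continuous_for_det => i j.
    have [_ c1] := sx [:: delta_mx 0 i] (chart_image_center hM p0).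
    have [_ c2] := sx [:: delta_mx 0 j] (chart_image_center hM p0).
    have -> : (fun z => gram x (C p0) z i j) = (fun z => lor ('D_(delta_mx 0 i) (x \o cinv (C p0)) z)
        ('D_(delta_mx 0 j) (x \o cinv (C p0)) z)) by apply/funext => z; rewrite mxE.
    exact: continuous_lor c1 c2.
  have G0p : 0 < \det G0 by have : (0 : R) < 1 by []; rewrite -dG pmulr_rgt0 // exprn_gt0.
  have e0 : 0 < 4^-1 * \det G0 by rewrite mulr_gt0.
  have /cvgrPdist_lt /(_ _ e0) /nbhs_ballP [d /= d0 Hd] := cd.
  exists d => [|z zd]; first exact: d0.
  have bz : ball (cmap (C p0) p0) d z by rewrite -ball_normE /= distrC.
  move: (Hd z bz) => /=; rewrite ltr_norml => /andP[_]; exact: aux G0p.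
pose d := Num.min d1 d2; have d0 : 0 < d by rewrite lt_min d10.
pose K : R := \sum_a \sum_j `|T a j| + 1.
have K0 : 0 < K by rewrite ltr_wpDl // sumr_ge0 // => a _; apply: sumr_ge0.
exists (d / 2 / K); first by rewrite !divr_gt0.
have Hn : \forall p \near p0, cdom (C p0) p /\ `|cmap (C p0) p - cmap (C p0) p0| < d / 2.
  apply: filterI; first exact: near_cdom (cdom_center hM p0).
  have := cmap_continuous hM (cdom_center hM p0) => /cvgrPdist_lt /(_ (d / 2)).
  by rewrite divr_gt0 // => /(_ isT); apply: filterS => q; rewrite distrC.
apply: filterS Hn => p [p0p pd] s s0 ss.
pose s' := s / n.+1%:R / 2.
have s'0 : 0 < s' by rewrite !divr_gt0.
have s's : s' <= s.
  rewrite /s' -mulrA ler_piMr ?(ltW s0) // mulr_ile1 ?invr_ge0 // invf_le1 ?ler1n ?ltr0n //.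
pose B := mball C x p s `&` cdom (C p0).
have oB : open B by apply: openI; [exact: mball_open|exact: cdom_open].
have mB := open_measurable_generated oB.
have -> : (ball_const * s ^+ n)%:E = (2^-1 * P^-1 * (2 * s') ^+ n * P)%:E.
  congr EFin; rewrite /ball_const /s' mulrC.
  have -> : 2 * (s / n.+1%:R / 2) = s * n.+1%:R^-1 by rewrite [LHS]mulrC divfK.
  rewrite exprMn mulrAC divfK ?gt_eqF //; ring.
have H1 : ((2^-1 * P^-1 * (2 * s') ^+ n * P)%:E <= vol B)%E.
  rewrite (hvol (p := p0) mB); last by move=> q [].
  apply: (@integral_rV_box R n _ T (cmap (C p0) p)) => //.
  - by rewrite mulr_ge0 // invr_ge0 ltW.
  - by move=> y; rewrite /patch; case: ifP => // _; rewrite lee_fin sqrtr_ge0.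
  move=> z zs.
  have zT : `|z *m T| < d / 2.
    apply: (@le_lt_trans _ _ (s' * K)); last first.
      by rewrite -ltr_pdivlMr // (le_lt_trans s's).
    apply/norm_rowP => [|j]; first by rewrite mulr_ge0 // ltW.
    rewrite mxE; apply: (le_trans (ler_norm_sum _ _ _)).
    apply: (@le_trans _ _ (\sum_a s' * `|T a j|)).
      by apply: ler_sum => a _; rewrite normrM ler_wpM2r // ltW // zs.
    rewrite -mulr_sumr (ler_wpM2l (ltW s'0)) //; apply: (@le_trans _ _ (\sum_a \sum_j `|T a j|)).
      apply: ler_sum => a _; rewrite (bigD1 j) //= lerDl.
      by apply: sumr_ge0.
    by rewrite ltW // ltrDl.
  have zd (t : R) : -1 <= t <= 1 -> `|cmap (C p0) p + t *: (z *m T) - cmap (C p0) p0| < d.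
    move=> /andP[t0 t1]; rewrite addrAC; apply: (le_lt_trans (ler_normD _ _)).
    rewrite (splitr d) ltr_leD // normrZ; apply: (@le_trans _ _ `|z *m T|); last exact: ltW.
    by rewrite ler_piMl // ler_norml t0 t1.
  have zd1 t : -1 <= t <= 1 -> `|cmap (C p0) p + t *: (z *m T) - cmap (C p0) p0| < d1.
    by move=> /zd /lt_le_trans; apply; rewrite ge_min lexx.
  have zd2 t : -1 <= t <= 1 -> `|cmap (C p0) p + t *: (z *m T) - cmap (C p0) p0| < d2.
    by move=> /zd /lt_le_trans; apply; rewrite ge_min lexx orbT.
  have h11 : -1 <= (1 : R) <= 1 by rewrite lexx andbT; lra.
  have yI : chart_image (C p0) (cmap (C p0) p + z *m T).
    by have [+ _] := Hd1 _ (zd1 _ h11); rewrite scale1r.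
  have [|||L Lle] := @segment_reach R n M C x hM hx p0 (cmap (C p0) p) (z *m T) (n.+1%:R * s').
  - by rewrite mulr_ge0 // ltW.
  - by move=> t ht; have [] := Hd1 _ (zd1 _ ht).
  - move=> t ht; have [_ /(_ (fun a => z 0 a) _ (mulmx_rows z T)) /andP[_ H]] := Hd1 _ (zd1 _ ht).
    apply: lnorm_le; first by rewrite mulr_ge0 // ltW.
    apply: (le_trans H); apply: (@le_trans _ _ (2 * \sum_(a < n) s' ^+ 2)).
      rewrite ler_wpM2l //; apply: ler_sum => a _.
      by rewrite -(real_normK (num_real (z 0 a))) ler_sqr ?nnegrE // ltW // zs.
    exact: aux2.
  rewrite (cmapK hM) // => H.
  have yB : B (cinv (C p0) (cmap (C p0) p + z *m T)).
    split; last exact: cdom_cinv.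
    exists L => //; apply: (le_lt_trans Lle); rewrite /s' mulrA mulrCA divff ?pnatr_eq0 // mulr1.
    by rewrite ltr_pdivrMr // ltr_pMr // ltr1n.
  rewrite /patch; case: ifPn => [_|]; last first.
    by move=> /negP; case; rewrite inE; exists (cinv (C p0) (cmap (C p0) p + z *m T)); rewrite ?(cinvK hM).
  rewrite lee_fin; have := Hd2 _ (zd2 _ h11); rewrite scale1r => H2.
  have -> : 2^-1 * P^-1 = Num.sqrt ((2^-1 * P^-1) ^+ 2) by rewrite sqrtr_sqr ger0_norm // mulr_ge0 // invr_ge0 ltW.
  rewrite ler_sqrt; last first.
    by apply: le_trans H2; rewrite mulr_ge0 // -(pmulr_rge0 _ (exprn_gt0 2 P0)) dG.
  apply: le_trans H2.
  have -> : \det G0 = P^-1 ^+ 2 by apply: (mulfI (lt0r_neq0 (exprn_gt0 2 P0))); rewrite dG -exprMn divff ?expr1n // gt_eqF.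
  by rewrite exprMn; lra.
apply: (le_trans H1); apply: le_measure; rewrite ?inE //; last by move=> q [].
exact: (open_measurable_generated (mball_open hM hx p s)).
Qed.

(** The constant is universal and only the admissible radii depend on the compact set. This is what
    allows packing arguments with arbitrarily fine grids. *)
Lemma mball_volume_compact (K : set M) : compact K ->
  exists2 s0 : R, 0 < s0 & forall p, K p -> forall s : R, 0 < s -> s < s0 ->
    ((ball_const * s ^+ n)%:E <= vol (mball C x p s))%E.
Proof.
move=> cK.
have /choice [r Hr] : forall p0, exists r : R, 0 < r /\ forall p, mball C x p0 r p ->
    forall s : R, 0 < s -> s < r -> ((ball_const * s ^+ n)%:E <= vol (mball C x p s))%E.
  move=> p0; have [s0 s00 H] := mball_volume_near p0.
  have [e e0 eH] := mball_sub_nbhs hM hx H.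
  exists (Num.min e s0); split; first by rewrite lt_min e0.
  move=> p pe s s1; rewrite lt_min => /andP[_ ss]; apply: eH => //.
  by apply: mballW pe; rewrite ge_min lexx.
have [|L HL] := @compact_finite_cover R n M C x hM hx K r cK; first by move=> z; case: (Hr z).
have [t t0 tL] : exists2 t : R, 0 < t & forall z, z \in L -> t <= r z.
  elim: L {HL} => [|z L [t t0 IH]]; first by exists 1.
  exists (Num.min t (r z)); first by rewrite lt_min t0; case: (Hr z).
  by move=> y; rewrite inE ge_min => /predU1P[->|/IH ->]; rewrite ?lexx ?orbT.
exists t => // p Kp s s0 st; have [z zL zp] := HL p Kp.
by have [_ H] := Hr z; apply: H zp _ s0 (lt_le_trans st (tL z zL)).
Qed.
End VolumeOfBalls.

(** * Intrinsic distance and variation of x and N along curves *)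

Section IntrinsicDistance.
Variables (R : realType) (n : nat) (M : ptopologicalType) (C : M -> chart R n M).
Local Notation E := 'rV[R]_n.+2.
Variables (x N : M -> E).
Hypothesis hM : oriented_manifold C.
Hypothesis hx : hyperbolic_embedding C x.
Let sx : smooth_map C x := smooth_x hx.
Hypothesis hconn : connected [set: M].

Lemma reach_connected (p q : M) : exists L, reach C x p q L.
Proof.
pose A := [set z | exists L, reach C x p z L].
have ballA z z' : mball C x z 1 z' -> A z' -> A z.
  move=> [L _ H] [L' H']; exists (L' + L); apply: (reach_trans hM hx H').
  exact: (reach_sym hM hx).
have oA : open A.
  rewrite openE => z Az; apply: filterS (nbhs_mball hM hx z ltr01) => z' zz'.
  by apply: (ballA z' z) => //; exact: mball_sym.
have cA : closed A.
  by move=> z /(_ _ (nbhs_mball hM hx z ltr01)) [z' [Az' zz']]; exact: ballA zz' Az'.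
have AT : A = [set: M].
  apply: hconn; [by exists p; exists 0; exact: reach_refl|by exists A; rewrite ?setTI|].
  by exists A; rewrite ?setTI.
by have : [set: M] q by []; rewrite -AT.
Qed.

Definition mdist (p q : M) : R := inf [set L | reach C x p q L].

Let dist_inf (p q : M) : has_inf [set L | reach C x p q L].
Proof.
split; first by have [L] := reach_connected p q; exists L.
by exists 0 => L /(reach_ge0).
Qed.

Lemma mdist_le (p q : M) L : reach C x p q L -> mdist p q <= L.
Proof. by move=> H; apply: ge_inf => //; case: (dist_inf p q). Qed.

Lemma mdist_ge0 (p q : M) : 0 <= mdist p q.
Proof. by apply: lb_le_inf; [case: (dist_inf p q)|move=> L /(reach_ge0)]. Qed.

Lemma mdist_lt (p q : M) (e : R) : mdist p q < e -> mball C x p e q.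
Proof.
move=> H; have e0 : 0 < e - mdist p q by rewrite subr_gt0.
have [L LH Le] := inf_adherent e0 (dist_inf p q).
by exists L => //; apply: lt_le_trans Le _; rewrite addrC subrK.
Qed.

Lemma mdist_self (p : M) : mdist p p = 0.
Proof. by apply/eqP; rewrite eq_le mdist_ge0 andbT; apply/mdist_le/reach_refl. Qed.

Lemma mdist_reach (p q z : M) L : reach C x q z L -> mdist p z <= mdist p q + L.
Proof.
move=> H; apply/ler_addgt0Pl => e e0.
have [L' Le H'] := @mdist_lt p q (mdist p q + e) ltac:(by rewrite ltrDl).
have := mdist_le (reach_trans hM hx H' H); lra.
Qed.

Lemma mdist_continuous (p : M) : continuous (mdist p).
Proof.
move=> q; apply/cvgrPdist_lt => e e0; apply: filterS (nbhs_mball hM hx q e0) => z [L Le H].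
have h1 := mdist_reach p H; have h2 := mdist_reach p (reach_sym hM hx H).
by rewrite ltr_norml; apply/andP; split; lra.
Qed.
End IntrinsicDistance.

Section AmbientEstimates.
Variables (R : realType) (n : nat) (M : ptopologicalType) (C : M -> chart R n M).
Local Notation E := 'rV[R]_n.+2.
Variables (x N : M -> E).
Hypothesis hM : oriented_manifold C.
Hypothesis hx : hyperbolic_embedding C x.
Hypothesis hN : unit_normal_field C x N.
Let sx : smooth_map C x := smooth_x hx.
Let sN : smooth_map C N := smooth_N hN.

(** The derivative of [f] is asked for along any curve whose images under [x] and [N] have the
    velocities induced by [v], because [f] is always an expression in [x] and [N]. Only points
    reached from [p] within length [L] have to be controlled. *)
Lemma reach_lipschitz (f : M -> R) (K : R) (p q : M) (L : R) : reach C x p q L ->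
  (forall z v L', reach C x p z L' -> L' <= L ->
     exists2 d, `|d| <= K * lnorm (dM C x z v) &
     forall (c : R -> M) (t : R), c t = z -> is_derive t 1 (x \o c) (dM C x z v) ->
       is_derive t 1 (N \o c) (dM C N z v) -> is_derive t 1 (f \o c) d) ->
  `|f q - f p| <= K * L.
Proof.
move=> [c [l [hc <- <- [hl <-]]]] H; apply: (curve_lipschitz hl) => t /andP[t0 t1].
have [v -> Hv] := curve_vector hM hx t hc.
have [|d dK Hd] := H (c t) v _ (reach_sub hM hx hc hl (lexx 0) t0 t1).
  by rewrite lerB // (length_mono hM hx hc hl).
exists d; [exact: (Hd c t erefl (Hv _ _ sx) (Hv _ _ sN))|exact: dK].
Qed.

Lemma expR_half_le2 (L : R) : L <= 2^-1 -> expR L <= 2.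
Proof.
move=> L2; apply: (@le_trans _ _ (expR 2^-1)); first by rewrite ler_expR.
have := expR_ge1Dx (- 2^-1 : R); rewrite expRN => H.
have e0 : 0 < expR (2^-1 : R) by exact: expR_gt0.
have : (1 + - 2^-1) * expR (2^-1 : R) <= 1 by rewrite -ler_pdivlMr // div1r.
lra.
Qed.

(** A vector tangent to the hyperboloid at [x p] has, projected at [x z], squared length at most
    cosh^2 of the distance times its own; for length at most 1/2 this cosh is at most 2. *)
Lemma near_perp_bound (p z : M) L (F : E) : reach C x p z L -> L <= 2^-1 -> lor F (x p) = 0 ->
  lor F F + lor F (x z) ^+ 2 <= 4 * lor F F.
Proof.
move=> H L2 Fp; pose psi := - lor (x p) (x z).
have psi2 : psi <= 2 by apply: le_trans (reach_lor hM hx H) (expR_half_le2 L2).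
have psi1 : 1 <= psi by exact: (hyperboloid_lor (x_hyperboloid hx p) (x_hyperboloid hx z)).
pose u := x z - psi *: x p.
have up : lor u (x p) = 0 by rewrite /u !lorE (lor_xx hx) (lorC (x z)) /psi; ring.
have uu : lor u u = psi ^+ 2 - 1.
  by rewrite /u !lorE !(lor_xx hx) (lorC (x z) (x p)) -[lor (x p) (x z)]opprK -/psi; ring.
have Fu : lor F (x z) = lor F u by rewrite /u !lorE Fp; ring.
have := lor_perp_cs (lor_xx hx p) Fp up; rewrite uu Fu.
have := lor_perp_ge0 (lor_xx hx p) Fp.
move: (lor F F) (lor F u ^+ 2) => a b a0 ba.
have : a * (psi ^+ 2 - 1) <= a * 3 by apply: ler_wpM2l => //; nra.
lra.
Qed.

Lemma sqrt4_mul (a : R) : Num.sqrt (4 * a) = 2 * Num.sqrt a.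
Proof.
rewrite sqrtrM //; congr (_ * _).
rewrite (_ : 4 = 2 ^+ 2 :> R); last by rewrite -natrX.
by rewrite sqrtr_sqr ger0_norm.
Qed.

Lemma near_tangent_bound (p z : M) L (F T : E) : reach C x p z L -> L <= 2^-1 -> lor F (x p) = 0 ->
  lor T (x z) = 0 -> `|lor F T| <= 2 * lnorm F * lnorm T.
Proof.
move=> H L2 Fp Tz; rewrite mulrAC -mulrA -[2 * _]mulrC -mulrA [lnorm F * 2]mulrC -sqrt4_mul mulrC.
rewrite mulrC; have F0 := lor_perp_ge0 (lor_xx hx p) Fp.
have T0 := lor_perp_ge0 (lor_xx hx z) Tz.
rewrite -sqrtr_sqr /lnorm -sqrtrM // ler_sqrt ?mulr_ge0 ?(mulr_ge0 _ F0) // lorC.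
apply: (le_trans (tangent_cs F (lor_xx hx z) Tz)); apply: ler_wpM2l => //.
exact: near_perp_bound H L2 Fp.
Qed.

Lemma reach_lor_x (p q : M) L (F : E) : reach C x p q L -> L <= 2^-1 -> lor F (x p) = 0 ->
  `|lor F (x q)| <= 2 * lnorm F * L.
Proof.
move=> H L2 Fp; have := @reach_lipschitz (fun z => lor F (x z)) (2 * lnorm F) p q L H.
rewrite Fp subr0; apply=> z v L' H' L'L.
exists (lor F (dM C x z v)).
  exact: near_tangent_bound H' (le_trans L'L L2) Fp (lor_dx_x hM hx z v).
by move=> c t <- D _; exact: (is_derive_lorr F D).
Qed.

Lemma reach_lor_N (B : R) (p q : M) L (F : E) : (forall z, normA C x N z <= B) ->
  reach C x p q L -> L <= 2^-1 -> lor F (x p) = 0 ->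
  `|lor F (N q) - lor F (N p)| <= 2 * lnorm F * B * L.
Proof.
move=> hB H L2 Fp; apply: (@reach_lipschitz (fun z => lor F (N z)) _ _ _ _ H) => z v L' H' L'L.
have B0 : 0 <= B by apply: le_trans (hB p); exact: sqrtr_ge0.
exists (lor F (dM C N z v)); last by move=> c t <- _ D; exact: (is_derive_lorr F D).
apply: (le_trans (near_tangent_bound H' (le_trans L'L L2) Fp (lor_dN_x hM hx hN z v))).
rewrite -[leRHS]mulrA; apply: ler_wpM2l; first by rewrite mulr_ge0 // sqrtr_ge0.
rewrite mulrC /lnorm -[X in _ <= _ * X](ger0_norm B0) -sqrtr_sqr -sqrtrM; last first.
  exact: (lor_perp_ge0 (lor_xx hx z) (lor_dx_x hM hx z v)).
rewrite ler_sqrt; last first.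
  by rewrite mulr_ge0 ?sqr_ge0 // (lor_perp_ge0 (lor_xx hx z) (lor_dx_x hM hx z v)).
rewrite mulrC; exact: (dN_norm_bound hM hx hN z v hB).
Qed.

(** Self-improvement: the component [u] of [x q] orthogonal to [x p] has length s = sqrt(psi^2 - 1),
    and its own product with [x q] is s^2. The linear estimate gives s^2 <= 2 s L, hence s <= 2L and
    a bound quadratic in L. *)
Lemma reach_lor_quadratic (p q : M) L : reach C x p q L -> L <= 2^-1 ->
  - lor (x p) (x q) <= 1 + 2 * L ^+ 2.
Proof.
move=> H L2; pose psi := - lor (x p) (x q).
have psi1 : 1 <= psi by exact: (hyperboloid_lor (x_hyperboloid hx p) (x_hyperboloid hx q)).
pose u := x q - psi *: x p.
have up : lor u (x p) = 0 by rewrite /u !lorE (lor_xx hx) (lorC (x q)) /psi; ring.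
have pE : lor (x p) (x q) = - psi by rewrite /psi opprK.
have uu : lor u u = psi ^+ 2 - 1 by rewrite /u !lorE !(lor_xx hx) (lorC (x q) (x p)) pE; ring.
have uq : lor u (x q) = psi ^+ 2 - 1 by rewrite /u !lorE (lor_xx hx) pE; ring.
have L0 := reach_ge0 H.
have := reach_lor_x H L2 up; rewrite uq /lnorm uu -/psi.
have h0 : 0 <= psi ^+ 2 - 1 by nra.
rewrite (ger0_norm h0); set s := Num.sqrt _ => Hs.
have sE : s ^+ 2 = psi ^+ 2 - 1 by rewrite sqr_sqrtr.
have s0 : 0 <= s by exact: sqrtr_ge0.
have sL : s <= 2 * L.
  have [->|s1] := eqVneq s 0; first by rewrite mulr_ge0.
  have sp : 0 < s by rewrite lt_def s1.
  by rewrite -(ler_pM2l sp) -expr2 sE; apply: (le_trans Hs); rewrite mulrAC mulrC mulrCA mulrA.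
clearbody s psi; nra.
Qed.
End AmbientEstimates.

(** * Projection to a tangent plane *)

Lemma am_gm (R : realType) (a f : R) : 2 * f * a <= a ^+ 2 + f ^+ 2.
Proof. by have := sqr_ge0 (a - f); rewrite sqrrB; lra. Qed.

Lemma is_derive_mulf (R : realType) (V : normedModType R) (f g : V -> R) (y v : V) (a b : R) :
  is_derive y v f a -> is_derive y v g b ->
  is_derive y v (fun z => f z * g z) (a * g y + f y * b).
Proof.
move=> Df Dg; have := is_deriveM Df Dg.
have -> : (f : V -> R) * g = (fun z => f z * g z) by apply/funext.
by move=> H; apply: (is_derive_eq H); rewrite /GRing.scale /=; ring.
Qed.

Lemma is_derive_sumf (R : realType) (V : normedModType R) (I : finType) (F : I -> V -> R) (y v : V)
    (d : I -> R) :
  (forall a, is_derive y v (F a) (d a)) -> is_derive y v (fun z => \sum_a F a z) (\sum_a d a).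
Proof.
move=> H; elim: (index_enum I) => [|a r IH].
  have -> : (fun z => \sum_(b <- [::]) F b z) = cst 0 by apply/funext => z; rewrite big_nil.
  rewrite big_nil; exact: is_derive_cst.
have -> : (fun z => \sum_(b <- a :: r) F b z) = (fun z => F a z + \sum_(b <- r) F b z).
  by apply/funext => z; rewrite big_cons.
by rewrite big_cons; exact: (is_deriveD (H a) IH).
Qed.

Lemma is_derive_descent (R : realType) (g : R -> R) (d s1 : R) :
  is_derive (0 : R) 1 g d -> d < 0 -> 0 < s1 -> exists2 s : R, 0 < s < s1 & g s < g 0.
Proof.
move=> [dg dE] d0 s10.
have : (fun h : R => h^-1 *: ((g \o shift 0) (h *: (1 : R)) - g 0)) @ 0^' --> d by rewrite -dE.
move=> /cvgrPdist_lt /(_ (- d)); rewrite oppr_gt0 => /(_ d0) /nbhs_ballP [r /= r0 H].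
pose s := Num.min s1 r / 2.
have m0 : 0 < Num.min s1 r by rewrite lt_min s10.
have s0 : 0 < s by rewrite divr_gt0.
have sm : s < Num.min s1 r by rewrite /s ltr_pdivrMr // ltr_pMr // ltr1n.
move: (sm); rewrite lt_min => /andP[ss1 sr].
exists s; first by rewrite s0.
have bs : ball 0 r s by rewrite -ball_normE /= sub0r normrN gtr0_norm.
have := H s bs (lt0r_neq0 s0); rewrite /= addr0 [_ *: 1]mulr1 ltr_norml => /andP[+ _].
rewrite -ltrBlDl; move=> h; have : s^-1 * (g s - g 0) < 0 by move: h; rewrite /GRing.scale /=; lra.
by rewrite pmulr_rlt0 ?invr_gt0 // subr_lt0.
Qed.

Section TangentProjection.
Variables (R : realType) (n : nat) (M : ptopologicalType) (C : M -> chart R n M).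
Local Notation E := 'rV[R]_n.+2.
Variables (x N : M -> E).
Hypothesis hM : oriented_manifold C.
Hypothesis hx : hyperbolic_embedding C x.
Hypothesis hN : unit_normal_field C x N.
Hypothesis hconn : connected [set: M].
Hypothesis hcomplete : complete_hypersurface C x.
Variable B : R.
Hypothesis hB : forall z, normA C x N z <= B.
Let sx : smooth_map C x := smooth_x hx.
Let dist := @mdist R n M C x.

(** Within length 5r of [q], a unit vector tangent to M at [q] acquires a normal component of at
    most 10 B r <= 1/2, and all lengths stay under 1/2. *)
Definition proj_radius : R := (20 * (B + 1))^-1.

Let B0 : 0 <= B. Proof. by apply: le_trans (hB point); exact: sqrtr_ge0. Qed.

Lemma proj_radius_gt0 : 0 < proj_radius.
Proof. by rewrite invr_gt0 mulr_gt0 // ltr_wpDl. Qed.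

Lemma proj_radius_small : 5 * proj_radius <= 4^-1 /\ 10 * B * proj_radius <= 2^-1.
Proof.
have h : proj_radius * (20 * (B + 1)) = 1.
  by rewrite /proj_radius mulVf // mulf_neq0 // gt_eqF // ltr_wpDl.
have := proj_radius_gt0; move: B0 h; move: proj_radius B => r b b0 h r0.
by split; nra.
Qed.

(* Ekeland-type minimization: a minimum point of |pi - y| + dist / 4 that does not project to y
   could be moved within M in a direction along which |pi - y| decreases faster than dist / 4
   increases, because the tangent planes stay nearly parallel. *)
Lemma tangent_projection_onto (q : M) (T : 'M[R]_n) (y : 'I_n -> R) (r : R) :
  tangent_frame C x q T -> 0 < r -> r <= proj_radius -> \sum_a y a ^+ 2 <= r ^+ 2 ->
  exists p, [/\ mball C x q (5 * r) p & forall a, lor (x p) (fV C x q T a) = y a].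
Proof.
move=> hT r0 rr yr; have [s1 s2] := proj_radius_small.
pose V := fV C x q T.
pose phi2 p := \sum_a (lor (x p) (V a) - y a) ^+ 2.
pose phi p := Num.sqrt (phi2 p).
pose F p := phi p + 4^-1 * dist q p.
have phi2_ge0 p : 0 <= phi2 p by apply: sumr_ge0 => a _; exact: sqr_ge0.
have cx : continuous x by have [_ _ _ _ []] := hx.
have cphi2 : continuous phi2.
  move=> p; apply: continuous_for_bigsum => a.
  have c1 : {for p, continuous (fun z => lor (x z) (V a) - y a)}.
    exact: (continuousB (continuous_lor (cx p) (cvg_cst (V a))) (cvg_cst (y a))).
  exact: (cvgM c1 c1).
have cF : continuous F.
  move=> p; apply: continuousD.
    by apply: continuous_comp; [exact: cphi2|exact: sqrt_continuous].
  have cd : {for p, continuous (dist q)} by exact: mdist_continuous.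
  exact: (cvgM (cvg_cst (4^-1 : R)) cd).
(* The minimum value is at most r, so a minimizer lies within 4r; the competitor below moves it by
   less than another 4r and remains in the compact ball. *)
have r80 : 0 < 8 * r by rewrite mulr_gt0.
pose K := cmball C x q (8 * r).
have Kq : K q by move=> e e0; apply: mball_center; rewrite addr_gt0.
have [p] := compact_EVT_min (ex_intro _ q Kq) (cmball_compact hM hx hcomplete r80 (p := q))
  (continuous_subspaceT cF).
rewrite inE => Kp minp.
have Fq : F q <= r.
  rewrite /F /dist (mdist_self hM hx hconn) mulr0 addr0 /phi /phi2.
  under eq_bigr do rewrite (lorC (x q)) /V /fV (lor_dx_x hM hx) sub0r sqrrN.
  by rewrite -(ger0_norm (ltW r0)) -sqrtr_sqr ler_sqrt // sqr_ge0.
have dp4 : dist q p <= 4 * r.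
  have := minp q (mem_set Kq); have : 0 <= phi p by exact: sqrtr_ge0.
  by move: Fq; rewrite /F; lra.
exists p; split; first by apply: (mdist_lt hM hx hconn); move: dp4; rewrite /dist; lra.
suff H0 : phi2 p = 0.
  move=> a; apply/eqP; rewrite -subr_eq0 -sqrf_eq0; move/eqP: H0.
  rewrite psumr_eq0 => [/allP /(_ a)|b _]; last exact: sqr_ge0.
  by rewrite mem_index_enum => /(_ isT).
apply/eqP/negPn/negP => phip.
have phi0 : 0 < phi p by rewrite sqrtr_gt0 lt_def phip phi2_ge0.
pose f := phi p; have f2 : f ^+ 2 = phi2 p by rewrite sqr_sqrtr.
pose F0 := \sum_a ((y a - lor (x p) (V a)) / f) *: V a.
have FF : lor F0 F0 = 1.
  rewrite /F0 lor_fV_comb //.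
  under eq_bigr do rewrite exprMn -sqrrN opprB.
  by rewrite -mulr_suml exprVn f2 divff.
have Fxq : lor F0 (x q) = 0.
  by rewrite /F0 lor_suml big1 // => a _; rewrite lorZl /V /fV (lor_dx_x hM hx) mulr0.
have FNq : lor F0 (N q) = 0.
  by rewrite /F0 lor_suml big1 // => a _; rewrite lorZl (lorC _ (N q)) /V /fV (lor_N_dx hN) mulr0.
have [L L5 HL] : mball C x q (5 * r) p.
  by apply: (mdist_lt hM hx hconn); move: dp4; rewrite /dist; lra.
have L2 : L <= 2^-1 by lra.
have FNp : lor F0 (N p) ^+ 2 <= 4^-1.
  have := reach_lor_N hM hx hN hB HL L2 Fxq.
  rewrite FNq subr0 /lnorm FF sqrtr1 mulr1 => h.
  have h1 : `|lor F0 (N p)| <= 2^-1.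
    apply: (le_trans h); apply: le_trans s2; have := reach_ge0 HL.
    by move: B0 L5 rr; move: proj_radius B => d b; nra.
  have := normr_ge0 (lor F0 (N p)); rewrite -real_normK ?num_real //.
  by move: `|_| h1 => u; nra.
(* [F0] points from the projection of [p] towards [y], and [W] is its part tangent to M at [p]; a
   normal component of at most 1/2 leaves <W,W> >= 3/4. *)
pose W := F0 + lor F0 (x p) *: x p - lor F0 (N p) *: N p.
have Wx : lor W (x p) = 0 by rewrite /W !lorE (lor_xx hx) (lor_Nx hN); ring.
have WN : lor W (N p) = 0 by rewrite /W !lorE (lorC (x p)) (lor_Nx hN) (lor_NN hN); ring.
have WF : lor W F0 = lor W W.
  by rewrite [in RHS]/W lorDr lorNr lorDr !lorZr Wx WN; ring.
have WW : 3 / 4 <= lor W W.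
  rewrite -WF /W !lorE FF (lorC (x p)) (lorC (N p)).
  have := sqr_ge0 (lor F0 (x p)); move: FNp; rewrite !expr2; lra.
have [T' hT'] := tangent_frame_exists hM hx p.
set v := \sum_a lor W (fV C x p T' a) *: row a T'.
have Xv : dM C x p v = W by exact: (tangent_realize hM hx hN hT' Wx WN).
have SW : \sum_a lor W (fV C x p T' a) ^+ 2 = lor W W.
  rewrite (frame_parseval W W (frame_lorentz hM hx hN hT')) Wx WN.
  by under [in RHS]eq_bigr do rewrite -expr2; ring.
have [d d0 Hd] := gram_near hM hx hT'.
pose k := Num.sqrt (2 * lor W W).
have k2 : k ^+ 2 = 2 * lor W W by rewrite sqr_sqrtr // mulr_ge0 //; lra.
have k0 : 0 <= k by exact: sqrtr_ge0.
have kW : k < 4 * lor W W.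
  rewrite -(ltr_pXn2r (n := 2)) ?nnegrE //; last by lra.
  by rewrite k2; move: WW; move: (lor W W) => u; nra.
pose y0 := cmap (C p) p.
have b0 : 0 < Num.min (d / (`|v| + 1)) (4 * r / (k + 1)).
  by rewrite lt_min !divr_gt0 ?mulr_gt0 // ltr_wpDl.
(* A differentiable majorant of [F] along the chart segment, touching it at s = 0: AM-GM replaces
   phi by (phi^2 + f^2)/(2f), and the distance is replaced by its growth bound with speed [k]. Since
   k < 4 <W,W>, its derivative at 0 is negative. *)
pose g s := (2 * f)^-1 * (phi2 (cinv (C p) (y0 + s *: v)) + f ^+ 2) + 4^-1 * (dist q p + s * k).
pose dg := (2 * f)^-1 * (\sum_a (2 * (lor (x p) (V a) - y a)) * lor W (V a)) + 4^-1 * k.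
have y0I : chart_image (C p) y0 by exact: (chart_image_center hM p).
have Dx : is_derive (0 : R) 1 (fun s : R => x (cinv (C p) (y0 + s *: v))) W.
  have Dv : is_derive y0 v (x \o cinv (C p)) W.
    rewrite -Xv; apply: DeriveDef; last by [].
    by apply: diff_derivable; exact: smooth_map_differentiable.
  exact: (proj2 (is_derive_line0 _ _ _ _) Dv).
have Dphi : is_derive (0 : R) 1 (fun s : R => phi2 (cinv (C p) (y0 + s *: v)))
    (\sum_a (2 * (lor (x p) (V a) - y a)) * lor W (V a)).
  apply: is_derive_sumf => a.
  have D1 : is_derive (0 : R) 1 (fun s : R => lor (x (cinv (C p) (y0 + s *: v))) (V a) - y a)
      (lor W (V a) - 0).
    exact: (is_deriveB (is_derive_lorl (V a) Dx) (is_derive_cst (y a) (0 : R) 1)).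
  have := is_derive_mulf D1 D1.
  rewrite scale0r addr0 (cmapK hM (cdom_center hM p)) subr0.
  by move=> H; apply: (is_derive_eq H); ring.
have Dg : is_derive (0 : R) 1 g dg.
  have D1 : is_derive (0 : R) 1 (fun s : R => phi2 (cinv (C p) (y0 + s *: v)) + f ^+ 2)
     (\sum_a (2 * (lor (x p) (V a) - y a)) * lor W (V a) + 0).
    exact: (is_deriveD Dphi (is_derive_cst (f ^+ 2) (0 : R) 1)).
  have D2 := is_derive_mulf (is_derive_cst ((2 * f)^-1) (0 : R) 1) D1.
  have D3 : is_derive (0 : R) 1 (fun s : R => 4^-1 * dist q p + (4^-1 * k) * s) (4^-1 * k).
    exact: is_derive_affine.
  have -> : g = (fun s => (2 * f)^-1 * (phi2 (cinv (C p) (y0 + s *: v)) + f ^+ 2) +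
      (4^-1 * dist q p + (4^-1 * k) * s)).
    by apply/funext => s; rewrite /g; ring.
  by apply: (is_derive_eq (is_deriveD D2 D3)); rewrite /dg /cst /=; ring.
have dg0 : dg < 0.
  have -> : dg = 4^-1 * k - lor W F0.
    rewrite /dg /F0 lor_sumr; under [in RHS]eq_bigr do rewrite lorZr.
    rewrite mulr_sumr addrC; congr (_ + _); rewrite -sumrN; apply: eq_bigr => a _.
    by field; rewrite gt_eqF.
  by rewrite WF; lra.
have [s /andP[s0 sb]] := is_derive_descent Dg dg0 b0.
have -> : g 0 = f + 4^-1 * dist q p.
  rewrite /g scale0r addr0 (cmapK hM (cdom_center hM p)) -f2 mul0r addr0; congr (_ + _).
  by field; rewrite gt_eqF.
apply/negP; rewrite -leNgt.
have near_seg (t : R) : -1 <= t <= 1 -> `|y0 + t *: (s *: v) - cmap (C p) p| < d.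
  rewrite -ler_norml => t1; rewrite addrC addKr scalerA normrZ normrM (gtr0_norm s0).
  apply: (@le_lt_trans _ _ (s * `|v|)); first by rewrite ler_wpM2r // ler_piMl // ltW.
  move: sb; rewrite lt_min => /andP[+ _]; rewrite ltr_pdivlMr ?ltr_wpDl //.
  by apply: le_lt_trans; rewrite ler_wpM2l ?(ltW s0) // lerDl.
have [|||L1 L1s HL1] := @segment_reach R n M C x hM hx p y0 (s *: v) (s * k).
- by rewrite mulr_ge0 // ltW.
- move=> t t1; have [] := Hd (y0 + t *: (s *: v)) _ => //; exact: near_seg.
- move=> t t1; apply: lnorm_le; first by rewrite mulr_ge0 // ltW.
  have [_ Hd2] := Hd _ (near_seg t t1).
  have vE : s *: v = \sum_a (s * lor W (fV C x p T' a)) *: row a T'.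
    by rewrite /v scaler_sumr; apply: eq_bigr => a _; rewrite scalerA.
  have /andP[_ h] := Hd2 _ _ vE; apply: (le_trans h).
  under eq_bigr do rewrite exprMn.
  by rewrite -mulr_sumr SW exprMn k2 le_eqVlt; apply/orP; left; apply/eqP; ring.
set p1 := cinv (C p) (y0 + s *: v) in HL1 *.
rewrite (cmapK hM (cdom_center hM p)) in HL1.
have dp1 := mdist_reach hM hx hconn q HL1.
have sk : s * k < 4 * r.
  move: sb; rewrite lt_min => /andP[_]; rewrite ltr_pdivlMr ?ltr_wpDl //.
  by apply: le_lt_trans; rewrite ler_wpM2l ?(ltW s0) // lerDl.
have Kp1 : K p1.
  apply: mball_sub_cmball; apply: (mdist_lt hM hx hconn).
  by move: dp4; rewrite /dist; lra.
have := minp p1 (mem_set Kp1); rewrite /F => h.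
have h1 : phi p1 <= (2 * f)^-1 * (phi2 p1 + f ^+ 2).
  rewrite -(@ler_pM2l _ (2 * f)) ?mulr_gt0 // mulrA divff ?mul1r; last by rewrite mulf_neq0 // gt_eqF.
  rewrite -[phi2 p1]sqr_sqrtr // -/(phi p1); exact: am_gm.
rewrite /g -/p1; move: h h1 dp1 L1s; rewrite -/f -/(dist q p1) -/(dist q p); lra.
Qed.
End TangentProjection.

Lemma sum_disjoint_le_integral (R : realType) d (T : measurableType d)
    (mu : {measure set T -> \bar R}) (h : T -> R) (I : finType) (F : I -> set T) (eta v : I -> R) :
  mu.-integrable [set: T] (EFin \o h) -> (forall z, 0 <= h z) ->
  (forall i, measurable (F i)) -> (forall i j z, F i z -> F j z -> i = j) ->
  (forall i z, F i z -> eta i <= h z) -> (forall i, 0 <= eta i) ->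
  (forall i, ((v i)%:E <= mu (F i))%E) ->
  \sum_i eta i * v i <= fine (\int[mu]_z (h z)%:E).
Proof.
move=> hi h0 mF dF hF e0 hv.
have hm := measurable_int _ hi.
rewrite -lee_fin fineK; last exact: integrable_fin_num.
rewrite -sumEFin.
pose D := \big[setU/set0]_(i <- index_enum I) F i.
have mD : measurable D by apply: bigsetU_measurable.
apply: (@le_trans _ _ (\int[mu]_(z in D) (h z)%:E)%E); last first.
  by apply: ge0_subset_integral => // z _; rewrite lee_fin.
rewrite ge0_integral_bigsetU //; last 4 first.
- exact: index_enum_uniq.
- by move=> i j _ _ [z [Fi Fj]]; exact: dF Fi Fj.
- by apply: measurable_funS hm.
- by move=> z _; rewrite lee_fin.
apply: lee_sum => i _; apply: (@le_trans _ _ (\int[mu]_(z in F i) (cst (eta i)%:E) z)%E).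
  by rewrite integral_cst // EFinM lee_wpmul2l // lee_fin.
apply: ge0_le_integral => //.
- by move=> z _; rewrite lee_fin.
- by apply: measurable_funS hm.
- by move=> z Fz; rewrite lee_fin; exact: hF Fz.
Qed.

Lemma natr_dist_ge1 (R : realType) (a b : nat) : a != b -> 1 <= `|a%:R - b%:R : R|.
Proof.
wlog ab : a b / (a < b)%N.
  by move=> H ab; have [h|h|/eqP h] := ltngtP a b; [exact: H|rewrite distrC; apply: H; rewrite // eq_sym|rewrite h in ab].
by move=> _; rewrite distrC -natrB ?(ltnW ab) // normr_nat ler1n subn_gt0.
Qed.

(** * Lower bounds of integrals over balls of fixed radius *)

Section UniformVolume.
Variables (R : realType) (n : nat) (M : ptopologicalType) (C : M -> chart R n M).
Local Notation E := 'rV[R]_n.+2.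
Variables (x N : M -> E).
Hypothesis hM : oriented_manifold C.
Hypothesis hx : hyperbolic_embedding C x.
Hypothesis hN : unit_normal_field C x N.
Hypothesis hconn : connected [set: M].
Hypothesis hcomplete : complete_hypersurface C x.
Variable B : R.
Hypothesis hB : forall z, normA C x N z <= B.
Variable vol : {measure set (g_sigma_algebraType (@open M)) -> \bar R}.
Hypothesis hvol : riemannian_volume C x vol.

Lemma mball_measurable (p : M) (r : R) : measurable (mball C x p r : set (g_sigma_algebraType (@open M))).
Proof. exact: (open_measurable_generated (mball_open hM hx p r)). Qed.

Lemma reach_lor_x_near (q p p' : M) (L L' : R) (F : E) : reach C x q p L -> reach C x p p' L' ->
  L + L' <= 2^-1 -> lor F (x q) = 0 -> `|lor F (x p') - lor F (x p)| <= 2 * lnorm F * L'.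
Proof.
move=> H H' LL Fq.
apply: (reach_lipschitz hM hx hN (f := fun z => lor F (x z)) H') => z v L1 H1 L1L.
exists (lor F (dM C x z v)).
  have H2 := reach_trans hM hx H H1.
  apply: (near_tangent_bound hM hx H2 _ Fq (lor_dx_x hM hx z v)).
  by apply: le_trans LL; rewrite lerD2l.
by move=> c t <- D _; exact: (is_derive_lorr F D).
Qed.

(** Lift a grid of step [tau] in the tangent plane at [q] by [tangent_projection_onto]. The
    projection is 2-Lipschitz, so balls of radius tau/4 around the lifted points are disjoint, and
    their number times tau^n does not depend on the grid. Refining the grid until the volume bound
    applies removes its threshold. The radius 6r is 5r for the lift plus room for the small ball. *)
Lemma ball_integral_lower (h : M -> R) (r eta : R) (q : M) :
  vol.-integrable [set: g_sigma_algebraType (@open M)] (fun z => (h z)%:E) -> (forall z, 0 <= h z) ->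
  0 < r -> r <= proj_radius B -> 0 <= eta -> (forall z, mball C x q (6 * r) z -> eta <= h z) ->
  eta * (ball_const R n * (r / (4 * n.+1%:R)) ^+ n) <= fine (\int[vol]_z (h z)%:E).
Proof.
move=> hi h0 r0 rr e0 hh.
have aux1 (L L' s : R) : L' < 5 * r -> L < s / 4 + s / 4 -> s <= r -> L' + L <= 2^-1 /\ L' + L < 6 * r.
  have [+ _] := proj_radius_small hB; have := proj_radius_gt0 hB; move: rr.
  move: (proj_radius B) => pr; lra.
have aux2 (L t u : R) : L < t / 4 + t / 4 -> t * 1 <= u -> u <= 2 * L -> False by lra.
have aux3 : 5 * r <= 1.
  by have [+ _] := proj_radius_small hB; move: rr; move: (proj_radius B) => pr; lra.
have [T hT] := tangent_frame_exists hM hx q.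
have [s0 s00 VB] := mball_volume_compact hM hx hvol (cmball_compact hM hx hcomplete ltr01 (p := q)).
have [m mE] : exists m : nat, r / (4 * n.+1%:R) / m.+1%:R < s0.
  exists (Num.truncn (r / (4 * n.+1%:R) / s0)).
  by rewrite ltr_pdivrMr ?ltr0n // -ltr_pdivrMl // mulrC truncnS_gt.
pose tau := r / n.+1%:R / m.+1%:R; pose s := tau / 4.
have tau0 : 0 < tau by rewrite !divr_gt0.
have s1 : 0 < s by rewrite divr_gt0.
have sE : s = r / (4 * n.+1%:R) / m.+1%:R.
  by rewrite /s /tau invfM; ring.
have taur : tau <= r.
  rewrite /tau -mulrA ler_piMr ?(ltW r0) // mulr_ile1 ?invr_ge0 // invf_le1 ?ler1n ?ltr0n //.
pose J := {ffun 'I_n -> 'I_m.+1}.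
pose y (j : J) (a : 'I_n) : R := tau * (j a)%:R.
have yr (j : J) : \sum_a y j a ^+ 2 <= r ^+ 2.
  apply: (@le_trans _ _ (\sum_(a < n) (r / n.+1%:R) ^+ 2)).
    apply: ler_sum => a _; rewrite ler_pXn2r ?nnegrE ?mulr_ge0 ?divr_ge0 ?(ltW tau0) ?(ltW r0) //.
    rewrite /y /tau -mulrA ler_piMr ?divr_ge0 ?(ltW r0) //.
    by rewrite mulrC ler_pdivrMr ?ltr0n // mul1r ler_nat ltnW.
  rewrite sumr_const card_ord expr_div_n -[leLHS]mulr_natr -mulrA ler_piMr ?sqr_ge0 //.
  rewrite mulrC ler_pdivrMr ?exprn_gt0 ?ltr0n // mul1r -natrX ler_nat.
  by rewrite (leq_trans (leqnSn n)) // -{1}(expn1 n.+1) leq_pexp2l.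
have /choice [pt Hpt] : forall j : J, exists p,
    mball C x q (5 * r) p /\ forall a, lor (x p) (fV C x q T a) = y j a.
  move=> j; have [p [h1 h2]] := tangent_projection_onto hM hx hN hconn hcomplete hB hT r0 rr (yr j).
  by exists p.
have := @sum_disjoint_le_integral R _ _ vol h J (fun j => mball C x (pt j) s) (fun=> eta)
  (fun=> ball_const R n * s ^+ n) hi h0.
rewrite sumr_const card_ffun !card_ord => H; apply: le_trans (H _ _ _ _ _).
- rewrite sE [in leRHS]expr_div_n -[leRHS]mulr_natl natrX.
  rewrite le_eqVlt; apply/orP; left; apply/eqP.
  have : (m.+1%:R : R) ^+ n != 0 by rewrite expf_neq0 // pnatr_eq0.
  by move: (_ ^+ n) (_ ^+ n) => u w w0; field.
- by move=> j; exact: mball_measurable.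
- move=> i j z Fi Fj; apply/ffunP => a; apply/val_inj/eqP/negPn/negP => ij.
  have [L Ls HL] := mball_triangle hM hx Fi (mball_sym hM hx Fj).
  have [[L' L's HL'] yi] := Hpt i; have [_ yj] := Hpt j.
  have Vq : lor (fV C x q T a) (x q) = 0 by rewrite /fV lor_dx_x.
  have := reach_lor_x_near HL' HL _ Vq.
  rewrite !(lorC (fV _ _ _ _ _)) yi yj /lnorm (frame_gram hM hx hT) eqxx sqrtr1 mulr1.
  have [-> _] := aux1 _ _ _ L's Ls taur.
  move=> /(_ isT); rewrite /y -mulrBr normrM (gtr0_norm tau0).
  have h1 := @natr_dist_ge1 R (j a) (i a) ltac:(by rewrite eq_sym).
  by apply: (aux2 _ _ _ Ls); rewrite ler_wpM2l // ltW.
- move=> j z [L Ls HL]; apply: hh; have [[L' L's HL'] _] := Hpt j.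
  exists (L' + L); last exact: (reach_trans hM hx HL' HL).
  have Ls2 : L < tau / 4 + tau / 4 by apply: lt_le_trans Ls _; rewrite lerDl ltW.
  by have [] := aux1 _ _ _ L's Ls2 taur.
- by [].
- move=> j; apply: VB => //; last by rewrite sE.
  apply: mball_sub_cmball; apply: mballW (proj1 (Hpt j)); exact: aux3.
Qed.
End UniformVolume.

(** * Polar graphs *)

Section PolarDecomposition.
Variables (R : realType) (m : nat).
Local Notation E := 'rV[R]_m.+1.
Implicit Types (o v w : E).

Lemma hyperboloid_of_lor o w : hyperboloid o -> lor w w = -1 -> 0 < - lor w o -> hyperboloid w.
Proof.
move=> [oo o0] ww wo; split=> //; rewrite ltNge; apply/negP => w0.
have := spat_cs w o; move: oo ww wo; rewrite !lor_spat.
have := spat_ge0 w; have := spat_ge0 o.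
move: (spat o o) (spat w w) (spat w o) (o 0 0) (w 0 0) o0 w0 => a b c s t s0 t0 a0 b0 h1 h2 h3.
have aE : a = s * s - 1 by lra.
have bE : b = t * t - 1 by lra.
rewrite aE bE => h4; have ts : t * s <= 0 by rewrite mulr_le0_ge0 // ltW.
have : (t * s) ^+ 2 < c ^+ 2 by nra.
have : (t * t - 1) * (s * s - 1) <= (t * s) ^+ 2.
  have : 0 <= t * t - 1 by lra.
  have : 0 <= s * s - 1 by lra.
  nra.
lra.
Qed.

Lemma hexp_hyperboloid o v (t : R) : hyperboloid o -> lor v o = 0 -> lor v v = 1 ->
  hyperboloid (cosh t *: o + sinh t *: v).
Proof.
move=> ho vo vv; have [oo _] := ho; apply: (hyperboloid_of_lor ho).
  by have := cosh_sinh t; rewrite !lorE vv oo (lorC o) vo; lra.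
by rewrite !lorE vo oo; apply: lt_le_trans ltr01 (le_trans (cosh_ge1 t) _); lra.
Qed.

Definition admissible o (Q : seq E) v := [/\ lor v o = 0, lor v v = 1 & v \notin Q].

(** Solves p = cosh(rho) o + sinh(rho) v for v. *)
Definition puncture_directions o (rho : R) (P : seq E) : seq E :=
  [seq (sinh rho)^-1 *: (p - cosh rho *: o) | p <- P].

Lemma directions_admissible o (rho : R) (P : seq E) v : hyperboloid o -> 0 < rho ->
  [set` P] `<=` geodesic_sphere o rho ->
  directions o rho (geodesic_sphere o rho `\` [set` P]) v <->
  admissible o (puncture_directions o rho P) v.
Proof.
move=> ho r0 hP; have s0 := sinh_gt0 r0; have [oo _] := ho; split.
  move=> [vo vv []]; rewrite hexp_unit //= => _ vP; split=> //.
  apply/negP => /mapP [p pP vE]; apply: vP; rewrite vE scalerA divff ?gt_eqF // scale1r.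
  by rewrite addrC subrK.
move=> [vo vv vQ]; split=> //; rewrite hexp_unit //; split.
  have hh := hexp_hyperboloid rho ho vo vv; split=> //.
  rewrite /hdist !lorE (lorC o v) vo oo mulr0 addr0 mulrN1 opprK arcosh_cosh //; exact: ltW.
move=> /= hP'; move/negP: vQ; apply; apply/mapP; exists (cosh rho *: o + sinh rho *: v) => //.
by rewrite addrAC subrr add0r scalerA mulVf ?scale1r // gt_eqF.
Qed.

Lemma puncture_direction_unit o (rho : R) (P : seq E) w : hyperboloid o -> 0 < rho ->
  [set` P] `<=` geodesic_sphere o rho -> w \in puncture_directions o rho P ->
  lor w o = 0 /\ lor w w = 1.
Proof.
move=> ho r0 hP /mapP [p pP ->]; have s0 := sinh_gt0 r0; have [oo _] := ho.
have [hp pd] := hP p pP; have [pp _] := hp.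
have po : lor p o = - cosh rho.
  apply: oppr_inj; rewrite opprK lorC; apply: arcosh_inj; rewrite ?cosh_ge1 ?(hyperboloid_lor ho hp) //.
  by rewrite arcosh_cosh ?(ltW r0).
split; first by rewrite !lorE po oo; ring.
have -> : 1 = (sinh rho)^-1 ^+ 2 * (cosh rho ^+ 2 - 1) :> R.
  have -> : cosh rho ^+ 2 - 1 = sinh rho ^+ 2 by have := cosh_sinh rho; lra.
  by rewrite -exprMn mulVf ?expr1n // gt_eqF.
by rewrite !lorE pp oo (lorC o) po; ring.
Qed.

(* [cosh (u v) *: o + sinh (u v) *: v] is exp_o (u(v) v). *)
Definition polar_graph (M : Type) (x : M -> E) o (Q : seq E) (u : E -> R) : Prop :=
  [/\ forall p, exists2 v, admissible o Q v & x p = cosh (u v) *: o + sinh (u v) *: v,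
      forall v, admissible o Q v -> 0 < u v /\ exists p, x p = cosh (u v) *: o + sinh (u v) *: v &
      smooth_on_subset [set v | admissible o Q v] (u : E -> R^o)].

Lemma radial_polar_graph (M : Type) (x : M -> E) o (rho : R) (P : seq E) :
  hyperboloid o -> 0 < rho -> [set` P] `<=` geodesic_sphere o rho ->
  radial_graph o rho (geodesic_sphere o rho `\` [set` P]) (range x) ->
  exists u, polar_graph x o (puncture_directions o rho P) u.
Proof.
move=> ho r0 hP [u [u0 us ux]]; exists u.
have dE : directions o rho (geodesic_sphere o rho `\` [set` P]) =
   [set v | admissible o (puncture_directions o rho P) v].
  by apply/seteqP; split=> v /(directions_admissible v ho r0 hP).
rewrite dE in u0 us ux; split=> // [p|v av]; last first.
  split; first exact: u0.
  have : range x (cosh (u v) *: o + sinh (u v) *: v).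
    by rewrite ux; exists v => //; rewrite hexp_unit //; [case: av|exact: u0].
  by move=> [p _ ?]; exists p.
have : range x (x p) by exists p.
rewrite ux => -[v av E]; exists v => //.
by rewrite -E hexp_unit //; [case: av|exact: u0].
Qed.
End PolarDecomposition.

Section PolarGraph.
Variables (R : realType) (n : nat) (M : ptopologicalType) (C : M -> chart R n M).
Local Notation E := 'rV[R]_n.+2.
Variables (x N : M -> E).
Hypothesis hM : oriented_manifold C.
Hypothesis hx : hyperbolic_embedding C x.
Hypothesis hN : unit_normal_field C x N.
Let sx : smooth_map C x := smooth_x hx.
Variables (o : E) (Q : seq E) (u : E -> R).
Hypothesis ho : hyperboloid o.
Hypothesis hu : polar_graph x o Q u.
Let oo : lor o o = -1. Proof. by case: ho. Qed.
Local Notation adm := (admissible o Q).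

Definition hcosh (p : M) : R := - lor o (x p).
Definition hsinh (p : M) : R := Num.sqrt (hcosh p ^+ 2 - 1).
(* Locked, so that rewriting with the bilinearity of [lor] does not expand it. *)
Fact dir_key : unit. Proof. by []. Qed.
Definition dir (p : M) : E := locked_with dir_key ((hsinh p)^-1 *: (x p - hcosh p *: o)).

Lemma dirE p : dir p = (hsinh p)^-1 *: (x p - hcosh p *: o).
Proof. by rewrite /dir unlock. Qed.

Lemma polar_of (p : M) v : adm v -> x p = cosh (u v) *: o + sinh (u v) *: v ->
  [/\ dir p = v, 0 < u v, hcosh p = cosh (u v) & hsinh p = sinh (u v)].
Proof.
move=> av xE; have [_ H _] := hu; have [u0 _] := H v av; have [vo vv _] := av.
have cE : hcosh p = cosh (u v) by rewrite /hcosh xE !lorE oo (lorC o) vo; ring.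
have sE : hsinh p = sinh (u v) by rewrite /hsinh cE sinh_cosh // ltW.
split=> //.
by rewrite dirE sE cE xE addrAC subrr add0r scalerA mulVf ?scale1r // gt_eqF // sinh_gt0.
Qed.

Lemma polarE (p : M) : [/\ adm (dir p), 0 < u (dir p), hcosh p = cosh (u (dir p)) &
  hsinh p = sinh (u (dir p))].
Proof.
have [H _ _] := hu; have [v av xE] := H p; by have [-> ? -> ->] := polar_of av xE.
Qed.

Lemma dir_adm p : adm (dir p). Proof. by case: (polarE p). Qed.
Lemma dir_perp p : lor (dir p) o = 0. Proof. by case: (dir_adm p). Qed.
Lemma dir_unit p : lor (dir p) (dir p) = 1. Proof. by case: (dir_adm p). Qed.
Lemma hsinh_gt0 p : 0 < hsinh p. Proof. by have [_ ? _ ->] := polarE p; exact: sinh_gt0. Qed.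
Lemma hcosh_gt1 p : 1 < hcosh p.
Proof.
have [_ u0 -> _] := polarE p; have := cosh_sinh (u (dir p)); have := sinh_gt0 u0.
by have := cosh_ge1 (u (dir p)); move: (cosh _) (sinh _) => c s; nra.
Qed.
Lemma hcosh_gt0 p : 0 < hcosh p. Proof. exact: lt_trans ltr01 (hcosh_gt1 p). Qed.
Lemma hcosh_sinh p : hsinh p ^+ 2 = hcosh p ^+ 2 - 1.
Proof. by rewrite sqr_sqrtr // subr_ge0 exprn_ege1 // ltW // hcosh_gt1. Qed.

Lemma polar_x p : x p = hcosh p *: o + hsinh p *: dir p.
Proof.
by rewrite dirE scalerA divff ?scale1r ?gt_eqF ?hsinh_gt0 // addrC subrK.
Qed.

Lemma dir_inj : injective dir.
Proof.
move=> p q pq; apply: (x_inj hx); rewrite (polar_x p) (polar_x q).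
by have [_ _ -> ->] := polarE p; have [_ _ -> ->] := polarE q; rewrite pq.
Qed.

Lemma dir_surj v : adm v -> exists p, dir p = v.
Proof.
move=> av; have [_ H _] := hu; have [_ [p xp]] := H v av; exists p.
by have [] := polar_of av xp.
Qed.

(** Inverse of [dir], meaningful at admissible directions; elsewhere it takes the default
    [point]. *)
Definition pt (v : E) : M := xget point [set p | dir p = v].

Lemma dir_pt v : adm v -> dir (pt v) = v.
Proof. by move=> /dir_surj [p pv]; rewrite /pt; case: xgetP => [q _ //|/(_ p)]. Qed.

Lemma pt_dir p : pt (dir p) = p.
Proof. by apply: dir_inj; apply: dir_pt; exact: dir_adm. Qed.

Lemma hcosh_continuous : continuous hcosh.
Proof.
move=> p; have cx : {for p, continuous x} by have [_ _ _ _ [cx _]] := hx; exact: cx.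
exact: (continuousN (continuous_lor (cvg_cst o) cx)).
Qed.

Lemma hsinh_continuous : continuous hsinh.
Proof.
move=> p; have c1 : {for p, continuous (fun q => hcosh q ^+ 2 - 1)}.
  exact: (continuousB (cvgM (@hcosh_continuous p) (@hcosh_continuous p)) (cvg_cst (1 : R))).
by apply: (continuous_comp c1); exact: sqrt_continuous.
Qed.

Lemma dir_continuous : continuous dir.
Proof.
move=> p; have cx : {for p, continuous x} by have [_ _ _ _ [cx _]] := hx; exact: cx.
have -> : dir = fun q => (hsinh q)^-1 *: (x q - hcosh q *: o).
  by apply/funext => q; exact: dirE.
apply: cvgZ; first by apply: cvgV; [rewrite gt_eqF // hsinh_gt0|exact: hsinh_continuous].
by apply: cvgB; [exact: cx|apply: cvgZl; exact: hcosh_continuous].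
Qed.

Lemma adm_extension v : adm v -> exists (U : set E) (g : E -> R), [/\ open U, U v,
  differentiable g v, {for v, continuous g} & forall w, U w -> adm w -> g w = u w].
Proof.
move=> av; have [_ _ H] := hu; have [U [g [oU Uv sg gu]]] := H v av.
exists U, g; split=> //; first exact: (smooth_on_differentiable_scalar oU sg Uv).
exact: smooth_on_continuous sg Uv.
Qed.

(** The ambient position depends continuously on the direction through a local extension of [u]; the
    embedding then transfers continuity from positions to points of M. *)
Lemma pt_near v (U : set M) : adm v -> nbhs (pt v) U -> \forall w \near v, adm w -> U (pt w).
Proof.
rewrite nbhsE => av [W [oW Wv] WU]; have [V oV VE] := x_open_preimage hx oW.
have [U0 [g [oU0 U0v _ cg gu]]] := adm_extension av.
pose F w := cosh (g w) *: o + sinh (g w) *: w.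
have cF : {for v, continuous F}.
  have ccosh (t : R) : {for t, continuous (@cosh R)}.
    by apply: derivable1_continuous; have [] := is_derive_cosh t.
  have csinh (t : R) : {for t, continuous (@sinh R)}.
    by apply: derivable1_continuous; have [] := is_derive_sinh t.
  have c1 : {for v, continuous (fun w => cosh (g w))} by exact: (continuous_comp cg (ccosh _)).
  have c2 : {for v, continuous (fun w => sinh (g w))} by exact: (continuous_comp cg (csinh _)).
  have h1 : {for v, continuous (fun w => cosh (g w) *: o)} by exact: (cvgZ c1 (cvg_cst o)).
  have h2 : {for v, continuous (fun w => sinh (g w) *: w)} by exact: (cvgZ c2 cvg_id).
  exact: (continuousD h1 h2).
have FE w : U0 w -> adm w -> F w = x (pt w).
  move=> U0w aw; have [_ _ cE sE] := polarE (pt w).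
  by rewrite (polar_x (pt w)) cE sE (dir_pt aw) /F (gu w).
have VF : V (F v) by rewrite (FE v) //; move: Wv; rewrite VE.
have n1 : nbhs v U0 by exact: open_nbhs_nbhs.
have n2 : nbhs v (F @^-1` V) by apply: cF; exact: open_nbhs_nbhs.
apply: filterS2 n1 n2 => w U0w VFw aw; apply: WU; rewrite VE /= -FE //.
Qed.

Lemma unit_perp_compact : compact [set v : E | lor v o = 0 /\ lor v v = 1].
Proof.
apply: bounded_closed_compact.
  exists (o 0 0 ^+ 2 + 1); split; first exact: num_real.
  move=> t ot v [vo vv]; have := lor_perp_bound oo vo; rewrite vv mul1r => h.
  have o2 := sqr_ge0 (o 0 0).
  have t0 : 0 <= t by apply: ltW; apply: le_lt_trans ot; rewrite addr_ge0.
  have v2 (i : 'I_n.+2) : v 0 i ^+ 2 <= o 0 0 ^+ 2.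
    have hs : v 0 0 * v 0 0 = spat v v - 1 by move: vv; rewrite lor_spat; lra.
    case: (unliftP ord0 i) => [j ->|->]; last first.
      by move: hs h; rewrite -expr2; move: (spat _ _) => a; lra.
    apply: le_trans h; rewrite /spat (bigD1 j) //= expr2 lerDl.
    by apply: sumr_ge0 => k _; rewrite -expr2 sqr_ge0.
  apply/norm_rowP => // i; apply: le_trans (ltW ot).
  have := v2 i; rewrite -(real_normK (num_real (v 0 i))).
  have := normr_ge0 (v 0 i); move: `|v 0 i| (o 0 0) o2 => a b b2 a0 ab; nra.
have -> : [set v : E | lor v o = 0 /\ lor v v = 1] =
  ((fun v => lor v o) @^-1` [set 0]) `&` ((fun v => lor v v) @^-1` [set 1]) by [].
have ci v : {for v, continuous (@id E)} by exact: cvg_id.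
have c1 : continuous (fun v : E => lor v o).
  by move=> v; apply: (@continuous_lor R n.+1 E id (fun=> o) v); [exact: ci|exact: cst_continuous].
have c2 : continuous (fun v : E => lor v v).
  by move=> v; apply: (@continuous_lor R n.+1 E id id v); exact: ci.
apply: closedI.
  exact: (proj1 (continuous_closedP _) c1 _ (@closed_eq _ 0)).
exact: (proj1 (continuous_closedP _) c2 _ (@closed_eq _ 1)).
Qed.
End PolarGraph.

Lemma is_derive_row (R : realType) (V : normedModType R) m (f : V -> 'rV[R]_m) (y v : V) (d : 'rV[R]_m) :
  (forall j, is_derive y v (fun z => f z 0 j) (d 0 j)) -> is_derive y v f d.
Proof.
move=> H; have df : derivable f y v by apply/derivable_mxP => i j; rewrite ord1; case: (H j).
split=> //; apply/rowP => j; have [_ <-] := H j.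
by have [_ <-] := derivable_coord j df.
Qed.

Lemma is_derive_scalef (R : realType) (V : normedModType R) m (f : V -> R) (g : V -> 'rV[R]_m)
    (y v : V) (a : R) (b : 'rV[R]_m) :
  is_derive y v f a -> is_derive y v g b ->
  is_derive y v (fun z => f z *: g z) (a *: g y + f y *: b).
Proof.
move=> Df [dg bE]; apply: is_derive_row => j; rewrite !mxE.
have -> : (fun z => (f z *: g z) 0 j) = (fun z => f z * g z 0 j) by apply/funext => z; rewrite mxE.
by rewrite -bE; apply: is_derive_mulf => //; exact: derivable_coord.
Qed.

Lemma is_derive_invf (R : realType) (V : normedModType R) (f : V -> R) (y v : V) (a : R) :
  f y != 0 -> is_derive y v f a -> is_derive y v (fun z => (f z)^-1) (- (f y) ^- 2 * a).
Proof. by move=> f0 [df <-]; split; [exact: derivableV|rewrite deriveV]. Qed.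

(** * Transversality and the derivative of cosh r with respect to the direction *)

Section RadialDerivative.
Variables (R : realType) (n : nat) (M : ptopologicalType) (C : M -> chart R n M).
Local Notation E := 'rV[R]_n.+2.
Variables (x N : M -> E).
Hypothesis hM : oriented_manifold C.
Hypothesis hx : hyperbolic_embedding C x.
Hypothesis hN : unit_normal_field C x N.
Let sx : smooth_map C x := smooth_x hx.
Variables (o : E) (Q : seq E) (u : E -> R).
Hypothesis ho : hyperboloid o.
Hypothesis hu : polar_graph x o Q u.
Let oo : lor o o = -1. Proof. by case: ho. Qed.
Local Notation adm := (admissible o Q).
Local Notation hc := (hcosh x o).
Local Notation hs := (hsinh x o).
Local Notation dir := (dir x o).
Local Notation pt := (pt x o).

Definition theta (p : M) : R := - lor o (N p).
Definition grad2 (p : M) : R := hc p ^+ 2 - 1 - theta p ^+ 2.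
Definition xi_norm (p : M) : R := lnorm (tangential N p (xi o (x p))).

Lemma lor_o_x p : lor o (x p) = - hc p. Proof. by rewrite /hcosh opprK. Qed.
Lemma lor_o_N p : lor o (N p) = - theta p. Proof. by rewrite /theta opprK. Qed.
Lemma lor_o_dir p : lor o (dir p) = 0. Proof. by rewrite lorC (dir_perp ho hu). Qed.
Lemma lor_xN p : lor (x p) (N p) = 0. Proof. by rewrite lorC (lor_Nx hN). Qed.

Lemma xi_norm_sqr p : lor (tangential N p (xi o (x p))) (tangential N p (xi o (x p))) = grad2 p.
Proof.
rewrite xi_linear //; [|exact: (x_hyperboloid hx)|exact: (hcosh_gt1 ho hu)].
rewrite /tangential !lorE (lorC (N p)) (lorC (x p) o) (lor_xx hx) (lor_NN hN) !(lorC (N p)).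
by rewrite lor_xN oo lor_o_x lor_o_N /grad2; ring.
Qed.

(** xi^T is minus the projection of o to the tangent space of M, so <W,o> = -<W,xi^T> and
    Cauchy-Schwarz applies. *)
Lemma tangent_lor_bound p W : lor W (x p) = 0 -> lor W (N p) = 0 ->
  lor W o ^+ 2 <= lor W W * grad2 p.
Proof.
move=> Wx WN; set X := tangential N p (xi o (x p)).
have XE : X = - (o + lor o (x p) *: x p) + lor o (N p) *: N p.
  rewrite /X /tangential xi_linear //; [|exact: (x_hyperboloid hx)|exact: (hcosh_gt1 ho hu)].
  by rewrite !lorE lor_xN mulr0 addr0 scaleNr opprK.
have Xx : lor X (x p) = 0.
  by rewrite XE !lorE (lor_xx hx) (lor_Nx hN); ring.
have -> : lor W o = - lor W X by rewrite XE !lorE Wx WN; ring.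
by rewrite sqrrN -xi_norm_sqr; exact: (lor_perp_cs (lor_xx hx p) Wx Xx).
Qed.

Fact radial_key : unit. Proof. by []. Qed.
(** The unit vector grad r at [x p]. *)
Definition radial (p : M) : E := locked_with radial_key (hs p *: o + hc p *: dir p).

Lemma radialE p : radial p = hs p *: o + hc p *: dir p.
Proof. by rewrite /radial unlock. Qed.

Lemma radial_x p : lor (radial p) (x p) = 0.
Proof.
rewrite (polar_x ho hu p) radialE !lorE oo lor_o_dir (dir_perp ho hu) (dir_unit ho hu); ring.
Qed.

Lemma lor_radial p w : lor (radial p) w = hs p * lor o w + hc p * lor (dir p) w.
Proof. by rewrite radialE !lorE. Qed.

Lemma lor_o_radial p : lor o (radial p) = - hs p.
Proof. by rewrite lorC lor_radial oo (dir_perp ho hu); ring. Qed.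

(** The derivative of cosh r along the tangent vector is computed twice: from its radial component
    [a], and from r = g(direction), where the direction moves with velocity [tau]. A local extension
    [g] of [u] is used because the admissible directions are not open in the ambient space. *)
Lemma radial_derivative p a (tau : E) w (U : set E) (g : E -> R) :
  open U -> U (dir p) -> differentiable g (dir p) -> (forall v, U v -> adm v -> g v = u v) ->
  lor tau o = 0 -> dM C x p w = a *: radial p + hs p *: tau ->
  a * hs p = sinh (g (dir p)) * 'D_tau g (dir p).
Proof.
move=> oU Up dg gu tauo xw.
pose y0 := cmap (C p) p; pose X := x \o cinv (C p).
have s0 := hsinh_gt0 ho hu p; have s2 := hcosh_sinh ho hu p.
have y0I : chart_image (C p) y0 by exact: (chart_image_center hM p).
have DX : is_derive y0 w X (dM C x p w).
  apply: DeriveDef; last by [].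
  by apply: diff_derivable; exact: smooth_map_differentiable.
have X0 : X y0 = x p by rewrite /X /= (cmapK hM (cdom_center hM p)).
have Dc : is_derive y0 w (fun y => - lor o (X y)) (a * hs p).
  have := is_deriveN (is_derive_lorr o DX).
  by rewrite xw lorDr !lorZr lor_o_radial (lorC o) tauo mulr0 addr0 mulrN opprK.
have Ds : is_derive y0 w (fun y => hs (cinv (C p) y)) (a * hc p).
  pose q y : R := - lor o (X y) * - lor o (X y) - 1.
  have D1 : is_derive y0 w q (a * hs p * - lor o (X y0) + - lor o (X y0) * (a * hs p) - 0).
    exact: (is_deriveB (is_derive_mulf Dc Dc) (is_derive_cst (1 : R) y0 w)).
  have p1 : 0 < q y0.
    by rewrite /q X0 -expr2 -/(hc p) -s2 exprn_gt0.
  have D2 := is_derive_scalar_comp (is_derive1_sqrt p1) D1.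
  have -> : (fun y => hs (cinv (C p) y)) = Num.sqrt \o q by apply/funext => y; rewrite /hsinh expr2.
  apply: (is_derive_eq D2); rewrite /q X0 -/(hc p) -expr2 -/(hs p).
  by field; rewrite gt_eqF.
pose phi y := dir (cinv (C p) y).
have Dphi : is_derive y0 w phi tau.
  have D3 : is_derive y0 w (fun y => X y - (- lor o (X y)) *: o)
      (dM C x p w - ((a * hs p) *: o + - lor o (X y0) *: 0)).
    exact: (is_deriveB DX (is_derive_scalef Dc (is_derive_cst o y0 w))).
  have D2 : is_derive y0 w (fun y => (hs (cinv (C p) y))^-1) (- (hs p) ^- 2 * (a * hc p)).
    have s1 : hs (cinv (C p) y0) != 0 by rewrite (cmapK hM (cdom_center hM p)) gt_eqF.
    apply: (is_derive_eq (@is_derive_invf _ _ (fun y => hs (cinv (C p) y)) _ _ _ s1 Ds)).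
    by rewrite (cmapK hM (cdom_center hM p)).
  have -> : phi = fun y => (hs (cinv (C p) y))^-1 *: (X y - (- lor o (X y)) *: o).
    by apply/funext => y; rewrite /phi dirE.
  apply: (is_derive_eq (is_derive_scalef D2 D3)).
  rewrite (cmapK hM (cdom_center hM p)) X0 xw scaler0 addr0 -/(hc p).
  have -> : x p - hc p *: o = hs p *: dir p by rewrite {1}(polar_x ho hu p) addrAC subrr add0r.
  have -> : a *: radial p + hs p *: tau - (a * hs p) *: o = (a * hc p) *: dir p + hs p *: tau.
    rewrite radialE scalerDr !scalerA; set v1 := _ *: o; set v2 := _ *: dir p; set v3 := hs p *: tau.
    by rewrite addrC !addrA addNr add0r.
  rewrite !scalerDr !scalerA mulVf ?gt_eqF // scale1r addrA -scalerDl.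
  have -> : - hs p ^- 2 * (a * hc p) * hs p + (hs p)^-1 * (a * hc p) = 0.
    by field; rewrite gt_eqF.
  by rewrite scale0r add0r.
have Dg : is_derive y0 w (g \o phi) ('D_tau g (dir p)).
  have pE : phi y0 = dir p by rewrite /phi (cmapK hM (cdom_center hM p)).
  have [dphi dE] := Dphi.
  have dg' : differentiable g (phi y0) by rewrite pE.
  by have := is_derive_chain dphi dg'; rewrite dE pE.
have Dcosh : is_derive y0 w (fun y => cosh (g (phi y))) (sinh (g (dir p)) * 'D_tau g (dir p)).
  have := is_derive_scalar_comp (is_derive_cosh (g (phi y0))) Dg.
  by rewrite {2}/phi (cmapK hM (cdom_center hM p)).
have [_ E1] := Dc; have [_ E2] := Dcosh; rewrite -E1 -E2; apply: near_eq_derive.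
have n1 : \forall y \near y0, U (phi y).
  have cphi : {for y0, continuous phi}.
    apply: continuous_comp; first exact: (cinv_continuous hM y0I).
    exact: (dir_continuous hx ho hu).
  by apply: cphi; apply: open_nbhs_nbhs; rewrite /phi (cmapK hM (cdom_center hM p)).
apply: filterS n1 => y Uy; rewrite /phi (gu _ Uy (dir_adm ho hu _)).
by have [_ _ <- _] := polarE ho hu (cinv (C p) y).
Qed.

(** If theta vanished, grad r would be tangent to M. Along it the direction is stationary, hence so
    is u of the direction, whereas r grows at unit rate. *)
Lemma theta_neq0 p : theta p != 0.
Proof.
apply/negP => /eqP t0; have oN : lor o (N p) = 0 by rewrite lor_o_N t0 oppr0.
have s0 := hsinh_gt0 ho hu p.
have dN : lor (dir p) (N p) = 0.
  have := lor_xN p; rewrite {1}(polar_x ho hu p) !lorE oN mulr0 add0r => /eqP.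
  by rewrite mulf_eq0 gt_eqF //= => /eqP.
have rN : lor (radial p) (N p) = 0 by rewrite lor_radial oN dN; ring.
have [w wE] := tangent_vector hM hx hN (radial_x p) rN.
have [U [g [oU Up dg _ gu]]] := adm_extension hu (dir_adm ho hu p).
have := @radial_derivative p 1 0 w U g oU Up dg gu (lor0l _).
rewrite wE scale1r scaler0 addr0 mul1r derive0 mulr0 => /(_ erefl) /eqP.
by rewrite gt_eqF.
Qed.

(* The velocity of the curve of M above gam is d / hsinh times the unit radial vector plus
   hsinh times tau; pair it with the tangential part of xi. *)
Lemma direction_curve_derivative (gam : R -> E) (t : R) (tau : E) :
  is_derive t 1 gam tau -> (\forall s \near t, adm (gam s)) -> lor tau (gam t) = 0 -> lor tau o = 0 ->
  exists2 d : R, is_derive t 1 (fun s => hc (pt (gam s))) d &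
    d ^+ 2 * hs (pt (gam t)) ^+ 2 <=
      grad2 (pt (gam t)) * (d ^+ 2 + hs (pt (gam t)) ^+ 4 * lor tau tau).
Proof.
move=> Dgam nadm taug tauo.
have at0 : adm (gam t) by exact: nbhs_singleton nadm.
set p := pt (gam t); have pg : dir p = gam t by exact: (dir_pt ho hu at0).
have s0 := hsinh_gt0 ho hu p; have s2 := hcosh_sinh ho hu p.
have t0 := theta_neq0 p.
have rN0 : lor (radial p) (N p) != 0.
  apply: contra t0 => /eqP rN.
  have : lor (hc p *: x p - hs p *: radial p) (N p) = 0 by rewrite !lorE lor_xN rN; ring.
  have -> : hc p *: x p - hs p *: radial p = o.
    rewrite [x p](polar_x ho hu p) radialE !scalerDr !scalerA [hs p * hc p]mulrC opprD addrACA subrr addr0.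
    by rewrite -scalerBl -!expr2 s2 opprB addrCA subrr addr0 scale1r.
  by rewrite lor_o_N => /eqP; rewrite oppr_eq0.
(* The radial component that makes the velocity orthogonal to [N p]; transversality makes the
   denominator nonzero. *)
pose a := - hs p * lor tau (N p) / lor (radial p) (N p).
pose W := a *: radial p + hs p *: tau.
have taur : lor tau (x p) = 0.
  by rewrite (polar_x ho hu p) !lorE tauo pg taug; ring.
have Wx : lor W (x p) = 0 by rewrite /W !lorE radial_x taur; ring.
have WN : lor W (N p) = 0 by rewrite /W /a !lorE; field.
have [w wE] := tangent_vector hM hx hN Wx WN.
have [U [g [oU Up dg _ gu]]] := adm_extension hu (dir_adm ho hu p).
have H := radial_derivative oU Up dg gu tauo wE.
exists (a * hs p).
  have [dgam dE] := Dgam.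
  have Dg : is_derive t 1 (g \o gam) ('D_tau g (gam t)).
    have dg' : differentiable g (gam t) by rewrite -pg.
    by have := is_derive_chain dgam dg'; rewrite dE.
  have Dc := is_derive_scalar_comp (is_derive_cosh (g (gam t))) Dg.
  rewrite H pg; apply: near_eq_is_derive Dc.
  have cg : {for t, continuous gam} by exact: derivable1_continuous.
  have nU : \forall s \near t, U (gam s).
    by apply: cg; apply: open_nbhs_nbhs; rewrite -pg.
  apply: filterS2 nU nadm => s Us as_; rewrite /= (gu _ Us as_).
  by have [_ _ -> _] := polarE ho hu (pt (gam s)); rewrite (dir_pt ho hu as_).
have := tangent_lor_bound Wx WN.
have -> : lor W o = - (a * hs p).
  by rewrite /W !lorE (lorC (radial p)) lor_o_radial tauo; ring.
have rr : lor (radial p) (radial p) = 1.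
  rewrite lor_radial lor_o_radial -[lor (dir p) _]lorC lor_radial lor_o_dir (dir_unit ho hu).
  by move: s2; move: (hs p) (hc p) => b c; lra.
have rt : lor (radial p) tau = 0.
  by rewrite lor_radial !(lorC _ tau) tauo pg taug; ring.
have -> : lor W W = a ^+ 2 + hs p ^+ 2 * lor tau tau.
  by rewrite /W !lorE rr (lorC tau (radial p)) rt; ring.
have s20 := sqr_ge0 (hs p).
move=> /(ler_wpM2r s20); congr (_ <= _); ring.
Qed.

End RadialDerivative.

(** * Properness *)

Section PerpNorm.
Variables (R : realType) (m : nat).
Local Notation E := 'rV[R]_m.+1.
Variable o : E.
Hypothesis oo : lor o o = -1.

Lemma lnorm_sqr (w : E) : lor w o = 0 -> lnorm w ^+ 2 = lor w w.
Proof. by move=> wo; rewrite sqr_sqrtr // (lor_perp_ge0 oo wo). Qed.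

Lemma lnorm_ge0 (w : E) : 0 <= lnorm w. Proof. exact: sqrtr_ge0. Qed.

Lemma lor_le_lnorm (v w : E) : lor v o = 0 -> lor w o = 0 -> lor v w <= lnorm v * lnorm w.
Proof.
move=> vo wo; apply: le_trans (ler_norm _) _; rewrite -sqrtr_sqr -sqrtrM ?(lor_perp_ge0 oo vo) //.
by rewrite ler_sqrt ?mulr_ge0 ?(lor_perp_ge0 oo vo) ?(lor_perp_ge0 oo wo) // (lor_perp_cs oo).
Qed.

Lemma lnormD (v w : E) : lor v o = 0 -> lor w o = 0 -> lnorm (v + w) <= lnorm v + lnorm w.
Proof.
move=> vo wo; have h := lor_le_lnorm vo wo; apply: lnorm_le.
  by rewrite addr_ge0 ?lnorm_ge0.
rewrite !lorE (lorC w v) -(lnorm_sqr vo) -(lnorm_sqr wo).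
by move: (lnorm v) (lnorm w) h => a b h; rewrite sqrrD; lra.
Qed.

Lemma lnormBC (v w : E) : lnorm (v - w) = lnorm (w - v).
Proof. by congr Num.sqrt; rewrite !lorE; ring. Qed.
End PerpNorm.

Lemma unit_vector_in_kernel (R : realType) n (f : 'I_n -> R) : (2 <= n)%N -> exists c : 'I_n -> R,
  \sum_a c a ^+ 2 = 1 /\ \sum_a c a * f a = 0.
Proof.
case: n f => [//|[//|k]] f _.
pose al := f ord0; pose be := f (lift ord0 ord0).
have sum2 (h : 'I_k.+2 -> R) : (forall a, h (lift ord0 (lift ord0 a)) = 0) ->
    \sum_a h a = h ord0 + h (lift ord0 ord0).
  by move=> h0; rewrite !big_ord_recl big1 ?addr0 // => a _; rewrite h0.
have l01 : (lift ord0 (ord0 : 'I_k.+1) == ord0 :> 'I_k.+2) = false by [].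
have [g0|g0] := eqVneq (al ^+ 2 + be ^+ 2) 0.
  have al0 : al = 0 by apply/eqP; rewrite -sqrf_eq0 eq_le sqr_ge0 andbT -g0 lerDl sqr_ge0.
  exists (fun a => (a == ord0)%:R); split; (rewrite sum2 /= ?l01 ?eqxx; last by
    move=> a; rewrite /= ?expr0n ?mul0r).
    by rewrite expr1n expr0n addr0.
  by rewrite mul1r -/al al0 mul0r addr0.
pose g := Num.sqrt (al ^+ 2 + be ^+ 2).
have g2 : g ^+ 2 = al ^+ 2 + be ^+ 2 by rewrite sqr_sqrtr // addr_ge0 ?sqr_ge0.
have gn0 : g != 0 by rewrite -sqrf_eq0 g2.
exists (fun a => if a == ord0 then be / g else if a == lift ord0 ord0 then - al / g else 0).
split; (rewrite sum2 /=; last by move=> a; rewrite /= ?expr0n ?mul0r).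
  by rewrite !expr_div_n -mulrDl sqrrN addrC g2 divff // -g2 sqrf_eq0.
by rewrite -/al -/be; field.
Qed.

Lemma shift_bound (R : realType) (a k l d : R) : 2 * a <= k -> k - l <= d -> l - 0 <= a -> a <= d.
Proof. by move=> h1 h2 h3; lra. Qed.

Section Properness.
Variables (R : realType) (n : nat) (M : ptopologicalType) (C : M -> chart R n M).
Local Notation E := 'rV[R]_n.+2.
Variables (x N : M -> E).
Hypothesis hn : (2 <= n)%N.
Hypothesis hM : oriented_manifold C.
Hypothesis hx : hyperbolic_embedding C x.
Hypothesis hN : unit_normal_field C x N.
Hypothesis hconn : connected [set: M].
Hypothesis hcomplete : complete_hypersurface C x.
Variable B : R.
Hypothesis hB : forall z, normA C x N z <= B.
Variables (o : E) (Q : seq E) (u : E -> R).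
Hypothesis ho : hyperboloid o.
Hypothesis hu : polar_graph x o Q u.
Hypothesis hQ : forall w, w \in Q -> lor w o = 0 /\ lor w w = 1.
Let oo : lor o o = -1. Proof. by case: ho. Qed.
Local Notation adm := (admissible o Q).
Local Notation hc := (hcosh x o).
Local Notation hs := (hsinh x o).
Local Notation dir := (dir x o).
Local Notation pt := (pt x o).

(** With c, c' and s, s' the hyperbolic cosines and sines at the two points, the cosh of their
    distance is cc' - ss' + ss'|v - v'|^2/2; here cc' - ss' >= 1, and the left side is at most 1 +
    2L^2. *)
Lemma dir_reach (p q : M) L : reach C x p q L -> L <= 2^-1 ->
  hs p * hs q * lnorm (dir p - dir q) ^+ 2 <= 4 * L ^+ 2.
Proof.
move=> H L2; have := reach_lor_quadratic hM hx hN H L2.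
have s0 := hsinh_gt0 ho hu p; have s2 := hcosh_sinh ho hu p.
have t0 := hsinh_gt0 ho hu q; have t2 := hcosh_sinh ho hu q.
have c0 := hcosh_gt0 ho hu p; have d0 := hcosh_gt0 ho hu q.
have op := dir_perp ho hu p; have oq := dir_perp ho hu q.
rewrite (lnorm_sqr oo); last by rewrite !lorE op oq subrr.
rewrite {1}(polar_x ho hu p) (polar_x ho hu q) !lorE oo !(lorC o) op oq (lorC (dir q)).
rewrite !(dir_unit ho hu).
move: (lor (dir p) (dir q)) (hs p) (hs q) (hc p) (hc q) s0 s2 t0 t2 c0 d0 => k s t c d.
move=> s0 s2 t0 t2 c0 d0 h.
have : 1 + s * t <= c * d.
  rewrite -(ler_pXn2r (n := 2)) ?nnegrE ?mulr_ge0 ?addr_ge0 ?mulr_ge0 ?(ltW s0) ?(ltW t0) ?(ltW c0) ?(ltW d0) //.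
  have -> : (c * d) ^+ 2 = (s ^+ 2 + 1) * (t ^+ 2 + 1) by rewrite s2 t2; ring.
  by have := sqr_ge0 (s - t); rewrite !expr2; nra.
by move: h; rewrite !expr2; lra.
Qed.

Lemma hcosh_reach (p q : M) L : reach C x p q L -> L <= 2^-1 -> hc q <= 2 * hc p.
Proof.
move=> H L2; apply: le_trans (reach_lor_growth hM hx ho H) _.
by rewrite ler_wpM2r ?(expR_half_le2 L2) // ltW // (hcosh_gt0 ho hu).
Qed.

(** The dimension n >= 2 provides a unit tangent vector [e] orthogonal to o, hence also to the
    direction of [q]. Realizing the point r e of the tangent plane as a projection moves the
    direction sideways by an amount visible in <dir p, e>. *)
Lemma side_step (q : M) (r : R) : 0 < r -> r <= proj_radius B ->
  exists p e, [/\ mball C x q (5 * r) p, lor e o = 0, lor e e = 1, lor (dir q) e = 0 &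
    hs p * lor (dir p) e = r].
Proof.
move=> r0 rr; have [T hT] := tangent_frame_exists hM hx q.
have [c [c1 co]] := unit_vector_in_kernel (fun a => lor (fV C x q T a) o) hn.
have [|p [pq px]] := tangent_projection_onto hM hx hN hconn hcomplete hB (y := fun a => r * c a) hT r0 rr.
  by under eq_bigr do rewrite exprMn; rewrite -mulr_sumr c1 mulr1.
pose e := \sum_a c a *: fV C x q T a.
have eo : lor e o = 0 by rewrite lor_suml -[RHS]co; apply: eq_bigr => a _; rewrite lorZl.
have pe : lor (x p) e = r.
  rewrite lor_sumr; under eq_bigr do rewrite lorZr px mulrCA -expr2.
  by rewrite -mulr_sumr c1 mulr1.
have qe : lor (x q) e = 0.
  rewrite lor_sumr big1 // => a _; rewrite lorZr lorC /fV (lor_dx_x hM hx) mulr0 //.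
exists p, e; split=> //.
- by rewrite (lor_fV_comb hM hx hT).
- move: qe; rewrite (polar_x ho hu q) !lorE (lorC o) eo mulr0 add0r => /eqP.
  by rewrite mulf_eq0 gt_eqF ?(hsinh_gt0 ho hu) //= => /eqP.
- by move: pe; rewrite {1}(polar_x ho hu p) !lorE (lorC o) eo mulr0 add0r.
Qed.

(** Such directions form a compact subset of the unit sphere, on which the inverse [pt] of [dir] is
    continuous. *)
Lemma away_from_punctures_bounded (q0 : M) (a : R) : 0 < a -> exists D : R,
  forall q, (forall w, w \in Q -> a <= lnorm (dir q - w)) -> mdist C x q0 q <= D.
Proof.
move=> a0; pose K := [set v : E | (lor v o = 0 /\ lor v v = 1) /\ forall w, w \in Q -> a <= lnorm (v - w)].
have cK : compact K.
  pose F (w : E) := [set v : E | a <= lnorm (v - w)].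
  have -> : K = [set v : E | lor v o = 0 /\ lor v v = 1] `&` \bigcap_(w in [set` Q]) F w.
    by apply/seteqP; split=> v [h1 h2]; split=> // w; exact: h2.
  apply: compact_closedI; first exact: unit_perp_compact ho.
  apply: closed_bigI => w _.
  have cl : continuous (fun v : E => lnorm (v - w)).
    move=> v; have c1 : {for v, continuous (fun z : E => z - w)}.
      by apply: continuousB; [exact: cvg_id|exact: cst_continuous].
    have c2 : {for v, continuous (fun z : E => lor (z - w) (z - w))}.
      exact: (@continuous_lor R n.+1 E (fun z : E => z - w) (fun z : E => z - w) v c1 c1).
    by apply: (continuous_comp c2); exact: sqrt_continuous.
  exact: (proj1 (continuous_closedP _) cl _ (@closed_ge _ a)).
have Kadm v : K v -> adm v.
  move=> [[vo vv] H]; split=> //; apply/negP => /H; rewrite subrr /lnorm lor0l sqrtr0.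
  by rewrite leNgt a0.
have cP : {within K, continuous pt}.
  apply/subspace_continuousP => v Kv U nU.
  by apply: filterS (pt_near hx ho hu (Kadm v Kv) nU) => w H /Kadm /H.
have cI := continuous_compact cP cK.
have := continuous_compact (continuous_subspaceT (@mdist_continuous _ _ _ _ _ hM hx hconn q0)) cI.
move=> /compact_bounded [D [_ HD]]; exists (D + 1) => q Hq.
have Kq : K (dir q) by split=> //; rewrite (dir_perp ho hu) (dir_unit ho hu).
apply: le_trans (ler_norm _) _; apply: (HD (D + 1)); first by rewrite ltrDl.
by exists q => //; exists (dir q) => //; exact: (pt_dir hx ho hu).
Qed.

Lemma separation (s : seq E) : (forall w, w \in s -> lor w o = 0 /\ lor w w = 1) ->
  exists2 b : R, 0 < b & forall w w', w \in s -> w' \in s -> w != w' -> b <= lnorm (w - w').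
Proof.
move=> hs'; have H w : lor w o = 0 -> exists2 b : R, 0 < b &
    forall w', w' \in s -> w != w' -> b <= lnorm (w - w').
  move=> wo; elim: s hs' => [|z s IH] hz; first by exists 1.
  have [|b b0 Hb] := IH; first by move=> y ys; apply: hz; rewrite inE ys orbT.
  have [zw|zw] := eqVneq w z.
    by exists b => // y; rewrite inE => /predU1P[-> /eqP|]; [rewrite zw|exact: Hb].
  have wz : 0 < lnorm (w - z).
    rewrite sqrtr_gt0; apply: (lor_perp_gt0 oo); last by rewrite subr_eq0.
    by rewrite !lorE wo (proj1 (hz z (mem_head _ _))) subrr.
  exists (Num.min b (lnorm (w - z))); first by rewrite lt_min b0.
  move=> y; rewrite inE ge_min => /predU1P[->|ys wy]; first by rewrite lexx orbT.
  by rewrite Hb.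
have G (s' : seq E) : {subset s' <= s} -> exists2 b : R, 0 < b &
    forall w w', w \in s' -> w' \in s -> w != w' -> b <= lnorm (w - w').
  elim: s' => [|z s' IH] ss; first by exists 1.
  have [|b b0 Hb] := IH; first by move=> y ys; apply: ss; rewrite inE ys orbT.
  have [|b' b'0 Hb'] := H z; first by case: (hs' z (ss z (mem_head _ _))).
  exists (Num.min b b'); first by rewrite lt_min b0.
  move=> w w'; rewrite inE ge_min => /predU1P[->|ws] w's ww'; first by rewrite Hb' ?orbT.
  by rewrite Hb.
exact: (G s (fun y ys => ys)).
Qed.

(** A point near the puncture [w] is moved sideways to a direction at distance at least [a] from
    [w], and by at most b/4, so that no other puncture is approached. The previous bound applies to
    the new point, at intrinsic distance at most 5 r1. *)
Lemma sublevel_bounded_away (q0 : M) (U r : R) : 0 < U -> 0 < r -> exists D : R,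
  forall q, hc q <= U -> r <= hs q -> mdist C x q0 q <= D.
Proof.
move=> U0 r0; have [b b0 Hb] := separation hQ.
have pr0 := proj_radius_gt0 hB; have [pr1 _] := proj_radius_small hB.
(* From r r1 |dir q - dir p|^2 <= 4 (5 r1)^2 the square of the displacement is at most 100 r1 / r,
   and this choice makes it at most (b/4)^2. *)
pose r1 := Num.min (proj_radius B) (r * (b / 40) ^+ 2).
have r10 : 0 < r1 by rewrite lt_min pr0 mulr_gt0 // exprn_gt0 // divr_gt0.
have r1p : r1 <= proj_radius B by rewrite ge_min lexx.
have r1b : r1 <= r * (b / 40) ^+ 2 by rewrite ge_min lexx orbT.
(* Since sinh r <= 2U at the new point, the sideways component r1 / sinh r is at least 2a; half of
   it absorbs the distance from [dir q] to [w]. *)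
pose a := Num.min (r1 / (4 * U)) (b / 4).
have a0 : 0 < a by rewrite lt_min !divr_gt0 ?mulr_gt0.
have a1 : a <= r1 / (4 * U) by rewrite ge_min lexx.
have a2 : a <= b / 4 by rewrite ge_min lexx orbT.
have [D HD] := away_from_punctures_bounded q0 a0.
exists (D + 5 * r1) => q qU rq.
have [|/existsNP [w /not_implyP [wQ /negP]]] := pselect (forall w, w \in Q -> a <= lnorm (dir q - w)).
  by move=> /HD h; apply: le_trans h _; rewrite lerDl mulr_ge0 // ltW.
rewrite -ltNge => qw.
have [p [e [[L L5 HL] eo ee qe pe]]] := side_step q r10 r1p.
have L2 : L <= 2^-1 by move: pr1 r1p L5; move: (proj_radius B) => pr; lra.
have pc : hc p <= 2 * U by apply: le_trans (hcosh_reach HL L2) _; rewrite ler_wpM2l.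
have hp0 := hsinh_gt0 ho hu p; have hq0 := hsinh_gt0 ho hu q.
have hpU : hs p <= 2 * U.
  apply: le_trans pc; rewrite -(ler_pXn2r (n := 2)) ?nnegrE ?(ltW hp0) ?(ltW (hcosh_gt0 ho hu p)) //.
  by rewrite (hcosh_sinh ho hu); lra.
have po := dir_perp ho hu p; have qo := dir_perp ho hu q; have [wo _] := hQ wQ.
have lne : lnorm e = 1 by rewrite /lnorm ee sqrtr1.
have pwo : lor (dir p - w) o = 0 by rewrite !lorE po wo subrr.
have qwo : lor (dir q - w) o = 0 by rewrite !lorE qo wo subrr.
have hpe : 2 * a <= lor (dir p) e.
  have h1 : lor (dir p) e = r1 / hs p by rewrite -pe mulrAC divff ?mul1r // gt_eqF.
  rewrite h1 ler_pdivlMr //; apply: (@le_trans _ _ (2 * a * (2 * U))).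
    by rewrite ler_wpM2l // mulr_ge0 // ltW.
  by move: a1; rewrite ler_pdivlMr ?mulr_gt0 //; lra.
have r1hp : r1 <= hs p.
  rewrite -pe ler_piMr ?(ltW hp0) //; apply: le_trans (lor_le_lnorm oo po eo) _.
  by rewrite lne mulr1 /lnorm (dir_unit ho hu) sqrtr1.
have pq4 : lnorm (dir q - dir p) <= b / 4.
  have h := dir_reach HL L2; have L0 := reach_ge0 HL.
  have bb : 0 <= b / 4 by rewrite divr_ge0 // ltW.
  rewrite -(ler_pXn2r (n := 2)) ?nnegrE ?lnorm_ge0 //.
  have : r * r1 * lnorm (dir q - dir p) ^+ 2 <= r * r1 * (b / 4) ^+ 2.
    apply: (@le_trans _ _ (hs q * hs p * lnorm (dir q - dir p) ^+ 2)).
      by rewrite ler_wpM2r ?sqr_ge0 // ler_pM // ltW.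
    apply: (le_trans h); apply: (@le_trans _ _ (4 * (5 * r1) ^+ 2)).
      by rewrite ler_wpM2l // ler_pXn2r ?nnegrE ?mulr_ge0 ?(ltW r10) // ltW.
    have := ler_wpM2l (ltW r10) r1b; rewrite !exprMn !expr2; lra.
  by rewrite ler_pM2l // mulr_gt0.
have : mdist C x q0 p <= D.
  apply: HD => w' w'Q; have [ww'|ww'] := eqVneq w w'.
    rewrite -ww'.
    have h1 : lor (dir p - w) e <= lnorm (dir p - w).
      by apply: le_trans (lor_le_lnorm oo pwo eo) _; rewrite lne mulr1.
    have h2 : lor (dir q - w) e <= a.
      by apply: le_trans (lor_le_lnorm oo qwo eo) _; rewrite lne mulr1 ltW.
    have h3 : lor (w - dir q) e <= a.
      apply: le_trans (lor_le_lnorm oo _ eo) _; first by rewrite !lorE qo wo subrr.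
      by rewrite lne mulr1 lnormBC ltW.
    by move: h1 h3; rewrite !lorE qe => h1 h3; exact: (shift_bound hpe h1 h3).
  have [w'o _] := hQ w'Q.
  have h1 := Hb _ _ wQ w'Q ww'.
  have h2 : lnorm (w - w') <= lnorm (w - dir q) + lnorm (dir q - dir p) + lnorm (dir p - w').
    have -> : w - w' = (w - dir q) + (dir q - dir p) + (dir p - w').
      by rewrite !addrA !subrK.
    apply: le_trans (lnormD oo _ _) _; [by rewrite !lorE po qo wo !subrr addr0|by rewrite !lorE po w'o subrr|].
    by rewrite lerD2r; apply: (lnormD oo); rewrite !lorE ?po ?qo ?wo ?subrr.
  move: h2; rewrite (lnormBC w (dir q)); lra.
move=> h; have := mdist_reach hM hx hconn q0 (reach_sym hM hx HL); lra.
Qed.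

(** Points close to o, where the direction varies too quickly, are also removed by a side step: at
    the new point sinh r is at least the step length. *)
Lemma sublevel_bounded (q0 : M) (U : R) : exists D : R, forall q, hc q <= U -> mdist C x q0 q <= D.
Proof.
have pr0 := proj_radius_gt0 hB; have [pr1 _] := proj_radius_small hB.
have [D HD] := @sublevel_bounded_away q0 (2 * (`|U| + 1)) (proj_radius B)
  ltac:(by rewrite mulr_gt0 // ltr_wpDl) pr0.
exists (D + 5 * proj_radius B) => q qU.
have [p [e [[L L5 HL] eo ee qe pe]]] := side_step q pr0 (lexx _).
have L2 : L <= 2^-1 by lra.
have pc : hc p <= 2 * (`|U| + 1).
  apply: le_trans (hcosh_reach HL L2) _; rewrite ler_wpM2l //.
  by apply: (le_trans qU); have := ler_norm U; lra.
have po := dir_perp ho hu p; have hp0 := hsinh_gt0 ho hu p.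
have h1 : mdist C x q0 p <= D.
  apply: HD => //; rewrite -[X in X <= _]pe ler_piMr ?(ltW hp0) //.
  apply: le_trans (lor_le_lnorm oo po eo) _.
  by rewrite /lnorm ee sqrtr1 mulr1 (dir_unit ho hu) sqrtr1.
have := mdist_reach hM hx hconn q0 (reach_sym hM hx HL); lra.
Qed.

(** The sublevel set lies in a compact intrinsic ball, on which the distance from the direction to
    [w] has a positive minimum because [w] is not admissible. *)
Lemma proper_at_puncture (w : E) (U : R) : w \in Q -> exists2 e : R, 0 < e &
  forall p, lnorm (dir p - w) < e -> U < hc p.
Proof.
move=> wQ; have [wo _] := hQ wQ; have [D HD] := sublevel_bounded point U.
pose r := `|D| + 1; have r0 : 0 < r by rewrite ltr_wpDl.
pose K := cmball C x point r.
have Kpt : K point by move=> e e0; apply: mball_center; rewrite addr_gt0.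
have cf : continuous (fun p => lnorm (dir p - w)).
  move=> p; have c1 : {for p, continuous (fun z => dir z - w)}.
    by apply: continuousB; [exact: (dir_continuous hx ho hu)|exact: cst_continuous].
  have c2 : {for p, continuous (fun z => lor (dir z - w) (dir z - w))} by exact: (continuous_lor c1 c1).
  by apply: (continuous_comp c2); exact: sqrt_continuous.
have [p] := compact_EVT_min (ex_intro _ point Kpt) (cmball_compact hM hx hcomplete r0 (p := point))
  (continuous_subspaceT cf).
move=> _ minp; exists (lnorm (dir p - w)).
  rewrite sqrtr_gt0; apply: (lor_perp_gt0 oo).
    by rewrite !lorE (dir_perp ho hu) wo subrr.
  by rewrite subr_eq0; apply/eqP => pw; have [_ _] := dir_adm ho hu p; rewrite pw wQ.
move=> q qp; rewrite ltNge; apply/negP => /HD qD.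
have Kq : K q.
  apply: mball_sub_cmball; apply: (mdist_lt hM hx hconn); apply: (le_lt_trans qD).
  by rewrite /r; apply: (le_lt_trans (ler_norm D)); rewrite ltrDl.
by have := minp q (mem_set Kq); rewrite leNgt qp.
Qed.
End Properness.

Lemma le_of_eqs (R : numDomainType) (a b c d : R) : a <= b -> c = a -> d = b -> c <= d.
Proof. by move=> ab -> ->. Qed.

Lemma sqr_increment (R : realType) (s t : R) : -1 <= s -> s <= 1 -> - (3 / 100) <= t - s ->
  t - s <= 3 / 100 -> t ^+ 2 <= s ^+ 2 + 7 / 100.
Proof.
move=> s0 s1 ts0 ts1; have -> : t = s + (t - s) by rewrite addrC subrK.
move: (t - s) ts0 ts1 => d d0 d1; rewrite sqrrD.
have : d ^+ 2 <= 1 / 100 by rewrite expr2; nra.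
have : s * d <= 3 / 100 by nra.
lra.
Qed.

Lemma steep_stable (R : realType) (a a' b b' L e : R) :
  - L <= a' - a -> a' - a <= L -> - e <= b' - b -> b' - b <= e ->
  0 <= a -> a <= 1 -> -1 <= b -> b <= 1 -> 4^-1 < 1 - a ^+ 2 - b ^+ 2 ->
  e <= 3 / 100 -> L <= 3 / 100 -> 16^-1 <= 1 - a' ^+ 2 - b' ^+ 2.
Proof.
move=> h1 h2 h3 h4 a0 a1 b0 b1 kq BL L3.
have := sqr_increment (_ : -1 <= a) a1 (_ : - (3 / 100) <= a' - a) (le_trans h2 L3).
have := sqr_increment b0 b1 (_ : - (3 / 100) <= b' - b) (le_trans h4 BL).
by move=> /(_ ltac:(lra)) q1 /(_ ltac:(lra) ltac:(lra)) q2; lra.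
Qed.

(** * Integrability forces small slope at large height *)

Section SteepExclusion.
Variables (R : realType) (n : nat) (M : ptopologicalType) (C : M -> chart R n M).
Local Notation E := 'rV[R]_n.+2.
Variables (x N : M -> E).
Hypothesis hM : oriented_manifold C.
Hypothesis hx : hyperbolic_embedding C x.
Hypothesis hN : unit_normal_field C x N.
Hypothesis hconn : connected [set: M].
Hypothesis hcomplete : complete_hypersurface C x.
Variable B : R.
Hypothesis hB : forall z, normA C x N z <= B.
Variables (o : E) (Q : seq E) (u : E -> R).
Hypothesis ho : hyperboloid o.
Hypothesis hu : polar_graph x o Q u.
Variable vol : {measure set (g_sigma_algebraType (@open M)) -> \bar R}.
Hypothesis hvol : riemannian_volume C x vol.
Hypothesis hint : vol.-integrable [set: g_sigma_algebraType (@open M)]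
  (fun p => (xi_norm x N o p)%:E).
Let oo : lor o o = -1. Proof. by case: ho. Qed.
Let B0 : 0 <= B. Proof. by apply: le_trans (hB point); exact: sqrtr_ge0. Qed.
Local Notation hc := (hcosh x o).
Local Notation hs := (hsinh x o).
Local Notation th := (theta N o).
Local Notation g2 := (grad2 x N o).

Lemma xi_norm_ge0 p : 0 <= xi_norm x N o p. Proof. exact: sqrtr_ge0. Qed.

Lemma grad2_xi_norm p : g2 p = xi_norm x N o p ^+ 2.
Proof.
have [Xx|] := pselect (lor (tangential N p (xi o (x p))) (x p) = 0).
  rewrite /xi_norm (_ : lnorm _ ^+ 2 = lor (tangential N p (xi o (x p))) (tangential N p (xi o (x p)))).
    by rewrite (xi_norm_sqr hx hN ho hu).
  by rewrite sqr_sqrtr // (lor_perp_ge0 (lor_xx hx p)).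
case; rewrite xi_linear //; [|exact: (x_hyperboloid hx)|exact: (hcosh_gt1 ho hu)].
by rewrite /tangential !lorE (lor_xx hx) (lor_Nx hN); ring.
Qed.

Lemma tangent_lor_o z T : lor T (x z) = 0 -> `|lor o T| <= hc z * lnorm T.
Proof.
move=> Tz; rewrite mulrC lorC; apply: sqrt_le_of_sq; first exact: ltW (hcosh_gt0 ho hu z).
apply: (le_trans (tangent_cs o (lor_xx hx z) Tz)); apply: ler_wpM2l.
  exact: (lor_perp_ge0 (lor_xx hx z) Tz).
by rewrite oo /hcosh sqrrN; lra.
Qed.

Lemma theta_le_hcosh z : `|th z| <= hc z.
Proof.
have h := sqr_ge0 (xi_norm x N o z); rewrite -grad2_xi_norm /grad2 in h.
have c0 := hcosh_gt0 ho hu z.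
by rewrite -(ler_pXn2r (n := 2)) ?nnegrE ?(ltW c0) // real_normK ?num_real //; lra.
Qed.

Lemma inv_hcosh_lipschitz p q L : reach C x p q L -> `|(hc q)^-1 - (hc p)^-1| <= L.
Proof.
move=> H; have := @reach_lipschitz _ _ _ _ _ _ hM hx hN (fun z => (hc z)^-1) 1 p q L H.
rewrite mul1r; apply=> z v L' _ _; have c0 := hcosh_gt0 ho hu z; have c1 := hcosh_gt1 ho hu z.
exists (- (hc z) ^- 2 * - lor o (dM C x z v)).
  rewrite mulrNN normrM (@gtr0_norm _ (_ ^- 2)) ?invr_gt0 ?exprn_gt0 // mul1r.
  rewrite mulrC ler_pdivrMr ?exprn_gt0 //.
  apply: (le_trans (tangent_lor_o (lor_dx_x hM hx z v))).
  by rewrite mulrC ler_wpM2l ?lnorm_ge0 // expr2 ler_peMl ?(ltW c0) // ltW.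
move=> c t <- D _; apply: (is_derive_invf (f := hc \o c)) => //=; first by rewrite gt_eqF // (hcosh_gt0 ho hu).
exact: (is_deriveN (is_derive_lorr o D)).
Qed.

(** The derivative of theta is at most B c and contributes B; the derivative of 1/c is at most 1/c
    in norm and, with |theta| <= c, contributes 1. *)
Lemma angle_lipschitz p q L : reach C x p q L -> `|th q / hc q - th p / hc p| <= (B + 1) * L.
Proof.
move=> H; apply: (@reach_lipschitz _ _ _ _ _ _ hM hx hN (fun z => th z / hc z) _ p q L H) => z v L' _ _.
have c0 := hcosh_gt0 ho hu z; have c1 := hcosh_gt1 ho hu z.
exists (- lor o (dM C N z v) * (hc z)^-1 + th z * (- (hc z) ^- 2 * - lor o (dM C x z v))).
  have T0 := lnorm_ge0 (dM C x z v).
  have h1 := tangent_lor_o (lor_dx_x hM hx z v).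
  have h2 := tangent_lor_o (lor_dN_x hM hx hN z v).
  have h3 := theta_le_hcosh z.
  have h4 : lnorm (dM C N z v) <= B * lnorm (dM C x z v).
    apply: lnorm_le; first by rewrite mulr_ge0.
    rewrite exprMn (sqr_sqrtr (lor_perp_ge0 (lor_xx hx z) (lor_dx_x hM hx z v))).
    exact: (dN_norm_bound hM hx hN z v hB).
  apply: le_trans (ler_normD _ _) _; rewrite mulrDl mul1r; apply: lerD.
    rewrite normrM normrN normfV (gtr0_norm c0) ler_pdivrMr //.
    by apply: (le_trans h2); rewrite mulrC ler_wpM2r // ltW.
  rewrite mulrNN !normrM (@gtr0_norm _ (_ ^- 2)) ?invr_gt0 ?exprn_gt0 // mulrA.
  rewrite mulrAC ler_pdivrMr ?exprn_gt0 // expr2.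
  move: h3 h1 T0 c0 (normr_ge0 (lor o (dM C x z v))) (normr_ge0 (th z)).
  move: `|th z| `|lor o _| (lnorm _) (hc z) => a b l c h3 h1 T0 c0 b0 a0.
  apply: (le_of_eqs (ler_pM a0 b0 h3 h1)); ring.
move=> c t <- D1 D2; apply: (is_derive_mulf (f := th \o c)).
  exact: (is_deriveN (is_derive_lorr o D2)).
apply: (is_derive_invf (f := hc \o c)) => //=; first by rewrite gt_eqF // (hcosh_gt0 ho hu).
exact: (is_deriveN (is_derive_lorr o D1)).
Qed.

Lemma steep_exclusion : exists K : R, forall q, K < hc q -> g2 q <= hc q ^+ 2 / 4.
Proof.
(* Then (B + 1) 6r = 3/100, so on the ball of radius 6r both 1/c and theta/c move by at most 3/100
   and their squares by at most 7/100: the ratio |xi^T|^2/c^2 stays above 1/4 - 14/100 > 1/16. *)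
pose r := proj_radius B / 10; have pr0 := proj_radius_gt0 hB.
have rB : (B + 1) * (6 * r) = 3 / 100.
  rewrite /r /proj_radius; field.
  by rewrite gt_eqF // ltr_wpDl.
have r0 : 0 < r by rewrite divr_gt0.
have rr : r <= proj_radius B by rewrite ler_pdivrMr // ler_peMr ?ler1n // ltW.
have B1 : 1 <= B + 1 by rewrite lerDr B0.
have r2 : 6 * r <= 2^-1.
  have r6 : 0 <= 6 * r by rewrite mulr_ge0 // ltW.
  have := ler_peMl r6 B1; rewrite rB; lra.
pose v0 := ball_const R n * (r / (4 * n.+1%:R)) ^+ n.
have v00 : 0 < v0 by rewrite mulr_gt0 ?ball_const_gt0 // exprn_gt0 // divr_gt0 // mulr_gt0.
pose J := fine (\int[vol]_z (xi_norm x N o z)%:E).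
(* On that ball c is at least half of its value at [q], so |xi^T| >= c/4 is at least [hc q / 8]
   there, and integrating gives [hc q / 8 * v0 <= J]. *)
exists (8 * J / v0) => q; apply: contraTT; rewrite -ltNge -leNgt => steep.
have cq0 := hcosh_gt0 ho hu q.
rewrite ler_pdivlMr //.
have eta0 : 0 <= hc q / 8 by rewrite divr_ge0 // ltW.
suff : hc q / 8 * v0 <= J by lra.
apply: (ball_integral_lower hM hx hN hconn hcomplete hB hvol hint xi_norm_ge0 r0 rr eta0 (q := q)).
move=> z [L Lr HL]; have L2 : L <= 2^-1 by lra.
have cz0 := hcosh_gt0 ho hu z; have L0 := reach_ge0 HL.
have cqz : hc q <= 2 * hc z by exact: (hcosh_reach hM hx ho hu (reach_sym hM hx HL) L2).
have h1 := inv_hcosh_lipschitz HL; have h2 := angle_lipschitz HL.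
have BL : (B + 1) * L <= 3 / 100 by rewrite -rB ler_wpM2l ?addr_ge0 // ltW.
have L3 : L <= 3 / 100 by apply: le_trans BL; rewrite ler_peMl.
have gE p : g2 p = hc p ^+ 2 * (1 - (hc p)^-1 ^+ 2 - (th p / hc p) ^+ 2).
  by rewrite /grad2; field; rewrite gt_eqF // (hcosh_gt0 ho hu).
have aq1 : 0 <= (hc q)^-1 <= 1 by rewrite invr_ge0 (ltW cq0) invf_le1 // (ltW (hcosh_gt1 ho hu q)).
have bq1 : `|th q / hc q| <= 1.
  by rewrite normrM normfV (gtr0_norm cq0) ler_pdivrMr // mul1r theta_le_hcosh.
have kq : 4^-1 < 1 - (hc q)^-1 ^+ 2 - (th q / hc q) ^+ 2.
  by have := steep; rewrite gE mulrC [X in _ < X]mulrC ltr_pM2r // exprn_gt0.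
have kz : 16^-1 <= 1 - (hc z)^-1 ^+ 2 - (th z / hc z) ^+ 2.
  move: h1 h2 aq1 bq1 kq BL L3; rewrite !ler_norml.
  by move=> /andP[h1 h2] /andP[h3 h4] /andP[a0 a1] /andP[b0 b1] kq BL L3; exact: (steep_stable h1 h2 h3 h4).
rewrite -(ler_pXn2r (n := 2)) ?nnegrE ?xi_norm_ge0 // -grad2_xi_norm gE.
apply: (@le_trans _ _ (hc z ^+ 2 * 16^-1)); last by rewrite ler_wpM2l // sqr_ge0.
have := ler_pM (ltW cq0) (ltW cq0) cqz cqz; rewrite !expr2; lra.
Qed.

End SteepExclusion.

(** * Coordinates at a puncture *)

Section PolarBasis.
Variables (R : realType) (n : nat).
Local Notation E := 'rV[R]_n.+2.

(* If d is null then x / 0 = 0 makes this the identity. *)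
Definition reflect (d w : E) : E := w - (2 * lor w d / lor d d) *: d.

Lemma lor_reflect d v w : lor (reflect d v) (reflect d w) = lor v w.
Proof.
rewrite /reflect !lorE (lorC d w); have [->|d0] := eqVneq (lor d d) 0.
  by rewrite invr0; ring.
by field.
Qed.

Lemma reflect_swap (a b : E) : lor a a = lor b b -> (lor (a - b) (a - b) = 0 -> a = b) ->
  reflect (a - b) a = b.
Proof.
move=> ab H; rewrite /reflect; have [/[dup] d0 /H ->|d0] := eqVneq (lor (a - b) (a - b)) 0.
  by rewrite subrr scaler0 subr0.
have -> : 2 * lor a (a - b) = lor (a - b) (a - b) by rewrite !lorE (lorC b a) -ab; ring.
by rewrite divff // scale1r opprB addrC subrK.
Qed.

Lemma reflect_fix (d w : E) : lor w d = 0 -> reflect d w = w.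
Proof. by move=> wd; rewrite /reflect wd mulr0 mul0r scale0r subr0. Qed.

Lemma lor_delta (i j : 'I_n.+2) : lor (delta_mx 0 i : E) (delta_mx 0 j) = lsign R i * (i == j)%:R.
Proof.
rewrite /lor (bigD1 i) //= big1 => [|k ki]; last by rewrite !mxE (negbTE ki) andbF mulr0 mul0r.
by rewrite !mxE !eqxx /= mulr1 addr0.
Qed.

Definition polar_basis (o w0 : E) (b : 'I_n -> E) : Prop :=
  [/\ forall i j, lor (b i) (b j) = (i == j)%:R, forall i, lor (b i) o = 0 & forall i, lor (b i) w0 = 0].

(** Two Lorentzian reflections act on the standard basis: the first sends e_0 to [o], the second
    fixes [o] and sends the image of e_1 to [w0]. The images of the remaining vectors form the
    basis. *)
Lemma polar_basis_exists (o w0 : E) : hyperboloid o -> lor w0 o = 0 -> lor w0 w0 = 1 ->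
  exists b, polar_basis o w0 b.
Proof.
move=> ho w0o w0w; have [oo _] := ho.
pose e i : E := delta_mx 0 i; pose i1 : 'I_n.+2 := lift ord0 ord0.
have e00 : lor (e ord0) (e ord0) = -1 by rewrite lor_delta eqxx lsign0 mulr1.
have e0h : hyperboloid (e ord0) by split=> //; rewrite mxE eqxx.
have E1 : reflect (e ord0 - o) (e ord0) = o.
  apply: reflect_swap; rewrite ?e00 // => d0; apply/eqP; rewrite -subr_eq0; apply/eqP.
  have eo : lor (e ord0) o = -1 by move: d0; rewrite !lorE e00 oo (lorC o); lra.
  by apply: (lor_perp_eq0 oo) => //; rewrite !lorE eo oo; ring.
pose f i := reflect (e ord0 - o) (e i).
have ff i j : lor (f i) (f j) = lor (e i) (e j) by exact: lor_reflect.
have fo i : i != ord0 -> lor (f i) o = 0.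
  move=> i0; have -> : lor (f i) o = lor (f i) (f ord0) by rewrite /f E1.
  by rewrite ff lor_delta (negbTE i0) mulr0.
have E2 : reflect (f i1 - w0) (f i1) = w0.
  apply: reflect_swap; first by rewrite ff lor_delta eqxx lsign_lift mulr1 w0w.
  move=> d0; apply/eqP; rewrite -subr_eq0; apply/eqP; apply: (lor_perp_eq0 oo) => //.
  by rewrite lorDl lorNl fo // w0o subrr.
have Eo : reflect (f i1 - w0) o = o.
  by apply: reflect_fix; rewrite lorC lorDl lorNl fo // w0o subrr.
exists (fun i => reflect (f i1 - w0) (f (lift ord0 (lift ord0 i)))); split=> [i j|i|i].
- by rewrite lor_reflect ff lor_delta lsign_lift mul1r !(inj_eq (@lift_inj _ _)).
- by rewrite -[X in lor _ X = _]Eo lor_reflect fo.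
- by rewrite -[X in lor _ X = _]E2 lor_reflect ff lor_delta (inj_eq (@lift_inj _ _)) mulr0.
Qed.
End PolarBasis.

Lemma lor_sub_sqr (R : realType) m (v w : 'rV[R]_m.+1) :
  lor (v - w) (v - w) = lor v v - 2 * lor v w + lor w w.
Proof. by rewrite !lorE (lorC w v); ring. Qed.

Section PolarChart.
Variables (R : realType) (n : nat).
Local Notation E := 'rV[R]_n.+2.
Variables (o w0 : E) (b : 'I_n -> E).
Hypothesis ho : hyperboloid o.
Hypothesis w0o : lor w0 o = 0.
Hypothesis w0w : lor w0 w0 = 1.
Hypothesis hb : polar_basis o w0 b.
Let oo : lor o o = -1. Proof. by case: ho. Qed.
Let bb i j : lor (b i) (b j) = (i == j)%:R. Proof. by case: hb. Qed.
Let bo i : lor (b i) o = 0. Proof. by case: hb. Qed.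
Let bw i : lor (b i) w0 = 0. Proof. by case: hb. Qed.

Definition sqsum (y : 'I_n -> R) : R := \sum_i y i ^+ 2.
(** The unit sphere of the complement of [o], written near [w0] as a graph over its tangent plane;
    meaningful for [sqsum y <= 1]. *)
Definition polar (y : 'I_n -> R) : E := Num.sqrt (1 - sqsum y) *: w0 + \sum_i y i *: b i.

Lemma lor_bcomb i (c : 'I_n -> R) : lor (b i) (\sum_j c j *: b j) = c i.
Proof.
rewrite lor_sumr (bigD1 i) //= big1 => [|j ji]; last by rewrite lorZr bb eq_sym (negbTE ji) mulr0.
by rewrite lorZr bb eqxx mulr1 addr0.
Qed.

Lemma lor_bcomb2 (c d : 'I_n -> R) : lor (\sum_j c j *: b j) (\sum_j d j *: b j) = \sum_i c i * d i.
Proof. by rewrite lor_suml; apply: eq_bigr => i _; rewrite lorZl lor_bcomb. Qed.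

Lemma lor_bcomb_w (c : 'I_n -> R) : lor (\sum_j c j *: b j) w0 = 0.
Proof. by rewrite lor_suml big1 // => i _; rewrite lorZl bw mulr0. Qed.

Lemma lor_bcomb_o (c : 'I_n -> R) : lor (\sum_j c j *: b j) o = 0.
Proof. by rewrite lor_suml big1 // => i _; rewrite lorZl bo mulr0. Qed.

Lemma sqsum_ge0 y : 0 <= sqsum y. Proof. by apply: sumr_ge0 => i _; exact: sqr_ge0. Qed.

Lemma polar_coord y i : lor (b i) (polar y) = y i.
Proof. by rewrite /polar lorDr lorZr bw lor_bcomb; ring. Qed.

Lemma polar_perp y : lor (polar y) o = 0.
Proof. by rewrite /polar lorDl lorZl w0o lor_bcomb_o; ring. Qed.

Lemma polar_unit y : sqsum y <= 1 -> lor (polar y) (polar y) = 1.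
Proof.
move=> y1; have r2 : Num.sqrt (1 - sqsum y) ^+ 2 = 1 - sqsum y by rewrite sqr_sqrtr // subr_ge0.
rewrite /polar !lorDl !lorDr !lorZl !lorZr w0w (lorC w0) lor_bcomb_w lor_bcomb2.
have -> : \sum_i y i * y i = sqsum y by apply: eq_bigr => i _; rewrite expr2.
by move: r2; rewrite expr2; set r := Num.sqrt _; move: r (sqsum y) => r s; lra.
Qed.

Lemma polar_near y : sqsum y <= 1 -> lnorm (polar y - w0) ^+ 2 <= 2 * sqsum y.
Proof.
move=> y1; rewrite (lnorm_sqr oo); last by rewrite lorDl lorNl polar_perp w0o subrr.
rewrite lor_sub_sqr w0w (polar_unit y1).
have -> : lor (polar y) w0 = Num.sqrt (1 - sqsum y).
  by rewrite /polar lorDl lorZl w0w lor_bcomb_w; ring.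
have y0 := sqsum_ge0 y.
have r2 : Num.sqrt (1 - sqsum y) ^+ 2 = 1 - sqsum y by rewrite sqr_sqrtr // subr_ge0.
have r0 := sqrtr_ge0 (1 - sqsum y).
have r1 : Num.sqrt (1 - sqsum y) <= 1 by rewrite -[leRHS]sqrtr1 ler_sqrt; lra.
have := ler_wpM2l r0 r1; move: r2; rewrite expr2 mulr1.
by set r := Num.sqrt _; move: r (sqsum y) => r s; lra.
Qed.

Lemma polar_dist y y' i : `|y i - y' i| <= lnorm (polar y - polar y').
Proof.
have po : lor (polar y - polar y') o = 0 by rewrite lorDl lorNl !polar_perp subrr.
have lb : lnorm (b i) = 1 by rewrite /lnorm bb eqxx sqrtr1.
have -> : y i - y' i = lor (b i) (polar y - polar y') by rewrite lorDr lorNr !polar_coord.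
rewrite ler_norml; apply/andP; split; last first.
  by have := lor_le_lnorm oo (bo i) po; rewrite lb mul1r.
have po' : lor (polar y' - polar y) o = 0 by rewrite lorDl lorNl !polar_perp subrr.
rewrite lerNl -lorNr opprB; have := lor_le_lnorm oo (bo i) po'.
by rewrite lb mul1r lnormBC.
Qed.

(** Besides the part V the velocity has a component along [w0], of square at most |V|^2 |y|^2 / (1 -
    |y|^2) <= |V|^2. *)
Lemma polar_line_derivative (A V : 'I_n -> R) (t : R) : sqsum (fun i => A i + V i * t) <= 2^-1 ->
  exists tau, [/\ is_derive t 1 (fun s => polar (fun i => A i + V i * s)) tau,
    lor tau (polar (fun i => A i + V i * t)) = 0, lor tau o = 0 & lor tau tau <= 2 * sqsum V].
Proof.
set y := fun i => A i + V i * t => y2.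
pose k := \sum_i V i * y i; pose r := Num.sqrt (1 - sqsum y).
have r2 : r ^+ 2 = 1 - sqsum y by rewrite sqr_sqrtr // subr_ge0; lra.
have r0 : 0 < r by rewrite sqrtr_gt0 subr_gt0; lra.
have Dy i : is_derive t 1 (fun s : R => A i + V i * s) (V i) by exact: is_derive_affine.
have Ds : is_derive t 1 (fun s : R => 1 - sqsum (fun i => A i + V i * s)) (- (2 * k)).
  have D1 : is_derive t 1 (fun s : R => \sum_i (A i + V i * s) * (A i + V i * s))
      (\sum_i (V i * y i + y i * V i)).
    by apply: is_derive_sumf => i; exact: (is_derive_mulf (Dy i) (Dy i)).
  have := is_deriveB (is_derive_cst (1 : R) t 1) D1.
  have -> : (cst 1 : R -> R) - (fun s : R => \sum_i (A i + V i * s) * (A i + V i * s)) =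
     (fun s : R => 1 - sqsum (fun i => A i + V i * s)).
    by apply/funext => s; congr (_ - _); apply: eq_bigr => i _; rewrite expr2.
  move=> H; apply: (is_derive_eq H); rewrite sub0r; congr (- _).
  by rewrite /k mulr_sumr; apply: eq_bigr => i _; ring.
have y1 : 0 < 1 - sqsum y by rewrite subr_gt0; lra.
have Dr : is_derive t 1 (fun s : R => Num.sqrt (1 - sqsum (fun i => A i + V i * s))) (- k / r).
  have D2 := @is_derive_scalar_comp R _ Num.sqrt (fun s : R => 1 - sqsum (fun i => A i + V i * s))
    t 1 _ _ (is_derive1_sqrt y1) Ds.
  apply: (is_derive_eq D2).
  by rewrite -/r; field; rewrite gt_eqF.
have Dsum : is_derive t 1 (fun s : R => \sum_i (A i + V i * s) *: b i) (\sum_i V i *: b i).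
  apply: is_derive_row => j; rewrite summxE.
  have -> : (fun s => (\sum_i (A i + V i * s) *: b i) 0 j) = (fun s => \sum_i (A i + V i * s) * b i 0 j).
    by apply/funext => s; rewrite summxE; apply: eq_bigr => i _; rewrite mxE.
  apply: (is_derive_eq (is_derive_sumf (fun i => is_derive_mulf (Dy i) (is_derive_cst (b i 0 j) t 1)))).
  by apply: eq_bigr => i _; rewrite mxE mulr0 addr0.
exists ((- k / r) *: w0 + \sum_i V i *: b i); split.
- have := is_deriveD (is_derive_scalef Dr (is_derive_cst w0 t 1)) Dsum.
  by rewrite scaler0 addr0.
- rewrite /polar -/r !lorDl !lorDr !lorZl !lorZr w0w (lorC w0) !lor_bcomb_w lor_bcomb2 -/k.
  by field; rewrite gt_eqF.
- by rewrite lorDl lorZl w0o lor_bcomb_o; ring.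
rewrite !lorDl !lorDr !lorZl !lorZr w0w (lorC w0) !lor_bcomb_w lor_bcomb2.
have -> : \sum_i V i * V i = sqsum V by apply: eq_bigr => i _; rewrite expr2.
have := sum_cauchy_schwarz V y; rewrite -/k -/(sqsum V) -/(sqsum y) => cs.
have V0 := sqsum_ge0 V.
have kr : (k / r) ^+ 2 <= sqsum V.
  rewrite expr_div_n r2 ler_pdivrMr //; apply: (le_trans cs); rewrite ler_wpM2l //; lra.
by move: kr; rewrite mulNr expr2; move: (k / r) => q; lra.
Qed.
End PolarChart.

(** Here D is the squared derivative of cosh r, s = sinh^2 r, g = |xi^T|^2, and T, W are squared
    speeds on the sphere and in coordinates. Flatness g <= s/3 allows the term g D to be absorbed on
    the left. *)
Lemma steepness_bounds (R : realType) (g s D W T : R) : 0 <= D -> g <= s / 3 -> 0 <= g -> 3 <= s ->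
  0 <= W -> T <= 2 * W -> 0 <= T -> D * s <= g * (D + s ^+ 2 * T) ->
  D <= s ^+ 2 * W /\ D <= 4 * W * g * s.
Proof.
move=> D0 gs g0 s3 W0 TW T0 H.
have sp : 0 < s by lra.
have D1 : D <= s ^+ 2 * W.
  have h1 : g * (D + s ^+ 2 * T) <= s / 3 * (D + s ^+ 2 * T).
    by rewrite ler_wpM2r // addr_ge0 // mulr_ge0 // sqr_ge0.
  have h2 : s * D <= s * ((D + s ^+ 2 * T) / 3) by lra.
  have h3 : D <= (D + s ^+ 2 * T) / 3 by rewrite -(ler_pM2l sp).
  have := ler_wpM2l (sqr_ge0 s) TW; lra.
suff D2 : D <= 4 * W * g * s by [].
  have h1 : D + s ^+ 2 * T <= 3 * (s ^+ 2 * W).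
    by have := ler_wpM2l (sqr_ge0 s) TW; lra.
  have h2 := ler_wpM2l g0 h1.
  have h3 : s * D <= s * (3 * W * g * s) by move: h2 H; rewrite expr2; lra.
  have h4 : D <= 3 * W * g * s by rewrite -(ler_pM2l sp).
  have : 0 <= W * g * s by rewrite !mulr_ge0 // ltW.
  lra.
Qed.

Section AtPuncture.
Variables (R : realType) (n : nat) (M : ptopologicalType) (C : M -> chart R n M).
Local Notation E := 'rV[R]_n.+2.
Variables (x N : M -> E).
Hypothesis hn : (2 <= n)%N.
Hypothesis hM : oriented_manifold C.
Hypothesis hx : hyperbolic_embedding C x.
Hypothesis hN : unit_normal_field C x N.
Hypothesis hconn : connected [set: M].
Hypothesis hcomplete : complete_hypersurface C x.
Variable B : R.
Hypothesis hB : forall z, normA C x N z <= B.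
Variables (o : E) (Q : seq E) (u : E -> R).
Hypothesis ho : hyperboloid o.
Hypothesis hu : polar_graph x o Q u.
Hypothesis hQ : forall w, w \in Q -> lor w o = 0 /\ lor w w = 1.
Variable vol : {measure set (g_sigma_algebraType (@open M)) -> \bar R}.
Hypothesis hvol : riemannian_volume C x vol.
Hypothesis hint : vol.-integrable [set: g_sigma_algebraType (@open M)]
  (fun p => (xi_norm x N o p)%:E).
Variables (w0 : E) (b : 'I_n -> E).
Hypothesis w0Q : w0 \in Q.
Hypothesis hb : polar_basis o w0 b.
Let oo : lor o o = -1. Proof. by case: ho. Qed.
Let w0o : lor w0 o = 0. Proof. by case: (hQ w0Q). Qed.
Let w0w : lor w0 w0 = 1. Proof. by case: (hQ w0Q). Qed.
Local Notation adm := (admissible o Q).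
Local Notation hc := (hcosh x o).
Local Notation hs := (hsinh x o).
Local Notation g2 := (grad2 x N o).
Local Notation polar := (polar w0 b).

Definition cpt (y : 'I_n -> R) : M := pt x o (polar y).

(** [rho] bounds the squared coordinate length. Inside, only the centre is a puncture and the
    flatness estimate holds; c >= 2 turns g <= c^2/4 into g <= sinh^2(r)/3. *)
Definition good_radius (rho : R) := [/\ 0 < rho, rho <= 4^-1,
  exists2 d : R, 0 < d & forall y w, sqsum y <= rho -> w \in Q -> w != w0 -> d <= lnorm (polar y - w) &
  forall y, 0 < sqsum y -> sqsum y <= rho ->
    [/\ adm (polar y), 2 <= hc (cpt y) & g2 (cpt y) <= hc (cpt y) ^+ 2 / 4]].

Lemma good_radius_exists : exists rho, good_radius rho.
Proof.
have [K HK] := steep_exclusion hM hx hN hconn hcomplete hB ho hu hvol hint.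
have [e e0 He] := proper_at_puncture hn hM hx hN hconn hcomplete hB ho hu hQ (Num.max K 2) w0Q.
have [d d0 Hd] := separation ho hQ.
pose m := Num.min e d; have m0 : 0 < m by rewrite lt_min e0.
exists (Num.min 4^-1 (m ^+ 2 / 16)).
have near_w0 y : sqsum y <= Num.min 4^-1 (m ^+ 2 / 16) -> sqsum y <= 1 /\ lnorm (polar y - w0) < m / 2.
  rewrite le_min => /andP[y1 y2]; have y3 : sqsum y <= 1 by lra.
  split=> //; rewrite -(ltr_pXn2r (n := 2)) ?nnegrE ?lnorm_ge0 ?divr_ge0 ?(ltW m0) //.
  apply: (le_lt_trans (polar_near ho w0o w0w hb y3)).
  by have := exprn_gt0 2 m0; rewrite expr_div_n; lra.
have md : m <= d by rewrite ge_min lexx orbT.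
have me : m <= e by rewrite ge_min lexx.
split.
- by rewrite lt_min; apply/andP; split; [|rewrite divr_gt0 // exprn_gt0].
- by rewrite ge_min lexx.
- exists (m / 2) => [|y w yr wQ ww0]; first by rewrite divr_gt0.
  have [_ ym] := near_w0 y yr; have := Hd _ _ wQ w0Q ww0.
  have [wo _] := hQ wQ; have po := polar_perp w0o hb y.
  have : lnorm (w - w0) <= lnorm (polar y - w) + lnorm (polar y - w0).
    have -> : w - w0 = (w - polar y) + (polar y - w0) by rewrite addrA subrK.
    rewrite (lnormBC (polar y) w); apply: (lnormD oo); first by rewrite lorDl lorNl wo po subrr.
    by rewrite lorDl lorNl w0o po subrr.
  lra.
move=> y y0 /near_w0 [y3 ym2]; have ym : lnorm (polar y - w0) < m by lra.
have ywn : polar y != w0.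
  apply/negP => /eqP yw; move: y0; rewrite /sqsum big1 ?ltxx // => i _.
  by rewrite -(polar_coord hb y i) yw; case: hb => _ _ ->; rewrite expr0n.
have ay : adm (polar y).
  split; [exact: (polar_perp w0o hb)|exact: (polar_unit w0w hb y3)|].
  apply/negP => yQ; have := Hd _ _ yQ w0Q ywn.
  by rewrite leNgt (lt_le_trans ym).
have h : Num.max K 2 < hc (cpt y).
  by apply: He; rewrite /cpt (dir_pt ho hu ay) (lt_le_trans ym).
move: h; rewrite gt_max => /andP[h1 h2].
by split=> //; [exact: ltW|exact: HK].
Qed.

Variable rho : R.
Hypothesis hrho : good_radius rho.

Lemma line_hcosh_derivative (A V : 'I_n -> R) (t : R) :
  0 < sqsum (fun i => A i + V i * t) < rho -> exists d,
  [/\ is_derive t 1 (fun s => hc (cpt (fun i => A i + V i * s))) d,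
      d ^+ 2 <= sqsum V * hc (cpt (fun i => A i + V i * t)) ^+ 4 &
      d ^+ 2 <= 4 * sqsum V * g2 (cpt (fun i => A i + V i * t)) * hc (cpt (fun i => A i + V i * t)) ^+ 2].
Proof.
have [r0 r4 _ Hr] := hrho; move=> /andP[y0 y1].
have [tau [Dt taug tauo tt]] := polar_line_derivative w0o w0w hb (A := A) (V := V) (t := t) ltac:(lra).
have nadm : \forall s \near t, adm (polar (fun i => A i + V i * s)).
  have cs : {for t, continuous (fun s : R => sqsum (fun i => A i + V i * s))}.
    apply: continuous_for_bigsum => i.
    have c1 : {for t, continuous (fun s : R => A i + V i * s)}.
      by apply: derivable1_continuous; have [] := is_derive_affine (A i) (V i) t.
    exact: (cvgM c1 c1).
  have n1 : \forall s \near t, 0 < sqsum (fun i => A i + V i * s) by exact: (cvgr_gt _ cs _ y0).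
  have n2 : \forall s \near t, sqsum (fun i => A i + V i * s) < rho by exact: (cvgr_lt _ cs _ y1).
  by apply: filterS2 n1 n2 => s s0 s1; have [] := Hr _ s0 (ltW s1).
have [d Dd H] := direction_curve_derivative hM hx hN ho hu Dt nadm taug tauo.
exists d; rewrite -/(cpt _) in Dd H *; set p := cpt _ in H *.
have [_ c2 hg] := Hr _ y0 (ltW y1); rewrite -/p in c2 hg.
have s2 := hcosh_sinh ho hu p; have s0 := hsinh_gt0 ho hu p.
have g0 : 0 <= g2 p by rewrite (grad2_xi_norm hx hN ho hu) sqr_ge0.
have V0 := sqsum_ge0 V.
have s2' : 3 <= hs p ^+ 2.
  have h02 : 0 <= (2 : R) by [].
  by rewrite s2; have := ler_pM h02 h02 c2 c2; rewrite expr2; lra.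
have cs : hc p ^+ 2 = hs p ^+ 2 + 1 by rewrite s2 subrK.
have e4 : forall a : R, a ^+ 4 = (a ^+ 2) ^+ 2 by move=> a; rewrite -exprM.
have gs : g2 p <= hs p ^+ 2 / 3 by move: hg; rewrite cs; lra.
move: H; rewrite !e4 cs.
have T0 : 0 <= lor tau tau by exact: (lor_perp_ge0 oo tauo).
move: (g2 p) (hs p ^+ 2) (d ^+ 2) (sqsum V) (lor tau tau) (sqr_ge0 d) gs g0 s2' V0 tt T0.
move=> g s D W T D0 gs g0 s3 W0 TW T0 H.
have sp : 0 < s by exact: lt_le_trans s3.
have [D1 D2] := steepness_bounds D0 gs g0 s3 W0 TW T0 H.
split=> //.
- apply: (le_trans D1); rewrite mulrC ler_wpM2l // ler_pXn2r ?nnegrE ?addr_ge0 ?(ltW sp) //.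
  by rewrite lerDl.
- by apply: (le_trans D2); rewrite ler_wpM2l ?lerDl // !mulr_ge0.
Qed.

Lemma abs_le_of_sqr (a c : R) : 0 <= c -> a ^+ 2 <= c ^+ 2 -> `|a| <= c.
Proof. by move=> c0 h; rewrite -(ler_pXn2r (n := 2)) ?nnegrE // real_normK // num_real. Qed.

Lemma sqsum_scale (a : R) (y : 'I_n -> R) : sqsum (fun i => a * y i) = a ^+ 2 * sqsum y.
Proof. by rewrite /sqsum mulr_sumr; apply: eq_bigr => i _; rewrite exprMn. Qed.

(** Along the radial segment from t0 y to y the derivative of 1/c is at most |y|, and properness
    makes 1/c smaller than any given [e] at its inner end. *)
Lemma inv_hcosh_puncture (y : 'I_n -> R) : 0 < sqsum y -> sqsum y < rho ->
  (hc (cpt y))^-1 <= Num.sqrt (sqsum y).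
Proof.
have [r0 r4 _ Hr] := hrho; move=> y0 y1; apply/ler_addgt0Pr => e e0.
have [d d0 Hd] := proper_at_puncture hn hM hx hN hconn hcomplete hB ho hu hQ e^-1 w0Q.
pose t0 := Num.min 2^-1 (d / 2); have t00 : 0 < t0 by rewrite lt_min; apply/andP; split; [|rewrite divr_gt0].
have t01 : t0 <= 2^-1 by rewrite ge_min lexx.
have t0d : t0 <= d / 2 by rewrite ge_min lexx orbT.
pose A i := t0 * y i; pose V i := (1 - t0) * y i.
have lE (s : R) : (fun i => A i + V i * s) = (fun i => (t0 + (1 - t0) * s) * y i).
  by apply/funext => i; rewrite /A /V; ring.
have sE (s : R) : sqsum (fun i => A i + V i * s) = (t0 + (1 - t0) * s) ^+ 2 * sqsum y.
  by rewrite lE sqsum_scale.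
have sV : sqsum V = (1 - t0) ^+ 2 * sqsum y by rewrite /V sqsum_scale.
pose r := Num.sqrt (sqsum y); have rr : r ^+ 2 = sqsum y by rewrite sqr_sqrtr // ltW.
have rge0 : 0 <= r by exact: sqrtr_ge0.
pose g (s : R) := (hc (cpt (fun i => A i + V i * s)))^-1.
have Dg (s : R) : 0 <= s <= 1 -> exists d', is_derive s 1 g d' /\ `|d'| <= r.
  move=> /andP[s0 s1].
  have ts : 0 < t0 + (1 - t0) * s <= 1.
    apply/andP; split; first by rewrite ltr_pwDl // mulr_ge0 // subr_ge0; lra.
    have : (1 - t0) * s <= (1 - t0) * 1 by rewrite ler_wpM2l // subr_ge0; lra.
    lra.
  have [|c [Dc c4 _]] := @line_hcosh_derivative A V s.
    rewrite sE; move/andP: ts => [ts0 ts1]; rewrite mulr_gt0 ?exprn_gt0 //=.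
    by apply: le_lt_trans y1; rewrite ler_piMl ?(ltW y0) // expr2 mulr_ile1 // ltW.
  have c0 := hcosh_gt0 ho hu (cpt (fun i => A i + V i * s)).
  exists (- (hc (cpt (fun i => A i + V i * s))) ^- 2 * c); split.
    by apply: is_derive_invf => //; rewrite gt_eqF.
  rewrite mulNr normrN normrM (@gtr0_norm _ (_ ^- 2)) ?invr_gt0 ?exprn_gt0 // mulrC.
  rewrite ler_pdivrMr ?exprn_gt0 //; apply: abs_le_of_sqr; first by rewrite mulr_ge0 // exprn_ge0 // ltW.
  apply: (le_trans c4); rewrite exprMn rr -exprM ler_wpM2r ?exprn_ge0 ?(ltW c0) //.
  rewrite sV ler_piMl ?(ltW y0) // expr2 mulr_ile1 // ?subr_ge0; lra.
have /choice [g' Hg'] : forall s : R, exists d', (0 <= s <= 1) -> is_derive s 1 g d' /\ `|d'| <= r.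
  move=> s; have [s01|s01] := boolP (0 <= s <= 1); last by exists 0.
  by have [d' H] := Dg s s01; exists d'.
have [s hs1|s hs1 gE] := @MVT01 R g g'; first by case: (Hg' s hs1).
have [_ gr] := Hg' s hs1.
have g1 : g 1 = (hc (cpt y))^-1.
  by rewrite /g lE mulr1 subrKC; congr ((hc (cpt _))^-1); apply/funext => i; rewrite mul1r.
have g0 : g 0 < e.
  rewrite /g lE mulr0 addr0 invf_plt ?posrE //; last exact: (hcosh_gt0 ho hu).
  have z0 : 0 < sqsum (fun i => t0 * y i) by rewrite sqsum_scale mulr_gt0 // exprn_gt0.
  have t02 : t0 ^+ 2 <= 1 by rewrite expr2 mulr_ile1 ?(ltW t00) //; lra.
  have z1 : sqsum (fun i => t0 * y i) <= rho.
    by rewrite sqsum_scale; apply: le_trans (ltW y1); rewrite ler_piMl // ltW.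
  have [az _ _] := Hr _ z0 z1.
  apply: Hd; rewrite /cpt (dir_pt ho hu az) -(ltr_pXn2r (n := 2)) ?nnegrE ?lnorm_ge0 ?(ltW d0) //.
  have z3 : sqsum (fun i => t0 * y i) <= 1 by lra.
  apply: (le_lt_trans (polar_near ho w0o w0w hb z3)); rewrite sqsum_scale.
  have : t0 ^+ 2 <= (d / 2) ^+ 2 by rewrite ler_pXn2r ?nnegrE ?(ltW t00) // divr_ge0 // ltW.
  have := exprn_gt0 2 d0; have := ler_wpM2l (sqr_ge0 t0) (_ : sqsum y <= 4^-1).
  rewrite exprMn => /(_ _) h hd2; have := h ltac:(lra); lra.
have := ler_norm (g' s); rewrite -/r -g1; lra.
Qed.
End AtPuncture.

(** * Divergence of the integral at a puncture *)

Lemma is_derive_powf (R : realType) (V : normedModType R) (f : V -> R) (y v : V) (a : R) m :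
  is_derive y v f a -> is_derive y v (fun z => f z ^+ m.+1) (m.+1%:R * f y ^+ m * a).
Proof.
move=> Df; elim: m => [|m IH]; first by rewrite expr0 mul1r mul1r.
have -> : (fun z => f z ^+ m.+2) = (fun z => f z * f z ^+ m.+1) by apply/funext => z; rewrite exprS.
apply: (is_derive_eq (is_derive_mulf Df IH)).
by rewrite [in RHS]exprS -[m.+2%:R]natr1 [in LHS]exprS; ring.
Qed.

Lemma quarter_sqr_le (R : realType) (c : R) : 2 <= c -> c ^+ 2 / 2 ^+ 2 <= c ^+ 2 - 1.
Proof. by move=> h; have := ler_pM (ler0n R 2) (ler0n R 2) h h; lra. Qed.

(** If balls of radii s c/16 and s d/16 met, the estimate for directions would give s^2 c d/4 <= 4
    L^2, while comparable heights give (c + d)^2 <= 6 c d and thus 4 L^2 <= (24/256) s^2 c d. *)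
Lemma separated_balls (R : realType) (s L c d p q D : R) : 0 < s -> 0 <= L -> 2 <= c -> 2 <= d ->
  d <= 2 * c -> c <= 2 * d -> p * q * D <= 4 * L ^+ 2 -> c / 2 <= p -> d / 2 <= q -> s ^+ 2 <= D ->
  L < s * c / 16 + s * d / 16 -> False.
Proof.
move=> s0 L0 c1 d1 h1 h2 hd k1 k2 sd Ls.
have c0 : 0 < c by lra.
have d0 : 0 < d by lra.
have e1 : c / 2 * (d / 2) * s ^+ 2 <= p * q * D.
  have c20 : 0 <= c / 2 by rewrite divr_ge0 // ltW.
  have d20 : 0 <= d / 2 by rewrite divr_ge0 // ltW.
  by apply: ler_pM => //; [rewrite mulr_ge0|exact: sqr_ge0|exact: ler_pM].
have e2 : L ^+ 2 <= (s * (c + d) / 16) ^+ 2.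
  by rewrite ler_pXn2r ?nnegrE ?divr_ge0 ?mulr_ge0 ?addr_ge0 ?(ltW s0) ?(ltW c0) ?(ltW d0) //; lra.
have e3 : (c + d) ^+ 2 <= 6 * (c * d).
  have := ler_wpM2r (ltW c0) h2; have := ler_wpM2r (ltW d0) h1; rewrite sqrrD !expr2; lra.
have e4 : (s * (c + d) / 16) ^+ 2 = s ^+ 2 * (c + d) ^+ 2 / 256 by field.
have e5 : 0 < s ^+ 2 * (c * d) by rewrite mulr_gt0 ?exprn_gt0 // mulr_gt0.
have e6 := ler_wpM2l (sqr_ge0 s) e3.
have : s ^+ 2 * (c * d) / 4 <= 4 * (s ^+ 2 * (6 * (c * d)) / 256) by lra.
lra.
Qed.

Section VolumeAtPuncture.
Variables (R : realType) (k : nat) (M : ptopologicalType) (C : M -> chart R k.+1 M).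
Local Notation n := k.+1.
Local Notation E := 'rV[R]_n.+2.
Variables (x N : M -> E).
Hypothesis hn : (2 <= n)%N.
Hypothesis hM : oriented_manifold C.
Hypothesis hx : hyperbolic_embedding C x.
Hypothesis hN : unit_normal_field C x N.
Hypothesis hconn : connected [set: M].
Hypothesis hcomplete : complete_hypersurface C x.
Variable B : R.
Hypothesis hB : forall z, normA C x N z <= B.
Variables (o : E) (Q : seq E) (u : E -> R).
Hypothesis ho : hyperboloid o.
Hypothesis hu : polar_graph x o Q u.
Hypothesis hQ : forall w, w \in Q -> lor w o = 0 /\ lor w w = 1.
Variable vol : {measure set (g_sigma_algebraType (@open M)) -> \bar R}.
Hypothesis hvol : riemannian_volume C x vol.
Hypothesis hint : vol.-integrable [set: g_sigma_algebraType (@open M)]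
  (fun p => (xi_norm x N o p)%:E).
Variables (w0 : E) (b : 'I_n -> E).
Hypothesis w0Q : w0 \in Q.
Hypothesis hb : polar_basis o w0 b.
Let oo : lor o o = -1. Proof. by case: ho. Qed.
Let w0o : lor w0 o = 0. Proof. by case: (hQ w0Q). Qed.
Let w0w : lor w0 w0 = 1. Proof. by case: (hQ w0Q). Qed.
Local Notation adm := (admissible o Q).
Local Notation hc := (hcosh x o).
Local Notation hs := (hsinh x o).
Local Notation g2 := (grad2 x N o).
Local Notation polar := (polar w0 b).
Local Notation cpt := (cpt x o w0 b).
Local Notation h := (xi_norm x N o).
Variable rho : R.
Hypothesis hrho : good_radius x N o Q w0 b rho.

Lemma xi_norm_continuous : continuous h.
Proof.
move=> p; have hE : h = fun q => Num.sqrt (g2 q).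
  by apply/funext => q; rewrite /xi_norm /lnorm (xi_norm_sqr hx hN ho hu).
have cc : {for p, continuous hc} by exact: (hcosh_continuous hx).
have cN : {for p, continuous N} by exact: (smooth_map_continuous hM (smooth_N hN)).
have ct : {for p, continuous (theta N o)} by exact: (continuousN (continuous_lor (cvg_cst o) cN)).
have cg : {for p, continuous g2}.
  have c1 : {for p, continuous (fun q => hc q ^+ 2 - 1)}.
    exact: (continuousB (cvgM cc cc) (cvg_cst (1 : R))).
  exact: (continuousB c1 (cvgM ct ct)).
by rewrite hE; apply: (continuous_comp cg); exact: sqrt_continuous.
Qed.

Lemma compact_uniform (K : set M) (e : R) : compact K -> 0 < e -> exists2 d : R, 0 < d &
  forall p z, K p -> mball C x p d z -> `|h z - h p| < e.
Proof.
move=> cK e0; have e2 : 0 < e / 2 by rewrite divr_gt0.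
have /choice [r Hr] : forall p : M, exists r : R, 0 < r /\
    forall z, mball C x p (r + r) z -> `|h z - h p| < e / 2.
  move=> p; have /cvgrPdist_lt /(_ _ e2) np := @xi_norm_continuous p.
  have [r r0 H] := mball_sub_nbhs hM hx np; exists (r / 2); split; first by rewrite divr_gt0.
  by move=> z; rewrite -splitr => /H; rewrite distrC.
have [|s Hs] := compact_finite_cover hM hx cK (r := r); first by move=> z; case: (Hr z).
have [t t0 tL] : exists2 t : R, 0 < t & forall z, z \in s -> t <= r z.
  elim: s {Hs} => [|z s [t t0 IH]]; first by exists 1.
  exists (Num.min t (r z)); first by rewrite lt_min t0; case: (Hr z).
  by move=> y; rewrite inE ge_min => /predU1P[->|/IH ->]; rewrite ?lexx ?orbT.
exists t => // p z Kp pz; have [y ys yp] := Hs p Kp; have [r0 H] := Hr y.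
have h1 : `|h p - h y| < e / 2 by apply: H; apply: mballW yp; rewrite lerDl ltW.
have h2 : `|h z - h y| < e / 2.
  by apply: H; apply: mballW (mball_triangle hM hx yp pz); rewrite lerD2l tL.
have -> : h z - h p = (h z - h y) - (h p - h y) by rewrite opprB addrA subrK.
by apply: le_lt_trans (ler_normB _ _) _; rewrite (splitr e) ltrD.
Qed.

Lemma balls_disjoint (y1 y2 : 'I_n -> R) (s : R) (i : 'I_n) (z : M) :
  0 < s -> 0 < sqsum y1 -> sqsum y1 <= rho -> 0 < sqsum y2 -> sqsum y2 <= rho -> s <= `|y1 i - y2 i| ->
  s * hc (cpt y1) / 16 <= 4^-1 -> s * hc (cpt y2) / 16 <= 4^-1 ->
  mball C x (cpt y1) (s * hc (cpt y1) / 16) z -> mball C x (cpt y2) (s * hc (cpt y2) / 16) z -> False.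
Proof.
have [_ _ _ Hr] := hrho.
move=> s0 y10 y1r y20 y2r sy b1 b2 m1 m2.
have [L Ls HL] := mball_triangle hM hx m1 (mball_sym hM hx m2).
have [a1 c1 _] := Hr _ y10 y1r; have [a2 c2 _] := Hr _ y20 y2r.
have L2 : L <= 2^-1 by lra.
have h1 := hcosh_reach hM hx ho hu HL L2.
have h2 := hcosh_reach hM hx ho hu (reach_sym hM hx HL) L2.
have hd := dir_reach hM hx hN ho hu HL L2.
rewrite /cpt !(dir_pt ho hu) // in hd.
have hsc p : 2 <= hc p -> hc p / 2 <= hs p.
  move=> cp; have s00 := hsinh_gt0 ho hu p.
  rewrite -(ler_pXn2r (n := 2)) ?nnegrE ?(ltW s00) ?divr_ge0 ?(le_trans _ cp) //.
  by rewrite (hcosh_sinh ho hu) expr_div_n; exact: quarter_sqr_le.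
have k1 := hsc _ c1; have k2 := hsc _ c2; have L0 := reach_ge0 HL.
have sd : s ^+ 2 <= lnorm (polar y1 - polar y2) ^+ 2.
  rewrite ler_pXn2r ?nnegrE ?lnorm_ge0 ?(ltW s0) //.
  exact: le_trans sy (polar_dist ho w0o hb y1 y2 i).
rewrite -/(cpt y1) -/(cpt y2) in hd.
exact: (separated_balls s0 L0 c1 c2 h1 h2 hd k1 k2 sd Ls).
Qed.

(** The distinguished coordinate [t] runs along the columns, the other k ones index them. *)
Definition vert (t : R) (j : 'I_k -> R) : 'I_n -> R := fun i => if unlift ord0 i is Some a then j a else t.

Lemma sqsum_vert t j : sqsum (vert t j) = t ^+ 2 + \sum_a j a ^+ 2.
Proof.
rewrite /sqsum big_ord_recl /vert unlift_none; congr (_ + _).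
by apply: eq_bigr => a _; rewrite liftK.
Qed.

(** The derivative of c is at most 2 |xi^T| c times the coordinate speed, so that of c^n is at most
    2 n |xi^T| c^n: up to constants, |xi^T| times the volume of a ball of radius proportional to
    c. *)
Lemma vertical_mvt (j : 'I_k -> R) (t1 t2 : R) : 0 < t1 -> t1 < t2 -> sqsum (vert t2 j) < rho ->
  exists2 t, t1 <= t <= t2 & hc (cpt (vert t1 j)) ^+ n - hc (cpt (vert t2 j)) ^+ n <=
    (t2 - t1) * (2 * n%:R * (h (cpt (vert t j)) * hc (cpt (vert t j)) ^+ n)).
Proof.
move=> t10 t12 yr; have d0 : 0 < t2 - t1 by rewrite subr_gt0.
pose A := vert t1 j; pose V := vert (t2 - t1) (fun=> 0).
have lE (s : R) : (fun i => A i + V i * s) = vert (t1 + (t2 - t1) * s) j.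
  by apply/funext => i; rewrite /A /V /vert; case: unliftP => //= *; rewrite mul0r addr0.
have sV : sqsum V = (t2 - t1) ^+ 2 by rewrite sqsum_vert big1 ?addr0 // => a _; rewrite expr0n.
pose g (s : R) := hc (cpt (fun i => A i + V i * s)) ^+ n.
have Dg (s : R) : exists d', 0 <= s <= 1 -> is_derive s 1 g d' /\
    `|d'| <= (t2 - t1) * (2 * n%:R * (h (cpt (vert (t1 + (t2 - t1) * s) j)) *
      hc (cpt (vert (t1 + (t2 - t1) * s) j)) ^+ n)).
  have [/andP[s0 s1]|s01] := boolP (0 <= s <= 1); last by exists 0.
  have ts : t1 <= t1 + (t2 - t1) * s <= t2.
    rewrite lerDl mulr_ge0 ?(ltW d0) //=; have := ler_wpM2l (ltW d0) s1; lra.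
  move/andP: (ts) => [ts1 ts2].
  have [|c [Dc _ c2]] := line_hcosh_derivative hM hx hN ho hu hQ w0Q hb hrho (A := A) (V := V) (t := s).
    rewrite lE sqsum_vert; apply/andP; split.
      by rewrite ltr_pwDl ?exprn_gt0 ?(lt_le_trans t10) // sumr_ge0 // => a _; exact: sqr_ge0.
    apply: le_lt_trans yr; rewrite sqsum_vert lerD2r ler_pXn2r ?nnegrE //; lra.
  rewrite lE in c2; set p := cpt _ in c2 *.
  have c0 := hcosh_gt0 ho hu p; have h0 := xi_norm_ge0 x N o p.
  exists (n%:R * hc p ^+ k * c) => _; split.
    by rewrite /p -lE; exact: is_derive_powf.
  have cb : `|c| <= (t2 - t1) * (2 * (h p * hc p)).
    apply: abs_le_of_sqr; first by rewrite !mulr_ge0 // ltW.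
    by apply: (le_trans c2); rewrite sV (grad2_xi_norm hx hN ho hu) le_eqVlt; apply/orP; left; apply/eqP; ring.
  rewrite normrM ger0_norm ?mulr_ge0 ?exprn_ge0 ?(ltW c0) //.
  apply: (le_trans (ler_wpM2l _ cb)); first by rewrite mulr_ge0 // exprn_ge0 // ltW.
  by rewrite le_eqVlt; apply/orP; left; apply/eqP; rewrite exprS; ring.
have /choice [g' Hg'] := Dg.
have [s hs1|s hs1 gE] := @MVT01 R g g'; first by case: (Hg' s hs1).
have [_ gr] := Hg' s hs1; move/andP: (hs1) => [s0 s1].
exists (t1 + (t2 - t1) * s).
  rewrite lerDl mulr_ge0 ?(ltW d0) //=; have := ler_wpM2l (ltW d0) s1; lra.
have g1 : g 1 = hc (cpt (vert t2 j)) ^+ n by rewrite /g lE mulr1 subrKC.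
have g0 : g 0 = hc (cpt (vert t1 j)) ^+ n by rewrite /g lE mulr0 addr0.
rewrite -g0 -g1 -opprB gE; apply: le_trans gr; rewrite -normrN; exact: ler_norm.
Qed.

(** Mean value points of adjacent cells may be arbitrarily close; cells of the same parity are
    separated by a whole cell. This costs the factor 2 in front of the integral. *)
Lemma sum_even_odd (F : nat -> R) (K : nat) :
  \sum_(i < K.*2) F i = \sum_(i < K) F i.*2 + \sum_(i < K) F i.*2.+1.
Proof.
elim: K => [|K IH]; first by rewrite !big_ord0 addr0.
by rewrite doubleS !big_ord_recr /= IH; ring.
Qed.

(** There are mm^k columns over a cube of edge [eta], each cut into 2K cells of height [sig].
    Telescoping c^n along a column turns the drop [D] into a sum over its mean value points, and
    disjoint balls around these convert it into the integral. The summand -1 collects the errors of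
    uniform continuity. *)
Lemma column_estimate (eta T D Cm s0 d sig : R) (mm K : nat) :
  0 < eta -> eta <= 1 -> T <= 1 -> (0 < mm)%N -> sig = eta / mm%:R -> eta + K.*2%:R * sig = T ->
  T ^+ 2 + k%:R * eta ^+ 2 < rho -> 1 <= Cm ->
  (forall t j, eta <= t <= T -> (forall a, 0 <= j a <= eta) ->
    [/\ hc (cpt (vert t j)) <= Cm,
        forall s : R, 0 < s -> s < s0 -> ((ball_const R n * s ^+ n)%:E <= vol (mball C x (cpt (vert t j)) s))%E &
        forall z, mball C x (cpt (vert t j)) d z -> `|h z - h (cpt (vert t j))| < (Cm ^+ n)^-1]) ->
  sig * Cm / 16 < s0 -> sig * Cm / 16 < d -> sig * Cm / 16 <= 4^-1 ->
  (forall j, (forall a, 0 <= j a <= eta) ->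
     D <= hc (cpt (vert eta j)) ^+ n - hc (cpt (vert T j)) ^+ n) ->
  ball_const R n / 16 ^+ n * (eta ^+ k * D / (2 * n%:R) - 1) <= 2 * fine (\int[vol]_z (h z)%:E).
Proof.
move=> e0 e1 T1 mm0 sigE TE Trho C1 Hpt ss0 ssd ss4 HD.
have aux1 (i e : nat) : (i < K)%N -> (e < 2)%N -> (i.*2 + e < K.*2)%N.
  by move=> iK e2; apply: (@leq_trans i.+1.*2); [rewrite doubleS -addn2 -addnS leq_add2l|rewrite leq_double].
have aux2 (i i' e : nat) : (i < i')%N -> ((i.*2 + e).+2 <= i'.*2 + e)%N.
  by move=> ii; rewrite -!addSn -doubleS leq_add2r leq_double.
have aux3 (t t' a1 a2 a3 s : R) : t <= a1 -> a2 - a1 = s -> a2 <= a3 -> a3 <= t' -> s <= t' - t by lra.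
have m0 : 0 < (mm%:R : R) by rewrite ltr0n.
have sig0 : 0 < sig by rewrite sigE divr_gt0.
pose J := {ffun 'I_k -> 'I_mm}; pose jj (f : J) (a : 'I_k) : R := sig * (f a)%:R.
pose tk (i : nat) : R := eta + i%:R * sig.
have jj_le f a : 0 <= jj f a <= eta.
  rewrite mulr_ge0 ?(ltW sig0) //= /jj sigE -mulrA ler_piMr ?(ltW e0) //.
  by rewrite mulrC ler_pdivrMr // mul1r ler_nat ltnW.
have tkS i : tk i.+1 - tk i = sig by rewrite /tk -natr1; ring.
have tk_le i i' : (i <= i')%N -> tk i <= tk i'.
  by move=> ii; rewrite lerD2l ler_wpM2r ?(ltW sig0) // ler_nat.
have tk0 : tk 0 = eta by rewrite /tk mul0r addr0.
have tkK : tk K.*2 = T by [].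
have ball_rho t j : eta <= t <= T -> (forall a, 0 <= j a <= eta) -> 0 < sqsum (vert t j) < rho.
  move=> /andP[t0 t1] hj; rewrite sqsum_vert; apply/andP; split.
    by rewrite ltr_pwDl ?exprn_gt0 ?(lt_le_trans e0) // sumr_ge0 // => a _; exact: sqr_ge0.
  apply: le_lt_trans Trho; rewrite lerD //.
    by rewrite ler_pXn2r ?nnegrE ?(le_trans (ltW e0)) //; exact: le_trans t1.
  apply: (@le_trans _ _ (\sum_(a < k) eta ^+ 2)).
    by apply: ler_sum => a _; have /andP[j0 j1] := hj a; rewrite ler_pXn2r ?nnegrE // ltW.
  by rewrite sumr_const card_ord mulr_natl.
have /choice [ts Hts] : forall fi : J * nat, exists t, (fi.2 < K.*2)%N -> tk fi.2 <= t <= tk fi.2.+1 /\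
    hc (cpt (vert (tk fi.2) (jj fi.1))) ^+ n - hc (cpt (vert (tk fi.2.+1) (jj fi.1))) ^+ n <=
    sig * (2 * n%:R * (h (cpt (vert t (jj fi.1))) * hc (cpt (vert t (jj fi.1))) ^+ n)).
  move=> [f i] /=; case: (ltnP i K.*2) => iK; last by exists 0.
  have [|||t tt H] := @vertical_mvt (jj f) (tk i) (tk i.+1).
  - by apply: lt_le_trans e0 _; rewrite -tk0 tk_le.
  - by rewrite -subr_gt0 tkS.
  - have tr : eta <= tk i.+1 <= T by rewrite -{1}tk0 -tkK !tk_le.
    by case/andP: (ball_rho _ _ tr (jj_le f)).
  by exists t => _; rewrite tkS in H.
have ts_rng f i : (i < K.*2)%N -> eta <= ts (f, i) <= T.
  move=> iK; have [/andP[t1 t2] _] := Hts (f, i) iK.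
  by rewrite (le_trans _ t1) -?{1}tk0 ?tk_le //= (le_trans t2) // -tkK tk_le.
pose y f i := vert (ts (f, i)) (jj f); pose p f i := cpt (y f i).
pose v f i := ball_const R n * (sig * hc (p f i) / 16) ^+ n.
(* A lower bound of |xi^T| on the whole ball. Its error Cm^-n, multiplied by c^n <= Cm^n, is at most
   1 per cell before the factor sig^n. *)
pose et f i := Num.max 0 (h (p f i) - (Cm ^+ n)^-1).
have c0 q : 0 < hc q by exact: (hcosh_gt0 ho hu).
have rad f i : (i < K.*2)%N -> sig * hc (p f i) / 16 <= sig * Cm / 16.
  move=> iK; have [cC _ _] := Hpt _ _ (ts_rng f i iK) (jj_le f).
  by rewrite ler_pM2r ?invr_gt0 // ler_pM2l.
have parity (e : nat) : (e < 2)%N ->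
    \sum_(q : 'I_K * J) et q.2 (q.1.*2 + e)%N * v q.2 (q.1.*2 + e)%N <= fine (\int[vol]_z (h z)%:E).
  move=> e2; have iK (i : 'I_K) : (i.*2 + e < K.*2)%N by exact: aux1.
  apply: (@sum_disjoint_le_integral R _ _ vol h _
    (fun q : 'I_K * J => mball C x (p q.2 (q.1.*2 + e)%N) (sig * hc (p q.2 (q.1.*2 + e)%N) / 16))
    (fun q : 'I_K * J => et q.2 (q.1.*2 + e)%N) (fun q : 'I_K * J => v q.2 (q.1.*2 + e)%N) hint).
  - by move=> z; exact: xi_norm_ge0.
  - by move=> q; exact: (mball_measurable hM hx).
  - move=> [i f] [i' f'] z /= m1 m2; apply/eqP/negPn/negP => neq.
    have /andP[g1 g2] := ball_rho _ _ (ts_rng f _ (iK i)) (jj_le f).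
    have /andP[g3 g4] := ball_rho _ _ (ts_rng f' _ (iK i')) (jj_le f').
    have b1 := le_trans (rad f _ (iK i)) ss4; have b2 := le_trans (rad f' _ (iK i')) ss4.
    (* Different columns differ by at least [sig] in a horizontal coordinate; in one column, two
       cells of equal parity have a full cell between them. *)
    have [l sl] : exists l, sig <= `|y f (i.*2 + e)%N l - y f' (i'.*2 + e)%N l|.
      have [ff|/eqP ff] := eqVneq f f'; last first.
        have [a fa] : exists a, f a != f' a.
          by apply/existsP; apply: contra_notT ff => /existsPn H; apply/ffunP => a; apply/eqP/negPn.
        exists (lift ord0 a); rewrite /y /vert liftK /jj -mulrBr normrM (gtr0_norm sig0).
        by rewrite ler_peMr ?(ltW sig0) // natr_dist_ge1.
      exists ord0; rewrite /y /vert unlift_none.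
      have ii : (i : nat) != i' by apply: contra neq => /eqP ii; rewrite ff; apply/eqP; congr (_, _); exact: val_inj.
      have [/andP[a1 a2] _] := Hts (f, _) (iK i); have [/andP[a3 a4] _] := Hts (f', _) (iK i').
      case: (ltngtP i i') ii => // lt_ii _.
        rewrite distrC; apply: le_trans (ler_norm _).
        exact: (aux3 _ _ _ _ _ _ a2 (tkS _) (tk_le _ _ (aux2 _ _ e lt_ii)) a3).
      apply: le_trans (ler_norm _).
      exact: (aux3 _ _ _ _ _ _ a4 (tkS _) (tk_le _ _ (aux2 _ _ e lt_ii)) a1).
    exact: (balls_disjoint sig0 g1 (ltW g2) g3 (ltW g4) sl b1 b2 m1 m2).
  - move=> [i f] z /= pz; have [_ _ Hz] := Hpt _ _ (ts_rng f _ (iK i)) (jj_le f).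
    rewrite ge_max xi_norm_ge0 /=.
    have /Hz : mball C x (p f (i.*2 + e)%N) d z.
      by apply: mballW pz; apply: (le_trans (rad f _ (iK i))); exact: ltW.
    by rewrite ltr_norml => /andP[+ _]; rewrite /p /y; lra.
  - by move=> [i f] /=; rewrite le_max lexx.
  move=> [i f] /=; have [_ Hv _] := Hpt _ _ (ts_rng f _ (iK i)) (jj_le f).
  apply: Hv; first by rewrite divr_gt0 // mulr_gt0.
  exact: le_lt_trans (rad f _ (iK i)) ss0.
have pairE e : \sum_(q : 'I_K * J) et q.2 (q.1.*2 + e)%N * v q.2 (q.1.*2 + e)%N =
    \sum_f \sum_(i < K) et f (i.*2 + e)%N * v f (i.*2 + e)%N.
  by rewrite exchange_big /= pair_bigA.
have tot : \sum_f \sum_(i < K.*2) et f i * v f i <= 2 * fine (\int[vol]_z (h z)%:E).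
  rewrite (eq_bigr (fun f => \sum_(i < K) et f i.*2 * v f i.*2 + \sum_(i < K) et f i.*2.+1 * v f i.*2.+1));
    last by move=> f _; exact: (sum_even_odd (fun i => et f i * v f i)).
  rewrite big_split /= mulr_natl mulr2n; apply: lerD.
    have := parity 0 isT; rewrite pairE; apply: le_trans; rewrite le_eqVlt; apply/orP; left; apply/eqP.
    by apply: eq_bigr => f _; apply: eq_bigr => i _; rewrite addn0.
  have := parity 1 isT; rewrite pairE; apply: le_trans; rewrite le_eqVlt; apply/orP; left; apply/eqP.
  by apply: eq_bigr => f _; apply: eq_bigr => i _; rewrite addn1.
apply: le_trans tot.
pose be := ball_const R n / 16 ^+ n; have be0 : 0 < be by rewrite divr_gt0 ?ball_const_gt0 // exprn_gt0.
have n0 : 0 < (2 * n%:R : R) by rewrite mulr_gt0 // ltr0n.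
have col f : be * sig ^+ n * (D / (2 * n%:R * sig) - K.*2%:R) <= \sum_(i < K.*2) et f i * v f i.
  pose F i := hc (cpt (vert (tk i) (jj f))) ^+ n.
  have tele : \sum_(i < K.*2) (F i - F i.+1) = F 0 - F K.*2.
    elim: (K.*2) => [|m IH]; first by rewrite big_ord0 subrr.
    by rewrite big_ord_recr /= IH addrA subrK.
  apply: (@le_trans _ _ (\sum_(i < K.*2) be * sig ^+ n * ((F i - F i.+1) / (2 * n%:R * sig) - 1))).
    rewrite -mulr_sumr ler_wpM2l ?mulr_ge0 ?exprn_ge0 ?(ltW be0) ?(ltW sig0) //.
    rewrite sumrB -mulr_suml tele sumr_const card_ord lerD2r ler_wpM2r ?invr_ge0 ?mulr_ge0 ?(ltW n0) ?(ltW sig0) //.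
    by rewrite /F tk0 tkK; exact: (HD _ (jj_le f)).
  apply: ler_sum => i _; have [_ Hi] := Hts (f, i : nat) (ltn_ord i).
  have [cC _ _] := Hpt _ _ (ts_rng f i (ltn_ord i)) (jj_le f).
  have -> : v f i = be * sig ^+ n * hc (p f i) ^+ n.
    by rewrite /v /be !exprMn exprVn; ring.
  rewrite mulrCA ler_wpM2l ?mulr_ge0 ?exprn_ge0 ?(ltW be0) ?(ltW sig0) //.
  have cn0 : 0 <= hc (p f i) ^+ n by rewrite exprn_ge0 // ltW.
  apply: (@le_trans _ _ ((h (p f i) - (Cm ^+ n)^-1) * hc (p f i) ^+ n)); last first.
    by rewrite ler_wpM2r // le_max lexx orbT.
  rewrite [leRHS]mulrBl lerB //.
    by rewrite ler_pdivrMr ?mulr_gt0 //; apply: (le_trans Hi); rewrite -/(y f i) -/(p f i) le_eqVlt; apply/orP; left; apply/eqP; ring.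
  rewrite mulrC ler_pdivrMr ?exprn_gt0 ?(lt_le_trans ltr01) // mul1r.
  by rewrite ler_pXn2r ?nnegrE ?(ltW (c0 _)) // (le_trans ler01).
apply: (@le_trans _ _ (\sum_(f : J) be * sig ^+ n * (D / (2 * n%:R * sig) - K.*2%:R))); last first.
  by apply: ler_sum => f _; exact: col.
rewrite sumr_const card_ffun !card_ord -[leRHS]mulr_natl natrX -/be.
have -> : mm%:R ^+ k * (be * sig ^+ n * (D / (2 * n%:R * sig) - K.*2%:R)) =
    be * (eta ^+ k * (D / (2 * n%:R) - K.*2%:R * sig)).
  have -> : eta ^+ k = mm%:R ^+ k * sig ^+ k by rewrite -exprMn sigE mulrC divfK // gt_eqF.
  have nn0 := lt0r_neq0 n0; have sn0 := lt0r_neq0 sig0.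
  by move: (2 * n%:R : R) nn0 => nn nn0; rewrite exprS; field; rewrite nn0 sn0.
rewrite ler_pM2l // mulrBr mulrA lerD2l lerN2.
have ek : eta ^+ k <= 1 by rewrite exprn_ile1 // ltW.
have Ks : K.*2%:R * sig <= 1 by lra.
by rewrite mulr_ile1 ?exprn_ge0 ?mulr_ge0 ?(ltW e0) ?(ltW sig0).
Qed.

(** The product of the direction minus [w0] with the first basis vector is [t], so the direction
    keeps distance [eta] from this puncture; [good_radius] handles the others. *)
Lemma region_compact (eta : R) : 0 < eta -> exists2 K : set M, compact K &
  forall t j, eta <= t -> 0 < sqsum (vert t j) -> sqsum (vert t j) <= rho -> K (cpt (vert t j)).
Proof.
move=> e0; have [_ r4 [d d0 Hd] Hr] := hrho.
have a0 : 0 < Num.min eta d by rewrite lt_min e0.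
have [D HD] := away_from_punctures_bounded hM hx hconn ho hu point a0.
have r0 : 0 < `|D| + 1 by rewrite ltr_wpDl.
exists (cmball C x point (`|D| + 1)); first exact: cmball_compact.
move=> t j et y0 yr; have [ay _ _] := Hr _ y0 yr.
apply: mball_sub_cmball; apply: (mdist_lt hM hx hconn); apply: (@le_lt_trans _ _ D); last first.
  by apply: (le_lt_trans (ler_norm D)); rewrite ltrDl.
apply: HD => w wQ; rewrite /cpt (dir_pt ho hu ay) ge_min; apply/orP.
have [->|ww0] := eqVneq w w0; [left|by right; exact: Hd].
have bo0 : lor (b ord0) o = 0 by case: hb.
have bw : lor (b ord0) w0 = 0 by case: hb.
have bb : lnorm (b ord0) = 1 by rewrite /lnorm; case: hb => -> _ _; rewrite eqxx sqrtr1.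
have po : lor (polar (vert t j) - w0) o = 0 by rewrite lorDl lorNl (polar_perp w0o hb) w0o subrr.
have := lor_le_lnorm oo bo0 po; rewrite bb mul1r lorDr lorNr bw subr0 (polar_coord hb).
by rewrite {1}/vert unlift_none; apply: le_trans.
Qed.

Lemma compact_bounded_above (K : set M) (f : M -> R) : compact K -> continuous f ->
  exists2 c : R, 1 <= c & forall p, K p -> f p <= c.
Proof.
move=> cK cf; have /compact_bounded [c [_ Hc]] := continuous_compact (continuous_subspaceT cf) cK.
exists (`|c| + 1); first by rewrite lerDr.
move=> p Kp; apply: le_trans (ler_norm _) _; apply: (Hc (`|c| + 1)); last by exists p.
by apply: (le_lt_trans (ler_norm c)); rewrite ltrDl.
Qed.

Lemma puncture_absurd : False.
Proof.
have [r0 r4 _ Hr] := hrho.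
have n0 : 0 < (n%:R : R) by rewrite ltr0n.
have n1 : 1 <= (n%:R : R) by rewrite ler1n.
(* With all n coordinates at most T, the squared length is at most n T^2 < rho. *)
pose T := rho / (2 * n%:R); have T0 : 0 < T by rewrite divr_gt0 // mulr_gt0.
have T1 : T <= 1.
  rewrite ler_pdivrMr ?mulr_gt0 // mul1r; lra.
have nT : n%:R * T ^+ 2 < rho.
  have h : n%:R * T = rho / 2 by rewrite /T; move: (n%:R : R) n0 => m m0; field; rewrite gt_eqF.
  rewrite expr2 mulrA h; have : rho / 2 * T <= rho / 2 by rewrite ler_piMr // divr_ge0 // ltW.
  lra.
have kT (eta : R) : 0 < eta -> eta <= T -> T ^+ 2 + k%:R * eta ^+ 2 < rho.
  move=> e0 eT; apply: le_lt_trans nT; rewrite -[n%:R]nat1r mulrDl mul1r lerD2l.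
  by rewrite ler_wpM2l // ler_pXn2r ?nnegrE // ltW.
have sq_le (eta t : R) (j : 'I_k -> R) : 0 < eta -> eta <= T -> eta <= t <= T ->
    (forall a, 0 <= j a <= eta) -> 0 < sqsum (vert t j) < rho.
  move=> e0 eT /andP[t1 t2] hj; rewrite sqsum_vert; apply/andP; split.
    by rewrite ltr_pwDl ?exprn_gt0 ?(lt_le_trans e0) // sumr_ge0 // => a _; exact: sqr_ge0.
  apply: le_lt_trans (kT _ e0 eT); rewrite lerD //.
    by rewrite ler_pXn2r ?nnegrE ?(le_trans (ltW e0)) //; exact: le_trans t2.
  apply: (@le_trans _ _ (\sum_(a < k) eta ^+ 2)).
    by apply: ler_sum => a _; have /andP[j0 j1] := hj a; rewrite ler_pXn2r ?nnegrE // ltW.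
  by rewrite sumr_const card_ord mulr_natl.
have hcc : continuous hc by exact: (hcosh_continuous hx).
have [KT cKT HKT] := region_compact T0.
have [C0 C01 HC0] := compact_bounded_above cKT hcc.
pose J := fine (\int[vol]_z (h z)%:E).
pose be := ball_const R n / 16 ^+ n; have be0 : 0 < be by rewrite divr_gt0 ?ball_const_gt0 // exprn_gt0.
have J0 : 0 <= J by apply: fine_ge0; apply: integral_ge0 => z _; rewrite lee_fin xi_norm_ge0.
(* [column_estimate] bounds eta^k D by 2n(2J/be + 1), whereas |y| <= n eta at the bottom gives c >=
   1/(n eta) and eta^k D >= 1/(n^n eta) - C0^n. An [eta] with 1/(n^n eta) > Z contradicts this; it
   is taken as an integral fraction of T. *)
pose Z := C0 ^+ n + 2 * n%:R * (2 * J / be + 1).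
have C0n : 0 < C0 ^+ n by rewrite exprn_gt0 // (lt_le_trans ltr01).
have Z0 : 0 < Z.
  by rewrite ltr_pwDl // !mulr_ge0 ?addr_ge0 ?divr_ge0 ?mulr_ge0 ?(ltW n0) ?(ltW be0).
have nn0 : 0 < (n%:R : R) ^+ n by rewrite exprn_gt0.
pose l := Num.truncn (T * Z * n%:R ^+ n).
pose eta := T / l.+1%:R; have l0 : 0 < (l.+1%:R : R) by rewrite ltr0n.
have e0 : 0 < eta by rewrite divr_gt0.
have eT : eta <= T by rewrite ler_pdivrMr // ler_peMr ?(ltW T0) // ler1n.
have eZ : Z < (n%:R ^+ n)^-1 / eta.
  rewrite ltr_pdivlMr // -[X in _ < X]div1r ltr_pdivlMr // /eta mulrA mulrAC ltr_pdivrMr // mul1r.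
  by rewrite [Z * T]mulrC truncnS_gt.
have eE : eta * l.+1%:R = T by rewrite /eta divfK // gt_eqF.
clearbody eta.
have [K cK HK] := region_compact e0.
have [Cm Cm1 HCm] := compact_bounded_above cK hcc.
have [s0 s00 VB] := mball_volume_compact hM hx hvol cK.
have Cmn0 : 0 < (Cm ^+ n)^-1 by rewrite invr_gt0 exprn_gt0 // (lt_le_trans ltr01).
have [d d0 Hd] := compact_uniform cK Cmn0.
pose mu := Num.min (Num.min s0 d) 4^-1.
have mu0 : 0 < mu by rewrite !lt_min s00 d0 /=.
have Cm0 : 0 < Cm by exact: lt_le_trans ltr01 Cm1.
pose m := Num.truncn (eta * Cm / 16 / mu).
have m0 : 0 < (m.+1%:R : R) by rewrite ltr0n.
(* The denominator is even, so that T - eta = l eta consists of an even number 2 l (m+1) of cells; m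
   makes the balls small enough for all three thresholds. *)
pose sig := eta / (m.+1.*2)%:R.
have m20 : 0 < (m.+1.*2%:R : R) by rewrite ltr0n.
have smu : sig * Cm / 16 < mu.
  apply: (@le_lt_trans _ _ (eta * Cm / 16 / m.+1%:R)); last first.
    by rewrite ltr_pdivrMr // -ltr_pdivrMl // mulrC truncnS_gt.
  have -> : sig * Cm / 16 = eta * Cm / 16 / m.+1.*2%:R by rewrite /sig; ring.
  rewrite ler_pM2l; last by rewrite divr_gt0 // mulr_gt0.
  by rewrite lef_pV2 ?posrE // ler_nat -addnn leq_addr.
have := @column_estimate eta T ((n%:R * eta)^-1 ^+ n - C0 ^+ n) Cm s0 d sig m.+1.*2 (l * m.+1)%N e0
  (le_trans eT T1) T1 isT erefl _ (kT _ e0 eT) Cm1 _ _ _ _ _.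
have TE : eta + (l * m.+1).*2%:R * sig = T.
  rewrite doubleMr natrM -eE /sig -natr1; move: (m.+1.*2%:R : R) m20 => M2 M20.
  by field; rewrite gt_eqF.
have s1 : sig * Cm / 16 < s0 by apply: lt_le_trans smu _; rewrite !ge_min lexx.
have s2 : sig * Cm / 16 < d by apply: lt_le_trans smu _; rewrite !ge_min lexx !orbT.
have s3 : sig * Cm / 16 <= 4^-1 by apply: ltW; apply: lt_le_trans smu _; rewrite !ge_min lexx !orbT.
move=> /(_ TE _ s1 s2 s3) H.
have {H} : be * (eta ^+ k * ((n%:R * eta)^-1 ^+ n - C0 ^+ n) / (2 * n%:R) - 1) <= 2 * J.
  apply: H => [t j te hj|j hj].
    have /andP[y0 y1] := sq_le _ _ _ e0 eT te hj; have /andP[te1 _] := te.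
    have Kp := HK t j te1 y0 (ltW y1); split; [exact: HCm|exact: VB|].
    by move=> z; exact: Hd.
  have te : eta <= eta <= T by rewrite lexx.
  have /andP[y0 y1] := sq_le _ _ _ e0 eT te hj.
  have tT : eta <= T <= T by rewrite eT lexx.
  have /andP[z0 z1] := sq_le _ _ _ e0 eT tT hj.
  have c0 := hcosh_gt0 ho hu (cpt (vert eta j)).
  apply: lerB.
    rewrite ler_pXn2r ?nnegrE ?(ltW c0) ?invr_ge0 ?mulr_ge0 ?(ltW n0) ?(ltW e0) //.
    have := inv_hcosh_puncture hn hM hx hN hconn hcomplete hB ho hu hQ w0Q hb hrho y0 y1.
    rewrite -[X in X <= _]invrK => hi.
    rewrite -[leRHS]invrK lef_pV2 ?posrE ?invr_gt0 ?mulr_gt0 //.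
    move: hi; rewrite invrK => /le_trans; apply.
    have ne0 : 0 <= n%:R * eta by rewrite mulr_ge0 ?(ltW n0) ?(ltW e0).
    rewrite -[leRHS](ger0_norm ne0) -sqrtr_sqr ler_sqrt ?sqr_ge0 // sqsum_vert exprMn.
    apply: (@le_trans _ _ (n%:R * eta ^+ 2)).
      rewrite -[n%:R]nat1r mulrDl mul1r lerD2l -[k in k%:R]card_ord mulr_natl -sumr_const.
      by apply: ler_sum => a _; have /andP[j0 j1] := hj a; rewrite ler_pXn2r ?nnegrE // ltW.
    by rewrite ler_wpM2r ?sqr_ge0 // expr2 ler_peMl // ltW.
  have cT := hcosh_gt0 ho hu (cpt (vert T j)).
  rewrite ler_pXn2r ?nnegrE ?(ltW cT) ?(le_trans ler01) //; apply: HC0.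
  exact: HKT (lexx T) z0 (ltW z1).
have ek1 : eta ^+ k <= 1 by rewrite exprn_ile1 ?(ltW e0) // (le_trans eT).
have ek0 : 0 <= eta ^+ k by rewrite exprn_ge0 // ltW.
have hD : (n%:R ^+ n)^-1 / eta - C0 ^+ n <= eta ^+ k * ((n%:R * eta)^-1 ^+ n - C0 ^+ n).
  have -> : eta ^+ k * ((n%:R * eta)^-1 ^+ n - C0 ^+ n) = (n%:R ^+ n)^-1 / eta - eta ^+ k * C0 ^+ n.
    rewrite mulrBr; congr (_ - _); rewrite exprVn exprMn invfM mulrCA; congr (_ * _).
    by rewrite exprS invfM mulrCA divff ?mulr1 // expf_neq0 // gt_eqF.
  by rewrite lerD2l lerN2 ler_piMl // ltW.
rewrite -ler_pdivlMl // => H.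
have h1 : eta ^+ k * ((n%:R * eta)^-1 ^+ n - C0 ^+ n) <= 2 * n%:R * (2 * J / be + 1).
  rewrite [leRHS]mulrC -ler_pdivrMr ?mulr_gt0 // -lerBlDr.
  by apply: (le_trans H); rewrite mulrC.
by move: eZ; rewrite /Z; lra.
Qed.
End VolumeAtPuncture.

(** * The Laplacian of the immersion and of the normal *)

(** Where one factor vanishes, continuity of the other is enough. This serves to differentiate an
    inverse matrix. *)
Lemma is_derive_mul_zero (R : realType) (V : normedModType R) (f g : V -> R) (y v : V) (d : R) :
  {for y, continuous f} -> is_derive y v g d -> g y = 0 ->
  is_derive y v (fun z => f z * g z) (f y * d).
Proof.
move=> cf [dg dE] g0.
have cv : f (h *: v + y) @[h --> 0^'] --> f y.
  have c1 : {for 0, continuous (fun h : R => h *: v + y)}.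
    by apply: continuousD; [apply: cvgZl; exact: cvg_id|exact: cst_continuous].
  have c2 : {for 0, continuous (fun h : R => f (h *: v + y))}.
    by apply: (continuous_comp c1); rewrite scale0r add0r.
  by have /continuous_withinNx := c2; rewrite scale0r add0r.
have cg : (h^-1 *: ((g \o shift y) (h *: v) - g y)) @[h --> 0^'] --> d by rewrite -dE.
have cfg : (h^-1 *: (((fun z => f z * g z) \o shift y) (h *: v) - f y * g y)) @[h --> 0^'] --> f y * d.
  have -> : (fun h : R => h^-1 *: (((fun z => f z * g z) \o shift y) (h *: v) - f y * g y)) =
      (fun h => f (h *: v + y) * (h^-1 *: ((g \o shift y) (h *: v) - g y))).
    by apply/funext => h; rewrite /= g0 mulr0 !subr0 /GRing.scale /=; ring.
  exact: (cvgM cv cg).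
by split; [apply/cvg_ex; exists (f y * d)|exact: cvg_lim cfg].
Qed.

Lemma lor_const_derive (R : realType) m n (U : set 'rV[R]_n) (F G : 'rV[R]_n -> 'rV[R]_m.+1)
    (k : R) (y v : 'rV[R]_n) :
  open U -> U y -> (forall z, U z -> lor (F z) (G z) = k) -> derivable F y v -> derivable G y v ->
  lor ('D_v F y) (G y) + lor (F y) ('D_v G y) = 0.
Proof.
move=> oU Uy H dF dG.
have [_] := is_derive_lor (DeriveDef dF erefl) (DeriveDef dG erefl).
move=> E; rewrite -E -[RHS](derive_cst k y v); apply: near_eq_derive.
by apply: filterS (open_nbhs_nbhs (conj oU Uy)) => z /H ->.
Qed.

Lemma double_sum_split (R : comNzRingType) n (f g k m : 'I_n -> 'I_n -> R) :
  \sum_a \sum_b (- (f a b + g a b) * k a b + m a b) =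
  - \sum_a \sum_b f a b * k a b - \sum_a \sum_b g a b * k a b + \sum_a \sum_b m a b.
Proof.
rewrite -!sumrN -!big_split; apply: eq_bigr => a _ /=.
by rewrite -!sumrN -!big_split; apply: eq_bigr => b _ /=; ring.
Qed.

Lemma cancel_sum (R : zmodType) n (k f g h : 'I_n -> R) :
  (forall a, k a = f a + g a - h a) -> \sum_a f a = \sum_a h a -> \sum_a k a = \sum_a g a.
Proof.
by move=> E e; rewrite (eq_bigr _ (fun a _ => E a)) sumrB big_split /= e addrAC subrr add0r.
Qed.

Lemma swap_terms (R : realType) (a1 b1 c1 d1 b2 c2 : R) :
  0 = a1 + b1 - (c1 + d1) -> b1 = b2 -> c1 = c2 -> a1 = c2 + d1 - b2.
Proof. by move=> h1 h2 h3; lra. Qed.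

Section Laplacian.
Variables (R : realType) (n : nat) (M : ptopologicalType) (C : M -> chart R n M).
Local Notation E := 'rV[R]_n.+2.
Variables (x N : M -> E).
Hypothesis hn0 : (0 < n)%N.
Hypothesis hM : oriented_manifold C.
Hypothesis hx : hyperbolic_embedding C x.
Hypothesis hN : unit_normal_field C x N.
Variable H : R.
Hypothesis hH : forall q, mean_curvature C x N q = H.
Variables (p : M) (T : 'M[R]_n).
Hypothesis hT : tangent_frame C x p T.
Let X := x \o cinv (C p).
Let NN := N \o cinv (C p).
Let U := chart_image (C p).
Let y0 := cmap (C p) p.
Let oU : open U. Proof. exact: (chart_image_open hM). Qed.
Let Uy0 : U y0. Proof. exact: (chart_image_center hM). Qed.
Let sX : smooth_on U X. Proof. exact: (smooth_x hx). Qed.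
Let sN : smooth_on U NN. Proof. exact: (smooth_N hN). Qed.
Let dX : forall y v, U y -> derivable X y v. Proof. by move=> y v Uy; have [+ _] := sX [::] Uy; apply. Qed.
Let dN : forall y v, U y -> derivable NN y v. Proof. by move=> y v Uy; have [+ _] := sN [::] Uy; apply. Qed.
Let d2X : forall y v w, U y -> derivable ('D_w X) y v. Proof. by move=> y v w Uy; have [+ _] := sX [:: w] Uy; apply. Qed.
Let d2N : forall y v w, U y -> derivable ('D_w NN) y v. Proof. by move=> y v w Uy; have [+ _] := sN [:: w] Uy; apply. Qed.

Let X_dX y v : U y -> lor ('D_v X y) (X y) = 0.
Proof.
move=> Uy; have h (z : 'rV[R]_n) : U z -> lor (X z) (X z) = -1 by rewrite (lor_xx hx).
have := lor_const_derive oU Uy h (@dX _ v Uy) (@dX _ v Uy); rewrite (lorC (X y)); lra.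
Qed.
Let N_dX y v : U y -> lor ('D_v X y) (NN y) = 0.
Proof. by move=> Uy; rewrite lorC; exact: (lor_N_dx_chart hM hx hN). Qed.
Let dN_X y v : U y -> lor ('D_v NN y) (X y) = 0.
Proof.
move=> Uy; have h (z : 'rV[R]_n) : U z -> lor (NN z) (X z) = 0 by rewrite (lor_Nx hN).
by have := lor_const_derive oU Uy h (@dN _ v Uy) (@dX _ v Uy); rewrite (lorC (NN y)) N_dX // addr0.
Qed.
Let dN_N y v : U y -> lor ('D_v NN y) (NN y) = 0.
Proof.
move=> Uy; have h (z : 'rV[R]_n) : U z -> lor (NN z) (NN z) = 1 by rewrite (lor_NN hN).
have := lor_const_derive oU Uy h (@dN _ v Uy) (@dN _ v Uy); rewrite (lorC (NN y)); lra.
Qed.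
Let ddX_X v w : lor ('D_w ('D_v X) y0) (X y0) = - lor ('D_v X y0) ('D_w X y0).
Proof.
have h (z : 'rV[R]_n) : U z -> lor ('D_v X z) (X z) = 0 by exact: X_dX.
by have := lor_const_derive oU Uy0 h (@d2X _ w v Uy0) (@dX _ w Uy0); lra.
Qed.
Let ddX_N y v w : U y -> lor ('D_w ('D_v X) y) (NN y) = - lor ('D_v X y) ('D_w NN y).
Proof.
move=> Uy; have h (z : 'rV[R]_n) : U z -> lor ('D_v X z) (NN z) = 0 by exact: N_dX.
by have := lor_const_derive oU Uy h (@d2X _ w v Uy) (@dN _ w Uy); lra.
Qed.
Let ddN_X v w : lor ('D_w ('D_v NN) y0) (X y0) = - lor ('D_v NN y0) ('D_w X y0).
Proof.
have h (z : 'rV[R]_n) : U z -> lor ('D_v NN z) (X z) = 0 by exact: dN_X.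
by have := lor_const_derive oU Uy0 h (@d2N _ w v Uy0) (@dX _ w Uy0); lra.
Qed.
Let ddN_N v w : lor ('D_w ('D_v NN) y0) (NN y0) = - lor ('D_v NN y0) ('D_w NN y0).
Proof.
have h (z : 'rV[R]_n) : U z -> lor ('D_v NN z) (NN z) = 0 by exact: dN_N.
by have := lor_const_derive oU Uy0 h (@d2N _ w v Uy0) (@dN _ w Uy0); lra.
Qed.
Let sff_sym y v w : U y -> lor ('D_v NN y) ('D_w X y) = lor ('D_w NN y) ('D_v X y).
Proof.
move=> Uy; have e := congr1 (fun z => lor z (NN y)) (schwarz v w oU sX Uy).
have e1 := @ddX_N y v w Uy; have e2 := @ddX_N y w v Uy.
have e3 : lor ('D_v X y) ('D_w NN y) = lor ('D_w X y) ('D_v NN y).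
  by apply: oppr_inj; exact: (etrans (esym e1) (etrans e e2)).
exact: (etrans (lorC _ _) (etrans (esym e3) (lorC _ _))).
Qed.

Let Gh y : 'M[R]_n := \matrix_(a, b) lor ('D_(row a T) X y) ('D_(row b T) X y).
Let hh y : 'M[R]_n := \matrix_(a, b) - lor ('D_(row a T) NN y) ('D_(row b T) X y).
(** The inverse Gram matrix in adjugate form, which makes its continuity visible. The vectors
    [row a T] are kept constant over the chart and are orthonormal at its centre. *)
Let K y : 'M[R]_n := (\det (Gh y))^-1 *: \adj (Gh y).

(** The mean curvature is defined at each point by the chart centred there; changing charts
    transports it to the fixed chart of [p], where the constancy of H can be differentiated. *)
Let chart_trace y : U y -> Gh y \in unitmx /\ \tr (K y *m hh y) = n%:R * H.
Proof.
move=> Uy; have [J uJ HJ] := chart_change hM Uy; set q := cinv (C p) y in HJ.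
have [S hS] := tangent_frame_exists hM hx q.
pose S' := T *m J *m invmx S.
have uS := frame_unitmx hS; have uT := frame_unitmx hT.
have uS' : S' \in unitmx by rewrite !unitmx_mul uT uJ unitmx_inv uS.
have rE a : row a T *m J = \sum_c S' a c *: row c S.
  rewrite -row_mul -[T *m J](mulmxKV uS) -/S'; apply/rowP => j; rewrite summxE !mxE.
  by apply: eq_bigr => c _; rewrite !mxE.
clearbody S'.
have EX a : 'D_(row a T) X y = \sum_c S' a c *: fV C x q S c.
  by rewrite (HJ _ x (smooth_x hx)) rE (dM_sum hM _ _ _ (smooth_x hx)).
have EN a : 'D_(row a T) NN y = \sum_c S' a c *: fU C N q S c.
  by rewrite (HJ _ N (smooth_N hN)) rE (dM_sum hM _ _ _ (smooth_N hN)).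
have GE : Gh y = S' *m S'^T.
  apply/matrixP => a b; rewrite !mxE !EX lor_suml; apply: eq_bigr => c _.
  rewrite lorZl lor_sumr [S'^T c b]mxE (bigD1 c) //= big1 => [|e ec]; last first.
    by rewrite lorZr (frame_gram hM hx hS) eq_sym (negbTE ec) mulr0.
  by rewrite addr0 lorZr (frame_gram hM hx hS) eqxx mulr1.
have hE : hh y = S' *m (\matrix_(c, e) fk C x N q S c e) *m S'^T.
  apply/matrixP => a b; rewrite !mxE EX EN lor_suml -sumrN.
  under [RHS]eq_bigr => e _ do rewrite !mxE mulr_suml.
  rewrite exchange_big /=; apply: eq_bigr => c _; rewrite lorZl lor_sumr mulr_sumr -sumrN.
  by apply: eq_bigr => e _; rewrite lorZr !mxE /fk; ring.
have uG : Gh y \in unitmx by rewrite GE unitmx_mul uS' unitmx_tr.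
split=> //; have -> : K y = invmx (Gh y) by rewrite /invmx uG.
have -> : \tr (invmx (Gh y) *m hh y) = \tr (\matrix_(c, e) fk C x N q S c e).
  rewrite hE mxtrace_mulC -!mulmxA mxtrace_mulC -!mulmxA.
  suff -> : S'^T *m (invmx (Gh y) *m S') = 1%:M by rewrite mulmx1.
  by rewrite mulmxA -[S'^T](mulKmx uS') -GE -!mulmxA [X in _ *m X]mulmxA mulmxV // mul1mx mulVmx.
have [trS _] := shape_frame hM hx hN hS.
have := hH q; rewrite /mean_curvature trS => hq.
rewrite -hq mulrC divfK ?pnatr_eq0 -?lt0n //.
by apply: eq_bigr => a _; rewrite mxE.
Qed.

Let Gh0 : Gh y0 = 1%:M.
Proof. by apply/matrixP => a b; rewrite !mxE; exact: (frame_gram hM hx hT). Qed.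

Let G_derive c a b : is_derive y0 c (fun y => Gh y a b)
  (lor ('D_c ('D_(row a T) X) y0) ('D_(row b T) X y0) + lor ('D_(row a T) X y0) ('D_c ('D_(row b T) X) y0)).
Proof.
have -> : (fun y => Gh y a b) = (fun y => lor ('D_(row a T) X y) ('D_(row b T) X y)).
  by apply/funext => y; rewrite mxE.
exact: (is_derive_lor (DeriveDef (@d2X _ c _ Uy0) erefl) (DeriveDef (@d2X _ c _ Uy0) erefl)).
Qed.

Let K_continuous a b : {for y0, continuous (fun y => K y a b)}.
Proof.
have cG i j : {for y0, continuous (fun y => Gh y i j)}.
  have -> : (fun y => Gh y i j) = (fun y => lor ('D_(row i T) X y) ('D_(row j T) X y)).
    by apply/funext => y; rewrite mxE.
  have [_ c1] := sX [:: row i T] Uy0; have [_ c2] := sX [:: row j T] Uy0.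
  exact: continuous_lor c1 c2.
have -> : (fun y => K y a b) = (fun y => (\det (Gh y))^-1 * ((-1) ^+ (b + a) * \det (row' b (col' a (Gh y))))).
  by apply/funext => y; rewrite !mxE.
have c1 : {for y0, continuous (fun y => \det (Gh y))} by exact: continuous_for_det.
have d0 : \det (Gh y0) != 0 by rewrite Gh0 det1 oner_eq0.
have c2 : {for y0, continuous (fun y => \det (row' b (col' a (Gh y))))}.
  apply: continuous_for_det => i j; clear c1 d0.
  have -> : (fun y => row' b (col' a (Gh y)) i j) = (fun y => Gh y (lift b i) (lift a j)).
    by apply/funext => y; rewrite !mxE.
  exact: cG.
exact: (cvgM (cvgV d0 c1) (cvgM (cvg_cst _) c2)).
Qed.

Let K0 : K y0 = 1%:M.
Proof. by rewrite /K Gh0 det1 invr1 scale1r -[LHS]mulmx1 mul_adj_mx det1. Qed.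

(** From K G = 1 one has K = 1 - K (G - 1) near the centre, and G - 1 vanishes at the centre. *)
Let K_derive c a b : is_derive y0 c (fun y => K y a b)
  (- (lor ('D_c ('D_(row a T) X) y0) ('D_(row b T) X y0) + lor ('D_(row a T) X y0) ('D_c ('D_(row b T) X) y0))).
Proof.
set D := _ + _.
have Dg e : is_derive y0 c (fun y => Gh y e b - (e == b)%:R)
   (lor ('D_c ('D_(row e T) X) y0) ('D_(row b T) X y0) + lor ('D_(row e T) X y0) ('D_c ('D_(row b T) X) y0) - 0).
  exact: (is_deriveB (G_derive c e b) (is_derive_cst ((e == b)%:R : R) y0 c)).
have DK : is_derive y0 c (fun y => (a == b)%:R - \sum_e K y a e * (Gh y e b - (e == b)%:R)) (0 - D).
  apply: (is_deriveB (is_derive_cst ((a == b)%:R : R) y0 c)).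
  have z e : Gh y0 e b - (e == b)%:R = 0 by rewrite Gh0 mxE subrr.
  have DS := is_derive_sumf (fun e => is_derive_mul_zero (@K_continuous a e) (Dg e) (z e)).
  apply: (is_derive_eq DS).
  rewrite (bigD1 a) //= big1 => [|e ea]; last by rewrite K0 mxE eq_sym (negbTE ea) mul0r.
  by rewrite K0 mxE eqxx mul1r subr0 addr0.
rewrite sub0r in DK; apply: near_eq_is_derive DK.
apply: filterS (open_nbhs_nbhs (conj oU Uy0)) => y Uy.
have [uG _] := chart_trace Uy.
have KG : K y *m Gh y = 1%:M by have -> : K y = invmx (Gh y); rewrite ?mulVmx // /invmx uG.
have := congr1 (fun A : 'M[R]_n => A a b) KG; rewrite !mxE => KGab.
under eq_bigr do rewrite mulrBr.
rewrite sumrB KGab (bigD1 b) //= eqxx mulr1 big1 => [|e eb]; last by rewrite (negbTE eb) mulr0.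
by rewrite addr0 subKr /K !mxE.
Qed.

(** Differentiate tr(K h) = nH. With A and B the two sides, the derivative of K contributes 2B, by
    the Weingarten formula and the symmetry of h, and the derivative of h contributes -(A + B). *)
Let trace_derive c : \sum_a lor ('D_c ('D_(row a T) NN) y0) ('D_(row a T) X y0) =
  \sum_a lor ('D_(row a T) NN y0) ('D_c ('D_(row a T) X) y0).
Proof.
have Dh a b : is_derive y0 c (fun y => hh y a b)
    (- (lor ('D_c ('D_(row a T) NN) y0) ('D_(row b T) X y0) + lor ('D_(row a T) NN y0) ('D_c ('D_(row b T) X) y0))).
  have -> : (fun y => hh y a b) = (fun y => - lor ('D_(row a T) NN y) ('D_(row b T) X y)).
    by apply/funext => y; rewrite mxE.
  exact: (is_deriveN (is_derive_lor (DeriveDef (@d2N _ c _ Uy0) erefl) (DeriveDef (@d2X _ c _ Uy0) erefl))).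
have Dt := is_derive_sumf (fun a => is_derive_sumf (fun b => is_derive_mulf (K_derive c a b) (Dh b a))).
have : 'D_c (fun y => \sum_a \sum_b K y a b * hh y b a) y0 = 0.
  rewrite -[RHS](derive_cst (n%:R * H : R) y0 c); apply: near_eq_derive.
  apply: filterS (open_nbhs_nbhs (conj oU Uy0)) => y Uy; have [_ <-] := chart_trace Uy.
  by apply: eq_bigr => a _; rewrite mxE.
have [_ ->] := Dt.
have hE a b : hh y0 a b = fk C x N p T a b by rewrite mxE.
have NE a : 'D_(row a T) NN y0 = - \sum_b hh y0 a b *: 'D_(row b T) X y0.
  rewrite [LHS](fUE hM hx hN hT); congr (- _); apply: eq_bigr => b _; by rewrite hE.
set A := \sum_a lor _ _; set B := \sum_a lor _ _.
have -> : \sum_a \sum_b (- (lor ('D_c ('D_(row a T) X) y0) ('D_(row b T) X y0) +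
    lor ('D_(row a T) X y0) ('D_c ('D_(row b T) X) y0)) * hh y0 b a +
    K y0 a b * - (lor ('D_c ('D_(row b T) NN) y0) ('D_(row a T) X y0) +
    lor ('D_(row b T) NN y0) ('D_c ('D_(row a T) X) y0))) = 2 * B - (A + B).
  have e1 : \sum_a \sum_b lor ('D_c ('D_(row a T) X) y0) ('D_(row b T) X y0) * hh y0 b a = - B.
    rewrite -sumrN; apply: eq_bigr => a _; rewrite NE lorNl opprK lorC lor_sumr; apply: eq_bigr => b _.
    by rewrite lorZr mulrC !hE (fk_sym hM hx hN).
  have e2 : \sum_a \sum_b lor ('D_(row a T) X y0) ('D_c ('D_(row b T) X) y0) * hh y0 b a = - B.
    rewrite exchange_big /= -e1; apply: eq_bigr => a _; apply: eq_bigr => b _.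
    by rewrite lorC !hE (fk_sym hM hx hN).
  have e3 : \sum_a \sum_b K y0 a b * - (lor ('D_c ('D_(row b T) NN) y0) ('D_(row a T) X y0) +
    lor ('D_(row b T) NN y0) ('D_c ('D_(row a T) X) y0)) = - (A + B).
    rewrite -big_split /= -sumrN; apply: eq_bigr => a _.
    rewrite (bigD1 a) //= big1 => [|b ba]; last by rewrite K0 mxE eq_sym (negbTE ba) mul0r.
    by rewrite K0 mxE eqxx mul1r addr0.
  rewrite (double_sum_split (fun a b => lor ('D_c ('D_(row a T) X) y0) ('D_(row b T) X y0))
    (fun a b => lor ('D_(row a T) X y0) ('D_c ('D_(row b T) X) y0)) (fun a b => hh y0 b a)
    (fun a b => K y0 a b * - (lor ('D_c ('D_(row b T) NN) y0) ('D_(row a T) X y0) +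
    lor ('D_(row b T) NN y0) ('D_c ('D_(row a T) X) y0)))) e1 e2 e3.
  by ring.
lra.
Qed.

Let S : E := \sum_a 'D_(row a T) ('D_(row a T) X) y0.
Let Z : E := \sum_a 'D_(row a T) ('D_(row a T) NN) y0.

(* The vector b accounts for the chart not being geodesic at p.  The Codazzi equation enters through
   the symmetry of the second fundamental form and the constancy of its trace near p. *)
Lemma laplacian_x_N : exists b : 'rV[R]_n,
  S = dM C x p b + (n%:R * H) *: N p + n%:R *: x p /\
  Z =
    dM C N p b - \tr (Defs.shape C x N p *m Defs.shape C x N p) *: N p - (n%:R * H) *: x p.
Proof.
have Xp : X y0 = x p by rewrite /X /= (cmapK hM (cdom_center hM p)).
have Np : NN y0 = N p by rewrite /NN /= (cmapK hM (cdom_center hM p)).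
have [tr1 tr2] := shape_frame hM hx hN hT.
have trH : \sum_a fk C x N p T a a = n%:R * H.
  by rewrite -tr1 -(hH p) /mean_curvature mulrC divfK // pnatr_eq0 -lt0n.
have NE a : 'D_(row a T) NN y0 = - \sum_b fk C x N p T a b *: 'D_(row b T) X y0.
  by rewrite [LHS](fUE hM hx hN hT).
have VV a b : lor ('D_(row a T) X y0) ('D_(row b T) X y0) = (a == b)%:R by exact: (frame_gram hM hx hT).
have Sx : lor S (x p) = - n%:R.
  rewrite lor_suml -Xp; under eq_bigr do rewrite ddX_X VV eqxx.
  by rewrite sumr_const card_ord mulNrn.
have SN : lor S (N p) = n%:R * H.
  rewrite lor_suml -Np -trH; apply: eq_bigr => a _.
  by rewrite (ddX_N _ _ Uy0); congr (- _); exact: lorC.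
pose W := S - n%:R *: x p - (n%:R * H) *: N p.
have Wx : lor W (x p) = 0 by rewrite /W !lorDl !lorNl !lorZl Sx (lor_Nx hN) (lor_xx hx); ring.
have WN : lor W (N p) = 0.
  by rewrite /W !lorDl !lorNl !lorZl SN (lor_NN hN) (lorC (x p)) (lor_Nx hN); ring.
have [b bW] := tangent_vector hM hx hN Wx WN; exists b; rewrite bW; split.
  by rewrite /W subrK subrK.
set S2 := \tr _.
suff : Z - dM C N p b + S2 *: N p + (n%:R * H) *: x p = 0.
  move=> /eqP; rewrite addr_eq0 => /eqP e.
  have -> : Z = Z - dM C N p b + S2 *: N p - S2 *: N p + dM C N p b by rewrite addrK subrK.
  by rewrite e addrC [- _ - _]addrC addrA.
rewrite [LHS](frame_decomposition _ (frame_lorentz hM hx hN hT)).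
have Zx : lor Z (x p) = n%:R * H.
  rewrite lor_suml -Xp -trH; apply: eq_bigr => a _; rewrite ddN_X; by [].
have ZN : lor Z (N p) = - S2.
  rewrite lor_suml -Np /S2 tr2 -sumrN; apply: eq_bigr => a _; rewrite ddN_N NE lorNl lorNr opprK.
  by rewrite lor_orthonormal_comb.
have ZV c : lor Z ('D_(row c T) X y0) = lor (dM C N p b) ('D_(row c T) X y0).
  have -> : lor (dM C N p b) ('D_(row c T) X y0) = lor ('D_(row c T) NN y0) S.
    rewrite (lor_dN_dx_sym hM hx hN p b (row c T)) bW /W !lorDr !lorNr !lorZr.
    by rewrite (lor_dN_N hM hN) (lor_dN_x hM hx hN); ring.
  rewrite lor_suml lor_sumr.
  (* Codazzi: the symmetry of the second fundamental form is differentiated in the direction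
     [row a T], and the second derivatives of x and N are exchanged. *)
  have h a : lor ('D_(row a T) ('D_(row a T) NN) y0) ('D_(row c T) X y0) =
     lor ('D_(row c T) ('D_(row a T) NN) y0) ('D_(row a T) X y0) +
     lor ('D_(row c T) NN y0) ('D_(row a T) ('D_(row a T) X) y0) -
     lor ('D_(row a T) NN y0) ('D_(row c T) ('D_(row a T) X) y0).
    have hs y : U y -> lor ('D_(row a T) NN y) ('D_(row c T) X y) - lor ('D_(row c T) NN y) ('D_(row a T) X y) = 0.
      by move=> Uy; apply/eqP; rewrite subr_eq0; apply/eqP; exact: sff_sym.
    have D1 := is_derive_lor (DeriveDef (@d2N _ (row a T) (row a T) Uy0) erefl) (DeriveDef (@d2X _ (row a T) (row c T) Uy0) erefl).
    have D2 := is_derive_lor (DeriveDef (@d2N _ (row a T) (row c T) Uy0) erefl) (DeriveDef (@d2X _ (row a T) (row a T) Uy0) erefl).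
    have [_ e] := is_deriveB D1 D2.
    have e0 : 'D_(row a T) ((fun q => lor ('D_(row a T) NN q) ('D_(row c T) X q)) -
        (fun q => lor ('D_(row c T) NN q) ('D_(row a T) X q))) y0 = 0.
      rewrite -[RHS](derive_cst (0 : R) y0 (row a T)); apply: near_eq_derive.
      by apply: filterS (open_nbhs_nbhs (conj oU Uy0)) => y /hs.
    have s1 := congr1 (lor ('D_(row a T) NN y0)) (schwarz (row c T) (row a T) oU sX Uy0).
    have s2 := congr1 (fun z => lor z ('D_(row a T) X y0)) (schwarz (row c T) (row a T) oU sN Uy0).
    exact: (swap_terms (etrans (esym e0) e) s1 s2).
  exact: (cancel_sum h (trace_derive _)).
rewrite !lorDl !lorNl !lorZl Zx ZN (lor_dN_x hM hx hN) (lor_dN_N hM hN) (lor_Nx hN) (lor_NN hN).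
rewrite (lor_xx hx) (lorC (x p)) (lor_Nx hN) big1 => [|c _].
  have -> : - (n%:R * H - 0 + S2 * 0 + n%:R * H * -1) = 0 by ring.
  have -> : - S2 - 0 + S2 * 1 + n%:R * H * 0 = 0 by ring.
  by rewrite !scale0r !addr0.
rewrite !lorDl !lorNl !lorZl ZV subrr (lor_N_dx hN) (lorC (x p)) (lor_dx_x hM hx).
by rewrite !mulr0 !addr0 scale0r.
Qed.
End Laplacian.

Lemma is_derive_cmul (R : realType) (V : normedModType R) (k : R) (f : V -> R) (y v : V) (a : R) :
  is_derive y v f a -> is_derive y v (fun z => k * f z) (k * a).
Proof. by move=> D; have := is_derive_mulf (is_derive_cst k y v) D; rewrite mul0r add0r. Qed.

(** A negative second derivative at 0 would make the first derivative negative just to the right of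
    0, and g would decrease there. *)
Lemma local_min_derivatives (R : realType) (g dg : R -> R) (d2 r : R) : 0 < r ->
  (forall s : R, `|s| < r -> is_derive s 1 g (dg s)) -> is_derive (0 : R) 1 dg d2 ->
  (forall s : R, `|s| < r -> g 0 <= g s) -> dg 0 = 0 /\ 0 <= d2.
Proof.
move=> r0 Dg Dd gmin.
have dg0 : dg 0 = 0.
  have D0 : is_derive (0 : R) 1 g 0.
    apply: (@derive1_at_min R g (- r) r 0).
    - lra.
    - by move=> t; rewrite in_itv /= => /andP[t1 t2]; have [] := Dg t ltac:(by rewrite ltr_norml t1).
    - by rewrite in_itv /=; lra.
    - by move=> t; rewrite in_itv /= => /andP[t1 t2]; apply: gmin; rewrite ltr_norml t1.
  have [_ <-] := Dg 0 ltac:(by rewrite normr0); by have [_ ->] := D0.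
split=> //; rewrite leNgt; apply/negP => d2n.
have : \forall h \near (0 : R)^', h^-1 * dg h < 0.
  have [dd dE] := Dd.
  have c : h^-1 *: ((dg \o shift 0) (h *: 1) - dg 0) @[h --> (0 : R)^'] --> d2 by rewrite -dE.
  have : \forall h \near (0 : R)^', h^-1 *: ((dg \o shift 0) (h *: 1) - dg 0) < 0.
    exact: (cvgr_lt _ c _ d2n).
  apply: filterS => h /=; rewrite dg0 subr0 addr0 /GRing.scale /= mulr1; apply.
move=> /nbhs_ballP [e /= e0 He].
pose s : R := Num.min e r / 2.
have s0 : 0 < s by rewrite divr_gt0 // lt_min e0.
have [se sr] : s < e /\ s < r.
  have : Num.min e r <= e /\ Num.min e r <= r by rewrite !ge_min !lexx orbT.
  have : 0 < Num.min e r by rewrite lt_min e0.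
  by rewrite /s; lra.
have [||t] := @MVT R g dg 0 s s0.
- by move=> t; rewrite in_itv /= => /andP[t1 t2]; apply: Dg; rewrite ger0_norm; lra.
- apply: derivable_within_continuous => t; rewrite in_itv /= => /andP[t1 t2].
  by have [] := Dg t ltac:(by rewrite ger0_norm //; exact: (le_lt_trans t2)).
rewrite in_itv /= => /andP[t1 t2] E.
have : t^-1 * dg t < 0.
  apply: He; last by rewrite gt_eqF.
  by rewrite -ball_normE /= sub0r normrN ger0_norm; lra.
rewrite pmulr_rlt0 ?invr_gt0 // => dgt.
have := gmin s; rewrite ger0_norm ?(ltW s0) // => /(_ sr).
have : dg t * (s - 0) < 0 by rewrite nmulr_rlt0 // subr0.
by rewrite -E; lra.
Qed.

Lemma laplacian_cancel (R : realType) m (LN LX dN dX N x w1 w2 A : 'rV[R]_m.+1) (s h k e eps al g : R) :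
  LN = dN - s *: N - h *: x -> LX = dX + h *: N + k *: x ->
  lor dN w1 + lor dX w2 - eps * (e * (al * lor dX A)) = 0 ->
  0 <= lor LN w1 + lor LX w2 - eps * (e * (al ^+ 2 * g + al * lor LX A)) ->
  0 <= lor (- (s *: N) - h *: x) w1 + lor (h *: N + k *: x) w2 -
    eps * (e * (al ^+ 2 * g + al * lor (h *: N + k *: x) A)).
Proof.
move=> -> -> E; set a := (X in 0 <= X -> _); set b := (X in _ -> 0 <= X).
have -> : a = b + (lor dN w1 + lor dX w2 - eps * (e * (al * lor dX A))) by rewrite /a /b !lorE; ring.
by rewrite E addr0.
Qed.

(** * Umbilicity defect and the second-order condition at a minimum *)

Section ShapeDefect.
Variables (R : realType) (n : nat) (M : ptopologicalType) (C : M -> chart R n M).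
Variables (x N : M -> 'rV[R]_n.+2).
Hypothesis hn0 : (0 < n)%N.
Hypothesis hM : oriented_manifold C.
Hypothesis hx : hyperbolic_embedding C x.
Hypothesis hN : unit_normal_field C x N.
Variable H : R.
Hypothesis hH : forall q, mean_curvature C x N q = H.

Definition shape_sqr p := \tr (Defs.shape C x N p *m Defs.shape C x N p).

Lemma trace_shape p : \tr (Defs.shape C x N p) = n%:R * H.
Proof. by rewrite -(hH p) /mean_curvature mulrC divfK // pnatr_eq0 -lt0n. Qed.

Lemma umbilicity_defect p (T : 'M[R]_n) : tangent_frame C x p T ->
  shape_sqr p - n%:R * H ^+ 2 = \sum_a \sum_b (fk C x N p T a b - H * (a == b)%:R) ^+ 2.
Proof.
move=> hT; have [t1 t2] := shape_frame hM hx hN hT.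
have -> : shape_sqr p - n%:R * H ^+ 2 = \sum_a (\sum_b fk C x N p T a b ^+ 2 - 2 * H * fk C x N p T a a + H ^+ 2).
  rewrite !big_split /= -t2 -/(shape_sqr p) sumrN -mulr_sumr -t1 trace_shape sumr_const card_ord -mulr_natl; ring.
apply: eq_bigr => a _; rewrite (bigD1 a) //= [in RHS](bigD1 a) //= eqxx.
have -> : \sum_(b | b != a) (fk C x N p T a b - H * (a == b)%:R) ^+ 2 = \sum_(b | b != a) fk C x N p T a b ^+ 2.
  by apply: eq_bigr => b ba; rewrite eq_sym (negbTE ba) mulr0 subr0.
by rewrite mulr1; ring.
Qed.

Lemma umbilicity_defect_ge0 p : 0 <= shape_sqr p - n%:R * H ^+ 2.
Proof.
have [T hT] := tangent_frame_exists hM hx p; rewrite (umbilicity_defect hT).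
by apply: sumr_ge0 => a _; apply: sumr_ge0 => b _; exact: sqr_ge0.
Qed.

Lemma umbilic_dN p : shape_sqr p = n%:R * H ^+ 2 -> forall v, dM C N p v = - (H *: dM C x p v).
Proof.
move=> e v; have [T hT] := tangent_frame_exists hM hx p.
have := umbilicity_defect hT; rewrite e subrr => /esym/eqP.
rewrite psumr_eq0 => [/allP h|a _]; last by apply: sumr_ge0 => b _; exact: sqr_ge0.
have k a b : fk C x N p T a b = H * (a == b)%:R.
  have := h a (mem_index_enum a); rewrite /= psumr_eq0 => [/allP h'|c _]; last exact: sqr_ge0.
  by have := h' b (mem_index_enum b); rewrite /= sqrf_eq0 subr_eq0 => /eqP.
have [c ->] := frame_coord hT v.
rewrite (dM_sum hM _ _ _ (smooth_N hN)) (dM_sum hM _ _ _ (smooth_x hx)) scaler_sumr -sumrN.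
apply: eq_bigr => a _; have := fUE hM hx hN hT a; rewrite /fU => ->.
rewrite (bigD1 a) //= big1 => [|b ba]; last by rewrite k eq_sym (negbTE ba) mulr0 scale0r.
by rewrite k eqxx mulr1 addr0 scalerN !scalerA mulrC.
Qed.

Variables (w1 w2 A : 'rV[R]_n.+2) (eps al : R).

(** Second derivatives along the frame are summed in chart coordinates. The drift [b] of
    [laplacian_x_N] enters through first derivatives only, and these vanish at a minimum. The
    coefficient of al^2 is the squared gradient of <x,A>. Setting eps = 0 gives the inequality for
    the function without barrier. *)
Lemma minimum_laplacian p :
  nbhs p [set z | lor (N p) w1 + lor (x p) w2 - eps * expR (al * lor (x p) A) <=
                  lor (N z) w1 + lor (x z) w2 - eps * expR (al * lor (x z) A)] ->
  0 <= lor (- (shape_sqr p *: N p) - (n%:R * H) *: x p) w1 + lor ((n%:R * H) *: N p + n%:R *: x p) w2 -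
    eps * (expR (al * lor (x p) A) *
      (al ^+ 2 * (lor A A + lor A (x p) ^+ 2 - lor A (N p) ^+ 2) +
       al * lor ((n%:R * H) *: N p + n%:R *: x p) A)).
Proof.
move=> pmin; have [T hT] := tangent_frame_exists hM hx p.
have [b [LX LN]] := laplacian_x_N hn0 hM hx hN hH hT.
set y0 := cmap (C p) p in LX LN; set X := x \o cinv (C p) in LX; set NN := N \o cinv (C p) in LN.
have Uy0 : chart_image (C p) y0 by exact: (chart_image_center hM).
have oU : open (chart_image (C p)) by exact: (chart_image_open hM).
have Xp : X y0 = x p by rewrite /X /= (cmapK hM (cdom_center hM p)).
have Np : NN y0 = N p by rewrite /NN /= (cmapK hM (cdom_center hM p)).
pose Ph y := lor (NN y) w1 + lor (X y) w2 - eps * expR (al * lor (X y) A).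
pose dPh v y := lor ('D_v NN y) w1 + lor ('D_v X y) w2 - eps * (expR (al * lor (X y) A) * (al * lor ('D_v X y) A)).
have DX y v : chart_image (C p) y -> is_derive y v X ('D_v X y).
  by move=> Uy; apply: DeriveDef => //; have [+ _] := smooth_x hx [::] Uy; apply.
have DN y v : chart_image (C p) y -> is_derive y v NN ('D_v NN y).
  by move=> Uy; apply: DeriveDef => //; have [+ _] := smooth_N hN [::] Uy; apply.
have De y v : chart_image (C p) y -> is_derive y v (fun y => expR (al * lor (X y) A))
    (expR (al * lor (X y) A) * (al * lor ('D_v X y) A)).
  move=> Uy; have Dl := is_derive_cmul al (is_derive_lorl A (DX y v Uy)).
  exact: (@is_derive_scalar_comp R _ expR _ y v _ _ (is_derive_expR _) Dl).
have DPh y v : chart_image (C p) y -> is_derive y v Ph (dPh v y).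
  move=> Uy; have D1 := is_derive_lorl w1 (DN y v Uy); have D2 := is_derive_lorl w2 (DX y v Uy).
  exact: (is_deriveB (is_deriveD D1 D2) (is_derive_cmul eps (De y v Uy))).
pose d2 v := lor ('D_v ('D_v NN) y0) w1 + lor ('D_v ('D_v X) y0) w2 -
  eps * (expR (al * lor (X y0) A) * (al * lor ('D_v X y0) A) * (al * lor ('D_v X y0) A) +
         expR (al * lor (X y0) A) * (al * lor ('D_v ('D_v X) y0) A)).
have DdPh v : is_derive y0 v (dPh v) (d2 v).
  have E1 : is_derive y0 v ('D_v NN) ('D_v ('D_v NN) y0).
    by apply: DeriveDef => //; have [+ _] := smooth_N hN [:: v] Uy0; apply.
  have E2 : is_derive y0 v ('D_v X) ('D_v ('D_v X) y0).
    by apply: DeriveDef => //; have [+ _] := smooth_x hx [:: v] Uy0; apply.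
  have E3 := is_derive_mulf (De y0 v Uy0) (is_derive_cmul al (is_derive_lorl A E2)).
  exact: (is_deriveB (is_deriveD (is_derive_lorl w1 E1) (is_derive_lorl w2 E2)) (is_derive_cmul eps E3)).
have key v : dPh v y0 = 0 /\ 0 <= d2 v.
  have cl : {for 0, continuous (fun s : R => y0 + s *: v)}.
    by apply: continuousD; [exact: cst_continuous|apply: cvgZl; exact: cvg_id].
  have y00 : y0 + 0 *: v = y0 by rewrite scale0r addr0.
  have near1 : \forall s \near (0 : R), chart_image (C p) (y0 + s *: v) /\ Ph y0 <= Ph (y0 + s *: v).
    have near0 : nbhs (y0 + 0 *: v) [set y | chart_image (C p) y /\ Ph y0 <= Ph y].
      rewrite y00; apply: filterI; first exact: (near_chart_image hM).
      have := cinv_continuous hM Uy0; rewrite /prop_for /continuous_at (cmapK hM (cdom_center hM p)).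
      by rewrite /Ph Xp Np => /(_ _ pmin).
    exact: (cl _ near0).
  move: near1 => /nbhs_ballP [r /= r0 Hr].
  have Hr' (s : R) : `|s| < r -> chart_image (C p) (y0 + s *: v) /\ Ph y0 <= Ph (y0 + s *: v).
    by move=> sr; apply: Hr; rewrite -ball_normE /= sub0r normrN.
  have e : dPh v (y0 + 0 *: v) = dPh v y0 by rewrite y00.
  rewrite -e; apply: (@local_min_derivatives R (fun s => Ph (y0 + s *: v)) (fun s => dPh v (y0 + s *: v)) (d2 v) r r0).
  - move=> s /Hr' [Us _]; have [d1 d2'] := DPh _ v Us; rewrite -d2'; exact: is_derive_line.
  - have [d1 d2'] := DdPh v; rewrite -d2' -[X in 'D_v _ X]y00; apply: is_derive_line.
    by rewrite y00.
  - by move=> s /Hr' [_]; rewrite y00.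
have [g0 _] := key b.
have : 0 <= \sum_a d2 (row a T) by apply: sumr_ge0 => a _; have [] := key (row a T).
have -> : \sum_a d2 (row a T) = lor (\sum_a 'D_(row a T) ('D_(row a T) NN) y0) w1 +
    lor (\sum_a 'D_(row a T) ('D_(row a T) X) y0) w2 - eps * (expR (al * lor (X y0) A) *
    (al ^+ 2 * (\sum_a lor ('D_(row a T) X y0) A ^+ 2) + al * lor (\sum_a 'D_(row a T) ('D_(row a T) X) y0) A)).
  rewrite /d2 sumrB big_split /= -!lor_suml -mulr_sumr; congr (_ - _ * _).
  rewrite lor_suml !mulr_sumr -big_split /= mulr_sumr; apply: eq_bigr => a _; ring.
have -> : \sum_a lor ('D_(row a T) X y0) A ^+ 2 = lor A A + lor A (x p) ^+ 2 - lor A (N p) ^+ 2.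
  rewrite [X in X + _ - _](frame_parseval A A (frame_lorentz hM hx hN hT)).
  have -> : \sum_a lor ('D_(row a T) X y0) A ^+ 2 = \sum_a lor A (fV C x p T a) * lor A (fV C x p T a).
    by apply: eq_bigr => a _; rewrite expr2 lorC.
  ring.
have g0' : lor (dM C N p b) w1 + lor (dM C x p b) w2 -
    eps * (expR (al * lor (x p) A) * (al * lor (dM C x p b) A)) = 0 by rewrite -Xp; exact: g0.
rewrite Xp => ineq; exact: (laplacian_cancel LN LX g0' ineq).
Qed.
End ShapeDefect.

(** * The strong minimum principle *)

Lemma hyperboloid_eq (R : realType) m (x y : 'rV[R]_m.+1) :
  lor x x = -1 -> lor y y = -1 -> lor x y = -1 -> x = y.
Proof.
move=> xx yy xy; apply/eqP; rewrite -subr_eq0; apply/eqP; apply: (lor_perp_eq0 yy).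
  by rewrite lorDl lorNl xy yy subrr.
by rewrite lor_sub_sqr xx yy xy; ring.
Qed.

Lemma pos_of_close (R : realType) (a b : R) : `|a - b| <= 2^-1 * b -> 0 < b -> 0 < a.
Proof. by rewrite ler_norml => /andP[h1 _] h2; lra. Qed.

Lemma convex_lt (R : realType) (a b d s : R) : a < d -> b < d -> 0 <= s -> s <= 1 -> (1 - s) * a + s * b < d.
Proof.
move=> ad bd s0 s1; have [->|sn] := eqVneq s 0; first lra.
have : 0 < s * (d - b) by rewrite mulr_gt0 ?subr_gt0 // lt_neqAle eq_sym sn.
have : 0 <= (1 - s) * (d - a) by rewrite mulr_ge0 // subr_ge0 // ltW.
lra.
Qed.

Lemma touching_contra (R : realType) (a b c r : R) :
  a - 1 <= b + c -> - c = 1 + r / 2 -> - a <= - b -> 0 < r -> False.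
Proof. by move=> h1 h2 h3 h4; lra. Qed.

Lemma half_lt (R : realType) (r : R) : 0 < r -> r / 2 < r.
Proof. by move=> h; lra. Qed.

Lemma half_gap (R : realType) (a b m e : R) : a <= b -> e <= (a - m) / 2 -> 0 < a - m -> m < b - e.
Proof. by move=> h1 h2 h3; lra. Qed.

Lemma barrier_contra (R : realType) (a m e1 e2 : R) : a - e1 <= m - e2 -> e1 < e2 -> m <= a -> False.
Proof. by move=> h1 h2 h3; lra. Qed.

Lemma sign_contra (R : realType) (u q : R) : 0 < q -> u <= 0 -> 0 <= u - q -> False.
Proof. by move=> h1 h2 h3; lra. Qed.

Section StrongMinimum.
Variables (R : realType) (n : nat) (M : ptopologicalType) (C : M -> chart R n M).
Variables (x N : M -> 'rV[R]_n.+2).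
Hypothesis hn0 : (0 < n)%N.
Hypothesis hM : oriented_manifold C.
Hypothesis hx : hyperbolic_embedding C x.
Hypothesis hN : unit_normal_field C x N.
Hypothesis hconn : connected [set: M].
Hypothesis cM : compact [set: M].
Variable H : R.
Hypothesis hH : forall q, mean_curvature C x N q = H.
Let cx : continuous x := smooth_map_continuous hM (smooth_x hx).
Let cN : continuous N := smooth_map_continuous hM (smooth_N hN).

(** Along the coordinate segment from [p] to [q] the velocity pairs positively with the initial
    velocity, so the chord has a tangential component at [p]. It makes the gradient of the barrier
    nonzero at the touching point. *)
Lemma tangential_part_near (z0 : M) : exists2 W : set M, nbhs z0 W &
  forall p q : M, W p -> W q -> p <> q -> exists v, 0 < lor (x q) (dM C x p v).
Proof.
have [T hT] := tangent_frame_exists hM hx z0; have [d d0 Hd] := gram_near_pair hM hx hT.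
set y0 := cmap (C z0) z0 in Hd; set X := x \o cinv (C z0) in Hd.
exists (cdom (C z0) `&` cmap (C z0) @^-1` ball y0 d).
  apply: filterI; first exact: (near_cdom hM (cdom_center hM z0)).
  exact: (cmap_continuous hM (cdom_center hM z0) (nbhsx_ballx _ _ d0)).
move=> p q [Dp Bp] [Dq Bq] pq.
set y1 := cmap (C z0) p; set y2 := cmap (C z0) q.
have B y : ball y0 d y -> `|y - y0| < d by rewrite -ball_normE /= distrC.
have p1 : cinv (C z0) y1 = p by exact: (cmapK hM).
have q2 : cinv (C z0) y2 = q by exact: (cmapK hM).
have b1 := B _ Bp; have b2 := B _ Bq.
pose w := y2 - y1.
have Hs (s : R) : 0 <= s <= 1 -> `|y1 + s *: w - y0| < d.
  move=> /andP[s0 s1]; have -> : y1 + s *: w - y0 = (1 - s) *: (y1 - y0) + s *: (y2 - y0).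
    by apply/rowP => i; rewrite !mxE; ring.
  apply: (le_lt_trans (ler_normD _ _)); rewrite !normrZ !ger0_norm ?subr_ge0 //.
  exact: convex_lt.
have [Iy1 _ _] := Hd y1 y1 b1 b1.
have [J uJ HJ] := chart_change hM Iy1.
exists (w *m J).
have e1 := HJ _ x (smooth_x hx) w; rewrite p1 in e1; rewrite -e1 -/X.
have Ix s (hs : 0 <= s <= 1) : chart_image (C z0) (y1 + s *: w).
  by have [I1 _ _] := Hd _ _ (Hs s hs) b1.
have [|s hs E] := @MVT01 R (fun s => lor (X (y1 + s *: w)) ('D_w X y1))
   (fun s => lor ('D_w X (y1 + s *: w)) ('D_w X y1)).
  move=> s hs; apply: is_derive_lorl; apply: is_derive_line.
  by have [+ _] := smooth_x hx [::] (Ix s hs); apply.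
have X2 : X (y1 + 1 *: w) = x q by rewrite scale1r /w addrC subrK /X /= q2.
have X1 : X (y1 + 0 *: w) = x p by rewrite scale0r addr0 /X /= p1.
have o1 : lor (x p) ('D_w X y1) = 0.
  by rewrite e1 lorC (lor_dx_x hM hx).
rewrite X2 X1 o1 subr0 in E; rewrite E.
have [_ _ G] := Hd _ _ (Hs s hs) b1.
have [c wE] := frame_coord hT w.
apply: (pos_of_close (G c w wE)).
rewrite lt_neqAle sumr_ge0 ?andbT => [|a _]; last exact: sqr_ge0.
apply/eqP => /esym/eqP; rewrite psumr_eq0 => [/allP c0|a _]; last exact: sqr_ge0.
apply: pq; rewrite -p1 -q2; congr (cinv _ _); apply/eqP; rewrite eq_sym -subr_eq0 -/w wE.
apply/eqP; apply: big1 => a _.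
by have := c0 a (mem_index_enum a); rewrite /= sqrf_eq0 => /eqP ->; rewrite scale0r.
Qed.

Lemma closed_min (K : set M) (g : M -> R) : closed K -> K !=set0 -> continuous g ->
  exists2 z, K z & forall z', K z' -> g z <= g z'.
Proof.
move=> cK K0 cg; have Kc : compact K by exact: (subclosed_compact cK cM).
have [z] := compact_EVT_min K0 Kc (continuous_subspaceT cg).
by rewrite inE => Kz Hz; exists z => // z' Kz'; apply: Hz; rewrite inE.
Qed.

Let lor_cont (g : M -> 'rV[R]_n.+2) (a : 'rV[R]_n.+2) : continuous g -> continuous (fun z => lor (g z) a).
Proof. by move=> cg z; apply: continuous_lor; [exact: cg|exact: cvg_cst]. Qed.

(** On the compact complement of a neighbourhood, the ambient distance to [z0] has a minimum, which
    is positive because [x] is injective. The barrier argument can thus use extrinsic balls. *)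
Lemma embedding_near (z0 : M) (W : set M) : nbhs z0 W ->
  exists2 e : R, 0 < e & forall z, - lor (x z) (x z0) < 1 + e -> W z.
Proof.
move=> hW; pose K := ~` W^°.
have cK : closed K by apply: open_closedC; exact: open_interior.
have [[z Kz]|K0] := pselect (K !=set0); last first.
  exists 1 => // z _; apply: interior_subset; apply: contrapT => h; apply: K0; exists z; exact: h.
have cg : continuous (fun z => - lor (x z) (x z0)).
  by move=> t; apply: cvgN; exact: lor_cont.
have [zm Km Hm] := closed_min cK (ex_intro _ z Kz) cg.
have gt1 : 1 < - lor (x zm) (x z0).
  rewrite lt_neqAle hyperboloid_lor ?andbT; try exact: (x_hyperboloid hx).
  apply/eqP => e1; apply: Km; suff -> : zm = z0 by [].
  apply: (x_inj hx); apply: hyperboloid_eq; rewrite ?(lor_xx hx) //.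
  by rewrite -[LHS]opprK -e1.
exists (- lor (x zm) (x z0) - 1); first by rewrite subr_gt0.
move=> t; rewrite addrC subrK => ht; apply: interior_subset; apply: contrapT => Kt.
by have := Hm t Kt; rewrite leNgt ht.
Qed.

Lemma boundary_point (Z : set M) : closed Z -> Z !=set0 -> Z != setT ->
  exists2 z0, Z z0 & forall L : R, 0 < L -> exists2 q, ~ Z q & mball C x z0 L q.
Proof.
move=> cZ Z0 ZT; apply: contrapT => nH; move/eqP: ZT; apply.
apply: hconn => //; last by exists Z => //; rewrite setTI.
exists Z; last by rewrite setTI.
rewrite openE => z Zz; apply: contrapT => nz; apply: nH; exists z => // L L0.
apply: contrapT => nq; apply: nz; apply: filterS (nbhs_mball hM hx z L0) => q zq.
by apply: contrapT => nZq; apply: nq; exists q.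
Qed.

Lemma tangential_square_gt0 p (A : 'rV[R]_n.+2) v : lor A (dM C x p v) != 0 ->
  0 < lor A A + lor A (x p) ^+ 2 - lor A (N p) ^+ 2.
Proof.
move=> Av; have [T hT] := tangent_frame_exists hM hx p.
have -> : lor A A + lor A (x p) ^+ 2 - lor A (N p) ^+ 2 = \sum_a lor A (fV C x p T a) ^+ 2.
  rewrite [X in X + _ - _](frame_parseval A A (frame_lorentz hM hx hN hT)).
  under [in RHS]eq_bigr do rewrite expr2.
  by ring.
rewrite lt_neqAle sumr_ge0 ?andbT => [|a _]; last exact: sqr_ge0.
apply/eqP => /esym/eqP; rewrite psumr_eq0 => [/allP c0|a _]; last exact: sqr_ge0.
move/eqP: Av; apply; have [c ->] := frame_coord hT v.
rewrite (dM_sum hM _ _ _ (smooth_x hx)) lor_sumr; apply: big1 => a _; rewrite lorZr.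
by have := c0 a (mem_index_enum a); rewrite /= sqrf_eq0 => /eqP; rewrite /fV => ->; rewrite mulr0.
Qed.

Section Minimum.
Variables w1 w2 : 'rV[R]_n.+2.
Let f z := lor (N z) w1 + lor (x z) w2.
Hypothesis superharmonic : forall p,
  lor (- (shape_sqr C x N p *: N p) - (n%:R * H) *: x p) w1 + lor ((n%:R * H) *: N p + n%:R *: x p) w2 <= 0.

Let cf : continuous f.
Proof. by move=> z; exact: (cvgD (@lor_cont _ w1 cN z) (@lor_cont _ w2 cx z)). Qed.

(* Hopf's argument: a ball centred outside the minimum set Z touches Z at p; the barrier
   exp(al <x, A>), A = x q + x p, beats f on a small ball around p. *)
Lemma strong_minimum p q : f p = f q.
Proof.
have [pm _ Hpm] := closed_min closedT (ex_intro _ point I) cf.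
pose m := f pm; pose Z := [set z | f z = m].
have fm z : m <= f z by exact: Hpm.
suff ZT : Z = setT.
  have hp : Z p by rewrite ZT.
  have hq : Z q by rewrite ZT.
  by rewrite [LHS]hp hq.
apply: contrapT => /eqP ZT.
have cZ : closed Z.
  have := (continuous_closedP f).1 cf [set m]; rewrite /preimage /=; apply.
  exact: closed_eq.
have [z0 Zz0 bz0] := boundary_point cZ (ex_intro _ pm erefl) ZT.
have [W Wz0 HW] := tangential_part_near z0.
have [e e0 He] := embedding_near Wz0.
(* The nearest point [p1] of Z to [y] satisfies -<x p1, x z0> <= e^L e^L < 1 + e, so both [y] and
   [p1] lie in [W]. *)
have L0 : 0 < ln (1 + e) / 2 by rewrite divr_gt0 // ln_gt0 // ltrDl.
have [y nZy [L LL zyL]] := bz0 _ L0.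
have L00 := reach_ge0 zyL.
have eL : expR L * expR L < 1 + e.
  rewrite -expRD -[ltRHS]lnK; last by rewrite posrE addr_gt0.
  by rewrite ltr_expR; move: LL; lra.
have eL1 : 1 <= expR L by rewrite -expR0 ler_expR.
have eL2 : expR L <= expR L * expR L by rewrite ler_peMl // expR_ge0.
have yzL : - lor (x y) (x z0) <= expR L by rewrite lorC; exact: (reach_lor hM hx zyL).
have Wy : W y by apply: He; apply: (le_lt_trans yzL); exact: (le_lt_trans eL2).
have c1 : continuous (fun z => - lor (x z) (x y)) by move=> t; apply: cvgN; exact: lor_cont.
have [p1 Zp1 Hp1] := closed_min cZ (ex_intro _ pm erefl) c1.
have Wp1 : W p1.
  apply: He; apply: le_lt_trans eL.
  have g := reach_lor_growth hM hx (x_hyperboloid hx p1) (reach_sym hM hx zyL).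
  apply: (le_trans g); apply: ler_wpM2l; first exact: expR_ge0.
  apply: (le_trans (Hp1 z0 Zz0)); by rewrite lorC.
have p1y : p1 <> y by move=> e1; apply: nZy; rewrite -e1.
have [v hv] := HW p1 y Wp1 Wy p1y.
(* Adding [x p1] makes the contact strict: at distance from [p1] with cosh equal to 1 + r/2, a point
   with <x z,A> >= <x p1,A> is strictly closer to [y] than [p1], hence outside Z. *)
pose A := x y + x p1.
pose g z := lor A A + lor A (x z) ^+ 2 - lor A (N z) ^+ 2.
have Av : lor A (dM C x p1 v) != 0.
  by rewrite /A lorDl [X in _ + X]lorC (lor_dx_x hM hx) addr0 gt_eqF.
have g0 : 0 < g p1 by exact: tangential_square_gt0 Av.
have cg : continuous g.
  have h1 : continuous (fun z => lor A (x z)).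
    by move=> t; under eq_fun do rewrite lorC; exact: (@lor_cont _ A cx t).
  have h2 : continuous (fun z => lor A (N z)).
    by move=> t; under eq_fun do rewrite lorC; exact: (@lor_cont _ A cN t).
  by move=> t; exact: (cvgB (cvgD (cvg_cst (lor A A)) (cvgM (h1 t) (h1 t))) (cvgM (h2 t) (h2 t))).
pose gam := g p1 / 2; have gam0 : 0 < gam by rewrite divr_gt0.
have gg : gam < g p1 by rewrite /gam; move: g0; lra.
have [r r0 Hr] := @embedding_near p1 [set z | gam < g z] (cvgr_gt _ (cg p1) _ gg).
pose k z := lor ((n%:R * H) *: N z + n%:R *: x z) A.
have ck : continuous k.
  have -> : k = (fun z => n%:R * H * lor (N z) A + n%:R * lor (x z) A).
    by apply/funext => z; rewrite /k lorDl !lorZl.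
  move=> t; exact: (cvgD (cvgM (cvg_cst _) (@lor_cont _ A cN t)) (cvgM (cvg_cst _) (@lor_cont _ A cx t))).
have [pk _ Hk] := closed_min closedT (ex_intro _ point I) ck.
(* Large enough for al g to dominate the drift k wherever g > gam, so that the barrier is strictly
   subharmonic on the small ball. *)
pose al := (`|k pk| + 1) / gam.
have al0 : 0 < al by rewrite divr_gt0 // ltr_wpDl.
have alg : al * gam = `|k pk| + 1 by rewrite divfK // gt_eqF.
have pos z : gam < g z -> 0 < al ^+ 2 * g z + al * k z.
  move=> gz; have h1 : `|k pk| + 1 < al * g z by rewrite -alg ltr_pM2l.
  have h2 : - `|k pk| <= k z.
    by apply: (le_trans _ (Hk z I)); have := lerNnormlW; rewrite lerNl -normrN ler_norm.
  have -> : al ^+ 2 * g z + al * k z = al * (al * g z + k z) by ring.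
  by apply: mulr_gt0 => //; move: h1 h2; lra.
pose d z := - lor (x z) (x p1).
have cd : continuous d by move=> t; apply: cvgN; exact: lor_cont.
have dp1 : d p1 = 1 by rewrite /d (lor_xx hx) opprK.
pose ex z := expR (al * lor (x z) A).
have cex : continuous ex.
  move=> t; apply: (@continuous_comp _ _ _ (fun z => al * lor (x z) A) expR); last exact: continuous_expR.
  by apply: cvgM; [exact: cvg_cst|exact: lor_cont].
(* On this part of the boundary sphere f exceeds m by compactness, and a small [eps] preserves that;
   on the rest the barrier is below its value at [p1]. So the minimum of f - eps ex is interior. *)
pose D := [set z | d z = 1 + r / 2 /\ lor (x p1) A <= lor (x z) A].
have fD z : D z -> m < f z.
  move=> [dz Az]; rewrite lt_neqAle fm andbT; apply/eqP => fz.
  have := Hp1 z (esym fz); move: Az dz; rewrite /d /A !lorDr (lor_xx hx) => h1 h2 h3.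
  exact: (touching_contra h1 h2 h3 r0).
have cD : closed D.
  have -> : D = d @^-1` [set 1 + r / 2] `&` (fun z => lor (x z) A) @^-1` [set t | lor (x p1) A <= t].
    by apply/seteqP; split.
  apply: closedI; first by apply: (continuous_closedP d).1 => //; exact: closed_eq.
  apply: (continuous_closedP (fun z => lor (x z) A)).1; first exact: lor_cont.
  exact: closed_ge.
have [eps eps0 Heps] : exists2 eps : R, 0 < eps & forall z, D z -> m < f z - eps * ex z.
  have [[zD DzD]|D0] := pselect (D !=set0); last first.
    by exists 1 => // z Dz; case: D0; exists z.
  have [zd Dzd Hzd] := closed_min cD (ex_intro _ zD DzD) cf.
  have cne : continuous (fun z => - ex z) by move=> t; apply: cvgN; exact: cex.
  have [ze _ Hze] := closed_min closedT (ex_intro _ point I) cne.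
  have e10 : 0 < ex ze by exact: expR_gt0.
  have fzd : 0 < f zd - m by rewrite subr_gt0; exact: fD.
  exists ((f zd - m) / (2 * ex ze)); first by rewrite divr_gt0 // mulr_gt0.
  move=> z Dz; have h1 := Hzd z Dz; have := Hze z I; rewrite lerN2 => h2.
  have h3 : (f zd - m) / (2 * ex ze) * ex z <= (f zd - m) / 2.
    rewrite invfM mulrA -[leRHS]mulr1 -[leLHS]mulrA.
    apply: ler_wpM2l; first by rewrite divr_ge0 // ltW.
    by rewrite mulrC ler_pdivrMr // mul1r.
  exact: (half_gap h1 h3 fzd).
pose K := [set z | d z <= 1 + r / 2].
have cK : closed K by exact: ((continuous_closedP d).1 cd _ (@closed_le R (1 + r / 2))).
have Kp1 : K p1 by rewrite /K /= dp1 lerDl divr_ge0 // ltW.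
pose phi z := f z - eps * ex z.
have cphi : continuous phi.
  move=> t; exact: (cvgB (cvgD (@lor_cont _ w1 cN t) (@lor_cont _ w2 cx t)) (cvgM (cvg_cst eps) (cex t))).
have [zs Kzs Hzs] := closed_min cK (ex_intro _ p1 Kp1) cphi.
have exp1 : 0 < eps * ex p1 by rewrite mulr_gt0 // expR_gt0.
have phis : phi zs <= m - eps * ex p1 by have := Hzs p1 Kp1; rewrite {2}/phi Zp1.
have dzs : d zs < 1 + r / 2.
  rewrite lt_neqAle Kzs andbT; apply/eqP => dz.
  have [Az|Az] := leP (lor (x p1) A) (lor (x zs) A).
    by have := Heps zs (conj dz Az); rewrite ltNge -/(phi zs) (le_trans phis) // gerBl ltW.
  have lex : ex zs < ex p1 by rewrite /ex ltr_expR ltr_pM2l.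
  have : eps * ex zs < eps * ex p1 by rewrite ltr_pM2l.
  by move=> h; exact: (barrier_contra phis h (fm zs)).
have nzs : nbhs zs [set z | phi zs <= phi z].
  have h : \forall z \near zs, d z < 1 + r / 2 by exact: (cvgr_lt _ (cd zs) _ dzs).
  by apply: filterS h => z dz; apply: Hzs; exact: ltW.
have := minimum_laplacian hn0 hM hx hN hH nzs.
have gzs : gam < g zs by apply: Hr; apply: (lt_trans dzs); rewrite ltrD2l; exact: half_lt.
have q0 : 0 < eps * (ex zs * (al ^+ 2 * g zs + al * k zs)).
  by rewrite !mulr_gt0 ?expR_gt0 //; exact: pos.
have := superharmonic zs; rewrite -/(g zs) -/(k zs) -/(ex zs).
exact: (sign_contra q0).
Qed.
End Minimum.
End StrongMinimum.

(** * Umbilic graphs *)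

Lemma lor_nondegenerate (R : realType) m (u : 'rV[R]_m.+1) : (forall w, lor u w = 0) -> u = 0.
Proof.
move=> h; apply/rowP => i; have := h (delta_mx 0 i); rewrite /lor (bigD1 i) //= big1 => [|j ji].
  rewrite !mxE !eqxx mulr1 addr0 /lsign; case: ifP => _; first by rewrite mulN1r => /eqP; rewrite oppr_eq0 => /eqP.
  by rewrite mul1r.
by rewrite !mxE eqxx (negbTE ji) mulr0.
Qed.

(* Hyperbolic half-angle formulas: for r1 < r2, sinh (r2 - r1) < sinh r2 - sinh r1. *)
Lemma ray_uniqueness (R : realType) (C1 S1 C2 S2 a t h : R) :
  1 < C1 -> C1 < C2 -> 0 < S1 -> 0 < S2 -> S1 ^+ 2 = C1 ^+ 2 - 1 -> S2 ^+ 2 = C2 ^+ 2 - 1 ->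
  0 <= a -> a < h -> C1 * a - S1 * t = h -> C2 * a - S2 * t = h -> False.
Proof.
move=> c1 c2 s1 s2 e1 e2 a0 ah h1 h2.
have ss : S1 < S2.
  rewrite -(ltr_pXn2r (n := 2)) ?nnegrE ?ltW // e1 e2 ltrD2r ltr_pXn2r ?nnegrE //; lra.
have tanh : S2 * (C1 - 1) <= S1 * (C2 - 1).
  rewrite -(ler_pXn2r (n := 2)) ?nnegrE ?mulr_ge0 ?subr_ge0 ?(ltW s1) ?(ltW s2) //; try lra.
  rewrite !exprMn e1 e2 -subr_ge0.
  have -> : (C1 ^+ 2 - 1) * (C2 - 1) ^+ 2 - (C2 ^+ 2 - 1) * (C1 - 1) ^+ 2 =
    (C1 - 1) * (C2 - 1) * (2 * (C2 - C1)) by ring.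
  by rewrite !mulr_ge0 ?subr_ge0 //; lra.
have E : h * (S2 - S1) = a * (S2 * C1 - S1 * C2).
  have g1 : h * S2 = (C1 * a - S1 * t) * S2 by rewrite h1.
  have g2 : h * S1 = (C2 * a - S2 * t) * S1 by rewrite h2.
  by rewrite mulrBr g1 g2; ring.
have l1 : a * (S2 * C1 - S1 * C2) <= a * (S2 - S1).
  by apply: ler_wpM2l => //; lra.
have l2 : a * (S2 - S1) < h * (S2 - S1) by rewrite ltr_pM2r // subr_gt0.
lra.
Qed.

(** [a] and [s] are the time and space parts of the constant vector seen from o; indices 1 and 2
    refer to the rays along and against its spatial part. The second equation gives a < h; the first
    then gives S1 s < (C1 - 1) a <= S1 a. The conclusion s < a is timelikeness. *)
Lemma center_bounds (R : realType) (C1 S1 C2 S2 a s h : R) :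
  1 < C1 -> 1 < C2 -> 0 < S1 -> 0 < S2 -> S1 ^+ 2 = C1 ^+ 2 - 1 ->
  0 <= a -> 0 <= s -> h ^+ 2 = 1 + a ^+ 2 - s ^+ 2 ->
  C1 * a - S1 * s = h -> C2 * a + S2 * s = h -> s < a /\ a < h.
Proof.
move=> c1 c2 s1 s2 e1 a0 s0 hh h1 h2.
have [s00|sn] := eqVneq s 0.
  have ap : 0 < a.
    rewrite lt_neqAle eq_sym a0 andbT; apply/eqP => az.
    by move: hh h2; rewrite s00 az !mulr0 addr0 => + h0; rewrite -h0 !expr0n /=; lra.
  by rewrite s00 -h2 s00 mulr0 addr0; split=> //; rewrite ltr_pMl.
have sp : 0 < s by rewrite lt_neqAle eq_sym sn.
have ah : a < h.
  have : 0 < S2 * s by rewrite mulr_gt0.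
  have : a <= C2 * a by rewrite ler_peMl // ltW.
  lra.
split=> //; rewrite -(ltr_pM2l s1).
have cs : C1 - 1 <= S1.
  rewrite -(ler_pXn2r (n := 2)) ?nnegrE ?(ltW s1) ?subr_ge0 ?(ltW c1) // e1.
  rewrite -subr_ge0; have -> : C1 ^+ 2 - 1 - (C1 - 1) ^+ 2 = 2 * (C1 - 1) by ring.
  by lra.
have : (C1 - 1) * a <= S1 * a by exact: ler_wpM2r.
lra.
Qed.

Section UmbilicSphere.
Variables (R : realType) (n : nat) (M : ptopologicalType) (C : M -> chart R n M).
Variables (x N : M -> 'rV[R]_n.+2).
Hypothesis hn0 : (0 < n)%N.
Hypothesis hM : oriented_manifold C.
Hypothesis hx : hyperbolic_embedding C x.
Hypothesis hN : unit_normal_field C x N.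
Hypothesis hconn : connected [set: M].
Hypothesis hcomplete : complete_hypersurface C x.
Variable H : R.
Hypothesis hH : forall q, mean_curvature C x N q = H.
Variables (o : 'rV[R]_n.+2) (u : 'rV[R]_n.+2 -> R).
Hypothesis ho : hyperboloid o.
Hypothesis hu : polar_graph x o [::] u.
Let oo : lor o o = -1. Proof. by case: ho. Qed.
Let cN : continuous N := smooth_map_continuous hM (smooth_N hN).
Local Notation hc := (hcosh x o).
Local Notation hs := (hsinh x o).

Lemma full_graph_compact : compact [set: M].
Proof.
have [D HD] := away_from_punctures_bounded hM hx hconn ho hu point ltr01.
have r0 : 0 < `|D| + 1 by rewrite ltr_wpDl.
suff -> : [set: M] = cmball C x point (`|D| + 1) by exact: (cmball_compact hM hx hcomplete r0).
apply/seteqP; split=> // q _; apply: mball_sub_cmball; apply: (mdist_lt hM hx hconn).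
by apply: (le_lt_trans (HD q _)) => //; apply: (le_lt_trans (ler_norm D)); rewrite ltrDl.
Qed.

Lemma theta_sign : exists2 sg : R, sg != 0 & forall p, 0 < sg * theta N o p.
Proof.
have ct : continuous (theta N o).
  have co : continuous (fun z => lor (N z) o).
    by move=> t; apply: continuous_lor; [exact: cN|exact: cvg_cst].
  have -> : theta N o = (fun z => - lor (N z) o) by apply/funext => z; rewrite /theta lorC.
  by move=> t; exact: (cvgN (co t)).
have tn p := theta_neq0 hM hx hN ho hu p.
have [[p tp]|np] := pselect (exists p, 0 < theta N o p); last first.
  exists (-1) => [|p]; first by rewrite oppr_eq0 oner_eq0.
  rewrite mulN1r oppr_gt0 lt_neqAle tn /= leNgt; apply/negP => h; apply: np; by exists p.
exists 1 => [|q]; first exact: oner_neq0.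
rewrite mul1r; suff ET : [set q | 0 < theta N o q] = [set: M] by have : [set: M] q by []; rewrite -ET.
apply: hconn; first by exists p.
- exists [set q | 0 < theta N o q]; last by rewrite setTI.
  have := (continuousP (theta N o)).1 ct _ (@open_gt R 0); exact.
- exists [set q | 0 <= theta N o q].
    have := (continuous_closedP (theta N o)).1 ct _ (@closed_ge R 0); exact.
  rewrite setTI; apply/seteqP; split=> z /=; first exact: ltW.
  by rewrite lt_neqAle eq_sym tn.
Qed.

Lemma cmc_graph_umbilic p : shape_sqr C x N p = n%:R * H ^+ 2.
Proof.
have [sg sg0 hsg] := theta_sign.
pose w1 := - (sg *: o); pose w2 := - ((sg * H) *: o).
have L z : lor (- (shape_sqr C x N z *: N z) - (n%:R * H) *: x z) w1 +
    lor ((n%:R * H) *: N z + n%:R *: x z) w2 =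
    - ((shape_sqr C x N z - n%:R * H ^+ 2) * (sg * theta N o z)).
  by rewrite /w1 /w2 /theta (lorC o) !lorNr !lorZr !lorDl !lorNl !lorZl; ring.
have dz z := umbilicity_defect_ge0 hn0 hM hx hN hH z.
have sup z : lor (- (shape_sqr C x N z *: N z) - (n%:R * H) *: x z) w1 +
    lor ((n%:R * H) *: N z + n%:R *: x z) w2 <= 0.
  by rewrite L oppr_le0 mulr_ge0 // ltW.
have cst := strong_minimum hn0 hM hx hN hconn full_graph_compact hH sup.
(* The function is constant, so every point is a minimum; the barrier is switched off with eps =
   0. *)
have nb : nbhs p [set z | lor (N p) w1 + lor (x p) w2 - 0 * expR (0 * lor (x p) 0) <=
                  lor (N z) w1 + lor (x z) w2 - 0 * expR (0 * lor (x z) 0)].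
  apply: filterE => z /=; have e := cst p z; by rewrite !mul0r !subr0 e.
have := minimum_laplacian hn0 hM hx hN hH nb; rewrite mul0r subr0 L oppr_ge0 pmulr_lle0 // => le0.
by apply/eqP; rewrite -subr_eq0 eq_le le0 dz.
Qed.

(** Umbilicity means dN = -H dx, so N + H x is Lipschitz with constant 0 along curves, tested
    against every vector. *)
Lemma cmc_graph_center : exists a, forall p, N p + H *: x p = a.
Proof.
exists (N point + H *: x point) => p; apply/eqP; rewrite -subr_eq0; apply/eqP.
apply: lor_nondegenerate => w.
have [L rL] := reach_connected hM hx hconn point p.
have := @reach_lipschitz _ _ _ _ _ _ hM hx hN (fun z => lor (N z + H *: x z) w) 0 _ _ _ rL.
rewrite !mul0r (lorDl (N p + H *: x p)) lorNl normr_le0 => h; apply/eqP; apply: h => z v L' _ _.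
exists 0; first by rewrite normr0 mul0r.
move=> c t ct Dx DN.
have -> : (fun z => lor (N z + H *: x z) w) \o c = (fun s => lor (N (c s)) w + H * lor (x (c s)) w).
  by apply/funext => s; rewrite /= lorDl lorZl.
have D := is_deriveD (is_derive_lorl w DN) (is_derive_cmul H (is_derive_lorl w Dx)).
apply: (is_derive_eq D).
by rewrite (umbilic_dN hn0 hM hx hN hH (cmc_graph_umbilic z)) lorNl lorZl addNr.
Qed.

(** The points of the sphere lie in the hyperplane <y,a> = -h, and each one is found on its ray from
    o by [ray_uniqueness]. The sign condition on <o,a> selects between a and -a. *)
Lemma sphere_of_center (a : 'rV[R]_n.+2) (h : R) : (forall p, lor (x p) a = - h) ->
  lor a a = 1 - h ^+ 2 -> 0 <= - lor o a ->
  exists (c : 'rV[R]_n.+2) (s : R), [/\ hyperboloid c, 0 < s & range x = geodesic_sphere c s].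
Proof.
move=> xa aa ao; pose a0 := - lor o a; pose a1 := a - a0 *: o.
have a1o : lor a1 o = 0 by rewrite /a1 lorDl lorNl lorZl oo /a0 (lorC a); ring.
have a1a : lor a1 a = lor a1 a1.
  by rewrite {3}/a1 lorDr lorNr lorZr a1o mulr0 subr0.
have a11 : lor a1 a1 = 1 - h ^+ 2 + a0 ^+ 2.
  by rewrite -a1a /a1 lorDl lorNl lorZl aa /a0; ring.
have perp v : lor v o = 0 -> lor v a = lor v a1.
  by move=> vo; rewrite /a1 lorDr lorNr lorZr vo mulr0 subr0.
pose s := lnorm a1.
have ss : s ^+ 2 = lor a1 a1 by rewrite sqr_sqrtr // (lor_perp_ge0 oo).
have s0 : 0 <= s by exact: lnorm_ge0.
have ray v : admissible o [::] v ->
    [/\ 1 < hc (pt x o v), 0 < hs (pt x o v), hs (pt x o v) ^+ 2 = hc (pt x o v) ^+ 2 - 1,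
      x (pt x o v) = hc (pt x o v) *: o + hs (pt x o v) *: v &
      hc (pt x o v) * a0 - hs (pt x o v) * lor v a = h].
  move=> av; have e := polar_x ho hu (pt x o v); rewrite (dir_pt ho hu av) in e.
  split=> //; [exact: (hcosh_gt1 ho hu)|exact: (hsinh_gt0 ho hu)|exact: (hcosh_sinh ho hu)|].
  have := xa (pt x o v); rewrite {1}e lorDl !lorZl => e2.
  by apply: oppr_inj; rewrite -e2 /a0; ring.
have [v1 [v1o v11 v1a]] : exists v1, [/\ lor v1 o = 0, lor v1 v1 = 1 & lor v1 a = s].
  have [a10|a1n] := eqVneq a1 0.
    exists (dir x o point); split; [exact: (dir_perp ho hu)|exact: (dir_unit ho hu)|].
    by rewrite perp ?(dir_perp ho hu) // a10 lor0r /s a10 /lnorm lor0r sqrtr0.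
  have sp : 0 < s by rewrite sqrtr_gt0 (lor_perp_gt0 oo).
  exists (s^-1 *: a1); rewrite !lorZl lorZr a1o mulr0 a1a -ss expr2 mulKf ?gt_eqF //.
  by split=> //; rewrite mulVf // gt_eqF.
have adm1 : admissible o [::] v1 by [].
have adm2 : admissible o [::] (- v1) by split; rewrite ?lorNl ?lorNr ?opprK ?v1o ?oppr0.
have [c1 s1 e1 _ h1] := ray v1 adm1; have [c2 s2 _ _] := ray (- v1) adm2.
rewrite lorNl v1a => h2'; rewrite v1a in h1.
have h2 : hc (pt x o (- v1)) * a0 + hs (pt x o (- v1)) * s = h by rewrite -[RHS]h2'; ring.
have hh : h ^+ 2 = 1 + a0 ^+ 2 - s ^+ 2 by rewrite ss a11; ring.
have [sa ah] := center_bounds c1 c2 s1 s2 e1 ao s0 hh h1 h2.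
have h0 : 0 < h by exact: le_lt_trans ah.
pose D := Num.sqrt (h ^+ 2 - 1).
have hh1 : 0 < h ^+ 2 - 1.
  have -> : h ^+ 2 - 1 = a0 ^+ 2 - s ^+ 2 by rewrite hh; ring.
  by rewrite subr_gt0 ltr_pXn2r // nnegrE.
(* <a,a> = -D^2, so a/D lies on the hyperboloid and h/D is the cosh of the radius. *)
have D0 : 0 < D by rewrite sqrtr_gt0.
have DD : D ^+ 2 = h ^+ 2 - 1 by rewrite sqr_sqrtr // ltW.
have Dh : D < h by rewrite -(ltr_pXn2r (n := 2)) ?nnegrE ?(ltW D0) ?(ltW h0) // DD gtrBl.
have hD1 : 1 < h / D by rewrite ltr_pdivlMr // mul1r.
pose c := D^-1 *: a.
have cc : lor c c = -1.
  rewrite /c lorZl lorZr aa -[X in _ * (_ * X)]opprB -DD expr2.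
  by rewrite mulrN mulKf ?gt_eqF // mulrN mulVf // gt_eqF.
have hcc : hyperboloid c.
  apply: (hyperboloid_of_lor ho cc); rewrite /c lorZl -mulrN lorC mulr_gt0 ?invr_gt0 //.
  exact: le_lt_trans s0 sa.
exists c, (arcosh (h / D)); split=> //; first exact: arcosh_gt0.
have cdist y : - lor c y = D^-1 * - lor y a by rewrite /c lorZl lorC mulrN.
apply/seteqP; split=> [_ [p _ <-]|y [hy dy]].
  split; first exact: (x_hyperboloid hx).
  by rewrite /hdist cdist xa opprK mulrC.
have ya : lor y a = - h.
  have := arcosh_inj (hyperboloid_lor hcc hy) (ltW hD1) dy.
  rewrite cdist mulrC => /(mulIf (invr_neq0 (lt0r_neq0 D0))) => <-; by rewrite opprK.
have [yy _] := hy.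
pose C2 := - lor o y.
have C21 : 1 < C2.
  rewrite lt_neqAle (hyperboloid_lor ho hy) andbT; apply/eqP => e.
  have oy : o = y by apply: hyperboloid_eq => //; rewrite -[LHS]opprK -/C2 -e.
  by move: ah; rewrite /a0 oy ya opprK ltxx.
have C2s : 0 < C2 ^+ 2 - 1 by rewrite subr_gt0 exprn_egt1.
pose S2 := Num.sqrt (C2 ^+ 2 - 1).
have S20 : 0 < S2 by rewrite sqrtr_gt0.
have S2S : S2 ^+ 2 = C2 ^+ 2 - 1 by rewrite sqr_sqrtr // ltW.
pose v := S2^-1 *: (y - C2 *: o).
have yE : y = C2 *: o + S2 *: v.
  by rewrite /v scalerA mulfV ?gt_eqF // scale1r addrC subrK.
have vo : lor v o = 0.
  by rewrite /v lorZl lorDl lorNl lorZl oo (lorC y) -[lor o y]opprK -/C2; ring.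
have vv : lor v v = 1.
  rewrite /v lorZl lorZr lor_sub_sqr yy lorZr lorZl lorZr oo (lorC y) -[lor o y]opprK -/C2.
  have -> : -1 - 2 * (C2 * - C2) + C2 * (C2 * -1) = S2 ^+ 2 by rewrite S2S; ring.
  by rewrite expr2 mulKf ?mulVf // gt_eqF.
have av : admissible o [::] v by [].
have [C11 S11 E1 xE Eh] := ray v av.
have Eh2 : C2 * a0 - S2 * lor v a = h.
  have e2 : - h = C2 * lor o a + S2 * lor v a.
    by rewrite -ya -!lorZl -lorDl -yE.
  by apply: oppr_inj; rewrite e2 /a0; ring.
exists (pt x o v) => //; rewrite xE [RHS]yE.
have [lt|gt|eC] := ltgtP (hc (pt x o v)) C2.
- by case: (ray_uniqueness C11 lt S11 S20 E1 S2S ao ah Eh Eh2).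
- by case: (ray_uniqueness C21 gt S20 S11 S2S E1 ao ah Eh2 Eh).
- rewrite eC; congr (_ + _ *: _); apply/eqP.
  by rewrite -(eqrXn2 (n := 2)) ?(ltW S11) ?(ltW S20) // E1 S2S eC.
Qed.

Lemma cmc_full_graph_sphere :
  exists (c : 'rV[R]_n.+2) (s : R), [/\ hyperboloid c, 0 < s & range x = geodesic_sphere c s].
Proof.
have [a ha] := cmc_graph_center.
have xa p : lor (x p) a = - H.
  by rewrite -(ha p) lorDr lorZr (lorC (x p)) (lor_Nx hN) (lor_xx hx) add0r mulrN1.
have aa : lor a a = 1 - H ^+ 2.
  rewrite -{1}(ha point) lorDl lorZl xa -(ha point) lorDr lorZr (lor_NN hN) (lor_Nx hN); ring.
have [ao|ao] := leP 0 (- lor o a); first exact: (sphere_of_center xa aa ao).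
apply: (@sphere_of_center (- a) (- H)).
- by move=> p; rewrite lorNr xa.
- by rewrite lorNl lorNr opprK sqrrN.
- by rewrite lorNr oppr_ge0 ltW.
Qed.
End UmbilicSphere.

Theorem corollary5p9 (R : realType) (n k : nat) (M : ptopologicalType)
    (C : M -> chart R n M) (x N : M -> 'rV[R]_n.+2) (o : 'rV[R]_n.+2)
    (rho : R) (P : seq 'rV[R]_n.+2)
    (vol : {measure set (g_sigma_algebraType (@open M)) -> \bar R})
    (hn : (2 <= n)%N)
    (hM : oriented_manifold C) (hconn : connected [set: M])
    (hx : hyperbolic_embedding C x)
    (ho : hyperboloid o) (hrho : 0 < rho)
    (hPuniq : uniq P) (hPsize : size P = k)
    (hPsphere : [set` P] `<=` geodesic_sphere o rho)
    (hgraph : radial_graph o rho (geodesic_sphere o rho `\` [set` P]) (range x))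
    (hcomplete : complete_hypersurface C x)
    (hN : unit_normal_field C x N)
    (hvol : riemannian_volume C x vol)
    (hA : exists B : R, forall p, normA C x N p <= B)
    (hH : exists H0 : R, forall p, mean_curvature C x N p = H0)
    (hint : vol.-integrable [set: g_sigma_algebraType (@open M)]
              (fun p => (lnorm (tangential N p (xi o (x p))))%:E)) :
  k = 0%N /\
  exists (c : 'rV[R]_n.+2) (s : R),
    [/\ hyperboloid c, 0 < s & range x = geodesic_sphere c s].
Proof.
(* Writing the dimension as m + 1 exposes the vertical coordinate used at a puncture. *)
case: n C x N o P hn hM hx ho hPuniq hPsize hPsphere hgraph hcomplete hN hvol hA hH hint => [//|m].
move=> C x N o P hn hM hx ho hPuniq hPsize hPsphere hgraph hcomplete hN hvol [B hB] [H hH] hint.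
have [u hu] := radial_polar_graph ho hrho hPsphere hgraph.
have hQ w : w \in puncture_directions o rho P -> lor w o = 0 /\ lor w w = 1.
  exact: puncture_direction_unit.
case: P hPuniq hPsize hPsphere hgraph hu hQ => [|p P] hPuniq hPsize hPsphere hgraph hu hQ.
  split; first by rewrite -hPsize.
  exact: (cmc_full_graph_sphere (ltn0Sn m) hM hx hN hconn hcomplete hH ho hu).
have w0Q : (sinh rho)^-1 *: (p - cosh rho *: o) \in puncture_directions o rho (p :: P).
  by rewrite inE eqxx.
have [w0o w0w] := hQ _ w0Q.
have [b hb] := polar_basis_exists ho w0o w0w.
have [r hr] := good_radius_exists hn hM hx hN hconn hcomplete hB ho hu hQ hvol hint w0Q hb.
by case: (puncture_absurd hn hM hx hN hconn hcomplete hB ho hu hQ hvol hint w0Q hb hr).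
Qed.
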